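(* For all integers $m,n\ge 0$, the triply graded Khovanov–Rozansky homology $H_{\mathrm{KR}}(T(m,n))=H(\mathrm{HH}(F(X_{m,n})))$ of the positive torus link $T(m,n)$ is supported in even homological degrees; i.e. its component of tridegree $(i,j,k)$ vanishes whenever $k$ is odd.
   Context: **Bimodules and complexes.** $R_n=\mathbb Z[x_1,\dots,x_n]$, graded by $\deg x_i=2$ ($R_0=\mathbb Z$). $Q$ denotes the grading shift $(QM)^i=M^{i-1}$. $s_i\in S_n$ is the transposition $(i,i+1)$ and $B_i=Q^{-1}(R_n\otimes_{R_n^{s_i}}R_n)$, a graded $R_n,R_n$-bimodule with $1\otimes1$ in degree $-1$. $\mathbb{BS}_n$ is the category of graded bimodules isomorphic to finite direct sums of shifts of tensor products (over $R_n$) of $B_i$'s, including the empty product $\mathbf 1_n=R_n$, with degree-zero bimodule maps. $\mathcal K^b(\mathbb{BS}_n)$ is the bounded homotopy category (cohomological grading), with $\otimes=\otimes_{R_n}$. For the braid group $\mathrm{Br}_n$ with standard generators $\sigma_i$ (positive crossings), the Rouquier complex $F(\beta)\in\mathcal K^b(\mathbb{BS}_n)$ is determined up to homotopy equivalence by $F(\beta\beta')\simeq F(\beta)\otimes F(\beta')$ and $F(\sigma_i)=(QB_i\to R_n)$ (with $R_n$ in homological degree 0; the map is multiplication $f\otimes g\mapsto fg$), $F(\sigma_i^{-1})=(R_n\to Q^{-1}B_i)$ (with $R_n$ in homological degree 0; the map is $1\mapsto x_i\otimes 1-1\otimes x_{i+1}$). **Hochschild cohomology.** For a graded bimodule $B$,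 $\mathrm{HH}^{i,j}(B)$ is the degree-$i$ part of the graded $\mathrm{Ext}^j_{R_n\otimes_{\mathbb Z} R_n}(R_n,B)$. For a complex $X$, $\mathrm{HH}(X)$ is the complex of triply graded $\mathbb Z$-modules obtained by applying $\mathrm{HH}$ termwise; $\mathrm{HH}^{i,j}(X^k)$ has tridegree $(i,j,k)$, and the differential has degree $(0,0,1)$; $k$ is the homological degree. $H(\mathrm{HH}(X))$ is its homology. **Torus links.** $X_{m,n}\in\mathrm{Br}_{m+n}$ is the positive permutation braid (replace $s_i$ by $\sigma_i$ in a reduced word) of the permutation $i\mapsto i+n$ ($1\le i\le m$), $m+j\mapsto j$ ($1\le j\le n$): a group of $m$ parallel strands crosses a group of $n$ parallel strands once, with all $mn$ crossings positive. Its closure is the positive torus link $T(m,n)$. $H_{\mathrm{KR}}(T(m,n))$ is normalized as $H(\mathrm{HH}(F(X_{m,n})))$. *)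

(* Defs.v *)
From HB Require Import structures.
From mathcomp Require Import all_boot all_order all_algebra all_fingroup.
From mathcomp Require Import mpoly.
From mathcomp Require Import boolp.

Set Implicit Arguments.
Unset Strict Implicit.
Unset Printing Implicit Defensive.

Import GRing.Theory.
Local Open Scope ring_scope.

Definition additive_fun (U V : zmodType) (f : U -> V) : Prop :=
  forall x y, f (x + y) = f x + f y.

Section AdditiveFun.
Variables (U V : zmodType) (f : U -> V).
Hypothesis fD : additive_fun f.

Lemma additive_fun0 : f 0 = 0.
Proof. by apply: (@addrI _ (f 0)); rewrite -fD !addr0. Qed.

Lemma additive_funN x : f (- x) = - f x.
Proof. by apply: (@addrI _ (f x)); rewrite -fD !subrr additive_fun0. Qed.

Lemma additive_funB x y : f (x - y) = f x - f y.
Proof. by rewrite fD additive_funN. Qed.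

Lemma additive_fun_sum (I : Type) (s : seq I) (F : I -> U) :
  f (\sum_(i <- s) F i) = \sum_(i <- s) f (F i).
Proof. exact: (big_morph f fD additive_fun0). Qed.

End AdditiveFun.

(* A set of expressions which becomes an abelian group modulo [sg_eq]. *)
Record setoid_group := SetoidGroup {
  sg_car :> Type;
  sg_eq : sg_car -> sg_car -> Prop;
  sg_zero : sg_car;
  sg_opp : sg_car -> sg_car;
  sg_add : sg_car -> sg_car -> sg_car;
  sg_refl : forall x, sg_eq x x;
  sg_sym : forall x y, sg_eq x y -> sg_eq y x;
  sg_trans : forall x y z, sg_eq x y -> sg_eq y z -> sg_eq x z;
  sg_opp_eq : forall x y, sg_eq x y -> sg_eq (sg_opp x) (sg_opp y);
  sg_add_eq : forall x x' y y',
    sg_eq x x' -> sg_eq y y' -> sg_eq (sg_add x y) (sg_add x' y');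
  sg_addA : forall x y z, sg_eq (sg_add x (sg_add y z)) (sg_add (sg_add x y) z);
  sg_addC : forall x y, sg_eq (sg_add x y) (sg_add y x);
  sg_add0 : forall x, sg_eq (sg_add sg_zero x) x;
  sg_addN : forall x, sg_eq (sg_add (sg_opp x) x) sg_zero
}.

(* the quotient, as the type of equivalence classes *)
Definition quot (S : setoid_group) : Type :=
  {C : S -> Prop | exists x, C = sg_eq x}.

HB.instance Definition _ (S : setoid_group) := gen_eqMixin (quot S).
HB.instance Definition _ (S : setoid_group) := gen_choiceMixin (quot S).

Section Quotient.
Variable S : setoid_group.

Definition cls (x : S) : quot S := exist _ (sg_eq x) (ex_intro _ x erefl).

Definition quot_repr (q : quot S) : S := sval (cid (svalP q)).

Lemma clsE x y : cls x = cls y <-> sg_eq x y.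
Proof.
split=> [/(f_equal sval) /= e|e]; first by rewrite e; exact: sg_refl.
apply: eq_exist => /=; apply/funext => z; apply/propext; split=> h.
- exact: sg_trans (sg_sym e) h.
- exact: sg_trans e h.
Qed.

Lemma quot_reprK q : cls (quot_repr q) = q.
Proof.
by case: q => C hC; apply: eq_exist; rewrite /= /quot_repr /=; case: cid.
Qed.

Lemma quot_repr_cls x : sg_eq (quot_repr (cls x)) x.
Proof. by apply/clsE; rewrite quot_reprK. Qed.

Lemma quot_ind (P : quot S -> Prop) : (forall x, P (cls x)) -> forall q, P q.
Proof. by move=> h q; rewrite -(quot_reprK q). Qed.

Definition quot_lift (T : Type) (f : S -> T) (q : quot S) : T :=
  f (quot_repr q).

Lemma quot_liftE (T : Type) (f : S -> T) :
  (forall x y, sg_eq x y -> f x = f y) -> forall x, quot_lift f (cls x) = f x.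
Proof. by move=> fE x; apply: fE; exact: quot_repr_cls. Qed.

Definition quot_add (p q : quot S) : quot S :=
  cls (sg_add (quot_repr p) (quot_repr q)).
Definition quot_opp (q : quot S) : quot S := cls (sg_opp (quot_repr q)).
Definition quot_zero : quot S := cls (sg_zero S).

Lemma quot_addE x y : quot_add (cls x) (cls y) = cls (sg_add x y).
Proof. by apply/clsE/sg_add_eq; exact: quot_repr_cls. Qed.

Lemma quot_oppE x : quot_opp (cls x) = cls (sg_opp x).
Proof. by apply/clsE/sg_opp_eq; exact: quot_repr_cls. Qed.

Lemma quot_addA : associative quot_add.
Proof.
elim/quot_ind=> x; elim/quot_ind=> y; elim/quot_ind=> z.
by rewrite !quot_addE; apply/clsE; exact: sg_addA.
Qed.

Lemma quot_addC : commutative quot_add.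
Proof.
elim/quot_ind=> x; elim/quot_ind=> y.
by rewrite !quot_addE; apply/clsE; exact: sg_addC.
Qed.

Lemma quot_add0 : left_id quot_zero quot_add.
Proof.
by elim/quot_ind=> x; rewrite quot_addE; apply/clsE; exact: sg_add0.
Qed.

Lemma quot_addN : left_inverse quot_zero quot_opp quot_add.
Proof.
by elim/quot_ind=> x; rewrite quot_oppE quot_addE; apply/clsE; exact: sg_addN.
Qed.

HB.instance Definition _ := GRing.isZmodule.Build (quot S)
  quot_addA quot_addC quot_add0 quot_addN.

Lemma clsD x y : cls (sg_add x y) = cls x + cls y.
Proof. by rewrite -quot_addE. Qed.

Lemma clsN x : cls (sg_opp x) = - cls x.
Proof. by rewrite -quot_oppE. Qed.

Lemma cls0 : cls (sg_zero S) = 0.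
Proof. by []. Qed.

End Quotient.

Record bimod (R : comNzRingType) := Bimod {
  bm_car :> zmodType;
  lact : R -> bm_car -> bm_car;
  ract : bm_car -> R -> bm_car;
  lactDr : forall a, additive_fun (lact a);
  lactDl : forall a b x, lact (a + b) x = lact a x + lact b x;
  lactM : forall a b x, lact (a * b) x = lact a (lact b x);
  lact1 : forall x, lact 1 x = x;
  ractDl : forall a, additive_fun (ract ^~ a);
  ractDr : forall a b x, ract x (a + b) = ract x a + ract x b;
  ractM : forall a b x, ract x (a * b) = ract (ract x a) b;
  ract1 : forall x, ract x 1 = x;
  lract : forall a b x, ract (lact a x) b = lact a (ract x b)
}.

Definition is_bimap (R : comNzRingType) (M N : bimod R) (f : M -> N) : Prop :=
  [/\ additive_fun f, forall a x, f (lact a x) = lact a (f x)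
    & forall a x, f (ract x a) = ract (f x) a].

Lemma lact_sum (R : comNzRingType) (M : bimod R) (I : Type) (s : seq I)
    (F : I -> R) (x : M) :
  lact (\sum_(i <- s) F i) x = \sum_(i <- s) lact (F i) x.
Proof.
exact: (@additive_fun_sum _ _ (fun a => lact a x) (fun a b => lactDl a b x)).
Qed.

Lemma ract_sum (R : comNzRingType) (M : bimod R) (I : Type) (s : seq I)
    (F : I -> R) (x : M) :
  ract x (\sum_(i <- s) F i) = \sum_(i <- s) ract x (F i).
Proof. exact: (@additive_fun_sum _ _ (fun a => ract x a) (fun a b => ractDr a b x)). Qed.

Section Tensor.
Variables (R : comNzRingType) (S : R -> Prop) (M N : bimod R).

(* [S] is meant to be (the underlying set of) a subring of [R]. *)
Definition balanced (T : zmodType) (phi : M -> N -> T) : Prop :=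
  [/\ forall y, additive_fun (phi ^~ y), forall x, additive_fun (phi x)
    & forall a x y, S a -> phi (ract x a) y = phi x (lact a y)].

(* Elements of the tensor product of [M] and [N] over [S] are formal sums of  *)
(* pairs (x, y), two sums being identified when every balanced biadditive map *)
(* takes the same value on both; [tprod_balanced] and [tlift_tprod] give the  *)
(* universal property.                                                        *)
Definition tsum (T : zmodType) (phi : M -> N -> T) (s : seq (M * N)) : T :=
  \sum_(p <- s) phi p.1 p.2.

Definition tens_eq (s t : seq (M * N)) : Prop :=
  forall (T : zmodType) (phi : M -> N -> T),
    balanced phi -> tsum phi s = tsum phi t.

Definition tens_opp (s : seq (M * N)) := [seq (- p.1, p.2) | p <- s].

Lemma tsum_cat T phi s t : @tsum T phi (s ++ t) = tsum phi s + tsum phi t.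
Proof. by rewrite /tsum big_cat. Qed.

Lemma tsum_opp T phi s : balanced phi ->
  @tsum T phi (tens_opp s) = - tsum phi s.
Proof.
case=> hl _ _; rewrite /tsum big_map -sumrN; apply: eq_bigr => -[x y] _ /=.
by rewrite (additive_funN (hl y)).
Qed.

Definition tens_setoid : setoid_group.
Proof.
refine (@SetoidGroup (seq (M * N)) tens_eq [::] tens_opp cat
  _ _ _ _ _ _ _ _ _).
- by move=> s T phi h.
- by move=> s t e T phi h; rewrite e.
- by move=> s t u e e' T phi h; rewrite e // e'.
- by move=> s t e T phi h; rewrite !tsum_opp // e.
- by move=> s s' t t' e e' T phi h; rewrite !tsum_cat e // e'.
- by move=> s t u T phi h; rewrite !tsum_cat addrA.
- by move=> s t T phi h; rewrite !tsum_cat addrC.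
- by move=> s T phi h.
- by move=> s T phi h; rewrite tsum_cat tsum_opp // addNr /tsum big_nil.
Defined.

Definition tens : zmodType := quot tens_setoid.

Definition tprod (x : M) (y : N) : tens :=
  cls ([:: (x, y)] : tens_setoid).

Definition tlift (T : zmodType) (phi : M -> N -> T) : tens -> T :=
  quot_lift (tsum phi : tens_setoid -> T).

Lemma tprod_balanced : balanced tprod.
Proof.
split=> [y x x'|x y y'|a x y Sa].
- rewrite /tprod -clsD; apply/clsE => T phi [hl _ _].
  by rewrite /tsum !big_cons !big_nil /= !addr0 hl.
- rewrite /tprod -clsD; apply/clsE => T phi [_ hr _].
  by rewrite /tsum !big_cons !big_nil /= !addr0 hr.
- apply/clsE => T phi [_ _ hb].
  by rewrite /tsum !big_cons !big_nil /= !addr0 hb.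
Qed.

Lemma tprodDl y : additive_fun (tprod ^~ y).
Proof. by case: tprod_balanced. Qed.
Lemma tprodDr x : additive_fun (tprod x).
Proof. by case: tprod_balanced. Qed.
Lemma tprodA a x y : S a -> tprod (ract x a) y = tprod x (lact a y).
Proof. by case: tprod_balanced => _ _ h; exact: h. Qed.

Lemma tens_cls s : cls (s : tens_setoid) = \sum_(p <- s) tprod p.1 p.2 :> tens.
Proof.
elim: s => [|[x y] s ih]; first by rewrite big_nil.
by rewrite big_cons -ih /tprod -clsD.
Qed.

Lemma tens_ind (P : tens -> Prop) :
  P 0 -> (forall p q, P p -> P q -> P (p + q)) ->
  (forall x y, P (tprod x y)) -> forall q, P q.
Proof.
move=> P0 PD Pt; elim/quot_ind => s; rewrite tens_cls.
by apply: big_ind => // -[x y] _; exact: Pt.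
Qed.

Section Lift.
Variables (T : zmodType) (phi : M -> N -> T).
Hypothesis phiB : balanced phi.

Lemma tlift_cls s : tlift phi (cls (s : tens_setoid)) = tsum phi s.
Proof. by rewrite /tlift quot_liftE // => s' t e; exact: e. Qed.

Lemma tlift_tprod x y : tlift phi (tprod x y) = phi x y.
Proof. by rewrite tlift_cls /tsum big_seq1. Qed.

Lemma tlift_additive : additive_fun (tlift phi).
Proof.
elim/quot_ind=> s; elim/quot_ind=> t.
by rewrite -[cls s + cls t]clsD !tlift_cls tsum_cat.
Qed.

End Lift.

Lemma tens_eqf (T : zmodType) (f g : tens -> T) :
  additive_fun f -> additive_fun g ->
  (forall x y, f (tprod x y) = g (tprod x y)) -> forall q, f q = g q.
Proof.
move=> fD gD e; elim/tens_ind => // [|p q ep eq].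
- by rewrite !additive_fun0.
- by rewrite fD gD ep eq.
Qed.

Definition tens_lact (a : R) : tens -> tens :=
  tlift (fun x y => tprod (lact a x) y).
Definition tens_ract (q : tens) (a : R) : tens :=
  tlift (fun x y => tprod x (ract y a)) q.

Lemma tens_lact_balanced a : balanced (fun x y => tprod (lact a x) y).
Proof.
split=> [y x x'|x y y'|b x y Sb]; first by rewrite lactDr tprodDl.
- by rewrite tprodDr.
- by rewrite -lract tprodA.
Qed.

Lemma tens_ract_balanced a : balanced (fun x y => tprod x (ract y a)).
Proof.
split=> [y x x'|x y y'|b x y Sb]; first by rewrite tprodDl.
- by rewrite (ractDl a y y') tprodDr.
- by rewrite lract tprodA.
Qed.

Lemma tens_lactE a x y : tens_lact a (tprod x y) = tprod (lact a x) y.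
Proof. exact: (tlift_tprod (tens_lact_balanced a)). Qed.
Lemma tens_ractE a x y : tens_ract (tprod x y) a = tprod x (ract y a).
Proof. exact: (tlift_tprod (tens_ract_balanced a)). Qed.
Lemma tens_lactD a : additive_fun (tens_lact a).
Proof. exact: (tlift_additive (tens_lact_balanced a)). Qed.
Lemma tens_ractD a : additive_fun (tens_ract ^~ a).
Proof. exact: (tlift_additive (tens_ract_balanced a)). Qed.

Definition tens_bimod : bimod R.
Proof.
refine (@Bimod R tens tens_lact tens_ract tens_lactD _ _ _ tens_ractD _ _ _ _).
- move=> a b; elim/tens_ind => [|p q ep eq|x y].
  + by rewrite !(additive_fun0 (tens_lactD _)) addr0.
  + by rewrite !tens_lactD ep eq addrACA.
  + by rewrite !tens_lactE lactDl tprodDl.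
- move=> a b; elim/tens_ind => [|p q ep eq|x y].
  + by rewrite !(additive_fun0 (tens_lactD _)).
  + by rewrite !tens_lactD ep eq.
  + by rewrite !tens_lactE lactM.
- elim/tens_ind => [|p q ep eq|x y].
  + by rewrite !(additive_fun0 (tens_lactD _)).
  + by rewrite !tens_lactD ep eq.
  + by rewrite !tens_lactE lact1.
- move=> a b; elim/tens_ind => [|p q ep eq|x y].
  + by rewrite !(additive_fun0 (tens_ractD _)) addr0.
  + by rewrite !(tens_ractD _ p q) ep eq addrACA.
  + by rewrite !tens_ractE ractDr tprodDr.
- move=> a b; elim/tens_ind => [|p q ep eq|x y].
  + by rewrite !(additive_fun0 (tens_ractD _)).
  + by rewrite !(tens_ractD _ _ _) ep eq.
  + by rewrite !tens_ractE ractM.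
- elim/tens_ind => [|p q ep eq|x y].
  + by rewrite !(additive_fun0 (tens_ractD _)).
  + by rewrite !(tens_ractD _ p q) ep eq.
  + by rewrite !tens_ractE ract1.
- move=> a b; elim/tens_ind => [|p q ep eq|x y].
  + by rewrite !(additive_fun0 (tens_lactD _), additive_fun0 (tens_ractD _)).
  + by rewrite !(tens_lactD, tens_ractD _ _ _) ep eq.
  + by rewrite !(tens_lactE, tens_ractE).
Defined.

End Tensor.

Arguments tprod {R S M N} x y.

(* A G-grading of V is the family of projections onto its homogeneous         *)
(* components.                                                                *)
Record grading (G V : zmodType) := Grading {
  comp :> G -> V -> V;
  compD : forall g, additive_fun (comp g);
  compK : forall g h x, comp g (comp h x) = if g == h then comp h x else 0;
  comp_fin : forall x, exists2 s : seq G, uniq s & x = \sum_(g <- s) comp g x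
}.

Lemma big_uniq_sub (G : eqType) (T : zmodType) (s t : seq G) (F : G -> T) :
  uniq s -> uniq t -> {subset s <= t} -> (forall g, g \notin s -> F g = 0) ->
  \sum_(g <- t) F g = \sum_(g <- s) F g.
Proof.
move=> us ut st F0; rewrite (bigID (mem s)) /= [X in _ + X]big1 // addr0.
rewrite -big_filter; apply: perm_big; apply: uniq_perm => //.
  exact: filter_uniq.
by move=> g; rewrite mem_filter /=; case: (boolP (g \in s)) => // /st ->.
Qed.

Section GradingTheory.
Variables (G V : zmodType) (c : grading G V).

Lemma comp0 g : c g 0 = 0.
Proof. exact: (additive_fun0 (compD c g)). Qed.

Lemma comp_notin (s : seq G) x g :
  x = \sum_(h <- s) c h x -> g \notin s -> c g x = 0.
Proof.
move=> e gs; rewrite e (additive_fun_sum (compD c g)) big1_seq // => h /= hs.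
by rewrite compK; case: eqP => // gh; rewrite gh hs in gs.
Qed.

Definition supp (x : V) : seq G := s2val (cid2 (comp_fin c x)).

Lemma supp_uniq x : uniq (supp x).
Proof. exact: (s2valP (cid2 (comp_fin c x))). Qed.

Lemma suppE x : x = \sum_(g <- supp x) c g x.
Proof. exact: (s2valP' (cid2 (comp_fin c x))). Qed.

Lemma supp_notin x g : g \notin supp x -> c g x = 0.
Proof. exact/comp_notin/suppE. Qed.

Definition gsum (T : zmodType) (F : G -> V -> T) (x : V) : T :=
  \sum_(g <- supp x) F g (c g x).

Section Gsum.
Variables (T : zmodType) (F : G -> V -> T).
Hypothesis F0 : forall g, F g 0 = 0.

Lemma gsumE (s : seq G) x :
  uniq s -> (forall g, g \notin s -> c g x = 0) ->
  gsum F x = \sum_(g <- s) F g (c g x).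
Proof.
move=> us sx; pose t := undup (s ++ supp x).
have ut : uniq t by exact: undup_uniq.
rewrite /gsum -(@big_uniq_sub _ _ (supp x) t) ?supp_uniq //; last 2 first.
- by move=> g gx; rewrite mem_undup mem_cat gx orbT.
- by move=> g /supp_notin ->.
rewrite (@big_uniq_sub _ _ s t) // => g.
- by move=> gs; rewrite mem_undup mem_cat gs.
- by move=> /sx ->.
Qed.

Lemma gsum_homog g x : gsum F (c g x) = F g (c g x).
Proof.
rewrite (@gsumE [:: g]) // ?big_seq1 ?compK ?eqxx // => h.
by rewrite inE compK => /negPf ->.
Qed.

Lemma gsumD : (forall g, additive_fun (F g)) -> additive_fun (gsum F).
Proof.
move=> FD x y; pose s := undup (supp x ++ supp y).
have us : uniq s by exact: undup_uniq.
have hx g : g \notin s -> c g x = 0.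
  by rewrite mem_undup mem_cat => /norP[/supp_notin].
have hy g : g \notin s -> c g y = 0.
  by rewrite mem_undup mem_cat => /norP[_ /supp_notin].
rewrite !(@gsumE s) // => [|g gs]; last by rewrite compD hx // hy // addr0.
by rewrite -big_split; apply: eq_bigr => g _; rewrite compD FD.
Qed.

End Gsum.

End GradingTheory.

Lemma gsum_shift (G V V' T : zmodType) (c : grading G V) (c' : grading G V')
    (F : G -> V -> T) (f : V' -> V) (e : G) :
  (forall g, F g 0 = 0) -> f 0 = 0 ->
  (forall g x, c (g + e) (f x) = f (c' g x)) ->
  forall x, gsum c F (f x) = gsum c' (fun g v => F (g + e) (f v)) x.
Proof.
move=> F0 f0 fh x; rewrite (@gsumE _ _ c _ F F0 [seq g + e | g <- supp c' x]).
- by rewrite big_map /gsum; apply: eq_bigr => g _; rewrite fh.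
- by rewrite map_inj_uniq ?supp_uniq //; exact: addIr.
- move=> g gs; rewrite -(subrK e g) fh (@supp_notin _ _ c') //.
  by apply: contra gs => ?; apply/mapP; exists (g - e); rewrite ?subrK.
Qed.

Lemma eq_gsum (G V T : zmodType) (c : grading G V) (F F' : G -> V -> T) x :
  (forall g v, F g v = F' g v) -> gsum c F x = gsum c F' x.
Proof. by move=> e; apply: eq_bigr. Qed.

Section FiniteSupport.
Variables (G V : zmodType) (c : G -> V -> V).
Hypothesis cD : forall g, additive_fun (c g).
Hypothesis cK :
  forall g h x, c g (c h x) = if g == h then c h x else 0.

Definition fin_supp x :=
  exists2 s : seq G, uniq s & x = \sum_(g <- s) c g x.

Lemma fin_supp0 : fin_supp 0.
Proof. by exists [::]; rewrite ?big_nil. Qed.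

Lemma fin_supp_incl x s t : uniq s -> uniq t -> {subset s <= t} ->
  x = \sum_(g <- s) c g x -> x = \sum_(g <- t) c g x.
Proof.
move=> us ut st e; rewrite {1}e; apply/esym/big_uniq_sub => // g gs.
rewrite e (additive_fun_sum (cD g)) big1_seq // => h /= hs.
by rewrite cK; case: eqP => // gh; rewrite gh hs in gs.
Qed.

Lemma fin_suppD x y : fin_supp x -> fin_supp y -> fin_supp (x + y).
Proof.
move=> [s us ex] [t ut ey]; exists (undup (s ++ t)); first exact: undup_uniq.
under eq_bigr do rewrite cD; rewrite big_split /=; congr (_ + _).
- apply: (@fin_supp_incl _ s) => //; first exact: undup_uniq.
  by move=> g gs; rewrite mem_undup mem_cat gs.
- apply: (@fin_supp_incl _ t) => //; first exact: undup_uniq.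
  by move=> g gs; rewrite mem_undup mem_cat gs orbT.
Qed.

Lemma fin_supp_sum (I : Type) (r : seq I) (F : I -> V) :
  (forall i, fin_supp (F i)) -> fin_supp (\sum_(i <- r) F i).
Proof. by move=> h; apply: big_ind => //; [exact: fin_supp0|exact: fin_suppD]. Qed.

Lemma fin_supp_homog g x : c g x = x -> fin_supp x.
Proof. by move=> e; exists [:: g]; rewrite ?big_seq1. Qed.

End FiniteSupport.

Definition Rn (n : nat) : comNzRingType := {mpoly int[n]}.

(* [delta] is the degree of the variables: it is 2 for Z-graded bimodules,    *)
(* and (2, 0) for bigraded ones (internal degree, homological degree).        *)
Record gbimod (G : zmodType) (delta : G) (n : nat) := GBimod {
  gb_bimod :> bimod (Rn n);
  gr : grading G gb_bimod;
  gr_lact : forall d (a : Rn n) g x, a \is d.-homog ->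
    gr (g + delta *+ d) (lact a x) = lact a (gr g x);
  gr_ract : forall d (a : Rn n) g x, a \is d.-homog ->
    gr (g + delta *+ d) (ract x a) = ract (gr g x) a
}.

Definition homog_of (G : zmodType) (delta : G) n (M : gbimod delta n)
  (g : G) (x : M) : Prop := gr M g x = x.

Definition graded_subset n (S : Rn n -> Prop) : Prop :=
  forall d a, S a -> S (pihomog mdeg d a).

Section GradedTensor.
Variables (G : zmodType) (delta : G) (n : nat).
Variables (S : Rn n -> Prop) (gS : graded_subset S) (M N : gbimod delta n).

Local Notation T := (tens_bimod S M N).

(* component of degree g of x (x) y: the sum of the x_h (x) y_(g-h) *)
Definition tens_comp_term (g h : G) (x : M) (y : N) : T :=
  tprod x (gr N (g - h) y).

Definition tens_comp (g : G) : T -> T :=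
  tlift (fun x y => gsum (gr M) (fun h x => tens_comp_term g h x y) x).

Lemma tens_comp_term0 g h y : tens_comp_term g h 0 y = 0.
Proof. exact: (additive_fun0 (tprodDl _ _)). Qed.

Lemma tens_comp_balanced g : balanced S
  (fun (x : M) (y : N) => gsum (gr M) (fun h x => tens_comp_term g h x y) x).
Proof.
have hr (x : M) : additive_fun
    (fun y : N => gsum (gr M) (fun h x => tens_comp_term g h x y) x).
  move=> y y'; rewrite /gsum -big_split; apply: eq_bigr => h _.
  by rewrite /tens_comp_term compD tprodDr.
have hl (y : N) : additive_fun
    (fun x : M => gsum (gr M) (fun h x => tens_comp_term g h x y) x).
  apply: gsumD => h; first exact: tens_comp_term0.
  by move=> x x'; rewrite /tens_comp_term tprodDl.
split=> // a x y Sa.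
rewrite [a](@pihomog_partitionE _ _ mdeg _ _ (leqnn _)).
rewrite ract_sum lact_sum (additive_fun_sum (hl y)) (additive_fun_sum (hr x)).
apply: eq_bigr => d _; set b := pihomog _ _ _.
have bh : b \is (nat_of_ord d).-homog by exact: pihomogP.
rewrite (@gsum_shift _ _ _ _ (gr M) (gr M) _ (fun v => ract v b) (delta *+ d)).
- apply: eq_gsum => h v; rewrite /tens_comp_term tprodA; last exact: gS.
  by rewrite -(gr_lact _ _ bh) opprD addrA subrK.
- by move=> h; exact: tens_comp_term0.
- exact: (additive_fun0 (ractDl b)).
- by move=> h v; rewrite gr_ract.
Qed.

Lemma tens_compE g x y : tens_comp g (tprod x y) =
  gsum (gr M) (fun h x => tens_comp_term g h x y) x.
Proof. exact: (tlift_tprod (tens_comp_balanced g)). Qed.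

Lemma tens_compD g : additive_fun (tens_comp g).
Proof. exact: (tlift_additive (tens_comp_balanced g)). Qed.

Lemma tens_comp_homog g h l x y :
  tens_comp g (tprod (gr M h x) (gr N l y)) =
  if g == h + l then tprod (gr M h x) (gr N l y) else 0.
Proof.
rewrite tens_compE gsum_homog => [|h']; last exact: tens_comp_term0.
rewrite /tens_comp_term compK subr_eq addrC; case: eqP => _ //.
exact: (additive_fun0 (tprodDr _ _)).
Qed.

Lemma tens_compK g h q :
  tens_comp g (tens_comp h q) = if g == h then tens_comp h q else 0.
Proof.
elim/tens_ind: q => [|p q ep eq|x y].
- by rewrite !(additive_fun0 (tens_compD _)) if_same.
- by rewrite !tens_compD ep eq; case: ifP; rewrite ?addr0.
- rewrite [tens_comp h _]tens_compE /gsum (additive_fun_sum (tens_compD g)).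
  under eq_bigr do rewrite tens_comp_homog addrC subrK.
  by case: eqP => // _; rewrite big1.
Qed.

Lemma tens_comp_fin q :
  exists2 s : seq G, uniq s & q = \sum_(g <- s) tens_comp g q.
Proof.
apply: (@tens_ind _ _ _ _ (fin_supp tens_comp)) => [|p p'|x y].
- exact: fin_supp0.
- exact: fin_suppD tens_compD tens_compK p p'.
- rewrite (suppE (gr M) x) (additive_fun_sum (tprodDl S y)).
  apply: (fin_supp_sum tens_compD tens_compK) => h.
  rewrite (suppE (gr N) y) (additive_fun_sum (tprodDr S _)).
  apply: (fin_supp_sum tens_compD tens_compK) => l.
  by apply: (fin_supp_homog (g := h + l)); rewrite tens_comp_homog eqxx.
Qed.

Definition tens_gr : grading G T :=
  Grading tens_compD tens_compK tens_comp_fin.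

Definition tens_gbimod : gbimod delta n.
Proof.
refine (@GBimod G delta n T tens_gr _ _).
- move=> d a g q ah /=; elim/tens_ind: q => [|p q ep eq|x y].
  + by rewrite !(additive_fun0 (tens_lactD _), additive_fun0 (tens_compD _)).
  + by rewrite !(tens_lactD, tens_compD) ep eq.
  + rewrite tens_lactE !tens_compE.
    rewrite (@gsum_shift _ _ _ _ (gr M) (gr M) _ (lact a) (delta *+ d)).
    * rewrite /gsum (additive_fun_sum (tens_lactD a)); apply: eq_bigr => h _.
      by rewrite /tens_comp_term tens_lactE opprD addrACA subrr addr0.
    * by move=> h; exact: tens_comp_term0.
    * exact: (additive_fun0 (lactDr a)).
    * by move=> h v; rewrite gr_lact.
- move=> d a g q ah /=; elim/tens_ind: q => [|p q ep eq|x y].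
  + by rewrite !(additive_fun0 (tens_ractD _), additive_fun0 (tens_compD _)).
  + by rewrite !(tens_ractD _ _ _, tens_compD) ep eq.
  + rewrite tens_ractE !tens_compE /gsum (additive_fun_sum (tens_ractD a)).
    apply: eq_bigr => h _; rewrite /tens_comp_term tens_ractE.
    by rewrite addrAC gr_ract.
Defined.

End GradedTensor.

Section Regular.
Variable n : nat.

Definition reg_bimod : bimod (Rn n).
Proof.
refine (@Bimod (Rn n) {mpoly int[n]} *%R *%R _ _ _ _ _ _ _ _ _).
- by move=> a x y; rewrite mulrDr.
- by move=> a b x; rewrite mulrDl.
- by move=> a b x; rewrite mulrA.
- by move=> x; rewrite mul1r.
- by move=> a x y; rewrite mulrDl.
- by move=> a b x; rewrite mulrDr.
- by move=> a b x; rewrite mulrA.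
- by move=> x; rewrite mulr1.
- by move=> a b x; rewrite mulrA.
Defined.

Definition reg_comp (i : int) (p : {mpoly int[n]}) : {mpoly int[n]} :=
  if i is Posz d then if odd d then 0 else pihomog mdeg d./2 p else 0.

Lemma reg_compD i : additive_fun (reg_comp i).
Proof.
case: i => d p q /=; last by rewrite addr0.
by case: ifP => _; rewrite ?addr0 ?pihomogD.
Qed.

Lemma reg_compK i j p :
  reg_comp i (reg_comp j p) = if i == j then reg_comp j p else 0.
Proof.
case: i => [d|d]; case: j => [e|e] //=; last by rewrite if_same.
  rewrite eqz_nat; case: (boolP (odd e)) => [|oe].
    by rewrite pihomog0 !if_same.
  case: (boolP (odd d)) => [od|od].
    by case: eqP => // de; rewrite -de od in oe.
  case: eqP => [->|/eqP de]; first exact: pihomog_id.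
  rewrite (@pihomog_ne0 _ _ mdeg e./2) ?pihomogP //.
  apply: contra de => /eqP de.
  by rewrite -(even_halfK oe) -(even_halfK od) de.
by rewrite pihomog0 if_same.
Qed.

Lemma reg_comp_fin p :
  exists2 s : seq int, uniq s & p = \sum_(i <- s) reg_comp i p.
Proof.
exists [seq Posz d.*2 | d <- iota 0 (mmeasure mdeg p)].
  by rewrite map_inj_uniq ?iota_uniq // => d e [] /double_inj.
rewrite big_map {1}[p](@pihomog_partitionE _ _ mdeg _ _ (leqnn _)).
rewrite -(big_mkord xpredT (fun d => pihomog mdeg d p)) /index_iota subn0.
by apply: eq_bigr => d _ /=; rewrite odd_double doubleK.
Qed.

Definition reg_gr : grading int reg_bimod :=
  @Grading int reg_bimod reg_comp reg_compD reg_compK reg_comp_fin.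

Lemma pihomogM d e (a p : {mpoly int[n]}) : a \is d.-homog ->
  pihomog mdeg (e + d) (a * p) = a * pihomog mdeg e p.
Proof.
move=> ah; rewrite [p](@pihomog_partitionE _ _ mdeg _ _ (leqnn _)).
rewrite mulr_sumr !raddf_sum mulr_sumr; apply: eq_bigr => l _ /=.
set b := pihomog _ l p; have bh : b \is (nat_of_ord l).-homog by exact: pihomogP.
have abh : a * b \is (d + l)%N.-homog by exact: dhomogM.
case: (eqVneq (nat_of_ord l) e) => [le|le].
  by rewrite !pihomog_dE // -le // addnC.
rewrite (pihomog_ne0 le bh) mulr0 (pihomog_ne0 _ abh) //.
by rewrite addnC eqn_add2r.
Qed.

Lemma pihomogM_lt d e (a p : {mpoly int[n]}) : a \is d.-homog -> (e < d)%N ->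
  pihomog mdeg e (a * p) = 0.
Proof.
move=> ah ed; rewrite [p](@pihomog_partitionE _ _ mdeg _ _ (leqnn _)).
rewrite mulr_sumr !raddf_sum big1 // => l _ /=.
set b := pihomog _ l p; have bh : b \is (nat_of_ord l).-homog by exact: pihomogP.
have abh : a * b \is (d + l)%N.-homog by exact: dhomogM.
apply: (pihomog_ne0 _ abh); apply/eqP => h.
by move: ed; rewrite -h ltnNge leq_addr.
Qed.

Lemma reg_comp_mul d (a : {mpoly int[n]}) i p : a \is d.-homog ->
  reg_comp (i + 2%:Z *+ d) (a * p) = a * reg_comp i p.
Proof.
move=> ah; have -> : 2%:Z *+ d = d.*2%:Z by rewrite -mulr_natr natz -PoszM mul2n.
case: i => [e|e].
  rewrite -PoszD /reg_comp oddD odd_double addbF.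
  case: ifP => oe; first by rewrite mulr0.
  by rewrite halfD oe odd_double add0n doubleK pihomogM.
rewrite [in RHS]/reg_comp mulr0 NegzE; case: (leqP e.+1 d.*2) => ed.
  rewrite addrC subzn // /reg_comp; case: ifP => // _.
  apply: (pihomogM_lt _ ah); rewrite ltn_half_double.
  by rewrite ltn_subrL /= (leq_trans _ ed).
have -> : - e.+1%:Z + d.*2%:Z = Negz (e - d.*2).
  by rewrite NegzE -subSn // addrC -opprB subzn // ltnW.
by [].
Qed.

Definition reg : gbimod 2%:Z n.
Proof.
refine (@GBimod int 2%:Z n reg_bimod reg_gr _ _) => d a i p ah /=.
- exact: reg_comp_mul.
- by rewrite ![_ * a]mulrC reg_comp_mul.
Defined.

End Regular.

Section Shift.
Variables (n : nat) (e : int) (M : gbimod 2%:Z n).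

Definition shift_gr : grading int M.
Proof.
refine (@Grading int M (fun i => gr M (i - e)) _ _ _).
- by move=> i; exact: compD.
- by move=> i j x; rewrite compK (inj_eq (addIr _)).
- move=> x; exists [seq i + e | i <- supp (gr M) x].
    by rewrite map_inj_uniq ?supp_uniq //; exact: addIr.
  rewrite big_map {1}(suppE (gr M) x).
  by apply: eq_bigr => i _; rewrite addrK.
Defined.

(* the shift Q^e M, where (Q^e M)^i = M^(i - e) *)
Definition shift : gbimod 2%:Z n.
Proof.
refine (@GBimod int 2%:Z n M shift_gr _ _) => d a i x ah /=.
- by rewrite addrAC gr_lact.
- by rewrite addrAC gr_ract.
Defined.

End Shift.

(* The simple transposition (i, i+1), with positions numbered from 0.         *)
Lemma sgen_subproof0 n (i : 'I_n.-1) : (i < n)%N.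
Proof. by apply: leq_trans (ltn_ord i) (leq_pred n). Qed.
Lemma sgen_subproof1 n (i : 'I_n.-1) : (i.+1 < n)%N.
Proof. by rewrite -ltn_predRL. Qed.

Definition sgen n (i : 'I_n.-1) : 'S_n :=
  tperm (Ordinal (sgen_subproof0 i)) (Ordinal (sgen_subproof1 i)).

Definition invariants n (i : 'I_n.-1) (a : Rn n) : Prop := msym (sgen i) a = a.

Lemma invariants_graded n (i : 'I_n.-1) : graded_subset (invariants i).
Proof. by move=> d a ha; rewrite /invariants msym_pihomog ha. Qed.

Definition Bgen n (i : 'I_n.-1) : gbimod 2%:Z n :=
  shift (-1) (tens_gbimod (@invariants_graded n i) (reg n) (reg n)).

(* The multiplication map f (x) g |-> f g, as a degree 0 map Q B_i -> R_n.    *)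
Section Multiplication.
Variables (n : nat) (i : 'I_n.-1).

Definition Bmul : shift 1 (Bgen i) -> reg n :=
  tlift (fun f g : reg n => (f : Rn n) * g).

Lemma Bmul_balanced :
  balanced (invariants i) (fun f g : reg n => (f : Rn n) * g : reg n).
Proof.
split=> [y x x'|x y y'|a x y _]; first by rewrite mulrDl.
- by rewrite mulrDr.
- by rewrite /= mulrA.
Qed.

Lemma BmulE (f g : Rn n) : Bmul (@tprod _ _ (reg n) (reg n) f g) = f * g.
Proof. exact: (tlift_tprod Bmul_balanced). Qed.

Lemma BmulD : additive_fun Bmul.
Proof. exact: (tlift_additive Bmul_balanced). Qed.

Lemma Bmul_bimap : is_bimap Bmul.
Proof.
split=> [|a x|a x]; first exact: BmulD.
- move: x; apply: (@tens_eqf _ (invariants i) (reg n) (reg n)) => [x y|x y|x y].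
  + by rewrite (@lactDr _ (shift 1 (Bgen i))) BmulD.
  + by rewrite BmulD lactDr.
  + have -> : @lact _ (shift 1 (Bgen i)) a (tprod x y) =
      @tprod _ _ (reg n) (reg n) (a * (x : Rn n)) y by exact: tens_lactE.
    by rewrite !BmulE; exact/esym/mulrA.
- move: x; apply: (@tens_eqf _ (invariants i) (reg n) (reg n)) => [x y|x y|x y].
  + by rewrite (@ractDl _ (shift 1 (Bgen i)) a x y) BmulD.
  + by rewrite BmulD (@ractDl _ (reg n) a).
  + have -> : @ract _ (shift 1 (Bgen i)) (tprod x y) a =
      @tprod _ _ (reg n) (reg n) x ((y : Rn n) * a) by exact: tens_ractE.
    by rewrite !BmulE; exact: mulrA.
Qed.

Lemma reg_compM j h (f g : Rn n) :
  reg_comp j (reg_comp h f * g) = reg_comp h f * reg_comp (j - h) g.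
Proof.
have z p q : reg_comp p (0 * (q : {mpoly int[n]})) = 0 * reg_comp (p - h) q.
  by rewrite !mul0r; exact: (additive_fun0 (@reg_compD n p)).
case: h z => h z; last exact: z.
rewrite [reg_comp (Posz h) f]/reg_comp; case: (boolP (odd h)) => oh; first exact: z.
have fh : pihomog mdeg h./2 f \is h./2.-homog by exact: pihomogP.
rewrite -(reg_comp_mul _ _ fh); congr (reg_comp _ _).
by rewrite -mulr_natr natz -PoszM mul2n (even_halfK oh) subrK.
Qed.

Lemma Bmul_deg j x : gr (reg n) j (Bmul x) = Bmul (gr (shift 1 (Bgen i)) j x).
Proof.
move: x; apply: (@tens_eqf _ (invariants i) (reg n) (reg n)) => [x y|x y|x y].
- by rewrite BmulD compD.
- by rewrite (compD (gr (shift 1 (Bgen i)))) BmulD.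
- rewrite BmulE.
  have -> : gr (shift 1 (Bgen i)) j (tprod x y) = gsum (gr (reg n))
    (fun h x => tens_comp_term (invariants i) (j - 1 - -1) h x y) x.
    exact: (tens_compE (@invariants_graded n i)).
  rewrite opprK subrK {1}(suppE (gr (reg n)) x) mulr_suml.
  rewrite (additive_fun_sum (compD (gr (reg n)) j)) /gsum (additive_fun_sum BmulD).
  by apply: eq_bigr => h _; rewrite BmulE /= reg_compM.
Qed.

End Multiplication.

(* A complex (X^k, d) is encoded by the direct sum of the X^k, bigraded by    *)
(* internal and homological degree, with d of bidegree (0, 1).                *)
Definition bidelta : int * int := (2%:Z, 0).

Lemma bidelta1 d : (bidelta *+ d).1 = 2%:Z *+ d.
Proof. by elim: d => // d ih; rewrite !mulrS /= ih. Qed.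
Lemma bidelta2 d : (bidelta *+ d).2 = 0.
Proof. by elim: d => // d ih; rewrite mulrS /= ih addr0. Qed.

Record complex (n : nat) := Complex {
  cx_bim :> gbimod bidelta n;
  diff : cx_bim -> cx_bim;
  diff_bimap : is_bimap diff;
  diff_deg : forall g x, gr cx_bim (g + (0, 1)) (diff x) = diff (gr cx_bim g x);
  diff2 : forall x, diff (diff x) = 0
}.

Section Conc.
Variables (n : nat) (M : gbimod 2%:Z n).

Definition conc_gr : grading (int * int)%type M.
Proof.
refine (@Grading (int * int)%type M
  (fun g x => if g.2 == 0 then gr M g.1 x else 0) _ _ _).
- by move=> [i k] x y /=; case: eqP; rewrite ?addr0 ?compD.
- move=> [i k] [j l] x /=; rewrite xpair_eqE.
  case: (eqVneq l 0) => [->|l0]; last by rewrite comp0 !if_same.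
  by case: eqP => _; rewrite ?andbT ?andbF // compK.
- move=> x; exists [seq (i, 0) | i <- supp (gr M) x].
    by rewrite map_inj_uniq ?supp_uniq // => i j [].
  by rewrite big_map {1}(suppE (gr M) x).
Defined.

Definition conc_gbimod : gbimod bidelta n.
Proof.
refine (@GBimod (int * int)%type bidelta n M conc_gr _ _) => d a [i k] x ah /=.
- rewrite bidelta2 addr0 bidelta1; case: eqP => _; first by rewrite gr_lact.
  by rewrite (additive_fun0 (lactDr a)).
- rewrite bidelta2 addr0 bidelta1; case: eqP => _; first by rewrite gr_ract.
  by rewrite (additive_fun0 (@ractDl _ M a)).
Defined.

(* M placed in homological degree 0 *)
Definition conc : complex n.
Proof.
refine (@Complex n conc_gbimod (fun=> 0) _ _ _) => //.
- split=> [x y|a x|a x]; first by rewrite addr0.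
  + by rewrite (additive_fun0 (lactDr a)).
  + by rewrite (additive_fun0 (@ractDl _ M a)).
- by move=> g x; rewrite comp0.
Defined.

End Conc.

Section TwoTerm.
Variables (n : nat) (A B : gbimod 2%:Z n) (f : A -> B).
Hypothesis f_bimap : is_bimap f.
Hypothesis f_deg : forall i x, gr B i (f x) = f (gr A i x).

Definition two_term_bimod : bimod (Rn n).
Proof.
refine (@Bimod (Rn n) (A * B)%type
  (fun a p => (lact a p.1, lact a p.2)) (fun p a => (ract p.1 a, ract p.2 a))
  _ _ _ _ _ _ _ _ _).
- by move=> a [x y] [x' y'] /=; rewrite !lactDr.
- by move=> a b [x y] /=; rewrite !lactDl.
- by move=> a b [x y] /=; rewrite !lactM.
- by move=> [x y] /=; rewrite !lact1.
- by move=> a [x y] [x' y'] /=; rewrite (ractDl a x x') (ractDl a y y').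
- by move=> a b [x y] /=; rewrite !ractDr.
- by move=> a b [x y] /=; rewrite !ractM.
- by move=> [x y] /=; rewrite !ract1.
- by move=> a b [x y] /=; rewrite !lract.
Defined.

Definition two_term_comp (g : int * int) (p : A * B) : A * B :=
  (if g.2 == -1 then gr A g.1 p.1 else 0, if g.2 == 0 then gr B g.1 p.2 else 0).

Lemma two_term_compD g :
  additive_fun (two_term_comp g : two_term_bimod -> two_term_bimod).
Proof.
move=> [x y] [x' y']; congr pair => /=.
    by case: eqP; rewrite ?addr0 ?compD.
  by case: eqP; rewrite ?addr0 ?compD.
Qed.

Lemma two_term_compK g h (p : two_term_bimod) :
  two_term_comp g (two_term_comp h p) = if g == h then two_term_comp h p else 0.
Proof.
  case: g h => [i k] [j l]; rewrite /two_term_comp /= xpair_eqE.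
  have h c : (k == c) -> (l == c) = (k == l) by move/eqP=> <-; rewrite eq_sym.
  have -> : (0 : two_term_bimod) = (0 : A, 0 : B) by [].
  transitivity (if (i == j) && (k == l) then (if l == -1 then gr A j p.1 else 0)
      else 0, if (i == j) && (k == l) then (if l == 0 then gr B j p.2 else 0)
      else 0); last by case: ifP.
  congr pair; case: ifP => [kc|kc].
  - rewrite (h _ kc); case: (k == l); last by rewrite andbF comp0.
    by rewrite andbT compK.
  - by case: (eqVneq k l) => [<-|_]; rewrite ?kc ?andbF ?if_same.
  - rewrite (h _ kc); case: (k == l); last by rewrite andbF comp0.
    by rewrite andbT compK.
  - by case: (eqVneq k l) => [<-|_]; rewrite ?kc ?andbF ?if_same.
Qed.

Lemma two_term_comp_fin (p : two_term_bimod) :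
  exists2 s, uniq s & p = \sum_(g <- s) (two_term_comp g p : two_term_bimod).
Proof.
have cD := two_term_compD; have cK := two_term_compK.
case: p => x y.
have -> : (x, y) = (\sum_(i <- supp (gr A) x) (gr A i x, 0 : B)) +
    (\sum_(i <- supp (gr B) y) (0 : A, gr B i y)) :> two_term_bimod.
  have ha (s : seq int) : \sum_(i <- s) (gr A i x, 0 : B) =
      (\sum_(i <- s) gr A i x, 0) :> two_term_bimod.
    by elim: s => [|i s ih]; rewrite ?big_nil // !big_cons ih; congr pair; exact: addr0.
  have hb (s : seq int) : \sum_(i <- s) (0 : A, gr B i y) =
      (0, \sum_(i <- s) gr B i y) :> two_term_bimod.
    by elim: s => [|i s ih]; rewrite ?big_nil // !big_cons ih; congr pair; exact: addr0.
  rewrite ha hb -!suppE; congr pair; last by rewrite add0r.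
  by rewrite addr0.
apply: (fin_suppD cD cK); apply: (fin_supp_sum cD cK) => i.
- by apply: (fin_supp_homog (g := (i, -1))); rewrite /two_term_comp /= compK eqxx.
- by apply: (fin_supp_homog (g := (i, 0))); rewrite /two_term_comp /= compK eqxx.
Qed.

Definition two_term_gr : grading (int * int)%type two_term_bimod :=
  @Grading _ two_term_bimod two_term_comp
    two_term_compD two_term_compK two_term_comp_fin.

Definition two_term_gbimod : gbimod bidelta n.
Proof.
refine (@GBimod (int * int)%type bidelta n two_term_bimod two_term_gr _ _)
  => d a [i k] [x y] ah; rewrite /= /two_term_comp /= bidelta2 addr0 bidelta1.
- by congr pair; case: eqP => _; rewrite ?gr_lact // (additive_fun0 (lactDr a)).
- by congr pair; case: eqP => _; rewrite ?gr_ract //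
    (additive_fun0 (@ractDl _ _ a)).
Defined.

Definition two_term_diff (p : two_term_gbimod) : two_term_gbimod :=
  (0 : A, f p.1).

Lemma two_term_diff_bimap : is_bimap two_term_diff.
Proof.
have [fD fl fr] := f_bimap.
split=> [[x y] [x' y']|a [x y]|a [x y]]; congr pair => //=.
- by rewrite addr0.
- by rewrite (additive_fun0 (lactDr a)).
- by rewrite (additive_fun0 (@ractDl _ _ a)).
Qed.

(* the complex A -> B with B in homological degree 0 *)
Definition two_term : complex n.
Proof.
refine (@Complex n two_term_gbimod two_term_diff two_term_diff_bimap _ _);
  have [fD fl fr] := f_bimap.
- move=> [i k] [x y]; rewrite /= /two_term_comp /= addr0; congr pair.
    by rewrite comp0 if_same.
  rewrite -[_ == 0](inj_eq (addIr (-1))) addrK add0r.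
  by case: eqP => _; rewrite ?f_deg ?(additive_fun0 fD).
- by move=> [x y]; rewrite /two_term_diff /= (additive_fun0 fD).
Defined.

End TwoTerm.

Section ComplexTensor.
Variable n : nat.

(* x |-> (-1)^k x on the part of homological degree k *)
Definition ksign_term (X : complex n) (g : int * int) (x : X) : X :=
  if odd `|g.2|%N then - x else x.
Definition ksign (X : complex n) (x : X) : X := gsum (gr X) (@ksign_term X) x.

Section KSign.
Variable X : complex n.

Lemma ksign_term0 g : @ksign_term X g 0 = 0.
Proof. by rewrite /ksign_term oppr0 if_same. Qed.

Lemma ksignD : additive_fun (@ksign X).
Proof.
apply: gsumD => [|g x y]; first exact: ksign_term0.
by rewrite /ksign_term; case: ifP => _ //; rewrite opprD.
Qed.

Lemma ksign_homog g (x : X) : ksign (gr X g x) = ksign_term g (gr X g x).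
Proof. exact: (gsum_homog _ ksign_term0). Qed.

Lemma homog_eqf (T : zmodType) (f h : X -> T) :
  additive_fun f -> additive_fun h ->
  (forall g x, f (gr X g x) = h (gr X g x)) -> forall x, f x = h x.
Proof.
move=> fD hD e x; rewrite (suppE (gr X) x) (additive_fun_sum fD).
by rewrite (additive_fun_sum hD); apply: eq_bigr.
Qed.

Lemma ksign_gr g (x : X) : gr X g (ksign x) = ksign (gr X g x).
Proof.
move: x; apply: homog_eqf => [x y|x y|h x].
- by rewrite ksignD compD.
- by rewrite compD ksignD.
- rewrite compK !ksign_homog /ksign_term.
  case: (eqVneq g h) => [->|gh]; first rewrite ksign_homog /ksign_term.
    by case: ifP; rewrite ?(additive_funN (compD _ h)) compK eqxx.
  rewrite (additive_fun0 ksignD).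
  by case: ifP; rewrite ?(additive_funN (compD _ g)) compK (negPf gh) ?oppr0.
Qed.

Lemma ksignK (x : X) : ksign (ksign x) = x.
Proof.
move: x; apply: homog_eqf => [x y|x y|g x] //; first by rewrite !ksignD.
rewrite [ksign (gr _ _ _)]ksign_homog /ksign_term; case: ifP => od.
  by rewrite (additive_funN ksignD) ksign_homog /ksign_term od opprK.
by rewrite ksign_homog /ksign_term od.
Qed.

Lemma diffD : additive_fun (@diff n X).
Proof. by case: (diff_bimap X). Qed.

Lemma ksign_diff (x : X) : ksign (diff x) = - diff (ksign x).
Proof.
move: x; apply: homog_eqf => [x y|x y|g x].
- by rewrite diffD ksignD.
- by rewrite ksignD diffD opprD.
- rewrite -diff_deg !ksign_homog diff_deg /ksign_term /=.
  have -> : odd `|g.2 + 1| = ~~ odd `|g.2|.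
    case: (g.2) => k; first by rewrite -PoszD addn1.
    have -> : Negz k + 1 = - k%:Z by rewrite NegzE -addn1 PoszD opprD subrK.
    by rewrite abszN /= negbK.
  by case: (odd `|g.2|) => /=; rewrite ?(additive_funN diffD) ?opprK.
Qed.

Lemma ksign_lact a (x : X) : @ksign X (lact a x) = lact a (ksign x).
Proof.
rewrite [a](@pihomog_partitionE _ _ mdeg _ _ (leqnn _)) !lact_sum.
rewrite (additive_fun_sum ksignD); apply: eq_bigr => d _.
set b := pihomog _ _ _.
have bh : b \is (nat_of_ord d).-homog by exact: pihomogP.
rewrite /ksign (@gsum_shift _ _ _ _ (gr X) (gr X) _ (lact b) (bidelta *+ d)).
- rewrite /gsum (additive_fun_sum (lactDr b)); apply: eq_bigr => g _.
  by rewrite /ksign_term [(g + _).2]/= bidelta2 addr0; case: ifP; rewrite ?(additive_funN (lactDr b)).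
- exact: ksign_term0.
- exact: (additive_fun0 (lactDr b)).
- by move=> g y; rewrite gr_lact.
Qed.

Lemma ksign_ract a (x : X) : @ksign X (ract x a) = ract (ksign x) a.
Proof.
rewrite [a](@pihomog_partitionE _ _ mdeg _ _ (leqnn _)) !ract_sum.
rewrite (additive_fun_sum ksignD); apply: eq_bigr => d _.
set b := pihomog _ _ _.
have bh : b \is (nat_of_ord d).-homog by exact: pihomogP.
rewrite /ksign (@gsum_shift _ _ _ _ (gr X) (gr X) _ (fun y => ract y b) (bidelta *+ d)).
- rewrite /gsum (additive_fun_sum (@ractDl _ X b)); apply: eq_bigr => g _.
  by rewrite /ksign_term [(g + _).2]/= bidelta2 addr0; case: ifP;
    rewrite ?(additive_funN (@ractDl _ X b)).
- exact: ksign_term0.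
- exact: (additive_fun0 (@ractDl _ X b)).
- by move=> g y; rewrite gr_ract.
Qed.

End KSign.

Section CTensor.
Variables X Y : complex n.

Definition all_of (a : Rn n) : Prop := True.
Lemma all_of_graded : @graded_subset n all_of.
Proof. by []. Qed.

(* Elements of all of R_n may cross the tensor sign: this is X (x)_{R_n} Y.   *)
Definition ctensor_gbimod : gbimod bidelta n :=
  tens_gbimod all_of_graded X Y.

Local Notation T := (tens_bimod all_of X Y).

Definition ctensor_diff : T -> T :=
  tlift (fun x y => tprod (diff x) y + tprod (ksign x) (diff y) : T).

Lemma ctensor_diff_balanced : balanced all_of
  (fun (x : X) (y : Y) => tprod (diff x) y + tprod (ksign x) (diff y) : T).
Proof.
have [_ dl dr] := diff_bimap X; have [_ dl' dr'] := diff_bimap Y.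
split=> [y x x'|x y y'|a x y _].
- by rewrite diffD ksignD (tprodDl _ y) (tprodDl _ (diff y)) addrACA.
- by rewrite diffD !(tprodDr _ _ _) addrACA.
- by rewrite dr ksign_ract dl' !tprodA.
Qed.

Lemma ctensor_diffE x y :
  ctensor_diff (tprod x y) = tprod (diff x) y + tprod (ksign x) (diff y).
Proof. exact: (tlift_tprod ctensor_diff_balanced). Qed.

Lemma ctensor_diffD : additive_fun ctensor_diff.
Proof. exact: (tlift_additive ctensor_diff_balanced). Qed.

Lemma tprod0l (y : Y) : tprod (0 : X) y = 0 :> T.
Proof. exact: (additive_fun0 (tprodDl _ y)). Qed.
Lemma tprod0r (x : X) : tprod x (0 : Y) = 0 :> T.
Proof. exact: (additive_fun0 (tprodDr _ x)). Qed.

Lemma ctensor_lactE a x y :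
  @lact _ ctensor_gbimod a (tprod x y) = tprod (lact a x) y.
Proof. exact: tens_lactE. Qed.
Lemma ctensor_ractE a x y :
  @ract _ ctensor_gbimod (tprod x y) a = tprod x (ract y a).
Proof. exact: tens_ractE. Qed.

Lemma ctensor_compE g x y : gr ctensor_gbimod g (tprod x y) =
  gsum (gr X) (fun h x => tens_comp_term all_of g h x y) x.
Proof. exact: (tens_compE all_of_graded). Qed.

Definition ctensor : complex n.
Proof.
refine (@Complex n ctensor_gbimod ctensor_diff _ _ _).
- split; first exact: ctensor_diffD.
  + move=> a; apply: tens_eqf => [q q'|q q'|x y].
    * by rewrite lactDr ctensor_diffD.
    * by rewrite ctensor_diffD lactDr.
    * rewrite ctensor_lactE !ctensor_diffE (@lactDr _ ctensor_gbimod).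
      rewrite !ctensor_lactE ksign_lact.
      by have [_ -> _] := diff_bimap X.
  + move=> a; apply: tens_eqf => [q q'|q q'|x y].
    * by rewrite (@ractDl _ ctensor_gbimod a q q') ctensor_diffD.
    * by rewrite ctensor_diffD (@ractDl _ ctensor_gbimod a).
    * rewrite ctensor_ractE !ctensor_diffE (@ractDl _ ctensor_gbimod).
      rewrite !ctensor_ractE.
      by have [_ _ ->] := diff_bimap Y.
- move=> g; apply: tens_eqf => [q q'|q q'|x y].
  + by rewrite ctensor_diffD compD.
  + by rewrite compD ctensor_diffD.
  + rewrite ctensor_diffE compD !ctensor_compE.
    rewrite (@gsum_shift _ _ _ _ (gr X) (gr X) _ (@diff n X) (0, 1)); last first.
    * by move=> h v; rewrite diff_deg.
    * exact: (additive_fun0 (@diffD X)).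
    * by move=> h; exact: tens_comp_term0.
    rewrite (@gsum_shift _ _ _ _ (gr X) (gr X) _ (@ksign X) 0); last first.
    * by move=> h v; rewrite addr0 ksign_gr.
    * exact: (additive_fun0 (@ksignD X)).
    * by move=> h; exact: tens_comp_term0.
    rewrite /gsum (additive_fun_sum ctensor_diffD) -big_split.
    apply: eq_bigr => h _; rewrite /tens_comp_term ctensor_diffE addr0.
    congr (_ + _); first by rewrite opprD addrACA subrr addr0.
    by rewrite -(@diff_deg _ Y) addrAC.
- apply: tens_eqf => [q q'|q q'|x y].
  + by rewrite !ctensor_diffD.
  + by rewrite addr0.
  + rewrite ctensor_diffE ctensor_diffD !ctensor_diffE !diff2 ksignK.
    rewrite tprod0l add0r tprod0r addr0 ksign_diff -(tprodDl _ (diff y)).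
    by rewrite addNr tprod0l.
Defined.

End CTensor.

End ComplexTensor.

(* F(sigma_i) = (Q B_i -> R_n), with R_n in homological degree 0 *)
Definition rouquier_gen n (i : 'I_n.-1) : complex n :=
  two_term (@Bmul_bimap n i) (@Bmul_deg n i).

Definition rouquier n (w : seq 'I_n.-1) : complex n :=
  foldr (fun i X => ctensor (rouquier_gen i) X) (conc (reg n)) w.

(* The permutation s_(i_1) o ... o s_(i_r) of the word w = i_1 ... i_r (recall  *)
(* that s * t is "s, then t" for MathComp permutations).                      *)
Definition word_perm n (w : seq 'I_n.-1) : 'S_n :=
  foldr (fun i s => (s * sgen i)%g) 1%g w.

Definition reduced_word n (s : 'S_n) (w : seq 'I_n.-1) : Prop :=
  word_perm w = s /\ forall w', word_perm w' = s -> (size w <= size w')%N.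

(* i |-> i + n for i < m, and m + j |-> j for j < n *)
Definition torus_fun m n (x : 'I_(m + n)) : 'I_(m + n) :=
  match split x with
  | inl i => cast_ord (addnC n m) (rshift n i)
  | inr j => cast_ord (addnC n m) (lshift m j)
  end.

Lemma torus_fun_inj m n : injective (@torus_fun m n).
Proof.
apply: (can_inj (g := fun y => match split (cast_ord (addnC m n) y) with
  | inl j => rshift m j | inr i => lshift n i end)) => x.
rewrite /torus_fun -[RHS]splitK; case: (split x) => i /=.
- by rewrite cast_ord_comp cast_ord_id -[rshift n i]/(unsplit (inr i)) unsplitK.
- by rewrite cast_ord_comp cast_ord_id -[lshift m i]/(unsplit (inl i)) unsplitK.
Qed.

Definition torus_perm m n : 'S_(m + n) := perm (@torus_fun_inj m n).

Section Homology.
Variables (A B C : zmodType) (f : A -> B) (g : B -> C).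
Hypotheses (fD : additive_fun f) (gD : additive_fun g).

Definition cycle : Type := {b : B | g b = 0}.

Definition cycle_zero : cycle := exist _ 0 (additive_fun0 gD).
Program Definition cycle_opp (x : cycle) : cycle := exist _ (- sval x) _.
Next Obligation. by rewrite additive_funN // (svalP x) oppr0. Qed.
Program Definition cycle_add (x y : cycle) : cycle :=
  exist _ (sval x + sval y) _.
Next Obligation. by rewrite gD (svalP x) (svalP y) addr0. Qed.

Definition homologous (x y : cycle) : Prop := exists a, sval x - sval y = f a.

Lemma homologous_eq (x y : cycle) : sval x = sval y -> homologous x y.
Proof. by move=> e; exists 0; rewrite e subrr (additive_fun0 fD). Qed.

Definition homology_setoid : setoid_group.
Proof.
refine (@SetoidGroup cycle homologous cycle_zero cycle_opp cycle_add
  _ _ _ _ _ _ _ _ _).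
- by move=> x; exact: homologous_eq.
- by move=> x y [a e]; exists (- a); rewrite (additive_funN fD) -e opprB.
- by move=> x y z [a e] [b e']; exists (a + b); rewrite fD -e -e' addrA subrK.
- by move=> x y [a e]; exists (- a); rewrite (additive_funN fD) -e /= opprD.
- move=> x x' y y' [a e] [b e']; exists (a + b).
  by rewrite fD -e -e' /= opprD addrACA.
- by move=> x y z; apply: homologous_eq; exact: addrA.
- by move=> x y; apply: homologous_eq; exact: addrC.
- by move=> x; apply: homologous_eq; exact: add0r.
- by move=> x; apply: homologous_eq; exact: addNr.
Defined.

(* the homology ker g / im f of A -> B -> C *)
Definition homology : zmodType := quot homology_setoid.

End Homology.

Section HomologyMap.
Variables (A B C A' B' C' : zmodType).
Variables (f : A -> B) (g : B -> C) (f' : A' -> B') (g' : B' -> C').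
Hypotheses (fD : additive_fun f) (gD : additive_fun g).
Hypotheses (fD' : additive_fun f') (gD' : additive_fun g').
Variable phi : B -> B'.
Hypothesis phiD : additive_fun phi.
Hypothesis phi_cycle : forall b, g b = 0 -> g' (phi b) = 0.
Hypothesis phi_boundary : forall a, exists a', phi (f a) = f' a'.

Definition cycle_map (x : cycle g) : cycle g' :=
  exist _ (phi (sval x)) (phi_cycle (svalP x)).

Definition homology_map : homology fD gD -> homology fD' gD' :=
  quot_lift (fun x : homology_setoid fD gD =>
    cls (cycle_map x : homology_setoid fD' gD')).

Lemma homology_mapE (x : cycle g) :
  homology_map (cls (x : homology_setoid fD gD)) =
  cls (cycle_map x : homology_setoid fD' gD').
Proof.
rewrite /homology_map quot_liftE // => {}x y [a e]; apply/clsE.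
have [a' e'] := phi_boundary a; exists a'.
by rewrite /= -additive_funB // e.
Qed.

Lemma homology_mapD : additive_fun homology_map.
Proof.
elim/quot_ind=> x; elim/quot_ind=> y; rewrite -clsD !homology_mapE -clsD.
by apply/clsE/homologous_eq => //=; exact: phiD.
Qed.

End HomologyMap.

Definition is_projective (R : comNzRingType) (P : bimod R) : Prop :=
  forall (M N : bimod R) (p : M -> N) (f : P -> N),
    is_bimap p -> (forall y, exists x, p x = y) -> is_bimap f ->
    exists2 h : P -> M, is_bimap h & forall x, p (h x) = f x.

(* A graded projective resolution ... -> P_1 -> P_0 -> R_n of R_n by graded   *)
(* bimodules, i.e. by graded modules over R_n (x)_Z R_n; P_j sits in          *)
(* homological degree -j, so that the differential raises degrees.            *)
Record projective_resolution (n : nat) := ProjectiveResolution {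
  pres :> complex n;
  aug : pres -> reg n;
  pres_nonpos : forall a l x, homog_of (M := pres) (a, l) x -> 0 < l -> x = 0;
  pres_projective : is_projective pres;
  aug_bimap : is_bimap aug;
  aug_deg : forall g x, gr (conc (reg n)) g (aug x) = aug (gr pres g x);
  aug_diff : forall x, aug (diff x) = 0;
  aug_surj : forall r, exists x, aug x = r;
  pres_exact : forall x, diff x = 0 -> aug x = 0 -> exists y, x = diff y
}.

Section HH.
Variables (n : nat) (P X : complex n).

(* bimodule maps P_j -> X^k of internal degree i *)
Definition is_cochain (i j k : int) (f : P -> X) : Prop :=
  [/\ is_bimap f,
      forall a l x, homog_of (M := P) (a, l) x -> l <> - j -> f x = 0
    & forall a x, homog_of (M := P) (a, - j) x ->
        homog_of (M := X) (a + i, k) (f x)].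

Definition cochain (i j k : int) : Type := {f : P -> X | is_cochain i j k f}.

HB.instance Definition _ i j k := gen_eqMixin (cochain i j k).
HB.instance Definition _ i j k := gen_choiceMixin (cochain i j k).

Section Cochain.
Variables i j k : int.

Lemma cochain_eq (f g : cochain i j k) : sval f =1 sval g -> f = g.
Proof. by case: f g => f pf [g pg] /= e; apply: eq_exist; exact/funext. Qed.

Lemma is_cochain0 : is_cochain i j k (fun=> 0).
Proof.
split=> [|//|a x _]; last exact: comp0.
split=> [x y|a x|a x]; first by rewrite addr0.
- by rewrite (additive_fun0 (lactDr a)).
- by rewrite (additive_fun0 (@ractDl _ X a)).
Qed.

Lemma is_cochainN f : is_cochain i j k f -> is_cochain i j k (fun x => - f x).
Proof.
move=> [[fD fl fr] f0 fh]; split=> [|a l x xh lj|a x xh].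
- split=> [x y|a x|a x]; first by rewrite fD opprD.
  + by rewrite fl (additive_funN (lactDr a)).
  + by rewrite fr (additive_funN (@ractDl _ X a)).
- by rewrite (f0 _ _ _ xh lj) oppr0.
- by rewrite /homog_of (additive_funN (compD _ _)) (fh _ _ xh).
Qed.

Lemma is_cochainD f g : is_cochain i j k f -> is_cochain i j k g ->
  is_cochain i j k (fun x => f x + g x).
Proof.
move=> [[fD fl fr] f0 fh] [[gD gl hr] g0 gh]; split=> [|a l x xh lj|a x xh].
- split=> [x y|a x|a x]; first by rewrite fD gD addrACA.
  + by rewrite fl gl lactDr.
  + by rewrite fr hr (@ractDl _ X a).
- by rewrite (f0 _ _ _ xh lj) (g0 _ _ _ xh lj) addr0.
- by rewrite /homog_of compD (fh _ _ xh) (gh _ _ xh).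
Qed.

Definition cochain_zero : cochain i j k := exist _ _ is_cochain0.
Definition cochain_opp (f : cochain i j k) : cochain i j k :=
  exist _ _ (is_cochainN (svalP f)).
Definition cochain_add (f g : cochain i j k) : cochain i j k :=
  exist _ _ (is_cochainD (svalP f) (svalP g)).

Lemma cochain_addA : associative cochain_add.
Proof. by move=> f g h; apply: cochain_eq => x /=; rewrite addrA. Qed.
Lemma cochain_addC : commutative cochain_add.
Proof. by move=> f g; apply: cochain_eq => x /=; rewrite addrC. Qed.
Lemma cochain_add0 : left_id cochain_zero cochain_add.
Proof. by move=> f; apply: cochain_eq => x /=; rewrite add0r. Qed.
Lemma cochain_addN : left_inverse cochain_zero cochain_opp cochain_add.
Proof. by move=> f; apply: cochain_eq => x /=; rewrite addNr. Qed.

HB.instance Definition _ := GRing.isZmodule.Build (cochain i j k)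
  cochain_addA cochain_addC cochain_add0 cochain_addN.

End Cochain.

Section Coboundary.
Variables (i j j' k : int) (ej : j' = j + 1).

Lemma is_cochain_coboundary (f : P -> X) :
  is_cochain i j k f -> is_cochain i j' k (fun x => f (diff x)).
Proof.
move=> [[fD fl fr] f0 fh]; have [dD dl dr] := diff_bimap P.
have dh a l x : homog_of (M := P) (a, l) x ->
    homog_of (M := P) (a, l + 1) (diff x).
  by move=> xh; rewrite /homog_of -[a in LHS]addr0 (diff_deg (a, l)) xh.
split=> [|a l x /dh xh lj|a x /dh xh].
- by split=> [x y|a x|a x]; rewrite ?dD ?dl ?dr ?fD ?fl ?fr.
- apply: f0 xh _ => e; apply: lj.
  by apply: (addIr 1); rewrite e ej opprD subrK.
- by apply: fh; move: xh; rewrite ej opprD subrK.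
Qed.

Definition coboundary (f : cochain i j k) : cochain i j' k :=
  exist _ _ (is_cochain_coboundary (svalP f)).

Lemma coboundaryD : additive_fun coboundary.
Proof. by move=> f g; apply: cochain_eq. Qed.

End Coboundary.

Lemma coboundary2 i j j' j'' k (e : j' = j + 1) (e' : j'' = j' + 1)
  (f : cochain i j k) : coboundary e' (coboundary e f) = 0.
Proof.
apply: cochain_eq => x /=; have [[fD _ _] _ _] := svalP f.
by rewrite diff2 (additive_fun0 fD).
Qed.

(* HH^(i,j)(X^k): the degree i part of the graded Ext^j(R_n, X^k) of bimodules, *)
(* when P is a projective resolution of R_n. The usual signs in the           *)
(* differential of Hom(P, X^k) change neither kernels nor images.             *)
Definition HH (i j k : int) : zmodType :=
  homology (@coboundaryD i (j - 1) j k (esym (subrK 1 j)))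
           (@coboundaryD i j (j + 1) k erefl).

(* The differential HH^(i,j)(X^k) -> HH^(i,j)(X^(k+1)) induced by that of X.  *)
Section HHDiff.
Variables (i k k' : int) (ek : k' = k + 1).

Lemma is_cochain_post j (f : P -> X) :
  is_cochain i j k f -> is_cochain i j k' (fun x => diff (f x)).
Proof.
move=> [[fD fl fr] f0 fh]; have [dD dl dr] := diff_bimap X.
split=> [|a l x xh lj|a x /fh xh].
- by split=> [x y|a x|a x]; rewrite ?fD ?fl ?fr ?dD ?dl ?dr.
- by rewrite (f0 _ _ _ xh lj) (additive_fun0 dD).
- by rewrite /homog_of ek -[a + i]addr0 (diff_deg (a + i, k)) xh.
Qed.

Definition post j (f : cochain i j k) : cochain i j k' :=
  exist _ _ (is_cochain_post (svalP f)).

Lemma postD j : additive_fun (@post j).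
Proof.
by move=> f g; apply: cochain_eq => x /=; have [dD _ _] := diff_bimap X.
Qed.

Lemma post_coboundary j j' (e : j' = j + 1) (f : cochain i j k) :
  post (coboundary e f) = coboundary e (post f).
Proof. exact: cochain_eq. Qed.

Lemma post_cycle j (f : cochain i j k) :
  coboundary (erefl (j + 1)) f = 0 -> coboundary (erefl (j + 1)) (post f) = 0.
Proof.
by move=> e; rewrite -post_coboundary e (additive_fun0 (@postD _)).
Qed.

Lemma post_boundary j j' (e : j' = j + 1) (f : cochain i j k) :
  exists f', post (coboundary e f) = coboundary e f'.
Proof. by exists (post f); exact: post_coboundary. Qed.

Definition HH_diff j : HH i j k -> HH i j k' :=
  homology_map _ _ (@post_cycle j).

Lemma HH_diffD j : additive_fun (@HH_diff j).
Proof.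
exact: (homology_mapD _ _ (@postD j) (@post_cycle j) (@post_boundary _ _ _)).
Qed.

Lemma HH_diffE j (f : cycle (@coboundary i j (j + 1) k erefl)) :
  HH_diff (cls (f : homology_setoid (coboundaryD _) (coboundaryD _))) =
  cls (cycle_map (@post_cycle j) f :
    homology_setoid (coboundaryD _) (coboundaryD _)).
Proof.
exact: (homology_mapE _ _ _ _ (@postD j) (@post_cycle j)
  (@post_boundary _ _ _)).
Qed.

End HHDiff.

Lemma HH_diff2 i j k k' k'' (e : k' = k + 1) (e' : k'' = k' + 1)
  (c : HH i j k) : HH_diff e' (HH_diff e c) = 0.
Proof.
elim/quot_ind: c => f.
rewrite !HH_diffE; apply/clsE/homologous_eq;
  by first [exact: coboundaryD | apply: cochain_eq => x /=; rewrite diff2].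
Qed.

(* the component of tridegree (i, j, k) of H(HH(X)) *)
Definition HHH (i j k : int) : zmodType :=
  homology (@HH_diffD i (k - 1) k (esym (subrK 1 k)) j)
           (@HH_diffD i k (k + 1) erefl j).

End HH.

(* Main.v *)
(**
HH is computed by the Koszul complex on the elements x_c - y_c of the left and
right variables, one for each strand c, so the claim is a vanishing in odd
degrees of an iterated homology, which we prove for closures of a larger family
of diagrams by the recursion of Hogancamp and Mellit. Their diagrams contain the
projector that kills every B_i with i in a block of strands; here it is replaced
by a positive word which kills these B_i in all homological degrees above a
bound n, for n as negative as needed. Such words are interchangeable above
degree n, and they exist, by iteration, for every block. Diagrams are indexed by
pairs (v, w) of binary words; the one without projector and without remaining
letters is the torus braid, and the recursion shortens v and w. Its steps are
the Markov move, absorption of crossings into the projector, and two triangles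
obtained from a central cycle z of even degree that represents multiplication
through the loop of a new strand around the block: the cone of z is again
killed by all B_i of the enlarged block. Constructing z only requires the
vanishing of an obstruction in an odd degree of the closed smaller projector,
which is known by induction. Since all shifts are even, odd vanishing propagates.

Rouquier complexes are represented by functors on complexes of abelian groups
with commuting left and right variables: R (x)_(R^s) C is the group C x C, as
1 and x_i form a basis of R over R^s. A reduced word of the torus permutation is
brought to a standard form by commutations of distant letters only.
*)

(* Taking HH termwise and then homology does not respect quasi-isomorphisms of bimodule complexes,
   but it is a cohomological functor on the homotopy category: the Koszul differential acts
   diagonally on a mapping cone, so every cone yields a long exact sequence. Hence every comparison
   below is an explicit bimodule homotopy, or a map whose cone has no homology above a bound in any
   left context. Only vanishing has to be transported, so homotopy retracts serve as well as
   equivalences; and since the bound is arbitrary, a cancellation may cost one degree. For a block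
   of l strands the loop has 2l crossings and z sits in degree -2l, while the obstruction to its
   existence sits in degree -2l + 1: this is where parity enters. The one rotation of a closed
   diagram that the recursion needs comes from the Markov move, used in both directions with a new
   strand at position 0 and all other strands renamed. The internal grading is forgotten until the
   very end, where the primitives found for a homogeneous cocycle are cut down to their homogeneous
   components. *)
From HB Require Import structures.
From Pilot Require Import Defs.
From mathcomp Require Import all_boot all_order all_algebra all_fingroup.
From mathcomp Require Import mpoly boolp.
From mathcomp Require Import zify ring.

Set Implicit Arguments.
Unset Strict Implicit.
Unset Printing Implicit Defensive.
Import Order.TTheory GRing.Theory Num.Theory.
Local Open Scope ring_scope.
#[local] Obligation Tactic := cbv beta.

(** * Linear identities by reflection *)

Section Reflection.
Variables (M : zmodType) (fs : seq (M -> M)) (vs : seq M).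

Inductive lexpr :=
  | LVar of nat | LZero | LAdd of lexpr & lexpr | LOpp of lexpr
  | LOp of nat & lexpr.

Definition lop i : M -> M := nth id fs i.

Fixpoint leval e : M :=
  match e with
  | LVar n => nth 0 vs n
  | LZero => 0
  | LAdd a b => leval a + leval b
  | LOpp a => - leval a
  | LOp i a => lop i (leval a)
  end.

Fixpoint linsert (i : nat) (s : seq nat) : seq nat :=
  if s is j :: s' then (if (i <= j)%N then i :: s else j :: linsert i s')
  else [:: i].

(* Normal form: a list of signed monomials (sorted operators, variable). *)
Fixpoint lnf (b : bool) (o : seq nat) (e : lexpr) : seq (bool * (seq nat * nat)) :=
  match e with
  (* Operator 0 is the differential. Words are sorted, so a monomial containing it twice starts with
     two zeros and vanishes. *)
  | LVar n => if o is 0 :: 0 :: _ then [::] else [:: (b, (o, n))]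
  | LZero => [::]
  | LAdd x y => lnf b o x ++ lnf b o y
  | LOpp x => lnf (~~ b) o x
  | LOp i x => lnf b (linsert i o) x
  end.

Definition lword (o : seq nat) (x : M) : M := foldr lop x o.
Definition lsign (b : bool) (x : M) : M := if b then - x else x.
Definition lterm (t : bool * (seq nat * nat)) : M :=
  lsign t.1 (lword t.2.1 (nth 0 vs t.2.2)).

(** The difference of the two sides is formally zero when its positive monomials are a permutation
    of its negative ones. *)
Definition lcheck (e1 e2 : lexpr) : bool :=
  let t := lnf false [::] (LAdd e1 (LOpp e2)) in
  perm_eq [seq p.2 | p <- t & ~~ p.1] [seq p.2 | p <- t & p.1].

Hypothesis fsD : forall i, additive_fun (lop i).
Hypothesis fsC : forall i j x, lop i (lop j x) = lop j (lop i x).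
Hypothesis fs00 : forall x, lop 0 (lop 0 x) = 0.

Lemma lword_insert i o x : lword (linsert i o) x = lop i (lword o x).
Proof. by elim: o => [//|j o ih] /=; case: ifP => //= _; rewrite ih fsC. Qed.

Lemma lwordD o : additive_fun (lword o).
Proof. by move=> x y; elim: o => [//|j o ih] /=; rewrite ih fsD. Qed.

Lemma lnfE b o e :
  \sum_(t <- lnf b o e) lterm t = lsign b (lword o (leval e)).
Proof.
elim: e b o => [n|| x ihx y ihy|x ih|i x ih] b o /=.
- case: o => [|[|i] [|[|j] o]]; rewrite ?big_seq1 // big_nil /= fs00.
  by case: b; rewrite /= ?oppr0.
- by rewrite big_nil (additive_fun0 (@lwordD o)); case: b; rewrite /= ?oppr0.
- by rewrite big_cat ihx ihy lwordD; case: b; rewrite /= ?opprD.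
- by rewrite ih (additive_funN (@lwordD o)); case: b; rewrite /= ?opprK.
- rewrite ih lword_insert; congr lsign.
  by elim: o {ih} => [//|j o /= <-]; rewrite fsC.
Qed.

Lemma lcheckP e1 e2 : lcheck e1 e2 -> leval e1 = leval e2.
Proof.
rewrite /lcheck; set t := lnf _ _ _ => pt.
have h : \sum_(x <- t) lterm x = leval e1 - leval e2 by rewrite lnfE.
apply/eqP; rewrite -subr_eq0 -h (bigID (fun x => x.1)) /=.
have eT : \sum_(x <- t | x.1) lterm x =
    - \sum_(p <- [seq p.2 | p <- t & p.1]) lword p.1 (nth 0 vs p.2).
  rewrite big_map big_filter -sumrN; apply: eq_bigr => -[b p] /= ->.
  by [].
have eF : \sum_(x <- t | ~~ x.1) lterm x =
    \sum_(p <- [seq p.2 | p <- t & ~~ p.1]) lword p.1 (nth 0 vs p.2).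
  by rewrite big_map big_filter; apply: eq_bigr => -[[] p].
by rewrite eT eF (perm_big _ pt) /= addNr eqxx.
Qed.

End Reflection.

(* A complex of bimodules over a polynomial ring, forgetting the internal     *)
(* grading: [op true j] and [op false j] are multiplication by the j-th       *)
(* variable on the left and on the right, and [hd k] is the part of           *)
(* homological degree [k].                                                    *)
Record cx := Cx {
  car :> zmodType;
  op : bool -> nat -> car -> car;
  dd : car -> car;
  hd : int -> car -> Prop;
  opD : forall s j, additive_fun (op s j);
  ddD : additive_fun dd;
  opC : forall s i t j x, op s i (op t j x) = op t j (op s i x);
  opdd : forall s j x, op s j (dd x) = dd (op s j x);
  dd0 : forall x, dd (dd x) = 0;
  hd0 : forall k, hd k 0;
  hdB : forall k x y, hd k x -> hd k y -> hd k (x - y);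
  hdop : forall s j k x, hd k x -> hd k (op s j x);
  hddd : forall k x, hd k x -> hd (k + 1) (dd x)
}.

Section CxTheory.
Variable C : cx.

Lemma hdN k (x : C) : hd k x -> hd k (- x).
Proof. by move=> h; rewrite -sub0r; apply: hdB => //; exact: hd0. Qed.
Lemma hdD k (x y : C) : hd k x -> hd k y -> hd k (x + y).
Proof. by move=> hx hy; rewrite -[y]opprK; apply: hdB => //; exact: hdN. Qed.

Definition cxops (l : seq (bool * nat)) : seq (C -> C) :=
  @dd C :: [seq op j.1 j.2 | j <- l].

Lemma lcheck_cx (l : seq (bool * nat)) (vs : seq C) (e1 e2 : lexpr) :
  lcheck e1 e2 -> leval (cxops l) vs e1 = leval (cxops l) vs e2.
Proof.
have opE i : lop (cxops l) i.+1 = 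
    if (i < size l)%N then let j := nth (true, 0%N) l i in @op C j.1 j.2 else id.
  rewrite /lop /=; case: ltnP => h; first by rewrite (nth_map (true, 0%N)).
  by rewrite nth_default // size_map.
apply: lcheckP => [[|i]|[|i] [|j] x|x] //.
- exact: ddD.
- by rewrite opE; case: ifP => // _; exact: opD.
- by rewrite opE; case: ifP => // _; rewrite /lop /= opdd.
- by rewrite opE; case: ifP => // _; rewrite /lop /= opdd.
- by rewrite !opE; case: ifP => // _; case: ifP => // _; exact: opC.
- exact: dd0.
Qed.

End CxTheory.

Ltac lfind x l :=
  lazymatch l with
  | x :: _ => constr:(0%N)
  | _ :: ?l' => let n := lfind x l' in constr:(n.+1)
  end.
Ltac lmem x l :=
  lazymatch l with
  | nil => constr:(false)
  | x :: _ => constr:(true)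
  | _ :: ?l' => lmem x l'
  end.
Ltac ladd x l :=
  let b := lmem x l in
  lazymatch b with true => l | false => constr:(x :: l) end.
Ltac lvars C t vs :=
  lazymatch t with
  | @GRing.add _ ?a ?b => let vs := lvars C a vs in lvars C b vs
  | @GRing.opp _ ?a => lvars C a vs
  | @GRing.zero _ => vs
  | @dd _ ?a => lvars C a vs
  | @op _ _ _ ?a => lvars C a vs
  | _ => ladd t vs
  end.
Ltac lops C t l :=
  lazymatch t with
  | @GRing.add _ ?a ?b => let l := lops C a l in lops C b l
  | @GRing.opp _ ?a => lops C a l
  | @GRing.zero _ => l
  | @dd _ ?a => lops C a l
  | @op _ ?s ?j ?a => let l := ladd (s, j) l in lops C a l
  | _ => l
  end.
Ltac lquote C l vs t :=
  lazymatch t with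
  | @GRing.add _ ?a ?b =>
    let a := lquote C l vs a in let b := lquote C l vs b in constr:(LAdd a b)
  | @GRing.opp _ ?a => let a := lquote C l vs a in constr:(LOpp a)
  | @GRing.zero _ => constr:(LZero)
  | @dd _ ?a => let a := lquote C l vs a in constr:(LOp 0 a)
  | @op _ ?s ?j ?a =>
    let i := lfind (s, j) l in let a := lquote C l vs a in constr:(LOp i.+1 a)
  | _ => let n := lfind t vs in constr:(LVar n)
  end.
(* Decides linear identities in a complex, up to commutation of operators.    *)
Ltac cxlin C :=
  lazymatch goal with
  | |- @eq _ ?x ?y =>
    let l := lops C x (@nil (bool * nat)) in let l := lops C y l in
    let vs := lvars C x (@nil (car C)) in let vs := lvars C y vs in
    let e1 := lquote C l vs x in let e2 := lquote C l vs y in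
    exact: (@lcheck_cx C l vs e1 e2 isT)
  end.

(** Slot 0 must hold a map of square zero. The default of [lop] is the identity, so the list
    contains the zero map instead of being empty. *)
Lemma lcheck_zmod (M : zmodType) (vs : seq M) (e1 e2 : lexpr) :
  lcheck e1 e2 ->
  leval [:: fun=> 0 : M] vs e1 = leval [:: fun=> 0 : M] vs e2.
Proof.
have opE i : lop [:: fun=> 0 : M] i.+1 = id by rewrite /lop /= nth_nil.
apply: lcheckP => [[|i]|[|i] [|j] x|x] //; rewrite ?opE //.
by move=> x y; rewrite /lop /= addr0.
Qed.

Lemma zlin_use (M : zmodType) (u v x y : M) : u = v -> x - u = y - v -> x = y.
Proof. by move=> -> /addIr. Qed.

Ltac zvars t vs :=
  lazymatch t with
  | @GRing.add _ ?a ?b => let vs := zvars a vs in zvars b vs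
  | @GRing.opp _ ?a => zvars a vs
  | @GRing.zero _ => vs
  | _ => ladd t vs
  end.
Ltac zquote vs t :=
  lazymatch t with
  | @GRing.add _ ?a ?b =>
    let a := zquote vs a in let b := zquote vs b in constr:(LAdd a b)
  | @GRing.opp _ ?a => let a := zquote vs a in constr:(LOpp a)
  | @GRing.zero _ => constr:(LZero)
  | _ => let n := lfind t vs in constr:(LVar n)
  end.
Ltac zlin0 :=
  lazymatch goal with
  | |- @eq ?T ?x ?y =>
    let vs := zvars x (@nil T) in let vs := zvars y vs in
    let e1 := zquote vs x in let e2 := zquote vs y in
    exact: (@lcheck_zmod _ vs e1 e2 isT)
  end.
(* Linear arithmetic in abelian groups, with the given equations.             *)
Tactic Notation "zlin" := zlin0.
Tactic Notation "zlin" constr(h1) :=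
  (first [apply: (zlin_use h1); zlin0 | apply: (zlin_use (esym h1)); zlin0]).
Tactic Notation "zlin" constr(h1) constr(h2) :=
  (first [apply: (zlin_use h1); zlin h2 | apply: (zlin_use (esym h1)); zlin h2]).
Tactic Notation "zlin" constr(h1) constr(h2) constr(h3) :=
  (first [apply: (zlin_use h1); zlin h2 h3
         |apply: (zlin_use (esym h1)); zlin h2 h3]).

Lemma pairE (A B : Type) (x y : A * B) : x.1 = y.1 -> x.2 = y.2 -> x = y.
Proof. by case: x y => [a b] [c d] /= -> ->. Qed.

Ltac hdsolve := repeat (apply: hdB || apply: hdD || apply: hdN || apply: hdop
  || apply: hddd || apply: hd0 || assumption).

(** * Induction from the invariants of a transposition, cones and crossings *)

Section Induced.
Variables (a b : nat) (C : cx).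

(** The pair (x, y) stands for 1 ⊗ x + x_a ⊗ y. The formula for a comes from x_a^2 = (x_a + x_b) x_a
    - x_a x_b and the one for b from x_b = (x_a + x_b) - x_a; the symmetric coefficients cross the
    tensor sign and act on [C]. *)
Definition bB_op (s : bool) (j : nat) (z : C * C) : C * C :=
  if s && (j == a) then
    (- op true a (op true b z.2), z.1 + op true a z.2 + op true b z.2)
  else if s && (j == b) then
    (op true a z.1 + op true b z.1 + op true a (op true b z.2), - z.1)
  else (op s j z.1, op s j z.2).

Program Definition bB : cx :=
  @Cx (C * C)%type bB_op (fun z => (dd z.1, dd z.2))
  (fun k z => hd k z.1 /\ hd k z.2) _ _ _ _ _ _ _ _ _.
Next Obligation.
move=> s j [x y] [x' y']; rewrite /bB_op /=.
  by case: ifP => _; [|case: ifP => _]; apply: pairE => /=; cxlin C.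
Qed.
Next Obligation.
by move=> [x y] [x' y']; apply: pairE => /=; cxlin C.
Qed.
Next Obligation.
move=> s i t j [x y]; rewrite /bB_op /=.
  by case: ifP => _; [|case: ifP => _]; (case: ifP => _; [|case: ifP => _]);
    apply: pairE => /=; cxlin C.
Qed.
Next Obligation.
move=> s j [x y]; rewrite /bB_op /=.
  by case: ifP => _; [|case: ifP => _]; apply: pairE => /=; cxlin C.
Qed.
Next Obligation.
by move=> [x y]; apply: pairE => /=; cxlin C.
Qed.
Next Obligation.
by move=> k; split; exact: hd0.
Qed.
Next Obligation.
by move=> k [x y] [x' y'] /= [h1 h2] [h3 h4]; split; exact: hdB.
Qed.
Next Obligation.
move=> s j k [x y] /= [h1 h2]; rewrite /bB_op /=.
  by case: ifP => _; [|case: ifP => _]; split; hdsolve.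
Qed.
Next Obligation.
by move=> k [x y] /= [h1 h2]; split; exact: hddd.
Qed.
End Induced.

(* Bimodule chain maps C -> D of homological degree [- s].                    *)
Record cmor (s : int) (C D : cx) := Cmor {
  mf :> C -> D;
  mfD : additive_fun mf;
  mfop : forall t j x, mf (op t j x) = op t j (mf x);
  mfd : forall x, mf (dd x) = dd (mf x);
  mfhd : forall k x, hd (k + s) x -> hd k (mf x)
}.

Lemma mf0 s C D (f : cmor s C D) : f 0 = 0.
Proof. exact: additive_fun0 (mfD f). Qed.
Lemma mfN s C D (f : cmor s C D) x : f (- x) = - f x.
Proof. exact: additive_funN (mfD f) x. Qed.
Lemma mfB s C D (f : cmor s C D) x y : f (x - y) = f x - f y.
Proof. by rewrite mfD mfN. Qed.

Section Cone.
Variables (s : int) (C D : cx) (f : cmor s C D).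

Program Definition cone : cx :=
  @Cx (D * C)%type (fun t j z => (op t j z.1, op t j z.2))
  (fun z => (dd z.1 + f z.2, - dd z.2))
  (fun k z => hd k z.1 /\ hd (k + s + 1) z.2) _ _ _ _ _ _ _ _ _.
Next Obligation.
by move=> t j [x y] [x' y']; apply: pairE => /=; rewrite opD.
Qed.
Next Obligation.
move=> [x y] [x' y']; apply: pairE => /=; rewrite ?mfD ?ddD ?opprD //.
  by rewrite addrACA.
Qed.
Next Obligation.
by move=> t i t' j [x y]; apply: pairE => /=; rewrite opC.
Qed.
Next Obligation.
move=> t j [x y]; apply: pairE => /=; rewrite ?opD ?opdd ?mfop //.
  by rewrite (additive_funN (@opD _ t j)) opdd.
Qed.
Next Obligation.
move=> [x y]; apply: pairE => /=.
    by rewrite ddD dd0 add0r mfN mfd addrN.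
  by rewrite (additive_funN (@ddD C)) dd0 !oppr0.
Qed.
Next Obligation.
by move=> k; split; exact: hd0.
Qed.
Next Obligation.
by move=> k [x y] [x' y'] /= [h1 h2] [h3 h4]; split; exact: hdB.
Qed.
Next Obligation.
by move=> t j k [x y] /= [h1 h2]; split; exact: hdop.
Qed.
Next Obligation.
move=> k [x y] /= [h1 h2]; split; hdsolve.
    by apply: mfhd; move: h2; rewrite addrAC.
  by move: h2; rewrite addrAC.
Qed.

End Cone.

(** The differential changes sign for every s, whatever its parity. Kernels and images are
    unaffected, and the sign is the one that the second summand of a cone carries. *)
Program Definition sh (s : int) (C : cx) : cx :=
  @Cx C (@op C) (fun x => - dd x) (fun k x => hd (k + s) x)
  _ _ _ _ _ _ _ _ _.
Next Obligation.
move=> s C.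
exact: opD.
Qed.
Next Obligation.
move=> s C.
by move=> x y; rewrite ddD opprD.
Qed.
Next Obligation.
move=> s C.
exact: opC.
Qed.
Next Obligation.
move=> s C.
by move=> t j x; rewrite (additive_funN (@opD C t j)) opdd.
Qed.
Next Obligation.
move=> s C.
by move=> x; rewrite (additive_funN (@ddD C)) dd0 !oppr0.
Qed.
Next Obligation.
move=> s C.
by move=> k; exact: hd0.
Qed.
Next Obligation.
move=> s C.
by move=> k x y; exact: hdB.
Qed.
Next Obligation.
move=> s C.
by move=> t j k x; exact: hdop.
Qed.
Next Obligation.
move=> s C.
by move=> k x h; rewrite addrAC; apply: hdN; exact: hddd.
Qed.

(** This is f ⊗ x ↦ f x in the coordinates of [bB]. *)
Program Definition mB (a b : nat) (C : cx) : cmor 0 (bB a b C) C :=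
  @Cmor 0 (bB a b C) C (fun z => z.1 + op true a z.2) _ _ _ _.
Next Obligation.
move=> a b C.
by move=> [x y] [x' y'] /=; cxlin C.
Qed.
Next Obligation.
move=> a b C.
move=> t j [x y]; rewrite /= /bB_op.
  case: ifP => [/andP[t1 /eqP ->]|_]; first by case: t t1 => //= _; cxlin C.
  case: ifP => [/andP[t1 /eqP ->]|_]; last by rewrite /=; cxlin C.
  by case: t t1 => //= _; cxlin C.
Qed.
Next Obligation.
move=> a b C.
by move=> [x y] /=; cxlin C.
Qed.
Next Obligation.
move=> a b C.
by move=> k [x y] /=; rewrite addr0 => -[h1 h2]; hdsolve.
Qed.

(* The Rouquier complex of a positive crossing, tensored with [C].            *)
Definition tT (a b : nat) (C : cx) : cx := cone (mB a b C).

(** * Koszul homology with a second differential *)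

(* Abelian groups with a Koszul differential [bl] and a commuting complex     *)
(* differential [bd]; [cyc] and [bnd] describe H(H(B, bl), bd).               *)
Record bic := Bic {
  bc :> zmodType;
  bl : bc -> bc;
  bd : bc -> bc;
  bh : int -> bc -> Prop;
  blD : additive_fun bl;
  bdD : additive_fun bd;
  bll : forall x, bl (bl x) = 0;
  bdd : forall x, bd (bd x) = 0;
  bld : forall x, bl (bd x) = bd (bl x);
  bh0 : forall k, bh k 0;
  bhB : forall k x y, bh k x -> bh k y -> bh k (x - y);
  bhl : forall k x, bh k x -> bh k (bl x);
  bhd : forall k x, bh k x -> bh (k + 1) (bd x)
}.

Section BicTheory.
Variable B : bic.
Implicit Types (x y z : B) (k : int).

Lemma bl0 : bl (0 : B) = 0. Proof. exact: additive_fun0 (@blD B). Qed.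
Lemma bdz : bd (0 : B) = 0. Proof. exact: additive_fun0 (@bdD B). Qed.
Lemma blN x : bl (- x) = - bl x. Proof. exact: additive_funN (@blD B) x. Qed.
Lemma bdN x : bd (- x) = - bd x. Proof. exact: additive_funN (@bdD B) x. Qed.
Lemma blB x y : bl (x - y) = bl x - bl y. Proof. by rewrite blD blN. Qed.
Lemma bdB x y : bd (x - y) = bd x - bd y. Proof. by rewrite bdD bdN. Qed.

Lemma bhE k k' x : bh k x -> k = k' -> bh k' x.
Proof. by move=> h <-. Qed.
Lemma bhN k x : bh k x -> bh k (- x).
Proof. by move=> h; rewrite -sub0r; apply: bhB => //; exact: bh0. Qed.
Lemma bhD k x y : bh k x -> bh k y -> bh k (x + y).
Proof. by move=> hx hy; rewrite -[y]opprK; apply: bhB => //; exact: bhN. Qed.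
Lemma bhd1 k x : bh (k - 1) x -> bh k (bd x).
Proof. by move=> /bhd h; apply: bhE h _; rewrite subrK. Qed.

Definition cyc k z :=
  [/\ bh k z, bl z = 0 & exists2 g, bh (k + 1) g & bd z = bl g].
Definition bnd k z :=
  exists e h, [/\ bh (k - 1) e, bh k h, bl e = 0 & z = bd e + bl h].
Definition vb k := forall z, cyc k z -> bnd k z.

Lemma bnd0 k : bnd k 0.
Proof. by exists 0, 0; split; rewrite ?bdz ?bl0 ?addr0 //; exact: bh0. Qed.
Lemma bndB k x y : bnd k x -> bnd k y -> bnd k (x - y).
Proof.
move=> [e [h [he hh le ->]]] [e' [h' [he' hh' le' ->]]].
exists (e - e'), (h - h'); split; try exact: bhB.
- by rewrite blB le le' subr0.
- by rewrite bdB blB opprD addrACA.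
Qed.
Lemma bndN k x : bnd k x -> bnd k (- x).
Proof. by rewrite -sub0r; apply: bndB; exact: bnd0. Qed.
Lemma bndD k x y : bnd k x -> bnd k y -> bnd k (x + y).
Proof. by move=> hx /bndN hy; rewrite -[y]opprK; exact: bndB. Qed.
Lemma cycB k x y : cyc k x -> cyc k y -> cyc k (x - y).
Proof.
move=> [hx lx [g hg eg]] [hy ly [g' hg' eg']].
split; [exact: bhB | by rewrite blB lx ly subr0 | exists (g - g')].
  exact: bhB.
by rewrite bdB blB eg eg'.
Qed.
Lemma bnd_d k x : bh (k - 1) x -> bl x = 0 -> bnd k (bd x).
Proof.
by move=> hx lx; exists x, 0; split; rewrite ?bl0 ?addr0 //; exact: bh0.
Qed.
Lemma bnd_l k x : bh k x -> bnd k (bl x).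
Proof. by move=> hx; exists 0, x; split; rewrite ?bl0 ?bdz ?add0r //; exact: bh0. Qed.
Lemma cycE k k' z : cyc k z -> k = k' -> cyc k' z. Proof. by move=> h <-. Qed.
Lemma bndE k k' z : bnd k z -> k = k' -> bnd k' z. Proof. by move=> h <-. Qed.
Lemma vbE k k' : vb k -> k = k' -> vb k'. Proof. by move=> h <-. Qed.

End BicTheory.

Record bmor (s : int) (B B' : bic) := Bmor {
  bf :> B -> B';
  bfD : additive_fun bf;
  bfl : forall x, bf (bl x) = bl (bf x);
  bfd : forall x, bf (bd x) = bd (bf x);
  bfh : forall k x, bh (k + s) x -> bh k (bf x)
}.

Section BicMor.
Variables (s : int) (B B' : bic) (f : bmor s B B').

Lemma bf0 : f 0 = 0. Proof. exact: additive_fun0 (bfD f). Qed.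
Lemma bfN x : f (- x) = - f x. Proof. exact: additive_funN (bfD f) x. Qed.
Lemma bfB x y : f (x - y) = f x - f y. Proof. by rewrite bfD bfN. Qed.

Lemma cyc_mor k z : cyc (k + s) z -> cyc k (f z).
Proof.
move=> [hz lz [g hg e]]; split; first exact: bfh.
  by rewrite -bfl lz bf0.
by exists (f g); [apply: bfh; apply: bhE hg _; lia | rewrite -bfd e bfl].
Qed.

Lemma bnd_mor k z : bnd (k + s) z -> bnd k (f z).
Proof.
move=> [e [h [he hh le ->]]]; exists (f e), (f h); split.
- by apply: bfh; apply: bhE he _; lia.
- exact: bfh.
- by rewrite -bfl le bf0.
- by rewrite bfD bfd bfl.
Qed.

Definition binj k := forall z, cyc (k + s) z -> bnd k (f z) -> bnd (k + s) z.
Definition bsurj k := forall z, cyc k z ->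
  exists2 z', cyc (k + s) z' & bnd k (f z' - z).

(** [bl] acts componentwise and does not involve f. Homology for [bl] therefore turns this into the
    cone of the induced map, and the iterated homology has the long exact sequence whose pieces are
    the next lemmas. *)
Program Definition bcone : bic :=
  @Bic (B' * B)%type (fun z => (bl z.1, bl z.2))
  (fun z => (bd z.1 + f z.2, - bd z.2))
  (fun k z => bh k z.1 /\ bh (k + s + 1) z.2) _ _ _ _ _ _ _ _ _.
Next Obligation.
by move=> [x y] [x' y']; apply: pairE => /=; rewrite blD.
Qed.
Next Obligation.
move=> [x y] [x' y']; apply: pairE => /=; rewrite ?bfD ?bdD ?opprD //.
  by rewrite addrACA.
Qed.
Next Obligation.
by move=> [x y]; apply: pairE => /=; rewrite bll.
Qed.
Next Obligation.
move=> [x y]; apply: pairE => /=; first by rewrite bdD bdd add0r bfN bfd addrN.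
  by rewrite bdN bdd !oppr0.
Qed.
Next Obligation.
move=> [x y]; apply: pairE => /=; first by rewrite blD bld bfl.
  by rewrite blN bld.
Qed.
Next Obligation.
by move=> k; split; exact: bh0.
Qed.
Next Obligation.
by move=> k [x y] [x' y'] /= [h1 h2] [h3 h4]; split; exact: bhB.
Qed.
Next Obligation.
by move=> k [x y] /= [h1 h2]; split; exact: bhl.
Qed.
Next Obligation.
move=> k [x y] /= [h1 h2]; split; last first.
    by apply: bhN; apply: bhE (bhd h2) _; lia.
  by apply: bhD; [exact: bhd | apply: bfh; apply: bhE h2 _; lia].
Qed.

(** Exactness at the cone. Every equation holds only modulo [bl], so the correcting terms have to be
    carried along with the usual diagram chase. *)
Lemma bcone_mid k : vb B' k -> vb B (k + s + 1) -> vb bcone k.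
Proof.
move=> hB' hB [y x] [[/= hy hx] [ly lx] [[g1 g2] [/= hg1 hg2] [e1 e2]]].
have cx : cyc (k + s + 1) x.
  split=> //; exists (- g2); first by apply: bhN; apply: bhE hg2 _; lia.
  by rewrite blN -e2 opprK.
have [e [h [he hh le ex]]] := hB _ cx.
have {}he : bh (k + s) e by apply: bhE he _; lia.
have cy : cyc k (y + f e).
  split; first by apply: bhD => //; exact: bfh.
    by rewrite blD ly -bfl le bf0 addr0.
  exists (g1 - f h); first by apply: bhB => //; apply: bfh; apply: bhE hh _; lia.
  rewrite bdD -bfd blB -bfl; have -> : bd e = x - bl h by zlin ex.
  by rewrite bfB; zlin e1.
have [e' [h' [he' hh' le' ey]]] := hB' _ cy.
exists (e', - e), (h', h); split.
- by split=> //=; apply: bhN; apply: bhE he _; lia.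
- by split.
- by apply: pairE => //=; rewrite blN le oppr0.
- by apply: pairE => /=; rewrite ?bfN ?bdN; [zlin ey | zlin ex].
Qed.

Lemma bcone_left k y :
  vb B (k + s) -> bnd k ((y, 0) : bcone) -> bnd k y.
Proof.
move=> hB [[e1 e2] [[h1 h2] [[/= he1 he2] [/= hh1 hh2] [l1 l2] [ey e0]]]].
have {}he2 : bh (k + s) e2 by apply: bhE he2 _; lia.
have c2 : cyc (k + s) e2.
  by split=> //; exists h2; [apply: bhE hh2 _; lia | zlin e0].
have [e [h [he hh le ex]]] := hB _ c2.
rewrite ey ex bfD bfd bfl.
apply: bndD; last exact: bnd_l.
apply: bndD; first exact: bnd_d.
apply: bndD; last by apply: bnd_l; exact: bfh.
apply: bnd_d; last by rewrite -bfl le bf0.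
by apply: bfh; apply: bhE he _; lia.
Qed.

Lemma cyc_bcone1 k y : cyc k y -> cyc k ((y, 0) : bcone).
Proof.
move=> [hy ly [g hg e]]; split; first by split=> //=; exact: bh0.
  by apply: pairE => //=; exact: bl0.
exists (g, 0); first by split=> //=; exact: bh0.
by apply: pairE => /=; rewrite ?bf0 ?bl0 ?bdz ?addr0 // oppr0.
Qed.

Lemma vb_bcone_left k : vb bcone k -> vb B (k + s) -> vb B' k.
Proof. by move=> hc hB y cy; apply: bcone_left => //; apply: hc; exact: cyc_bcone1. Qed.

Lemma vb_bcone_right k : vb bcone k -> vb B' (k + 1) -> vb B (k + s + 1).
Proof.
move=> hc hB' x cx; have [hx lx [g hg eg]] := cx.
have cfx : cyc (k + 1) (f x) by apply: cyc_mor; apply: cycE cx _; lia.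
have [e [h [he hh le ef]]] := hB' _ cfx.
have {}he : bh k e by apply: bhE he _; lia.
have cz : cyc k ((- e, x) : bcone).
  split; first by split=> //=; exact: bhN.
    by apply: pairE => /=; rewrite ?blN ?le ?oppr0.
  exists (h, - g); first by split=> //=; apply: bhN; apply: bhE hg _; lia.
  by apply: pairE => /=; rewrite ?bdN ?blN; [zlin ef | rewrite eg].
have [[e1 e2] [[h1 h2] [[/= _ he2] [/= _ hh2] [/= _ l2] [_ ex]]]] := hc _ cz.
rewrite ex; apply: bndD; last exact: bnd_l.
by apply: bndN; apply: bnd_d => //; apply: bhE he2 _; lia.
Qed.

Lemma bcone_iso k : binj (k + 1) -> bsurj k -> vb bcone k.
Proof.
move=> fi fs [y x] [[/= hy hx] [ly lx] [[g1 g2] [/= hg1 hg2] [e1 e2]]].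
have cx : cyc (k + 1 + s) x.
  split; [by apply: bhE hx _; lia|exact: lx|].
  exists (- g2); first by apply: bhN; apply: bhE hg2 _; lia.
  by rewrite blN -e2 opprK.
have bfx : bnd (k + 1) (f x).
  have -> : f x = bd (- y) + bl g1 by rewrite bdN; zlin e1.
  apply: bndD; last exact: bnd_l.
  by apply: bnd_d; [apply: bhN; apply: bhE hy _; lia | rewrite blN ly oppr0].
have [e [h [he hh le ex]]] := fi _ cx bfx.
have {}he : bh (k + s) e by apply: bhE he _; lia.
have cy : cyc k (y + f e).
  split; first by apply: bhD => //; exact: bfh.
    by rewrite blD ly -bfl le bf0 addr0.
  exists (g1 - f h); first by apply: bhB => //; apply: bfh; apply: bhE hh _; lia.
  rewrite bdD -bfd blB -bfl; have -> : bd e = x - bl h by zlin ex.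
  by rewrite bfB; zlin e1.
have [x' [hx' lx' [g' hg' eg']] [e' [h' [he' hh' le' ey]]]] := fs _ cy.
exists (- e', x' - e), (- h', h + g'); split.
- split=> /=; first exact: bhN.
  by apply: bhE (bhB hx' he) _; lia.
- split=> /=; first exact: bhN.
  by apply: bhD; [apply: bhE hh _ | apply: bhE hg' _]; lia.
- by apply: pairE => /=; rewrite ?blN ?blB ?le ?le' ?lx' ?subr0 ?oppr0.
- apply: pairE => /=; rewrite ?bdN ?blN ?bfB ?blD ?bdB; first by zlin ey.
  by zlin ex eg'.
Qed.

Lemma bsurj_cone k : vb bcone k -> bsurj k.
Proof.
move=> hc z cz.
have [[e1 e2] [[h1 h2] [[/= he1 he2] [/= hh1 hh2] [/= l1 l2] [/= ez e0]]]] :=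
  hc _ (cyc_bcone1 cz).
exists e2.
  by split; [apply: bhE he2 _; lia | by [] |
    exists h2; [apply: bhE hh2 _; lia | zlin e0]].
have -> : f e2 - z = - (bd e1 + bl h1) by zlin ez.
by apply: bndN; apply: bndD; [exact: bnd_d | exact: bnd_l].
Qed.

Lemma binj_cone k : vb bcone (k - 1) -> binj k.
Proof.
move=> hc z cz [e [h [he hh le ez]]]; have [hz lz [g hg eg]] := cz.
have c : cyc (k - 1) ((- e, z) : bcone).
  split; first by split=> /=; [exact: bhN | apply: bhE hz _; lia].
    by apply: pairE => /=; rewrite ?blN ?le ?oppr0.
  exists (h, - g); first by split=> /=; [apply: bhE hh _ |
    apply: bhN; apply: bhE hg _]; lia.
  by apply: pairE => /=; rewrite ?bdN ?blN ?eg //; zlin ez.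
have [[e1 e2] [[h1 h2] [[/= _ he2] [/= _ hh2] [/= _ l2] [_ ->]]]] := hc _ c.
apply: bndD; last by apply: bnd_l; apply: bhE hh2 _; lia.
by apply: bndN; apply: bnd_d => //; apply: bhE he2 _; lia.
Qed.

End BicMor.

(** A homotopy that commutes with [bl] descends to the homology for [bl], where it is an ordinary
    homotopy for [bd]. *)
Lemma vb_retract (A B : bic) (f : bmor 0 A B) (g : bmor 0 B A) (H : A -> A) :
  additive_fun H -> (forall x, H (bl x) = bl (H x)) ->
  (forall k x, bh (k + 1) x -> bh k (H x)) ->
  (forall x, g (f x) = x - bd (H x) - H (bd x)) ->
  forall k, vb B k -> vb A k.
Proof.
move=> HD Hl Hh Hg k vB z cz; have [hz lz [w hw e]] := cz.
have -> : z = g (f z) + (bd (H z) + bl (H w)) by rewrite Hg -Hl -e; zlin.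
apply: bndD.
  by apply: bnd_mor; rewrite addr0; apply: vB; apply: cyc_mor; rewrite addr0.
apply: bndD; last by apply: bnd_l; exact: Hh.
apply: bnd_d; first by apply: Hh; apply: bhE hz _; lia.
by rewrite -Hl lz (additive_fun0 HD).
Qed.

Lemma bmor_homotopic s (A B : bic) (f g : bmor s A B) (H : A -> B) :
  additive_fun H -> (forall x, H (bl x) = bl (H x)) ->
  (forall k x, bh (k + s + 1) x -> bh k (H x)) ->
  (forall x, f x - g x = bd (H x) + H (bd x)) ->
  forall k z, cyc (k + s) z -> bnd k (f z - g z).
Proof.
move=> HD Hl Hh Hg k z [hz lz [w hw e]]; rewrite Hg e Hl.
apply: bndD; last by apply: bnd_l; exact: Hh.
apply: bnd_d; first by apply: Hh; apply: bhE hz _; lia.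
by rewrite -Hl lz (additive_fun0 HD).
Qed.

(** * Koszul complexes of the closed strands *)

Lemma hdE (C : cx) k k' (x : C) : hd k x -> k = k' -> hd k' x.
Proof. by move=> h <-. Qed.

(** The exterior algebra on L is unfolded into nested pairs, the first component being the one
    without the generator. It is built on bare groups, so that [kosm] applies to arbitrary functions
    and not only to chain maps. *)
Fixpoint kosT (L : seq nat) (M : zmodType) : zmodType :=
  if L is _ :: L' then (kosT L' M * kosT L' M)%type else M.

Fixpoint kosm (L : seq nat) (M N : zmodType) (f : M -> N) :
    kosT L M -> kosT L N :=
  match L return kosT L M -> kosT L N with
  | [::] => f
  | _ :: L' => fun z => (kosm f z.1, kosm f z.2)
  end.
Arguments kosm L {M N} f z.

Section Kosm.
Variable L : seq nat.

Lemma kosm_ext (M N : zmodType) (f g : M -> N) : f =1 g -> kosm L f =1 kosm L g.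
Proof. by move=> e; elim: L => [//|c L' ih] [x y] /=; rewrite !ih. Qed.
Lemma kosm_comp (M N P : zmodType) (g : N -> P) (f : M -> N) z :
  kosm L g (kosm L f z) = kosm L (fun x => g (f x)) z.
Proof. by elim: L z => [//|c L' ih] [x y] /=; rewrite !ih. Qed.
Lemma kosm_id (M : zmodType) (z : kosT L M) : kosm L id z = z.
Proof. by elim: L z => [//|c L' ih] [x y] /=; rewrite !ih. Qed.
Lemma kosm_addf (M N : zmodType) (f g : M -> N) z :
  kosm L (fun x => f x + g x) z = kosm L f z + kosm L g z.
Proof. by elim: L z => [//|c L' ih] [x y] /=; rewrite !ih. Qed.
Lemma kosm_oppf (M N : zmodType) (f : M -> N) z :
  kosm L (fun x => - f x) z = - kosm L f z.
Proof. by elim: L z => [//|c L' ih] [x y] /=; rewrite !ih. Qed.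
Lemma kosm_zero (M N : zmodType) z : kosm L (fun=> 0 : N) (z : kosT L M) = 0.
Proof. by elim: L z => [//|c L' ih] [x y] /=; rewrite !ih. Qed.
Lemma kosmD (M N : zmodType) (f : M -> N) :
  additive_fun f -> additive_fun (kosm L f).
Proof.
by move=> fD; elim: L => [//|c L' ih] [x y] [x' y']; apply: pairE; rewrite /= ih.
Qed.

End Kosm.
Arguments kosmD L {M N f}.
Arguments kosm_zero L {M} N z.

Definition phi (C : cx) c (x : C) := op true c x - op false c x.

Lemma phiD (C : cx) c : additive_fun (@phi C c).
Proof. by move=> x y; rewrite /phi; cxlin C. Qed.

(** The tensor product over the strands c in L of the two-term complexes [phi c]; the minus sign
    makes the partial differentials anticommute. On [C] alone, the degree zero cocycles are the
    elements on which the strands of L act equally from both sides. *)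
Fixpoint kdel (L : seq nat) (C : cx) : kosT L C -> kosT L C :=
  match L return kosT L C -> kosT L C with
  | [::] => fun=> 0
  | c :: L' => fun z => (kdel z.1, kosm L' (@phi C c) z.1 - kdel z.2)
  end.
Arguments kdel L {C} z.

Fixpoint khd (L : seq nat) (C : cx) (k : int) : kosT L C -> Prop :=
  match L return kosT L C -> Prop with
  | [::] => hd k
  | c :: L' => fun z => khd k z.1 /\ khd k z.2
  end.
Arguments khd L {C} k z.

Lemma kosm_hd L (C D : cx) (f : C -> D) k k' :
  (forall x, hd k x -> hd k' (f x)) ->
  forall z, khd L k z -> khd L k' (kosm L f z).
Proof.
move=> hf; elim: L => [//|c L ih] [x y] /= [hx hy].
by split; apply: ih.
Qed.

Lemma kosm_kdel L (C D : cx) (f : C -> D) : additive_fun f ->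
  (forall c x, c \in L -> f (phi c x) = phi c (f x)) ->
  forall z, kosm L f (kdel L z) = kdel L (kosm L f z).
Proof.
move=> fD; elim: L => [|c L ih] fc z /=; first exact: additive_fun0.
have {}ih : forall w, kosm L f (kdel L w) = kdel L (kosm L f w).
  by apply: ih => c' x c'L; apply: fc; rewrite inE c'L orbT.
have fkD := kosmD L fD.
rewrite (additive_funB fkD) !ih; congr (_, _ - _).
by rewrite !kosm_comp; apply: kosm_ext => x; apply: fc; rewrite inE eqxx.
Qed.

Lemma kdelD L C : additive_fun (@kdel L C).
Proof.
elim: L => [|c L ih]; first by move=> z z'; rewrite addr0.
move=> [x y] [x' y']; apply: pairE; first exact: ih.
by rewrite /= ih (kosmD L (@phiD C c)); zlin.
Qed.

Lemma phiC (C : cx) c c' (x : C) : phi c (phi c' x) = phi c' (phi c x).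
Proof. by rewrite /phi; cxlin C. Qed.
Lemma phid (C : cx) c (x : C) : phi c (dd x) = dd (phi c x).
Proof. by rewrite /phi; cxlin C. Qed.

Section Kosb.
Variables (L : seq nat) (C : cx).

Lemma khdB k x y : khd L k x -> khd L k y -> @khd L C k (x - y).
Proof.
elim: L x y => [|c L' ih] /= x y; first exact: hdB.
by move=> [h1 h2] [h3 h4]; split; exact: ih.
Qed.

Lemma khd_kdel k x : khd L k x -> khd L k (@kdel L C x).
Proof.
elim: L x => [|c L' ih] /= x; first by move=> _; exact: hd0.
move=> [h1 h2]; split; first exact: ih.
suff hB u v : khd L' k u -> khd L' k v -> @khd L' C k (u - v).
  apply: hB (ih _ h2); apply: kosm_hd h1 => y hy; rewrite /phi; hdsolve.
elim: (L') u v => [|c' L'' ih'] /= u v; first exact: hdB.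
by move=> [a1 a2] [a3 a4]; split; exact: ih'.
Qed.

Program Definition kosb : bic :=
  @Bic (kosT L C) (kdel L) (kosm L (@dd C)) (khd L)
  _ _ _ _ _ _ _ _ _.
Next Obligation.
exact: kdelD.
Qed.
Next Obligation.
exact: kosmD (@ddD C).
Qed.
Next Obligation.
elim: L => [//|c L' ih] [x y]; apply: pairE => /=; rewrite ?ih //.
  rewrite (additive_funB (@kdelD L' C)) ih subr0 -kosm_kdel ?subrr //.
    exact: phiD.
  by move=> *; exact: phiC.
Qed.
Next Obligation.
move=> x; rewrite kosm_comp -[RHS](kosm_zero L C x).
  by apply: kosm_ext => y; rewrite dd0.
Qed.
Next Obligation.
by move=> x; rewrite kosm_kdel //; [exact: ddD | move=> *; rewrite phid].
Qed.
Next Obligation.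
by move=> k; elim: L => [|c L' ih] /=; [exact: hd0 | split].
Qed.
Next Obligation.
exact: khdB.
Qed.
Next Obligation.
exact: khd_kdel.
Qed.
Next Obligation.
by move=> k x hx; apply: kosm_hd hx => y; exact: hddd.
Qed.

End Kosb.

(** * Vanishing of the homology and homotopy retracts *)

Definition van L k C := vb (kosb L C) k.

Program Definition kosbm L s (C D : cx) (f : cmor s C D) : bmor s (kosb L C) (kosb L D) :=
  @Bmor s (kosb L C) (kosb L D) (kosm L f) _ _ _ _.
Next Obligation.
move=> L s C D f.
exact: kosmD (mfD f).
Qed.
Next Obligation.
move=> L s C D f.
move=> x; apply: kosm_kdel; first exact: mfD.
  by move=> c y _; rewrite /phi (additive_funB (mfD f)) !mfop.
Qed.
Next Obligation.
move=> L s C D f.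
by move=> x /=; rewrite !kosm_comp; apply: kosm_ext => y; exact: mfd.
Qed.
Next Obligation.
move=> L s C D f.
by move=> k x hx; apply: kosm_hd hx => y; exact: mfhd.
Qed.

(** The predicate S selects the operators with which f commutes. Besides bimodule maps, there are
    maps that are linear on the left only, such as y ↦ y p, and division by a variable, which is
    linear in all the others. *)
Definition lin (S : bool -> nat -> bool) (C D : cx) (f : C -> D) :=
  additive_fun f /\ forall t j x, S t j -> f (op t j x) = op t j (f x).
Definition aS (t : bool) (j : nat) := true.

Definition retr (C D : cx) : Prop :=
  exists (f : cmor 0 C D) (g : cmor 0 D C) (H : C -> C),
  [/\ lin aS H, forall k x, hd (k + 1) x -> hd k (H x)
    & forall x, g (f x) = x - dd (H x) - H (dd x)].

Definition cid_mor C : cmor 0 C C.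
Proof. by refine (@Cmor 0 C C id _ _ _ _) => // k x; rewrite addr0. Defined.

Program Definition ccomp s s' C D E (g : cmor s' D E) (f : cmor s C D) : cmor (s + s') C E :=
  @Cmor _ C E (fun x => g (f x)) _ _ _ _.
Next Obligation.
move=> s s' C D E g f.
by move=> x y; rewrite !mfD.
Qed.
Next Obligation.
move=> s s' C D E g f.
by move=> t j x; rewrite !mfop.
Qed.
Next Obligation.
move=> s s' C D E g f.
by move=> x; rewrite !mfd.
Qed.
Next Obligation.
move=> s s' C D E g f.
by move=> k x hx; apply: mfhd; apply: mfhd; apply: hdE hx _; lia.
Qed.

Definition ccast s s' C D (e : s = s') (f : cmor s C D) : cmor s' C D.
Proof. by case: s' / e. Defined.
Lemma ccastE s s' C D (e : s = s') (f : cmor s C D) x : ccast e f x = f x.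
Proof. by case: s' / e. Qed.

Lemma retr_refl C : retr C C.
Proof.
exists (cid_mor C), (cid_mor C), (fun=> 0); split.
- by split=> [x y|t j x _]; rewrite ?addr0 // (additive_fun0 (opD _ _)).
- by move=> k x _; exact: hd0.
- by move=> x /=; rewrite (additive_fun0 (@ddD C)) !subr0.
Qed.

Lemma retr_trans C D E : retr C D -> retr D E -> retr C E.
Proof.
move=> [f [g [H [[HD Hl] Hh Hg]]]] [f' [g' [H' [[HD' Hl'] Hh' Hg']]]].
exists (ccast (addr0 0) (ccomp f' f)), (ccast (addr0 0) (ccomp g g')).
exists (fun x => H x + g (H' (f x))); split.
- split=> [x y|t j x _]; first by rewrite HD mfD HD' mfD; zlin.
  by rewrite Hl // mfop Hl' // mfop opD.
- move=> k x hx; apply: hdD; first exact: Hh.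
  apply: mfhd; rewrite addr0; apply: Hh'; apply: mfhd; rewrite addr0 //.
- move=> x; rewrite !ccastE /= Hg' !(additive_funB (mfD g)) Hg ddD -mfd -mfd.
  by zlin.
Qed.

Lemma retr_van L k C D : retr C D -> van L k D -> van L k C.
Proof.
move=> [f [g [H [[HD Hl] Hh Hg]]]].
apply: (@vb_retract (kosb L C) (kosb L D) (kosbm L f) (kosbm L g) (kosm L H)).
- exact: kosmD.
- move=> x; apply: kosm_kdel => // c y _.
  by rewrite /phi (additive_funB HD) !Hl.
- by move=> j x hx; apply: kosm_hd hx => y; exact: Hh.
- move=> x /=; rewrite !kosm_comp -[X in X - _ - _](kosm_id x) -!kosm_oppf.
  by rewrite -!kosm_addf; apply: kosm_ext => y /=; rewrite Hg.
Qed.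

Lemma retr_inv C D (f : cmor 0 C D) (g : cmor 0 D C) :
  (forall x, g (f x) = x) -> retr C D.
Proof.
move=> K; exists f, g, (fun=> 0); split.
- by split=> [x y|t j x _]; rewrite ?addr0 // (additive_fun0 (opD _ _)).
- by move=> k x _; exact: hd0.
- by move=> x /=; rewrite (additive_fun0 (@ddD C)) !subr0.
Qed.

(** Retractions in both directions are required, without relation to each other; this already makes
    vanishing equivalent on both sides. *)
Definition heq C D := retr C D /\ retr D C.
Lemma heq_refl C : heq C C. Proof. by split; exact: retr_refl. Qed.
Lemma heq_sym C D : heq C D -> heq D C. Proof. by case. Qed.
Lemma heq_trans C D E : heq C D -> heq D E -> heq C E.
Proof. by move=> [h1 h2] [h3 h4]; split; [exact: retr_trans h1 h3 | exact: retr_trans h4 h2]. Qed.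

Lemma heq_inv C D (f : cmor 0 C D) (g : cmor 0 D C) :
  (forall x, g (f x) = x) -> (forall x, f (g x) = x) -> heq C D.
Proof. by move=> K K'; split; [exact: retr_inv K | exact: retr_inv K']. Qed.

(* A letter [(t, (a, b))] stands for the crossing [T_{ab}] if [t] and for the *)
(* bimodule [B_{ab}] otherwise.                                               *)
Definition letter := (bool * (nat * nat))%type.

Definition lapp (l : letter) (C : cx) : cx :=
  match l with
  | (true, ab) => tT ab.1 ab.2 C
  | (false, ab) => bB ab.1 ab.2 C
  end.

Definition bmap (M N : zmodType) (f : M -> N) (z : M * M) : N * N := (f z.1, f z.2).
Definition tmap (e : bool) (M N : zmodType) (f : M -> N) (z : M * (M * M)) :
  N * (N * N) := (f z.1, (lsign e (f z.2.1), lsign e (f z.2.2))).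

(** The flag is the Koszul sign: an odd map changes sign on the summand of a crossing that lies in
    homological degree -1. *)
Definition lmap (e : bool) (l : letter) (C D : cx) (f : C -> D) :
    lapp l C -> lapp l D :=
  match l return lapp l C -> lapp l D with
  | (true, ab) => @tmap e C D f
  | (false, ab) => @bmap C D f
  end.
Arguments lmap e l {C D} f x.

Lemma lsignD (M : zmodType) e : additive_fun (@lsign M e).
Proof. by case: e => // x y /=; rewrite opprD. Qed.
Lemma lsign_fun (M N : zmodType) (f : M -> N) e x :
  additive_fun f -> f (lsign e x) = lsign e (f x).
Proof. by case: e => //= fD; rewrite (additive_funN fD). Qed.

Lemma lmap_lin (S : bool -> nat -> bool) e (l : letter) (C D : cx) (f : C -> D) :
  S true l.2.1 -> S true l.2.2 -> lin S f -> lin S (lmap e l f).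
Proof.
case: l => [[] [a b]] /= Sa Sb [fD fl]; split.
- by move=> [x [y z]] [x' [y' z']] /=; rewrite /tmap /= !fD !lsignD.
- move=> t j [x [y z]] Sj; rewrite /= /tmap /= fl //; congr pair.
  rewrite /bB_op /=; case: ifP => [/andP[t1 /eqP je]|_]; last case: ifP => [/andP[t1 /eqP je]|_].
  + by case: e; apply: pairE => /=; rewrite ?(fD, additive_funN fD) ?fl //; cxlin D.
  + by case: e; apply: pairE => /=; rewrite ?(fD, additive_funN fD) ?fl //; cxlin D.
  + by case: e; apply: pairE => /=; rewrite !fl //; cxlin D.
- by move=> [y z] [y' z'] /=; rewrite /bmap /= !fD.
- move=> t j [y z] Sj; rewrite /= /bmap /=.
  rewrite /bB_op /=; case: ifP => [/andP[t1 /eqP je]|_]; last case: ifP => [/andP[t1 /eqP je]|_].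
  + by apply: pairE => /=; rewrite ?(fD, additive_funN fD) ?fl //; cxlin D.
  + by apply: pairE => /=; rewrite ?(fD, additive_funN fD) ?fl //; cxlin D.
  + by apply: pairE => /=; rewrite !fl //; cxlin D.
Qed.

Lemma lmap_ext e l (C D : cx) (f g : C -> D) : f =1 g -> lmap e l f =1 lmap e l g.
Proof.
move=> E; case: l => [[] [a b]].
- by move=> [x [y z]] /=; rewrite /tmap /= !E.
- by move=> [y z] /=; rewrite /bmap /= !E.
Qed.

Lemma lmap_comp e e' l (C D E : cx) (g : D -> E) (f : C -> D) z : additive_fun g ->
  lmap e l g (lmap e' l f z) = lmap (e (+) e') l (fun x => g (f x)) z.
Proof.
move=> gD; case: l z => [[] [a b]] z //=.
rewrite /tmap /= !(lsign_fun _ _ gD).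
by case: e e' => [] [] //=; rewrite !opprK.
Qed.

Lemma lmap_id l (C : cx) z : lmap false l (@id C) z = z.
Proof. by case: l z => [[] [a b]]; [move=> [x [y z]] | move=> [y z]]. Qed.

Lemma lmap_hd s e l (C D : cx) (f : C -> D) :
  (forall k x, hd (k + s) x -> hd k (f x)) ->
  forall k x, hd (k + s) x -> hd k (lmap e l f x).
Proof.
move=> hf k; case: l => [[] [a b]] /=.
  move=> [x [y z]] /= [hx [hy hz]]; split; first exact: hf.
  by split; case: e; try apply: hdN; apply: hf; [apply: hdE hy _ | apply: hdE hy _
    | apply: hdE hz _ | apply: hdE hz _]; lia.
by move=> [y z] /= [hy hz]; split; exact: hf.
Qed.

Lemma lmap_d e l (C D : cx) (f : C -> D) : lin (fun t _ => t) f ->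
  (forall x, f (dd x) = lsign e (dd (f x))) ->
  forall x, lmap e l f (dd x) = lsign e (dd (lmap e l f x)).
Proof.
move=> [fD fl] fd; have fN := additive_funN fD; case: l => [[] [a b]] /=.
  move=> [x [y z]] /=; rewrite /tmap /= !(fD, fN, fl) // !fd.
  by case: e {fd} => /=; apply: pairE => /=; [cxlin D| |cxlin D|];
    apply: pairE => /=; cxlin D.
by move=> [y z] /=; rewrite /bmap /= !fd; case: e {fd}.
Qed.

Lemma lin_sub (S S' : bool -> nat -> bool) (C D : cx) (f : C -> D) :
  (forall t j, S' t j -> S t j) -> lin S f -> lin S' f.
Proof. by move=> sub [fD fl]; split=> // t j x /sub; exact: fl. Qed.

Lemma mf_lin s (C D : cx) (f : cmor s C D) : lin aS f.
Proof. by split; [exact: mfD | move=> *; exact: mfop]. Qed.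

Program Definition lcmor l s C D (f : cmor s C D) : cmor s (lapp l C) (lapp l D) :=
  @Cmor s _ _ (lmap false l f) (@lmap_lin aS false l _ _ f isT isT (mf_lin f)).1 _ _ _.
Next Obligation.
move=> l s C D f.
by move=> t j x; exact: (@lmap_lin aS false l _ _ f isT isT (mf_lin f)).2.
Qed.
Next Obligation.
move=> l s C D f.
apply: (@lmap_d false) => [|x]; last exact: mfd.
  exact: lin_sub (mf_lin f).
Qed.
Next Obligation.
move=> l s C D f.
by apply: lmap_hd; exact: mfhd.
Qed.

Lemma lmap_addf e l (C D : cx) (f g : C -> D) z :
  lmap e l (fun x => f x + g x) z = lmap e l f z + lmap e l g z.
Proof.
case: l z => [[] [a b]] z //=; rewrite /tmap /= !lsignD.
by apply: pairE.
Qed.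
Lemma lmap_oppf e l (C D : cx) (f : C -> D) z :
  lmap e l (fun x => - f x) z = - lmap e l f z.
Proof.
by case: l z => [[] [a b]] z //=; rewrite /tmap /=; apply: pairE => //=; case: e.
Qed.

Lemma retr_lapp l C D : retr C D -> retr (lapp l C) (lapp l D).
Proof.
move=> [f [g [H [Hl Hh Hg]]]]; have HD := Hl.1.
exists (lcmor l f), (lcmor l g), (lmap true l H); split.
- exact: lmap_lin.
- exact: lmap_hd.
- move=> x /=; rewrite lmap_comp; last exact: mfD.
  rewrite (@lmap_ext _ _ _ _ _ _ Hg) !lmap_addf !lmap_oppf lmap_id -!addrA -!opprD.
  congr (_ - _); have HN := additive_funN HD; have H2 t j := Hl.2 t j _ isT.
  case: l x => [[] [a b]] x /=.
    rewrite /tmap /= !(HD, HN, H2); apply: pairE => /=; first by cxlin C.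
    by apply: pairE => /=; cxlin C.
  by rewrite /bmap /=; apply: pairE.
Qed.

Lemma heq_lapp l C D : heq C D -> heq (lapp l C) (lapp l D).
Proof. by move=> [h1 h2]; split; exact: retr_lapp. Qed.

Lemma lapp_sh l s C : heq (lapp l (sh s C)) (sh s (lapp l C)).
Proof.
have c1 : lin aS (fun x : C => x : sh s C) by [].
have c2 : lin aS (fun x : sh s C => x : C) by [].
(* The identity anticommutes with the differentials of [sh s C] and [C], so it has to be treated as
   an odd map. *)
pose F := lmap true l (fun x : sh s C => x : C).
pose G := lmap true l (fun x : C => x : sh s C).
have [FD Fl] : lin aS F by exact: lmap_lin.
have [GD Gl] : lin aS G by exact: lmap_lin.
have Fd x : F (dd x) = - dd (F x).
  by apply: (@lmap_d true) => // y /=; rewrite opprK.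
have Gd x : G (dd x) = - dd (G x).
  by apply: (@lmap_d true) => // y /=; rewrite opprK.
have Fh k x : hd k x -> hd (k + s) (F x).
  move=> hx; apply: (@lmap_hd (- s)).
    by move=> j y hy; have {}hy : @hd C (j - s + s) y := hy; apply: hdE hy _; lia.
  by rewrite addrK.
have Gh k x : hd (k + s) x -> hd k (G x) by apply: lmap_hd.
have @f : cmor 0 (lapp l (sh s C)) (sh s (lapp l C)).
  refine (@Cmor 0 _ (sh s (lapp l C)) F FD (fun t j x => Fl t j x isT) _ _).
  - by move=> x /=; rewrite Fd.
  - by move=> k x; rewrite addr0; exact: Fh.
have @g : cmor 0 (sh s (lapp l C)) (lapp l (sh s C)).
  refine (@Cmor 0 (sh s (lapp l C)) _ G GD (fun t j x => Gl t j x isT) _ _).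
  - by move=> x /=; rewrite (additive_funN GD) Gd opprK.
  - by move=> k x; rewrite addr0; exact: Gh.
apply: (@heq_inv _ _ f g) => x /=.
- by rewrite /F /G lmap_comp ?lmap_id.
- rewrite /F /G lmap_comp //.
  by case: l {F G FD Fl GD Gl Fd Gd Fh Gh f g} x => [[] [a b]]; [move=> [x [y z]] | move=> [y z]].
Qed.

Lemma lapp_cone l s C D (f : cmor s C D) :
  heq (lapp l (cone f)) (cone (lcmor l f)).
Proof.
have fN : additive_fun f by exact: mfD.
have f0 := additive_funN fN.
case: l => [[] [a b]].
(* The summand of degree -1 of the crossing is exchanged with the shifted summand [C] of the cone,
   which costs a sign where the two meet. *)
- pose F (z : (D * C) * ((D * C) * (D * C))) :=
    ((z.1.1, (z.2.1.1, z.2.2.1)), (z.1.2, (- z.2.1.2, - z.2.2.2))).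
  pose G (z : (D * (D * D)) * (C * (C * C))) :=
    ((z.1.1, z.2.1), ((z.1.2.1, - z.2.2.1), (z.1.2.2, - z.2.2.2))).
  have @f1 : cmor 0 (lapp (true, (a, b)) (cone f)) (cone (lcmor (true, (a, b)) f)).
    refine (@Cmor 0 _ _ (F : lapp (true, (a, b)) (cone f) -> cone (lcmor (true, (a, b)) f)) _ _ _ _).
    + move=> [[y1 x1] [[y2 x2] [y3 x3]]] [[y1' x1'] [[y2' x2'] [y3' x3']]].
      by rewrite /F /=; do !apply: pairE => //=; rewrite opprD.
    + move=> t j [[y1 x1] [[y2 x2] [y3 x3]]].
      rewrite /F /= /bB_op /=; case: ifP => _; [|case: ifP => _];
        by do !(apply: pairE => //=); first [cxlin D | cxlin C].
    + move=> [[y1 x1] [[y2 x2] [y3 x3]]]; rewrite /F /=.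
      by do !(apply: pairE => //=); rewrite /tmap /= ?(mfD, mfN, mfop, mfd); first [cxlin D | cxlin C].
    + move=> k [[y1 x1] [[y2 x2] [y3 x3]]] /= [[h1 h2] [[h3 h4] [h5 h6]]].
      split; split; hdsolve; try split; hdsolve;
      by [apply: hdE h1 _; lia|apply: hdE h2 _; lia|apply: hdE h3 _; lia
        |apply: hdE h4 _; lia|apply: hdE h5 _; lia|apply: hdE h6 _; lia].
  have @g1 : cmor 0 (cone (lcmor (true, (a, b)) f)) (lapp (true, (a, b)) (cone f)).
    refine (@Cmor 0 _ _ (G : cone (lcmor (true, (a, b)) f) -> lapp (true, (a, b)) (cone f)) _ _ _ _).
    + move=> [[y1 [y2 y3]] [x1 [x2 x3]]] [[y1' [y2' y3']] [x1' [x2' x3']]].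
      by rewrite /G /=; do !apply: pairE => //=; rewrite opprD.
    + move=> t j [[y1 [y2 y3]] [x1 [x2 x3]]].
      rewrite /G /= /bB_op /=; case: ifP => _; [|case: ifP => _];
        by do !(apply: pairE => //=); first [cxlin D | cxlin C].
    + move=> [[y1 [y2 y3]] [x1 [x2 x3]]]; rewrite /G /=.
      by do !(apply: pairE => //=); rewrite /tmap /= ?(mfD, mfN, mfop, mfd); first [cxlin D | cxlin C].
    + move=> k [[y1 [y2 y3]] [x1 [x2 x3]]] /= [[h1 [h2 h3]] [h4 [h5 h6]]].
      split; split; hdsolve; try split; hdsolve;
      by [apply: hdE h1 _; lia|apply: hdE h2 _; lia|apply: hdE h3 _; lia
        |apply: hdE h4 _; lia|apply: hdE h5 _; lia|apply: hdE h6 _; lia].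
  apply: (@heq_inv _ _ f1 g1).
  + by move=> [[y1 x1] [[y2 x2] [y3 x3]]]; rewrite /= /F /G /= !opprK.
  + by move=> [[y1 [y2 y3]] [x1 [x2 x3]]]; rewrite /= /F /G /= !opprK.
- pose F (z : (D * C) * (D * C)) := ((z.1.1, z.2.1), (z.1.2, z.2.2)).
  pose G (z : (D * D) * (C * C)) := ((z.1.1, z.2.1), (z.1.2, z.2.2)).
  have @f1 : cmor 0 (lapp (false, (a, b)) (cone f)) (cone (lcmor (false, (a, b)) f)).
    refine (@Cmor 0 _ _ (F : lapp (false, (a, b)) (cone f) -> cone (lcmor (false, (a, b)) f)) _ _ _ _).
    + by [].
    + move=> t j [[y2 x2] [y3 x3]].
      by rewrite /F /= /bB_op /=; case: ifP => _; [|case: ifP => _].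
    + by [].
    + by move=> k [[y2 x2] [y3 x3]] /= [[h1 h2] [h3 h4]]; rewrite !addr0 in h1 h2 h3 h4 *.
  have @g1 : cmor 0 (cone (lcmor (false, (a, b)) f)) (lapp (false, (a, b)) (cone f)).
    refine (@Cmor 0 _ _ (G : cone (lcmor (false, (a, b)) f) -> lapp (false, (a, b)) (cone f)) _ _ _ _).
    + by [].
    + move=> t j [[y2 x2] [y3 x3]].
      by rewrite /G /= /bB_op /=; case: ifP => _; [|case: ifP => _].
    + by [].
    + by move=> k [[y2 x2] [y3 x3]] /= [[h1 h2] [h3 h4]]; rewrite !addr0 in h1 h2 h3 h4 *.
  by apply: (@heq_inv _ _ f1 g1) => -[[? ?] [? ?]].
Qed.

Definition capp (A : seq letter) (C : cx) : cx := foldr lapp C A.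

Lemma capp_cat A A' C : capp (A ++ A') C = capp A (capp A' C).
Proof. exact: foldr_cat. Qed.

Fixpoint capf (e : bool) (A : seq letter) (C D : cx) (f : C -> D) :
    capp A C -> capp A D :=
  match A return capp A C -> capp A D with
  | [::] => f
  | l :: A' => @lmap e l (capp A' C) (capp A' D) (capf e f)
  end.
Arguments capf e A {C D} f x.

Fixpoint capm (A : seq letter) s (C D : cx) (f : cmor s C D) :
    cmor s (capp A C) (capp A D) :=
  match A return cmor s (capp A C) (capp A D) with
  | [::] => f
  | l :: A' => @lcmor l s (capp A' C) (capp A' D) (capm A' f)
  end.
Arguments capm A {s C D} f.

Lemma capf_ext e A (C D : cx) (f g : C -> D) : f =1 g -> capf e A f =1 capf e A g.
Proof. by move=> E; elim: A => [//|l A ih] x /=; exact: lmap_ext. Qed.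

Lemma capmE A s (C D : cx) (f : cmor s C D) x : capm A f x = capf false A f x.
Proof. by elim: A x => [//|l A ih] x /=; exact: lmap_ext. Qed.

Definition okl (S : bool -> nat -> bool) (l : letter) := S true l.2.1 && S true l.2.2.

Lemma capf_lin (S : bool -> nat -> bool) e A (C D : cx) (f : C -> D) :
  all (okl S) A -> lin S f -> lin S (capf e A f).
Proof.
by move=> + fl; elim: A => [//|l A ih] /= /andP[/andP[h1 h2] /ih]; exact: lmap_lin.
Qed.

Lemma okl_sub (S : bool -> nat -> bool) A : (forall j, S true j) -> all (okl S) A.
Proof. by move=> h; apply/allP => l _; rewrite /okl !h. Qed.

Lemma capf_D e A (C D : cx) (f : C -> D) : lin (fun t _ => t) f ->
  additive_fun (capf e A f).
Proof. by move=> fl; apply: (@capf_lin (fun t _ => t) e A _ _ f _ fl).1; exact: okl_sub. Qed.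

Lemma capf_comp e e' A (C D E : cx) (g : D -> E) (f : C -> D) z :
  lin (fun t _ => t) g ->
  capf e A g (capf e' A f z) = capf (e (+) e') A (fun x => g (f x)) z.
Proof.
move=> gl; elim: A z => [//|l A ih] z /=.
by rewrite lmap_comp; [exact: lmap_ext | exact: capf_D].
Qed.

Lemma capf_id A (C : cx) z : capf false A (@id C) z = z.
Proof. by elim: A z => [//|l A ih] z /=; rewrite (lmap_ext _ ih) lmap_id. Qed.

Lemma capf_addf e A (C D : cx) (f g : C -> D) z :
  capf e A (fun x => f x + g x) z = capf e A f z + capf e A g z.
Proof. by elim: A z => [//|l A ih] z /=; rewrite (lmap_ext _ ih) lmap_addf. Qed.
Lemma capf_oppf e A (C D : cx) (f : C -> D) z :
  capf e A (fun x => - f x) z = - capf e A f z.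
Proof. by elim: A z => [//|l A ih] z /=; rewrite (lmap_ext _ ih) lmap_oppf. Qed.

Lemma capf_hd s e A (C D : cx) (f : C -> D) :
  (forall k x, hd (k + s) x -> hd k (f x)) ->
  forall k x, hd (k + s) x -> hd k (capf e A f x).
Proof. by move=> hf; elim: A => [//|l A ih]; exact: lmap_hd. Qed.

Lemma capm_comp A s s' (C D E : cx) (g : cmor s' D E) (f : cmor s C D) z :
  capm A (ccomp g f) z = capm A g (capm A f z).
Proof.
rewrite !capmE capf_comp //; exact: lin_sub (mf_lin g).
Qed.

Lemma retr_capp A C D : retr C D -> retr (capp A C) (capp A D).
Proof. by elim: A => [//|l A ih] /ih; exact: retr_lapp. Qed.
Lemma heq_capp A C D : heq C D -> heq (capp A C) (capp A D).
Proof. by move=> [h1 h2]; split; exact: retr_capp. Qed.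

Lemma capp_cone A s C D (f : cmor s C D) :
  heq (capp A (cone f)) (cone (capm A f)).
Proof.
elim: A => [|l A ih] /=; first exact: heq_refl.
exact: heq_trans (heq_lapp l ih) (lapp_cone l _).
Qed.

Lemma capp_sh A s C : heq (capp A (sh s C)) (sh s (capp A C)).
Proof.
elim: A => [|l A ih] /=; first exact: heq_refl.
exact: heq_trans (heq_lapp l ih) (lapp_sh l s _).
Qed.

Lemma vb_iso (B B' : bic) (f : bmor 0 B B') (g : bmor 0 B' B) k :
  (forall x, g (f x) = x) -> vb B' k -> vb B k.
Proof.
move=> K; apply: (@vb_retract B B' f g (fun=> 0)) => //.
- by move=> x y; rewrite addr0.
- by move=> x; rewrite bl0.
- by move=> j x _; exact: bh0.
- by move=> x; rewrite K bdz !subr0.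
Qed.

Section KosCone.
Variables (L : seq nat) (s : int) (C D : cx) (f : cmor s C D).

Let fst' (z : cone f) : D := z.1.
Let snd' (z : cone f) : C := z.2.
Let inl' (x : D) : cone f := (x, 0).
Let inr' (x : C) : cone f := (0, x).

Let fstD : additive_fun fst'. Proof. by []. Qed.
Let sndD : additive_fun snd'. Proof. by []. Qed.
Let inlD : additive_fun inl'.
Proof. by move=> x y; apply: pairE; rewrite //= addr0. Qed.
Let inrD : additive_fun inr'.
Proof. by move=> x y; apply: pairE; rewrite //= addr0. Qed.

Let kinv (z : kosT L D * kosT L C) : kosb L (cone f) :=
  kosm L inl' z.1 + kosm L inr' z.2.

(** The nested pairs of [kosT] over a product are only isomorphic to the product of the nested
    pairs. The isomorphism consists of [kosm] applied to the projections and to the inclusions. *)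
Lemma kos_cone k : van L k (cone f) <-> vb (bcone (kosbm L f)) k.
Proof.
have @F : bmor 0 (kosb L (cone f)) (bcone (kosbm L f)).
  refine (@Bmor 0 (kosb L (cone f)) (bcone (kosbm L f))
    (fun z => (kosm L fst' z, kosm L snd' z)) _ _ _ _).
  - by move=> x y; apply: pairE; [exact: (kosmD L fstD)|exact: (kosmD L sndD)].
  - move=> x; apply: pairE.
      exact: (@kosm_kdel L (cone f) D fst' fstD (fun _ _ _ => erefl)).
    exact: (@kosm_kdel L (cone f) C snd' sndD (fun _ _ _ => erefl)).
  - move=> x; apply: pairE => /=; rewrite !kosm_comp.
      by rewrite -kosm_addf.
    by rewrite -kosm_oppf.
  - move=> j x; rewrite addr0 => hx; split=> /=.
      by apply: kosm_hd hx => y [].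
    by apply: kosm_hd hx => y [].
have @G : bmor 0 (bcone (kosbm L f)) (kosb L (cone f)).
  refine (@Bmor 0 (bcone (kosbm L f)) (kosb L (cone f)) kinv _ _ _ _).
  - move=> [x y] [x' y']; rewrite /kinv /=.
    by rewrite (kosmD L inlD) (kosmD L inrD) addrACA.
  - have e1 c z : inl' (phi c z) = phi c (inl' z).
      by apply: pairE; rewrite /= ?subr0 ?(additive_fun0 (opD _ _)) ?subr0.
    have e2 c z : inr' (phi c z) = phi c (inr' z).
      by apply: pairE; rewrite /= ?subr0 ?(additive_fun0 (opD _ _)) ?subr0.
    move=> [x y]; rewrite /kinv /= kdelD; congr (_ + _).
      exact: (@kosm_kdel L D (cone f) inl' inlD (fun c z _ => e1 c z)).
    exact: (@kosm_kdel L C (cone f) inr' inrD (fun c z _ => e2 c z)).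
  - move=> [x y]; rewrite /kinv /= (kosmD L inlD) (kosmD L (@ddD (cone f))).
    rewrite -addrA !kosm_comp -[kosm L inr' (- _)]/(kosm L inr' _).
    rewrite (additive_funN (kosmD L inrD)) kosm_comp -kosm_oppf -kosm_addf.
    congr (_ + _); apply: kosm_ext => z; apply: pairE => /=.
    + by rewrite mf0 addr0.
    + by rewrite (additive_fun0 (@ddD C)) oppr0.
    + by rewrite (additive_fun0 (@ddD D)) add0r subr0.
    + by rewrite add0r.
  - move=> j [x y]; rewrite addr0 /kinv => -[/= hx hy]; apply: (@bhD (kosb L (cone f))).
      by apply: kosm_hd hx => z hz; split=> //=; exact: hd0.
    by apply: kosm_hd hy => z hz; split=> //=; exact: hd0.
split; [apply: (@vb_iso _ _ G F) | apply: (@vb_iso _ _ F G)].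
- move=> [x y] /=; rewrite /kinv /=; apply: pairE => /=.
    rewrite (kosmD L fstD) !kosm_comp /= kosm_zero addr0; exact: kosm_id.
  rewrite (kosmD L sndD) !kosm_comp /= kosm_zero add0r; exact: kosm_id.
- move=> x /=; rewrite /kinv /= !kosm_comp -kosm_addf -[RHS]kosm_id.
  by apply: kosm_ext => -[y z]; apply: pairE; rewrite /= ?addr0 ?add0r.
Qed.

End KosCone.

Lemma van_sh L k s C : van L k (sh s C) <-> van L (k + s) C.
Proof.
have e1 : forall z, kosm L (@dd (sh s C)) z = - kosm L (@dd C) z.
  by move=> z; rewrite -kosm_oppf.
have e2 : forall z : kosT L C, @kdel L (sh s C) z = @kdel L C z.
  by elim: L {e1} => [//|c L ih] [x y] /=; rewrite !ih.
have e3 : forall j (z : kosT L C), @khd L (sh s C) j z = @khd L C (j + s) z.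
  by elim: L {e1 e2} => [//|c L ih] j [x y] /=; rewrite !ih.
split=> h z [hz lz [g hg e]].
- have [|x [y [hx hy lx ez]]] := h z.
    split; [by rewrite /= e3|by rewrite /= e2|exists (- g)].
      by rewrite /= e3; apply: (@bhN (kosb L C)); apply: bhE hg _; lia.
    have {}e : kosm L (@dd C) z = kdel L g := e.
    by rewrite /= e2 e1 e (additive_funN (@kdelD L C)).
  exists (- x), y; rewrite /= in ez hx hy lx *; split.
  + by apply: (@bhN (kosb L C)); move: hx; rewrite e3 => /(@bhE (kosb L C)); apply; lia.
  + by rewrite -e3.
  + by rewrite -e2 (additive_funN (@kdelD L (sh s C))) lx oppr0.
  + by rewrite ez e1 e2 (additive_funN (kosmD L (@ddD C))).
- have [|x [y [hx hy lx ez]]] := h z.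
    split; [by rewrite /= -e3|by rewrite /= -e2|exists (- g)].
      apply: (@bhN (kosb L C)); move: hg; rewrite /= e3 => /(@bhE (kosb L C)); apply; lia.
    by rewrite blN /= -e2 -[kdel L g]e -[kosm L (@dd C) z]opprK -e1.
  exists (- x), y; rewrite /= in ez hx hy lx *; split.
  + by rewrite e3; apply: (@bhN (kosb L C)); apply: bhE hx _; lia.
  + by rewrite e3.
  + by rewrite e2 (additive_funN (@kdelD L C)) lx oppr0.
  + by rewrite ez e1 e2 (additive_funN (kosmD L (@ddD C))) opprK.
Qed.

(* Vanishing above degree [n] of all homology in all contexts; this replaces  *)
(* contractibility when projectors are replaced by finite approximations.     *)
Definition nul (n : int) (C : cx) := forall A L k, n < k -> van L k (capp A C).

Lemma van_heq L k C D : heq C D -> van L k C <-> van L k D.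
Proof. by move=> [h1 h2]; split; exact: retr_van. Qed.

Lemma nul_retr n C D : retr C D -> nul n D -> nul n C.
Proof. by move=> h nD A L k nk; apply: retr_van (retr_capp A h) _; exact: nD. Qed.
Lemma nul_heq n C D : heq C D -> nul n C <-> nul n D.
Proof. by move=> [h1 h2]; split; exact: nul_retr. Qed.
Lemma nul_le n n' C : n <= n' -> nul n C -> nul n' C.
Proof. by move=> h nC A L k nk; apply: nC; exact: le_lt_trans nk. Qed.
Lemma nul_capp n A C : nul n C -> nul n (capp A C).
Proof. by move=> h A' L k nk; rewrite -capp_cat; exact: h. Qed.

Lemma van_capp_cone L k A s C D (f : cmor s C D) :
  van L k (capp A (cone f)) <-> vb (bcone (kosbm L (capm A f))) k.
Proof. by rewrite (van_heq _ _ (capp_cone A f)) kos_cone. Qed.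

Lemma nul_sh n s C : nul n (sh s C) <-> nul (n + s) C.
Proof.
split=> h A L k nk.
- have : van L (k - s) (capp A (sh s C)) by apply: h; lia.
  by rewrite (van_heq _ _ (capp_sh A s C)) van_sh subrK.
- by rewrite (van_heq _ _ (capp_sh A s C)) van_sh; apply: h; lia.
Qed.

Section NulCone.
Variables (s : int) (C D : cx) (f : cmor s C D) (n : int).

Lemma nul_cone : nul n D -> nul (n + s + 1) C -> nul n (cone f).
Proof.
move=> hD hC A L k nk; apply/van_capp_cone; apply: bcone_mid; first exact: hD.
by apply: hC; lia.
Qed.
End NulCone.

(* Quasi-isomorphisms above degree [n]. *)
Definition eqv n s (C D : cx) (f : cmor s C D) := nul n (cone f).

Lemma eqvP n s C D (f : cmor s C D) : eqv n f <-> forall A L k, n < k ->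
  bsurj (kosbm L (capm A f)) k /\ binj (kosbm L (capm A f)) (k + 1).
Proof.
split=> [h A L k nk | h A L k nk].
  have hk : vb (bcone (kosbm L (capm A f))) k.
    by apply/van_capp_cone; exact: h.
  by split; [exact: bsurj_cone | apply: binj_cone; rewrite addrK].
by have [h1 h2] := h A L k nk; apply/van_capp_cone; exact: bcone_iso.
Qed.

Section EqvComp.
Variables (s s' : int) (C D E : cx) (g : cmor s' D E) (f : cmor s C D) (n : int).

Let compE A L z : kosbm L (capm A (ccomp g f)) z =
  kosbm L (capm A g) (kosbm L (capm A f) z).
Proof. by rewrite /= kosm_comp; apply: kosm_ext => x; exact: capm_comp. Qed.

Lemma eqv_comp : eqv n g -> eqv (n + s') f -> eqv n (ccomp g f).
Proof.
move=> /eqvP hg /eqvP hf; apply/eqvP => A L k nk.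
have [gs gi] := hg A L k nk; have [|fs fi] := hf A L (k + s'); first lia.
split=> z cz.
  have [y cy by_] := gs z cz; have [x cx bx] := fs y cy.
  exists x; first by apply: cycE cx _; lia.
  rewrite compE.
  have -> : kosbm L (capm A g) (kosbm L (capm A f) x) - z =
    kosbm L (capm A g) (kosbm L (capm A f) x - y) + (kosbm L (capm A g) y - z).
    by rewrite bfB; zlin.
  by apply: bndD => //; exact: bnd_mor.
rewrite compE => bz; apply: bndE (fi z _ _) _; try lia.
  by apply: cycE cz _; lia.
apply: bndE (gi _ _ bz) _; last by lia.
by apply: cyc_mor; apply: cycE cz _; lia.
Qed.

(** The bound rises by one: surjectivity of f in degree k needs injectivity of g in degree k - s',
    which [eqv n g] provides only when k - s' exceeds n + 1. *)
Lemma eqv_cancel : eqv n (ccomp g f) -> eqv n g -> eqv (n + s' + 1) f.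
Proof.
move=> /eqvP hgf /eqvP hg; apply/eqvP => A L k nk.
have [|gs _] := hgf A L (k - s'); first lia.
have [|_ gi] := hgf A L (k - s'); first lia.
have [|_ hi] := hg A L (k - s' - 1); first lia.
split=> z cz.
  have [|x cx bx] := gs (kosbm L (capm A g) z).
    by apply: cyc_mor; apply: cycE cz _; lia.
  exists x; first by apply: cycE cx _; lia.
  apply: bndE (hi _ _ _) _; last by lia.
    apply: cycB; last by apply: cycE cz _; lia.
    by apply: cyc_mor; apply: cycE cx _; lia.
  by rewrite bfB -compE; apply: bndE bx _; lia.
move=> bz; apply: bndE (gi z _ _) _; last by lia.
  by apply: cycE cz _; lia.
by rewrite compE; apply: bnd_mor; apply: bndE bz _; lia.
Qed.
End EqvComp.

Lemma lmap_htpy l (C D : cx) (H : C -> D) z : lin aS H ->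
  lmap false l (fun x => dd (H x) + H (dd x)) z =
  dd (lmap true l H z) + lmap true l H (dd z).
Proof.
move=> [HD Hl]; have HN := additive_funN HD.
have {}Hl t j x : H (op t j x) = op t j (H x) by exact: Hl.
case: l z => [[] [a b]]; last by move=> [y z].
move=> [x [y z]]; rewrite /= /tmap /= !(HD, HN, Hl).
by apply: pairE; [|apply: pairE] => /=; cxlin D.
Qed.

Lemma eqv_homotopic n s (C D : cx) (f f' : cmor s C D) (H : C -> D) :
  lin aS H -> (forall k x, hd (k + s + 1) x -> hd k (H x)) ->
  (forall x, f x - f' x = dd (H x) + H (dd x)) ->
  eqv n f -> eqv n f'.
Proof.
move=> Hl Hh Hg /eqvP hf; apply/eqvP => A L k nk.
have key j z : cyc (j + s) z ->
    bnd j (kosbm L (capm A f) z - kosbm L (capm A f') z).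
  have AHl : lin aS (capf true A H) by apply: capf_lin => //; exact: okl_sub.
  apply: (@bmor_homotopic s (kosb L (capp A C)) (kosb L (capp A D))
    (kosbm L (capm A f)) (kosbm L (capm A f')) (kosm L (capf true A H))).
  - exact: kosmD AHl.1.
  - move=> x; apply: kosm_kdel => [|c y _]; first exact: AHl.1.
    by rewrite /phi (additive_funB AHl.1) !AHl.2.
  - move=> i x hx; apply: kosm_hd hx => y; rewrite -addrA.
    by apply: capf_hd => i' x'; rewrite addrA; exact: Hh.
  - move=> x /=; rewrite -kosm_oppf -kosm_addf !kosm_comp -kosm_addf.
    apply: kosm_ext => y; rewrite !capmE -capf_oppf -capf_addf.
    rewrite (@capf_ext _ _ _ _ _ (fun x => dd (H x) + H (dd x))) //.
    elim: A y {AHl x z} => [//|l A ih] y /=.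
    rewrite (@lmap_ext _ _ _ _ _ _ ih).
    by apply: lmap_htpy; apply: capf_lin => //; exact: okl_sub.
have [fs fi] := hf A L k nk; split=> z cz.
  have [x cx bx] := fs z cz; exists x => //.
  have -> : kosbm L (capm A f') x - z = (kosbm L (capm A f) x - z) -
    (kosbm L (capm A f) x - kosbm L (capm A f') x) by zlin.
  by apply: bndB => //; exact: key.
move=> bz; apply: fi => //.
have -> : kosbm L (capm A f) z = kosbm L (capm A f') z +
    (kosbm L (capm A f) z - kosbm L (capm A f') z) by zlin.
by apply: bndD => //; exact: key.
Qed.

Definition weq (w w' : seq letter) := forall C, heq (capp w C) (capp w' C).

Lemma weq_refl w : weq w w. Proof. by move=> C; exact: heq_refl. Qed.
Lemma weq_sym w w' : weq w w' -> weq w' w.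
Proof. by move=> h C; exact: heq_sym. Qed.
Lemma weq_trans w2 w1 w3 : weq w1 w2 -> weq w2 w3 -> weq w1 w3.
Proof. by move=> h h' C; exact: heq_trans (h C) (h' C). Qed.
Lemma weq_cat w1 w1' w2 w2' : weq w1 w1' -> weq w2 w2' -> weq (w1 ++ w2) (w1' ++ w2').
Proof.
move=> h1 h2 C; rewrite !capp_cat.
exact: heq_trans (heq_capp w1 (h2 C)) (h1 _).
Qed.
Lemma weq_catl w w1 w2 : weq w1 w2 -> weq (w ++ w1) (w ++ w2).
Proof. by apply: weq_cat; exact: weq_refl. Qed.
Lemma weq_catr w w1 w2 : weq w1 w2 -> weq (w1 ++ w) (w2 ++ w).
Proof. by move=> h; apply: weq_cat => //; exact: weq_refl. Qed.

Ltac bsplit j a := case: (eqVneq j a) => [?|?]; [subst j|].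
Ltac neqs := repeat match goal with
  | h : is_true (?x != ?y) |- context [?x == ?y] => rewrite (negPf h)
  | h : is_true (?x != ?y) |- context [?y == ?x] => rewrite (eq_sym y x) (negPf h)
  | |- context [?x == ?x] => rewrite (eqxx x)
  end.
Ltac bop := cbn [op bB_op]; rewrite /=; repeat (progress (rewrite /bB_op; neqs; rewrite /=)).
Ltac pcx C := bop; repeat (apply: pairE => /=); cxlin C.
(* Proves that an explicitly given map commutes with [op t j].                *)
Ltac oplin C t j l :=
  rewrite /=; case: t => /=;
  [ l j; bop; repeat (apply: pairE => /=); cxlin C
  | bop; repeat (apply: pairE => /=); cxlin C].

Definition bBm p q s (C D : cx) (f : cmor s C D) :
  cmor s (bB p q C) (bB p q D) := lcmor (false, (p, q)) f.

(** * Reidemeister moves *)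

Section Local.
Variables (p q : nat) (C : cx).
Hypothesis pq : p != q.
Local Notation B := (bB p q).
Ltac lab j := bsplit j p; [|bsplit j q].

(** In tensor notation [jB] is f ⊗ x ↦ f ⊗ 1 ⊗ x and [rB] is f ⊗ g ⊗ x ↦ f ⊗ ∂(g) x, with ∂ the
    divided difference, so that ∂(1) = 0 and ∂(x_p) = 1. The map [sB] is the section of [rB] whose
    image is killed by multiplication. Together they split B B into two copies of B. *)
Program Definition jB : cmor 0 (B C) (B (B C)) :=
  @Cmor 0 (B C) (B (B C)) (fun z => ((z.1, 0), (z.2, 0))) _ _ _ _.
Next Obligation.
by move=> [x y] [x' y']; pcx C.
Qed.
Next Obligation.
by move=> t j [x y]; oplin C t j lab.
Qed.
Next Obligation.
by move=> [x y]; pcx C.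
Qed.
Next Obligation.
by move=> k [x y] /=; rewrite addr0 => -[h1 h2]; repeat split; hdsolve.
Qed.

Program Definition rB : cmor 0 (B (B C)) (B C) :=
  @Cmor 0 (B (B C)) (B C) (fun z => (z.1.2, z.2.2)) _ _ _ _.
Next Obligation.
by move=> [[x y] [z w]] [[x' y'] [z' w']]; pcx C.
Qed.
Next Obligation.
by move=> t j [[x y] [z w]]; oplin C t j lab.
Qed.
Next Obligation.
by move=> [[x y] [z w]]; pcx C.
Qed.
Next Obligation.
by move=> k [[x y] [z w]] /=; rewrite addr0 => -[[h1 h2] [h3 h4]].
Qed.

Program Definition sB : cmor 0 (B C) (B (B C)) :=
  @Cmor 0 (B C) (B (B C)) (fun z =>
  ((op true p (op true q z.2), z.1), (- z.1 - op true p z.2 - op true q z.2, z.2)))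
  _ _ _ _.
Next Obligation.
by move=> [x y] [x' y']; pcx C.
Qed.
Next Obligation.
by move=> t j [x y]; oplin C t j lab.
Qed.
Next Obligation.
by move=> [x y]; pcx C.
Qed.
Next Obligation.
by move=> k [x y] /=; rewrite addr0 => -[h1 h2]; repeat split; hdsolve.
Qed.

(** The map x ↦ x_p ⊗ x - 1 ⊗ x_q x of the complex of a negative crossing. *)
Program Definition dB : cmor 0 C (B C) :=
  @Cmor 0 C (B C) (fun x => (- op true q x, x)) _ _ _ _.
Next Obligation.
by move=> x x'; pcx C.
Qed.
Next Obligation.
by move=> t j x; oplin C t j lab.
Qed.
Next Obligation.
by move=> x; pcx C.
Qed.
Next Obligation.
by move=> k x /=; rewrite addr0 => h1; repeat split; hdsolve.
Qed.

(** On the summand of B B given by [jB], multiplication is an isomorphism onto B. Gaussian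
    elimination leaves the summand given by [sB], in degree -1. *)
Lemma retr_TB : retr (tT p q (B C)) (sh 1 (B C)).
Proof.
have @f : cmor 0 (tT p q (B C)) (sh 1 (B C)).
  refine (@Cmor 0 (tT p q (B C)) (sh 1 (B C)) (fun z => (z.2.1.2, z.2.2.2)) _ _ _ _).
  - by move=> [[x1 x2] [[y1 y2] [z1 z2]]] [[x1' x2'] [[y1' y2'] [z1' z2']]]; pcx C.
  - by move=> t j [[x1 x2] [[y1 y2] [z1 z2]]]; oplin C t j lab.
  - by move=> [[x1 x2] [[y1 y2] [z1 z2]]]; pcx C.
  - move=> k [x y] [_ /= [[_ h2] [_ h4]]].
    by split; [apply: hdE h2 _|apply: hdE h4 _]; lia.
have @g : cmor 0 (sh 1 (B C)) (tT p q (B C)).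
  refine (@Cmor 0 (sh 1 (B C)) (tT p q (B C)) (fun z => ((0, 0),
  ((op true p (op true q z.2), z.1), (- z.1 - op true p z.2 - op true q z.2, z.2)))) _ _ _ _).
  - by move=> [x y] [x' y']; pcx C.
  - by move=> t j [x y]; oplin C t j lab.
  - by move=> [x y]; pcx C.
  - by move=> k [x y] /=; rewrite !addr0 => -[h1 h2]; repeat split; hdsolve.
exists f, g, (fun z => ((0, 0), ((z.1.1, 0), (z.1.2, 0)))); split.
- split; first by move=> [[x1 x2] [[y1 y2] [z1 z2]]] [[x1' x2'] [[y1' y2'] [z1' z2']]]; pcx C.
  by move=> t j [[x1 x2] [[y1 y2] [z1 z2]]] _; oplin C t j lab.
- by move=> k [[x1 x2] [[y1 y2] [z1 z2]]] /= [[h1 h2] _]; rewrite !addr0; repeat split; hdsolve.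
- by move=> [[x y] [[z00 z01] [z10 z11]]]; pcx C.
Qed.

Lemma retr_BT : retr (B (tT p q C)) (sh 1 (B C)).
Proof.
have @f : cmor 0 (B (tT p q C)) (sh 1 (B C)).
  refine (@Cmor 0 (B (tT p q C)) (sh 1 (B C)) (fun z => (z.1.2.2, z.2.2.2)) _ _ _ _).
  - by move=> [[x [x1 x2]] [y [y1 y2]]] [[x' [x1' x2']] [y' [y1' y2']]]; pcx C.
  - by move=> t j [[x [x1 x2]] [y [y1 y2]]]; oplin C t j lab.
  - by move=> [[x [x1 x2]] [y [y1 y2]]]; pcx C.
  - move=> k [[x [x1 x2]] [y [y1 y2]]] /= [[_ [_ h1]] [_ [_ h2]]].
    by split; [apply: hdE h1 _|apply: hdE h2 _]; lia.
have @g : cmor 0 (sh 1 (B C)) (B (tT p q C)).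
  refine (@Cmor 0 (sh 1 (B C)) (B (tT p q C)) (fun z => ((0, (- op true p z.1, z.1)),
    (0, (- op true p z.2, z.2)))) _ _ _ _).
  - by move=> [x y] [x' y']; pcx C.
  - by move=> t j [x y]; oplin C t j lab.
  - by move=> [x y]; pcx C.
  - move=> k [x y] /=; rewrite !addr0 => -[h1 h2].
    by repeat split; hdsolve.
exists f, g, (fun z => ((0, (z.1.1, 0)), (0, (z.2.1, 0)))); split.
- split; first by move=> [[x [x1 x2]] [y [y1 y2]]] [[x' [x1' x2']] [y' [y1' y2']]]; pcx C.
  by move=> t j [[x [x1 x2]] [y [y1 y2]]] _; oplin C t j lab.
- move=> k [[x [x1 x2]] [y [y1 y2]]] /= [[h1 _] [h2 _]].
  by rewrite !addr0; repeat split; hdsolve.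
- by move=> [[x [x1 x2]] [y [y1 y2]]]; pcx C.
Qed.

(* the mapping cone of C -> B C, with C in degree - 1 *)
Definition tS := cone dB.

(** The second Reidemeister move: [tS] is the negative crossing, shifted by one. *)
Lemma retr_TS : retr (tT p q tS) (sh 1 C).
Proof.
have @f : cmor 0 (tT p q tS) (sh 1 C).
  refine (@Cmor 0 (tT p q tS) (sh 1 C) (fun w =>
    w.1.2 + (w.2.1.1.2 + op true p w.2.2.1.2)) _ _ _ _).
  - by move=> [[y1 x1] [[y2 x2] [y3 x3]]] [[y1' x1'] [[y2' x2'] [y3' x3']]] /=; cxlin C.
  - move=> t j [[[y1 z1] x1] [[[y2 z2] x2] [[y3 z3] x3]]].
    by oplin C t j lab.
  - by move=> [[[y1 z1] x1] [[[y2 z2] x2] [[y3 z3] x3]]] /=; cxlin C.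
  - move=> k [[[y1 z1] x1] [[[y2 z2] x2] [[y3 z3] x3]]] /= [[[h1 h2] h3] [[[h4 h5] h6] [[h7 h8] h9]]].
    by hdsolve; [apply: hdE h3 _|apply: hdE h5 _|apply: hdE h8 _]; lia.
have @g : cmor 0 (sh 1 C) (tT p q tS).
  refine (@Cmor 0 (sh 1 C) (tT p q tS) (fun y =>
    (((0, 0), y), (((op true q y, 0), 0), ((- y, 0), 0)))) _ _ _ _).
  - by move=> x x'; pcx C.
  - by move=> t j x; oplin C t j lab.
  - by move=> x; pcx C.
  - move=> k x /=; rewrite !addr0 => h.
    by repeat split; hdsolve.
exists f, g, (fun w => (((0, 0), 0),
  (((w.1.1.1, 0), - w.2.1.1.2), ((w.1.1.2, 0), - w.2.2.1.2)))); split.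
- split.
    by move=> [[[y1 z1] x1] [[[y2 z2] x2] [[y3 z3] x3]]] [[[y1' z1'] x1'] [[[y2' z2'] x2'] [[y3' z3'] x3']]]; pcx C.
  move=> t j [[[y1 z1] x1] [[[y2 z2] x2] [[y3 z3] x3]]] _.
  by oplin C t j lab.
- move=> k [[[y1 z1] x1] [[[y2 z2] x2] [[y3 z3] x3]]] /= [[[h1 h2] h3] [[[h4 h5] h6] [[h7 h8] h9]]].
  rewrite !addr0 in h1 h2 h3 h4 h5 h6 h7 h8 h9 *.
  by repeat split; hdsolve.
- move=> [[[y1 z1] x1] [[[y2 z2] x2] [[y3 z3] x3]]]; pcx C.
Qed.

Lemma heq_swapB : heq (bB p q C) (bB q p C).
Proof.
have @f : cmor 0 (bB p q C) (bB q p C).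
  refine (@Cmor 0 (bB p q C) (bB q p C) (fun z => (z.1 + op true p z.2 + op true q z.2, - z.2)) _ _ _ _).
  - by move=> [x y] [x' y']; pcx C.
  - by move=> t j [x y]; oplin C t j lab.
  - by move=> [x y]; pcx C.
  - by move=> k [x y] /=; rewrite addr0 => -[h1 h2]; repeat split; hdsolve.
have @g : cmor 0 (bB q p C) (bB p q C).
  refine (@Cmor 0 (bB q p C) (bB p q C) (fun z => (z.1 + op true p z.2 + op true q z.2, - z.2)) _ _ _ _).
  - by move=> [x y] [x' y']; pcx C.
  - by move=> t j [x y]; oplin C t j lab.
  - by move=> [x y]; pcx C.
  - by move=> k [x y] /=; rewrite addr0 => -[h1 h2]; repeat split; hdsolve.
by apply: (@heq_inv _ _ f g) => -[x y]; pcx C.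
Qed.

Lemma heq_swapT : heq (tT p q C) (tT q p C).
Proof.
have @f : cmor 0 (tT p q C) (tT q p C).
  refine (@Cmor 0 (tT p q C) (tT q p C) (fun z => (z.1, (z.2.1 + op true p z.2.2 + op true q z.2.2, - z.2.2))) _ _ _ _).
  - by move=> [w [x y]] [w' [x' y']]; pcx C.
  - by move=> t j [w [x y]]; oplin C t j lab.
  - by move=> [w [x y]]; pcx C.
  - by move=> k [w [x y]] /=; rewrite !addr0 => -[h1 [h2 h3]]; repeat split; hdsolve.
have @g : cmor 0 (tT q p C) (tT p q C).
  refine (@Cmor 0 (tT q p C) (tT p q C) (fun z => (z.1, (z.2.1 + op true p z.2.2 + op true q z.2.2, - z.2.2))) _ _ _ _).
  - by move=> [w [x y]] [w' [x' y']]; pcx C.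
  - by move=> t j [w [x y]]; oplin C t j lab.
  - by move=> [w [x y]]; pcx C.
  - by move=> k [w [x y]] /=; rewrite !addr0 => -[h1 [h2 h3]]; repeat split; hdsolve.
by apply: (@heq_inv _ _ f g) => -[w [x y]]; pcx C.
Qed.

End Local.

Section Far.
Variables (a b c d : nat) (C : cx).
Hypotheses (ac : a != c) (ad : a != d) (bc : b != c) (bd' : b != d).
Ltac lab j := bsplit j a; [|bsplit j b; [|bsplit j c; [|bsplit j d]]].

Program Definition farBB : cmor 0 (bB a b (bB c d C)) (bB c d (bB a b C)) :=
  @Cmor 0 (bB a b (bB c d C)) (bB c d (bB a b C))
  (fun z => ((z.1.1, z.2.1), (z.1.2, z.2.2))) _ _ _ _.
Next Obligation.
by move=> [[x1 x2] [y1 y2]] [[x1' x2'] [y1' y2']]; pcx C.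
Qed.
Next Obligation.
by move=> t j [[x1 x2] [y1 y2]]; oplin C t j lab.
Qed.
Next Obligation.
by move=> [[x1 x2] [y1 y2]]; pcx C.
Qed.
Next Obligation.
by move=> k [[x1 x2] [y1 y2]] /=; rewrite addr0 => -[[h1 h2] [h3 h4]].
Qed.

Program Definition farBT : cmor 0 (bB a b (tT c d C)) (tT c d (bB a b C)) :=
  @Cmor 0 (bB a b (tT c d C)) (tT c d (bB a b C))
  (fun z => ((z.1.1, z.2.1), ((z.1.2.1, z.2.2.1), (z.1.2.2, z.2.2.2)))) _ _ _ _.
Next Obligation.
by move=> [[x [x1 x2]] [y [y1 y2]]] [[x' [x1' x2']] [y' [y1' y2']]]; pcx C.
Qed.
Next Obligation.
by move=> t j [[x [x1 x2]] [y [y1 y2]]]; oplin C t j lab.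
Qed.
Next Obligation.
by move=> [[x [x1 x2]] [y [y1 y2]]]; pcx C.
Qed.
Next Obligation.
by move=> k [[x [x1 x2]] [y [y1 y2]]] /=; rewrite !addr0 => -[[h1 [h2 h3]] [h4 [h5 h6]]].
Qed.

Program Definition farTB : cmor 0 (tT a b (bB c d C)) (bB c d (tT a b C)) :=
  @Cmor 0 (tT a b (bB c d C)) (bB c d (tT a b C))
  (fun z => ((z.1.1, (z.2.1.1, z.2.2.1)), (z.1.2, (z.2.1.2, z.2.2.2)))) _ _ _ _.
Next Obligation.
by move=> [[x y] [[x1 y1] [x2 y2]]] [[x' y'] [[x1' y1'] [x2' y2']]]; pcx C.
Qed.
Next Obligation.
by move=> t j [[x y] [[x1 y1] [x2 y2]]]; oplin C t j lab.
Qed.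
Next Obligation.
by move=> [[x y] [[x1 y1] [x2 y2]]]; pcx C.
Qed.
Next Obligation.
by move=> k [[x y] [[x1 y1] [x2 y2]]] /=; rewrite !addr0 => -[[h1 h2] [[h3 h4] [h5 h6]]].
Qed.

(** The summand B B has degree -1 for both crossings, hence changes sign when the crossings are
    exchanged. *)
Program Definition farTT : cmor 0 (tT a b (tT c d C)) (tT c d (tT a b C)) :=
  @Cmor 0 (tT a b (tT c d C)) (tT c d (tT a b C))
  (fun z => ((z.1.1, (z.2.1.1, z.2.2.1)), ((z.1.2.1, (- z.2.1.2.1, - z.2.2.2.1)),
     (z.1.2.2, (- z.2.1.2.2, - z.2.2.2.2))))) _ _ _ _.
Next Obligation.
by move=> [[x [x1 x2]] [[y [y1 y2]] [w [w1 w2]]]] [[x' [x1' x2']] [[y' [y1' y2']] [w' [w1' w2']]]]; pcx C.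
Qed.
Next Obligation.
by move=> t j [[x [x1 x2]] [[y [y1 y2]] [w [w1 w2]]]]; oplin C t j lab.
Qed.
Next Obligation.
by move=> [[x [x1 x2]] [[y [y1 y2]] [w [w1 w2]]]]; pcx C.
Qed.
Next Obligation.
move=> k [[x [x1 x2]] [[y [y1 y2]] [w [w1 w2]]]] /=; rewrite !addr0.
  by move=> -[[h1 [h2 h3]] [[h4 [h5 h6]] [h7 [h8 h9]]]]; repeat split; hdsolve.
Qed.
End Far.

Lemma heq_far (l l' : letter) C : l.2.1 != l'.2.1 -> l.2.1 != l'.2.2 ->
  l.2.2 != l'.2.1 -> l.2.2 != l'.2.2 ->
  heq (lapp l (lapp l' C)) (lapp l' (lapp l C)).
Proof.
case: l l' => [t [a b]] [t' [c d]] /= ac ad bc bd'.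
have sy x y : x != y -> y != x :> nat by rewrite eq_sym.
case: t t' => [] [].
- apply: (@heq_inv _ _ (@farTT a b c d C ac ad bc bd')
    (@farTT c d a b C (sy _ _ ac) (sy _ _ bc) (sy _ _ ad) (sy _ _ bd'))).
  + by move=> [[x [x1 x2]] [[y [y1 y2]] [w [w1 w2]]]]; rewrite /= !opprK.
  + by move=> [[x [x1 x2]] [[y [y1 y2]] [w [w1 w2]]]]; rewrite /= !opprK.
- apply: (@heq_inv _ _ (@farTB a b c d C ac ad bc bd')
    (@farBT c d a b C (sy _ _ ac) (sy _ _ bc) (sy _ _ ad) (sy _ _ bd'))).
  + by move=> [[x y] [[x1 y1] [x2 y2]]].
  + by move=> [[x [x1 x2]] [y [y1 y2]]].
- apply: (@heq_inv _ _ (@farBT a b c d C ac ad bc bd')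
    (@farTB c d a b C (sy _ _ ac) (sy _ _ bc) (sy _ _ ad) (sy _ _ bd'))).
  + by move=> [[x [x1 x2]] [y [y1 y2]]].
  + by move=> [[x y] [[x1 y1] [x2 y2]]].
- apply: (@heq_inv _ _ (@farBB a b c d C ac ad bc bd')
    (@farBB c d a b C (sy _ _ ac) (sy _ _ bc) (sy _ _ ad) (sy _ _ bd'))).
  + by move=> [[x1 x2] [y1 y2]].
  + by move=> [[x1 x2] [y1 y2]].
Qed.

Section ThreeStrands.
Variables (p q r : nat) (C : cx).
Hypotheses (pq : p != q) (pr : p != r) (qr : q != r).
Local Notation Ba := (bB p q).
Local Notation Bb := (bB r q).
Ltac lab j := bsplit j p; [|bsplit j q; [|bsplit j r]].

(** The product B_b B_a B_b splits into B_b and the bimodule induced from the symmetric polynomials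
    in three variables. [piB] and [ioB] split off the first summand; [piB] is multiplication by the
    middle factor followed by a divided difference. *)
Program Definition piB : cmor 0 (Bb (Ba (Bb C))) (Bb C) :=
  @Cmor 0 (Bb (Ba (Bb C))) (Bb C) (fun z =>
  (z.1.1.2 + op true p z.1.2.2, z.2.1.2 + op true p z.2.2.2)) _ _ _ _.
Next Obligation.
by move=> [[[a1 a2] [a3 a4]] [[a5 a6] [a7 a8]]] [[[b1 b2] [b3 b4]] [[b5 b6] [b7 b8]]]; pcx C.
Qed.
Next Obligation.
by move=> t j [[[a1 a2] [a3 a4]] [[a5 a6] [a7 a8]]]; oplin C t j lab.
Qed.
Next Obligation.
by move=> [[[a1 a2] [a3 a4]] [[a5 a6] [a7 a8]]]; pcx C.
Qed.
Next Obligation.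
move=> k [[[a1 a2] [a3 a4]] [[a5 a6] [a7 a8]]] /=; rewrite !addr0.
  by move=> -[[[h1 h2] [h3 h4]] [[h5 h6] [h7 h8]]]; repeat split; hdsolve.
Qed.

Program Definition ioB : cmor 0 (Bb C) (Bb (Ba (Bb C))) :=
  @Cmor 0 (Bb C) (Bb (Ba (Bb C))) (fun n =>
  (((- op true r n.1 - op true q n.1, n.1), (n.1, 0)),
   ((- op true r n.2 - op true q n.2, n.2), (n.2, 0)))) _ _ _ _.
Next Obligation.
by move=> [a1 a2] [b1 b2]; pcx C.
Qed.
Next Obligation.
by move=> t j [a1 a2]; oplin C t j lab.
Qed.
Next Obligation.
by move=> [a1 a2]; pcx C.
Qed.
Next Obligation.
by move=> k [a1 a2] /=; rewrite !addr0 => -[h1 h2]; repeat split; hdsolve.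
Qed.

(** It identifies the second summand of B_b B_a B_b with the one of B_a B_b B_a, and is zero on B_b.
    This is the content of [uBB] and [pi_uB] below. *)
Program Definition uB : cmor 0 (Bb (Ba (Bb C))) (Ba (Bb (Ba C))) :=
  @Cmor 0 (Bb (Ba (Bb C))) (Ba (Bb (Ba C))) (fun z =>
  let a1 := z.1.1.1 in let a2 := z.1.1.2 in let a3 := z.1.2.1 in let a4 := z.1.2.2 in
  let a5 := z.2.1.1 in let a6 := z.2.1.2 in let a7 := z.2.2.1 in let a8 := z.2.2.2 in
  (((a1 + op true q a2 + op true r a2 + op true p (op true q a4) +
     op true p (op true q (op true r a8)), op true r a4),
    (a5 + op true q a6 + op true r a6, - a4)),
   ((a3 - a2 - op true p a4 - op true p (op true r a8) - op true q (op true r a8),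
     op true r a8),
    (a4 + a7 + op true q a8 + op true r a8 - a6, - a8)))) _ _ _ _.
Next Obligation.
by move=> [[[a1 a2] [a3 a4]] [[a5 a6] [a7 a8]]] [[[b1 b2] [b3 b4]] [[b5 b6] [b7 b8]]]; pcx C.
Qed.
Next Obligation.
by move=> t j [[[a1 a2] [a3 a4]] [[a5 a6] [a7 a8]]]; oplin C t j lab.
Qed.
Next Obligation.
by move=> [[[a1 a2] [a3 a4]] [[a5 a6] [a7 a8]]]; pcx C.
Qed.
Next Obligation.
move=> k [[[a1 a2] [a3 a4]] [[a5 a6] [a7 a8]]] /=; rewrite !addr0.
  by move=> -[[[h1 h2] [h3 h4]] [[h5 h6] [h7 h8]]]; repeat split; hdsolve.
Qed.

Lemma piioB x : piB (ioB x) = x.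
Proof. by case: x => x y; pcx C. Qed.

Local Notation Fa := (@bBm p q _ _ _).
Local Notation Fb := (@bBm r q _ _ _).
Local Notation ma D := (mB p q D).
Local Notation mb D := (mB r q D).

(** Away from the summand B_b, the differentials leaving B_b B_a B_b in one triple product are those
    leaving B_a B_b B_a in the other, read through [uB]. *)
Lemma uB2a z : mb (Ba (Bb C)) (z - ioB (piB z)) = Fa (Fb (ma C)) (uB z).
Proof.
by move: z => [[[a1 a2] [a3 a4]] [[a5 a6] [a7 a8]]]; pcx C.
Qed.
Lemma uB2b z : Fb (Fa (mb C)) (z - ioB (piB z)) = ma (Bb (Ba C)) (uB z).
Proof.
by move: z => [[[a1 a2] [a3 a4]] [[a5 a6] [a7 a8]]]; pcx C.
Qed.

(* The tensor T_b T_a T_b as an iterated cone, with its eight summands.       *)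
Definition pack (y : C) (b1 b2 : Bb C) (a : Ba C) (ab : Ba (Bb C))
  (ba : Bb (Ba C)) (bb : Bb (Bb C)) (bab : Bb (Ba (Bb C))) :
  tT r q (tT p q (tT r q C)) :=
  (((y, b1), ((a.1, ab.1), (a.2, ab.2))),
   (((b2.1, bb.1), ((ba.1.1, bab.1.1), (ba.1.2, bab.1.2))),
    ((b2.2, bb.2), ((ba.2.1, bab.2.1), (ba.2.2, bab.2.2))))).

Lemma packP (P : tT r q (tT p q (tT r q C)) -> Prop) :
  (forall y b1 b2 a ab ba bb bab, P (pack y b1 b2 a ab ba bb bab)) ->
  forall w, P w.
Proof.
move=> h [[[y b1] [[c1 e1] [c2 e2]]] [[[b21 bb1] [[f1 g1] [f2 g2]]]
  [[b22 bb2] [[f3 g3] [f4 g4]]]]].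
exact: (h y b1 (b21, b22) (c1, c2) (e1, e2) ((f1, f2), (f3, f4)) (bb1, bb2)
  ((g1, g2), (g3, g4))).
Qed.

Lemma pack_op t j y b1 b2 a ab ba bb bab :
  op t j (pack y b1 b2 a ab ba bb bab) =
  pack (op t j y) (op t j b1) (op t j b2) (op t j a) (op t j ab) (op t j ba)
    (op t j bb) (op t j bab).
Proof.
move: b1 b2 a ab ba bb bab => [b1 b1'] [b2 b2'] [a a'] [[e1 e2] [e3 e4]]
  [[f1 f2] [f3 f4]] [[g1 g2] [g3 g4]] [[[h1 h2] [h3 h4]] [[h5 h6] [h7 h8]]].
rewrite /pack; oplin C t j lab.
Qed.

Lemma pack_dd y b1 b2 a ab ba bb bab :
  dd (pack y b1 b2 a ab ba bb bab) =
  pack (dd y + ma C a + (mb C b1 + mb C b2))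
    (- dd b1 + ma _ ab + mb _ bb) (- dd b2 - Fb (mb C) bb - Fb (ma C) ba)
    (- dd a - Fa (mb C) ab + mb _ ba) (dd ab + mb _ bab)
    (dd ba + Fb (Fa (mb C)) bab) (dd bb - Fb (ma (Bb C)) bab) (- dd bab).
Proof.
move: b1 b2 a ab ba bb bab => [b1 b1'] [b2 b2'] [a a'] [[e1 e2] [e3 e4]]
  [[f1 f2] [f3 f4]] [[g1 g2] [g3 g4]] [[[h1 h2] [h3 h4]] [[h5 h6] [h7 h8]]].
by rewrite /pack; pcx C.
Qed.
End ThreeStrands.

(* Pushes morphisms inside sums; matching is syntactic because unification     *)
(* would see through the definition of [mB].                                  *)
Ltac mpush := repeat match goal with
  | |- context [@mf ?s ?C ?D ?f (@GRing.add _ ?x ?y)] => rewrite (@mfD s C D f x y)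
  | |- context [@mf ?s ?C ?D ?f (@GRing.opp _ ?x)] => rewrite (@mfN s C D f x)
  | |- context [@mf ?s ?C ?D ?f (@GRing.zero _)] => rewrite (@mf0 s C D f)
  | |- context [@mf ?s ?C ?D ?f (@dd _ ?x)] => rewrite (@mfd s C D f x)
  | |- context [@dd ?C (@GRing.add _ ?x ?y)] => rewrite (@ddD C x y)
  | |- context [@dd ?C (@GRing.opp _ ?x)] => rewrite (additive_funN (@ddD C) x)
  | |- context [@dd ?C (@GRing.zero _)] => rewrite (additive_fun0 (@ddD C))
  end.
Lemma mfhd0 (C D : cx) (f : cmor 0 C D) k x : hd k x -> hd k (f x).
Proof. by move=> h; apply: mfhd; rewrite addr0. Qed.

Lemma mB_jB p q C (pq : p != q) z : mB p q (bB p q C) (jB C pq z) = z.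
Proof. by case: z => x y; pcx C. Qed.
Lemma rB_jB p q C (pq : p != q) z : rB C pq (jB C pq z) = 0.
Proof. by case: z => x y; pcx C. Qed.
Lemma FmB_jB p q C (pq : p != q) z :
  bBm p q (mB p q C) (jB C pq z) = z.
Proof. by case: z => x y; pcx C. Qed.
Lemma sr_jm p q C (pq : p != q) z :
  z = sB C pq (rB C pq z) + jB C pq (mB p q (bB p q C) z).
Proof. by move: z => [[x y] [z w]]; pcx C. Qed.
Lemma mB_nat p q (C D : cx) (f : C -> D) (z : bB p q C) : lin (fun t _ => t) f ->
  mB p q D (bmap f z) = f (mB p q C z).
Proof. by case: z => x y [fD fl] /=; rewrite fD fl. Qed.
Lemma lin_mf s (C D : cx) (f : cmor s C D) : lin (fun t _ => t) f.
Proof. exact: lin_sub (mf_lin f). Qed.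

Lemma pack_hd (p q r : nat) (C : cx) k y b1 b2 a ab ba bb bab :
  hd k (@pack p q r C y b1 b2 a ab ba bb bab) <->
  hd k y /\ hd (k + 1) b1 /\ hd (k + 1) b2 /\ hd (k + 1) a /\ hd (k + 2) ab /\
    hd (k + 2) ba /\ hd (k + 2) bb /\ hd (k + 3) bab.
Proof.
move: b1 b2 a ab ba bb bab => [b1 b1'] [b2 b2'] [a a'] [[e1 e2] [e3 e4]]
  [[f1 f2] [f3 f4]] [[g1 g2] [g3 g4]] [[[h1 h2] [h3 h4]] [[h5 h6] [h7 h8]]].
have e2' : k + 0 + 1 + 0 + 1 = k + 2 by lia.
have e3' : k + 0 + 1 + 0 + 1 + 0 + 1 = k + 3 by lia.
have e1' : k + 0 + 1 = k + 1 by lia.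
by rewrite /= e3' e2' e1'; tauto.
Qed.

Section ReidemeisterThree.
Variables (p q r : nat) (C : cx).
Hypotheses (pq : p != q) (pr : p != r) (qr : q != r).
Hypotheses (rq : r != q) (rp : r != p) (qp : q != p).
Local Notation Ba := (bB p q).
Local Notation Bb := (bB r q).
Local Notation Fa := (@bBm p q _ _ _).
Local Notation Fb := (@bBm r q _ _ _).
Local Notation ma D := (mB p q D).
Local Notation mb D := (mB r q D).
Local Notation pi := (piB C pq pr qr).
Local Notation io := (ioB C pq pr qr).
Local Notation u := (uB C pq pr qr).
Local Notation u' := (uB C rq rp qp).
Local Notation rb := (rB C rq).
Local Notation jb := (jB C rq).

Lemma uBB z : u' (u z) = z - io (pi z).
Proof.
by move: z => [[[a1 a2] [a3 a4]] [[a5 a6] [a7 a8]]]; pcx C.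
Qed.
Lemma pi_uB z : piB C rq rp qp (u z) = 0.
Proof.
by move: z => [[[a1 a2] [a3 a4]] [[a5 a6] [a7 a8]]]; pcx C.
Qed.
Lemma piE z : pi z = rb (Fb (ma (Bb C)) z).
Proof.
by move: z => [[[a1 a2] [a3 a4]] [[a5 a6] [a7 a8]]]; pcx C.
Qed.
Lemma piE' z : piB C rq rp qp z = rB C pq (Fa (mb (Ba C)) z).
Proof.
by move: z => [[[a1 a2] [a3 a4]] [[a5 a6] [a7 a8]]]; pcx C.
Qed.
Lemma mu_io z : mb (Bb C) z - Fb (mb C) z =
  ma (Bb C) (mb (Ba (Bb C)) (io (rb z))) -
  Fb (ma C) (Fb (Fa (mb C)) (io (rb z))).
Proof. by move: z => [[x y] [z w]]; pcx C. Qed.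

Opaque mB jB rB sB piB ioB uB bBm.

(** In T_b T_a T_b, the summand B_b of B_b B_a B_b cancels one copy of B_b in B_b B_b, and the other
    copy cancels one of the two terms B_b. Six terms remain, symmetric in a and b. The map projects
    to them and includes them into the other triple product; n is the correction term of the first
    cancellation. *)
Definition r3f (w : tT r q (tT p q (tT r q C))) : tT p q (tT r q (tT p q C)) :=
  let bb := (w.2.1.1.2, w.2.2.1.2) : Bb (Bb C) in
  let n := io (rb bb) in
  let ba := ((w.2.1.2.1.1, w.2.1.2.2.1), (w.2.2.2.1.1, w.2.2.2.2.1)) : Bb (Ba C) in
  let ab := (w.1.2.1.2, w.1.2.2.2) : Ba (Bb C) in
  let bab := ((w.2.1.2.1.2, w.2.1.2.2.2), (w.2.2.2.1.2, w.2.2.2.2.2)) : Bb (Ba (Bb C)) in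
  let x := ba + Fb (Fa (mb C)) n in
  pack w.1.1.1 0 (w.1.2.1.1, w.1.2.2.1) (w.1.1.2 + (w.2.1.1.1, w.2.2.1.1))
    x (ab + mb (Ba (Bb C)) n) (- jB C pq (mb (Ba C) x)) (u bab).

Lemma r3fE y b1 b2 a ab ba bb bab : r3f (pack y b1 b2 a ab ba bb bab) =
  let n := io (rb bb) in
  let x := ba + Fb (Fa (mb C)) n in
  pack y 0 a (b1 + b2) x (ab + mb (Ba (Bb C)) n) (- jB C pq (mb (Ba C) x)) (u bab).
Proof.
move: b1 b2 a ab ba bb bab => [b1 b1'] [b2 b2'] [a a'] [[e1 e2] [e3 e4]]
  [[f1 f2] [f3 f4]] [[g1 g2] [g3 g4]] [[[h1 h2] [h3 h4]] [[h5 h6] [h7 h8]]].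
by [].
Qed.

Lemma packD (p' q' r' : nat) y b1 b2 a ab ba bb bab y' b1' b2' a' ab' ba' bb' bab' :
  @pack p' q' r' C y b1 b2 a ab ba bb bab + pack y' b1' b2' a' ab' ba' bb' bab' =
  pack (y + y') (b1 + b1') (b2 + b2') (a + a') (ab + ab') (ba + ba') (bb + bb') (bab + bab').
Proof. by []. Qed.
Lemma packN (p' q' r' : nat) y b1 b2 a ab ba bb bab :
  - @pack p' q' r' C y b1 b2 a ab ba bb bab =
  pack (- y) (- b1) (- b2) (- a) (- ab) (- ba) (- bb) (- bab).
Proof. by []. Qed.

Lemma mb_nat (D E : cx) s (f : cmor s D E) z : mb E (Fb f z) = f (mb D z).
Proof. exact: (mB_nat z (lin_mf f)). Qed.
Lemma ma_nat (D E : cx) s (f : cmor s D E) z : ma E (Fa f z) = f (ma D z).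
Proof. exact: (mB_nat z (lin_mf f)). Qed.

Program Definition r3 : cmor 0 (tT r q (tT p q (tT r q C))) (tT p q (tT r q (tT p q C))) :=
  @Cmor _ _ _ r3f _ _ _ _.
Next Obligation.
elim/packP => y b1 b2 a ab ba bb bab; elim/packP => y' b1' b2' a' ab' ba' bb' bab'.
rewrite packD !r3fE; cbv zeta; rewrite packD; congr pack; rewrite ?(mfD, mfN); zlin.
Qed.
Next Obligation.
move=> t j; elim/packP => y b1 b2 a ab ba bb bab.
rewrite (pack_op pq pr qr) !r3fE; cbv zeta; rewrite (pack_op rq rp qp).
rewrite !(opD, mfop, additive_fun0 (opD _ _), additive_funN (opD _ _), mfD).
by [].
Qed.
Next Obligation.
elim/packP => y b1 b2 a ab ba bb bab.
rewrite (pack_dd pq pr qr) !r3fE; cbv zeta; rewrite (pack_dd rq rp qp).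
congr pack; mpush.
- zlin.
- by rewrite mB_jB mB_jB; zlin.
- rewrite 2!FmB_jB mb_nat; zlin.
- have := mu_io bb; mpush => e; zlin e.
- have := uB2b pq pr qr bab; mpush; rewrite piE => e; zlin e.
- have := uB2a pq pr qr bab; mpush; rewrite piE => e; zlin e.
- have -> : Fa (mb (Ba C)) (u bab) = jB C pq (mb _ (ma (Bb (Ba C)) (u bab))).
    rewrite [LHS](sr_jm pq) ma_nat -[RHS]add0r; congr (_ + _).
    by have := pi_uB bab; rewrite piE' => ->; mpush.
  have := f_equal (fun z => jB C pq (mb _ z)) (uB2b pq pr qr bab); mpush.
  rewrite piE => e; zlin e.
- by [].
Qed.
Next Obligation.
move=> k; elim/packP => y b1 b2 a ab ba bb bab.
rewrite addr0 r3fE => /pack_hd [hy [hb1 [hb2 [ha [hab [hba [hbb hbab]]]]]]]; apply/pack_hd.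
have hn k' (z : Bb C) : hd k' z -> hd k' (io z) by exact: mfhd0.
have hn' : hd (k + 2) (io (rb bb)) by apply: hn; apply: (@mfhd0 _ _ (rb)).
have hx : hd (k + 2) (ba + Fb (Fa (mb C)) (io (rb bb))).
  by apply: hdD => //; apply: (@mfhd0 _ _ (Fb (Fa (mb C)))).
split; first exact: hy.
split; first exact: hd0.
split; first exact: ha.
split; first exact: hdD hb1 hb2.
split; first exact: hx.
split; first exact: hdD hab (mfhd0 (mb (Ba (Bb C))) hn').
split; first exact: hdN (mfhd0 (jB C pq) (mfhd0 (mb (Ba C)) hx)).
exact: (mfhd0 u hbab).
Qed.

Lemma r3E y b1 b2 a ab ba bb bab : r3 (pack y b1 b2 a ab ba bb bab) =
  pack y 0 a (b1 + b2) (ba + Fb (Fa (mb C)) (io (rb bb)))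
    (ab + mb (Ba (Bb C)) (io (rb bb)))
    (- jB C pq (mb (Ba C) (ba + Fb (Fa (mb C)) (io (rb bb))))) (u bab).
Proof. exact: r3fE. Qed.

End ReidemeisterThree.

Section R3Inverse.
Variables (p q r : nat) (C : cx).
Hypotheses (pq : p != q) (pr : p != r) (qr : q != r).
Hypotheses (rq : r != q) (rp : r != p) (qp : q != p).
Local Notation Ba := (bB p q).
Local Notation Bb := (bB r q).
Local Notation Fa := (@bBm p q _ _ _).
Local Notation Fb := (@bBm r q _ _ _).
Local Notation ma D := (mB p q D).
Local Notation mb D := (mB r q D).
Local Notation io := (ioB C pq pr qr).
Local Notation rb := (rB C rq).
Local Notation jb := (jB C rq).

(** The two entries invert the two maps cancelled by the elimination. *)
Definition r3H (w : tT r q (tT p q (tT r q C))) : tT r q (tT p q (tT r q C)) :=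
  pack 0 0 0 0 0 0 (jb w.1.1.2) (- io (rb (w.2.1.1.2, w.2.2.1.2))).

Lemma r3HE y b1 b2 a ab ba bb bab : r3H (pack y b1 b2 a ab ba bb bab) =
  pack 0 0 0 0 0 0 (jb b1) (- io (rb bb)).
Proof. by case: bb. Qed.

Lemma retr_r3 : retr (tT r q (tT p q (tT r q C))) (tT p q (tT r q (tT p q C))).
Proof.
exists (r3 C pq pr qr rq rp qp), (r3 C rq rp qp pq pr qr), r3H; split.
- split.
    elim/packP => y b1 b2 a ab ba bb bab; elim/packP => y' b1' b2' a' ab' ba' bb' bab'.
    by rewrite packD !r3HE packD; congr pack; mpush; zlin.
  move=> t j; elim/packP => y b1 b2 a ab ba bb bab _.
  rewrite (pack_op pq pr qr) !r3HE (pack_op pq pr qr) !mfop.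
  by rewrite !(additive_fun0 (opD _ _)) (additive_funN (opD _ _)).
- move=> k; elim/packP => y b1 b2 a ab ba bb bab.
  rewrite r3HE => /pack_hd [hy [hb1 [hb2 [ha [hab [hba [hbb hbab]]]]]]]; apply/pack_hd.
  do 6![split; first exact: hd0]; split.
    by apply: (@mfhd0 _ _ (jb)); apply: hdE hb1 _; lia.
  apply: hdN; apply: (@mfhd0 _ _ (io)).
  by apply: (@mfhd0 _ _ (rb)); apply: hdE hbb _; lia.
- elim/packP => y b1 b2 a ab ba bb bab.
  rewrite 2!r3E uBB (pack_dd pq pr qr y) 2!r3HE (pack_dd pq pr qr) !packN !packD; congr pack; mpush.
  + zlin.
  + rewrite mB_jB; zlin.
  + rewrite FmB_jB; zlin.
  + zlin.
  + rewrite rB_jB; mpush; zlin.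
  + rewrite rB_jB; mpush; zlin.
  + rewrite rB_jB; mpush.
    have e1 := sr_jm rq bb.
    have := sr_jm rq (Fb (ma (Bb C)) (io (rb bb))).
    rewrite -piE piioB mb_nat => e2.
    zlin e1 e2.
  + rewrite piE; zlin.
Qed.
End R3Inverse.

Lemma heq_r3 p q r C : p != q -> p != r -> q != r ->
  heq (tT r q (tT p q (tT r q C))) (tT p q (tT r q (tT p q C))).
Proof.
move=> pq pr qr; have [qp rp rq] : [/\ q != p, r != p & r != q].
  by rewrite eq_sym pq eq_sym pr eq_sym qr.
by split; [exact: (retr_r3 C pq pr qr rq rp qp) | exact: (retr_r3 C rq rp qp pq pr qr)].
Qed.

Opaque mB jB rB sB piB ioB uB bBm.

Section Slide.
Variables (p q r : nat) (M : cx).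
Hypotheses (pq : p != q) (pr : p != r) (qr : q != r).
Hypotheses (rq : r != q) (rp : r != p) (qp : q != p).
Local Notation Ba := (bB p q).
Local Notation Bb := (bB r q).
Local Notation Fb := (@bBm r q _ _ _).
Local Notation ma D := (mB p q D).
Local Notation mb D := (mB r q D).
Local Notation io := (ioB M pq pr qr).
Local Notation u := (uB M pq pr qr).
Local Notation u' := (uB M rq rp qp).
Local Notation rb := (rB M rq).
Local Notation jb := (jB M rq).
Local Notation W := (sh 1 (cone (ccomp (mb (Ba (Bb M))) u'))).
Local Notation X := (tT r q (tT p q (Bb M))).

Ltac lab j := bsplit j p; [|bsplit j q; [|bsplit j r]].

Definition spack (n : Bb M) (a : Ba (Bb M)) (bn : Bb (Bb M)) (ba : Bb (Ba (Bb M))) : X :=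
  ((n, a), ((bn.1, ba.1), (bn.2, ba.2))).

Lemma spackP (P : X -> Prop) : (forall n a bn ba, P (spack n a bn ba)) -> forall w, P w.
Proof.
by move=> h [[n a] [[b1 c1] [b2 c2]]]; exact: (h n a (b1, b2) (c1, c2)).
Qed.
Lemma spack_op t j n a bn ba : op t j (spack n a bn ba) =
  spack (op t j n) (op t j a) (op t j bn) (op t j ba).
Proof.
move: n a bn ba => [x1 x2] [[a1 a2] [a3 a4]] [[b1 b2] [b3 b4]]
  [[[h1 h2] [h3 h4]] [[h5 h6] [h7 h8]]].
by rewrite /spack; oplin M t j lab.
Qed.
Lemma spack_dd n a bn ba : dd (spack n a bn ba) =
  spack (dd n + ma _ a + mb _ bn) (- dd a + mb _ ba) (- dd bn - Fb (ma (Bb M)) ba) (dd ba).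
Proof.
move: n a bn ba => [x1 x2] [[a1 a2] [a3 a4]] [[b1 b2] [b3 b4]]
  [[[h1 h2] [h3 h4]] [[h5 h6] [h7 h8]]].
rewrite /spack; bop.
Transparent mB bBm. rewrite /=; bop.
by pcx M.
Qed.
Opaque mB bBm.
Lemma spackD n a bn ba n' a' bn' ba' : spack n a bn ba + spack n' a' bn' ba' =
  spack (n + n') (a + a') (bn + bn') (ba + ba').
Proof. by []. Qed.
Lemma spackN n a bn ba : - spack n a bn ba = spack (- n) (- a) (- bn) (- ba).
Proof. by []. Qed.
Lemma spack_hd k n a bn ba : hd k (spack n a bn ba) <->
  hd k n /\ hd (k + 1) a /\ hd (k + 1) bn /\ hd (k + 2) ba.
Proof.
have e2' : k + 0 + 1 + 0 + 1 = k + 2 by clear; lia.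
have e1' : k + 0 + 1 = k + 1 by clear; lia.
by case: bn ba => [b1 b2] [c1 c2]; rewrite /= e2' e1'; tauto.
Qed.

Definition wpair (x : Ba (Bb M)) (w : Ba (Bb (Ba M))) : W := (x, w).
Lemma wpairP (P : W -> Prop) : (forall x w, P (wpair x w)) -> forall z, P z.
Proof. by move=> h [x w]; exact: h. Qed.
Lemma wpairD x w x' w' : wpair x w + wpair x' w' = wpair (x + x') (w + w').
Proof. by []. Qed.
Lemma wpair_op t j x w : op t j (wpair x w) = wpair (op t j x) (op t j w).
Proof. by []. Qed.
Lemma wpair_dd x w : dd (wpair x w) = wpair (- dd x - mb _ (u' w)) (dd w).
Proof.
apply: (@pairE (Ba (Bb M)) (Ba (Bb (Ba M)))); first exact: opprD.
exact: opprK.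
Qed.
Lemma wpair_hd k x w : hd k (wpair x w) <-> hd (k + 1) x /\ hd (k + 2) w.
Proof.
have e : k + 1 + (0 + 0) + 1 = k + 2 by clear; lia.
by rewrite /= e.
Qed.

Definition slf_f (w : X) : W :=
  wpair (w.1.2 + mb (Ba (Bb M)) (io (rb (w.2.1.1, w.2.2.1)))) (- u (w.2.1.2, w.2.2.2)).
Lemma slf_fE n a bn ba : slf_f (spack n a bn ba) =
  wpair (a + mb (Ba (Bb M)) (io (rb bn))) (- u ba).
Proof. by case: bn ba => [? ?] [? ?]. Qed.

Program Definition slf : cmor 0 X W := @Cmor 0 X W slf_f _ _ _ _.
Next Obligation.
elim/spackP => n a bn ba; elim/spackP => n' a' bn' ba'.
by rewrite spackD !slf_fE wpairD; congr wpair; mpush; zlin.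
Qed.
Next Obligation.
move=> t j; elim/spackP => n a bn ba.
rewrite spack_op !slf_fE wpair_op; congr wpair.
  by rewrite opD !mfop.
by rewrite mfop (additive_funN (opD _ _)).
Qed.
Next Obligation.
elim/spackP => n a bn ba; rewrite spack_dd !slf_fE wpair_dd; congr wpair; mpush.
- have := uB2a pq pr qr ba; have := uBB pq pr qr rq rp qp ba => -> _.
  rewrite -piE; mpush; zlin.
- zlin.
Qed.
Next Obligation.
move=> k; elim/spackP => n a bn ba; rewrite addr0 slf_fE.
move=> /spack_hd [hn [ha [hbn hba]]]; apply/wpair_hd; split.
  exact: hdD ha (mfhd0 (mb (Ba (Bb M))) (mfhd0 io (mfhd0 rb hbn))).
exact: hdN (mfhd0 u hba).
Qed.

Definition slg_f (z : W) : X :=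
  spack 0 z.1 (- jb (ma (Bb M) z.1)) (- u' z.2).
Lemma slg_fE x w : slg_f (wpair x w) = spack 0 x (- jb (ma (Bb M) x)) (- u' w).
Proof. by []. Qed.

Lemma Fmu w : Fb (ma (Bb M)) (u' w) = jb (ma (Bb M) (mb _ (u' w))).
Proof.
rewrite [LHS](sr_jm rq) mb_nat -[RHS]add0r; congr (_ + _).
by have := pi_uB rq rp qp pq pr qr w; rewrite (@piE p q r M pq pr qr rq) => ->; mpush.
Qed.

Program Definition slg : cmor 0 W X := @Cmor 0 W X slg_f _ _ _ _.
Next Obligation.
elim/wpairP => x w; elim/wpairP => x' w'.
by rewrite wpairD !slg_fE spackD; congr spack; mpush; zlin.
Qed.
Next Obligation.
move=> t j; elim/wpairP => x w; rewrite wpair_op !slg_fE spack_op !mfop.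
by rewrite (additive_fun0 (opD _ _)) !(additive_funN (opD _ _)).
Qed.
Next Obligation.
elim/wpairP => x w; rewrite wpair_dd !slg_fE spack_dd; congr spack; mpush.
- by rewrite mB_jB; zlin.
- zlin.
- rewrite Fmu; zlin.
- zlin.
Qed.
Next Obligation.
move=> k; elim/wpairP => x w h0; have := hdE h0 (addr0 k); rewrite slg_fE => /wpair_hd [hx hw].
apply/spack_hd; split; first exact: hd0.
split; first exact: hx.
split; first exact: hdN (mfhd0 jb (mfhd0 (ma (Bb M)) hx)).
exact: hdN (mfhd0 u' hw).
Qed.

Definition slH (w : X) : X := spack 0 0 (jb w.1.1) (- io (rb (w.2.1.1, w.2.2.1))).
Lemma slHE n a bn ba : slH (spack n a bn ba) = spack 0 0 (jb n) (- io (rb bn)).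
Proof. by case: bn. Qed.

(** The elimination used for the third Reidemeister move reduces T_b T_a B_b to B_a B_b and the
    common summand of B_b B_a B_b and B_a B_b B_a. Completing the latter to all of B_a B_b B_a gives
    a complex whose terms all begin with B_a, so whatever kills B_a on its right also kills T_b T_a
    B_b. *)
Lemma retr_slide : retr X W.
Proof.
exists slf, slg, slH; split.
- split.
    elim/spackP => n a bn ba; elim/spackP => n' a' bn' ba'.
    by rewrite spackD !slHE spackD; congr spack; mpush; zlin.
  move=> t j; elim/spackP => n a bn ba _; rewrite spack_op !slHE spack_op !mfop.
  by rewrite !(additive_fun0 (opD _ _)) (additive_funN (opD _ _)).
- move=> k; elim/spackP => n a bn ba; rewrite slHE => /spack_hd [hn [ha [hbn hba]]].
  apply/spack_hd; split; first exact: hd0.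
  split; first exact: hd0.
  split; first exact: (mfhd0 jb hn).
  apply: hdN; apply: (mfhd0 io); apply: (mfhd0 rb); apply: hdE hbn _; clear; lia.
- elim/spackP => n a bn ba.
  rewrite -[slg _]/(slg_f _) -[slf _]/(slf_f _) slf_fE slg_fE.
  rewrite slHE !spack_dd slHE !spackN !spackD; congr spack; mpush.
  + rewrite mB_jB; zlin.
  + zlin.
  + have e1 := sr_jm rq bn.
    have := sr_jm rq (Fb (ma (Bb M)) (io (rb bn))).
    rewrite -piE piioB mb_nat => e2; zlin e1 e2.
  + rewrite uBB piE; mpush; zlin.
Qed.
End Slide.
Transparent mB jB rB sB piB ioB uB bBm.

(** * Positive words, absorption, and finite approximations of projectors *)

Definition T (i : nat) : letter := (true, (i, i.+1)).
Definition Bl (i : nat) : letter := (false, (i, i.+1)).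
Definition tw (v : seq nat) : seq letter := map T v.

Lemma tw_cat v v' : tw (v ++ v') = tw v ++ tw v'.
Proof. exact: map_cat. Qed.

Definition far i j := (i.+1 < j)%N || (j.+1 < i)%N.
Definition adj i j := (j == i.+1) || (i == j.+1).

Lemma far_sym i j : far i j = far j i. Proof. exact: orbC. Qed.
Lemma adj_sym i j : adj i j = adj j i. Proof. exact: orbC. Qed.

Lemma weq_far s s' i j : far i j ->
  weq [:: (s, (i, i.+1)); (s', (j, j.+1))] [:: (s', (j, j.+1)); (s, (i, i.+1))].
Proof. by move=> ij C; apply: heq_far => /=; move: ij; rewrite /far; lia. Qed.

Lemma weq_swap s a b : a != b -> weq [:: (s, (a, b))] [:: (s, (b, a))].
Proof. by move=> ab C; case: s; [exact: heq_swapT | exact: heq_swapB]. Qed.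

Lemma weq1 l l' : weq [:: l] [:: l'] -> forall w w', weq w w' -> weq (l :: w) (l' :: w').
Proof. by move=> h w w' h'; exact: (weq_cat h h'). Qed.

Lemma weq_braid1 i : weq [:: T i; T i.+1; T i] [:: T i.+1; T i; T i.+1].
Proof.
have h1 : weq [:: T i.+1] [:: (true, (i.+2, i.+1))] by apply: weq_swap; lia.
have h2 : weq [:: (true, (i.+2, i.+1))] [:: T i.+1] by exact: weq_sym.
have e : weq [:: (true, (i.+2, i.+1)); T i; (true, (i.+2, i.+1))]
    [:: T i; (true, (i.+2, i.+1)); T i].
  by move=> C; apply: (@heq_r3 i i.+1 i.+2); lia.
apply: weq_trans (weq_trans (weq_sym e) _).
  by apply: weq1; [exact: weq_refl | apply: (weq1 h1); exact: weq_refl].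
by apply: (weq1 h2); apply: weq1; [exact: weq_refl | exact: h2].
Qed.

Definition bnded (C : cx) := forall k (x : C), 0 < k -> hd k x -> x = 0.

Lemma bnded_lapp (l : letter) (C : cx) : bnded C -> bnded (lapp l C).
Proof.
move=> h; case: l => [[] [a b]] k x k0 /=.
  case: x => [x [y z]] /= [h1 [h2 h3]].
  by rewrite (h _ _ k0 h1) (h _ _ _ h2) ?(h _ _ _ h3) //; lia.
case: x => [y z] /= [h2 h3].
by rewrite (h _ _ _ h2) ?(h _ _ _ h3) //; lia.
Qed.
Lemma bnded_capp (A : seq letter) (C : cx) : bnded C -> bnded (capp A C).
Proof. by move=> h; elim: A => [//|l A ih]; exact: bnded_lapp. Qed.

Lemma bnded_nul C : bnded C -> nul 0 C.
Proof.
move=> h A L k k0 z [hz _ _]; suff -> : z = 0 by exact: bnd0.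
have := bnded_capp (A := A) h; move: (capp A C) z hz => D z hz hD.
elim: L z hz => [|c L ih] /= z; first exact: hD.
by case: z => x y /= [/ih -> /ih ->].
Qed.

Lemma nul_T n G i Y : nul n (capp G Y) -> nul (n + 1) (capp (rcons G (Bl i)) Y) ->
  nul n (capp (rcons G (T i)) Y).
Proof.
move=> h1 h2; rewrite -cats1 capp_cat.
apply/(nul_heq _ (capp_cone G (mB i i.+1 Y))); apply: nul_cone => //.
by rewrite addr0; move: h2; rewrite -cats1 capp_cat.
Qed.

(** A crossing differs from the identity only by its term B, which G kills in the degrees
    concerned. *)
Lemma van_absorb L n k A G a b Y : n < k -> nul n (capp G (bB a b Y)) ->
  van L k (capp (A ++ G) (tT a b Y)) <-> van L k (capp (A ++ G) Y).
Proof.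
move=> nk h; split=> hv.
  apply: (@vb_bcone_left _ _ _ (kosbm L (capm (A ++ G) (mB a b Y)))).
    by apply/van_capp_cone.
  by rewrite addr0 /= capp_cat; exact: h.
apply/(van_capp_cone _ _ _ (mB a b Y)); apply: bcone_mid => //.
by rewrite /= capp_cat; apply: h; lia.
Qed.

Definition rg n (G : seq letter) i := forall Y, bnded Y -> nul n (capp (G ++ [:: Bl i]) Y).
Definition lg n (G : seq letter) i := forall Y, bnded Y -> nul n (capp (Bl i :: G) Y).
(* A word in the crossings [ts] approximating a projector killed by the       *)
(* corresponding bimodules on both sides.                                     *)
Definition good n (v ts : seq nat) := {subset v <= ts} /\
  forall i, i \in ts -> rg n (tw v) i /\ lg n (tw v) i.

Lemma rg_cat n A G i : rg n G i -> rg n (A ++ G) i.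
Proof. by move=> h Y bY; rewrite -catA capp_cat; apply: nul_capp; exact: h. Qed.
Lemma lg_cat n A G i : lg n G i -> lg n (G ++ A) i.
Proof. by move=> h Y bY; rewrite -cat_cons capp_cat; apply: h; exact: bnded_capp. Qed.

Lemma abs_r n L k A G v Z : n < k -> bnded Z -> (forall j, j \in v -> rg n G j) ->
  van L k (capp (A ++ G ++ tw v) Z) <-> van L k (capp (A ++ G) Z).
Proof.
move=> nk bZ; rewrite catA capp_cat; elim: v => [//|j v ih] h.
rewrite -ih => [|i iv]; last by apply: h; rewrite inE iv orbT.
apply: (@van_absorb L n k A G j j.+1 (capp (tw v) Z)) => //.
have := h j (mem_head _ _) _ (bnded_capp (A := tw v) bZ).
by rewrite capp_cat.
Qed.

Lemma abs_l n L k A G v Z : n < k -> bnded Z -> (forall j, j \in v -> lg n G j) ->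
  van L k (capp (A ++ tw v ++ G) Z) <-> van L k (capp (A ++ G) Z).
Proof.
move=> nk bZ; elim: v A => [//|j v ih] A h.
rewrite -[A ++ _]/(A ++ T j :: (tw v ++ G)) -cat_rcons ih; last first.
  by move=> i iv; apply: h; rewrite inE iv orbT.
rewrite cat_rcons !capp_cat; rewrite -[A]cats0.
apply: (@van_absorb L n k A [::]) => //.
by apply: h => //; exact: mem_head.
Qed.

(** In A v v' the word v absorbs v' on its right, and v' absorbs v on its left. Both A v and A v'
    are thus compared with A v v'. *)
Lemma good_change n L k A v v' ts Z : n < k -> bnded Z ->
  good n v ts -> good n v' ts ->
  van L k (capp (A ++ tw v) Z) <-> van L k (capp (A ++ tw v') Z).
Proof.
move=> nk bZ [s g] [s' g']; rewrite -(@abs_r n L k A (tw v) v') //; last first.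
  by move=> j /s' /g [].
by rewrite (@abs_l n) // => j /s /g' [].
Qed.

Lemma expand_l n G v Z : bnded Z ->
  (forall j Y, j \in v -> bnded Y -> nul (n + 1) (capp (rcons G (Bl j)) Y)) ->
  nul n (capp G Z) -> nul n (capp (G ++ tw v) Z).
Proof.
move=> bZ + hZ; elim: v => [|j v ih] h; first by rewrite cats0.
rewrite -[G ++ _]/(G ++ T j :: tw v) -cat_rcons capp_cat; apply: nul_T.
  by rewrite -capp_cat; apply: ih => i Y iv; apply: h; rewrite inE iv orbT.
by apply: h; [rewrite inE eqxx | exact: bnded_capp].
Qed.

Lemma expand_r n A v Z : (forall j, j \in v -> nul (n + 1) (capp [:: Bl j] Z)) ->
  nul n (capp A Z) -> nul n (capp (A ++ tw v) Z).
Proof.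
move=> + hZ; elim/last_ind: v => [|v j ih] h; first by rewrite cats0.
rewrite /tw map_rcons -rcons_cat; apply: nul_T.
  by apply: ih => i iv; apply: h; rewrite mem_rcons inE iv orbT.
rewrite -cats1 capp_cat; apply: nul_capp; apply: h.
by rewrite mem_rcons inE eqxx.
Qed.

(** The word v t v t ... t v with r + 1 copies of v. *)
Fixpoint gpow v t r : seq nat := if r is r'.+1 then gpow v t r' ++ t :: v else v.
Lemma gpow_alt v t r : gpow v t r.+1 = v ++ t :: gpow v t r.
Proof. by elim: r => [//|r ih]; rewrite [LHS]/= -/(gpow v t r.+1) {1}ih /= -catA. Qed.

Lemma gpowP v t r : exists A, gpow v t r = A ++ v.
Proof.
case: r => [|r]; first by exists [::].
by exists (gpow v t r ++ [:: t]); rewrite /= -catA.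
Qed.
Lemma gpowP' v t r : exists A, gpow v t r = v ++ A.
Proof.
case: r => [|r]; first by exists [::]; rewrite cats0.
by exists (t :: gpow v t r); rewrite gpow_alt.
Qed.

Lemma retr_nul1 n A C D : retr C (sh 1 D) -> nul (n + 1) (capp A D) -> nul n (capp A C).
Proof.
move=> h hD; apply: nul_retr (retr_capp A h) _.
by apply/(nul_heq _ (capp_sh A 1 D))/nul_sh.
Qed.

(** Each further t v gains one degree. Expanding the last v into identities and terms B_j, a term
    with B_j follows T_t: in the identity part of T_t the preceding v kills B_j, in the part B_t the
    induction hypothesis applies. What remains is T_t B_t, a retract of B_t shifted by one. *)
Lemma gpow_rg n0 v ts t r (n := - r%:Z) : good n0 v ts -> n0 <= n ->
  rg n (tw (gpow v t r)) t.
Proof.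
rewrite {}/n => -[sv g]; elim: r => [|r ih] h Y bY.
  by apply: bnded_nul; exact: bnded_capp.
have {}ih : rg (- r%:Z) (tw (gpow v t r)) t by apply: ih; lia.
rewrite /= tw_cat -[tw (t :: v)]/([:: T t] ++ tw v) catA -catA.
rewrite catA capp_cat; apply: expand_l; first exact: bnded_capp.
- move=> j Z jv bZ; have [A eA] := gpowP v t r.
  have nB Y' : bnded Y' -> nul (- r%:Z) (capp (tw (gpow v t r)) (capp [:: Bl j] Y')).
    move=> bY'; rewrite -capp_cat; have [h1 _] := g _ (sv _ jv).
    by apply: (@nul_le n0); [lia | rewrite eA tw_cat; apply: rg_cat].
  rewrite -cats1 capp_cat cats1; apply: nul_T.
    by apply: nul_le (nB _ bZ); lia.
  rewrite -cats1 capp_cat; have := ih _ (bnded_lapp (l := Bl j) bZ).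
  by rewrite capp_cat; apply: nul_le; lia.
- have -> : capp (tw (gpow v t r) ++ [:: T t]) (capp [:: Bl t] Y) =
    capp (tw (gpow v t r)) (tT t t.+1 (bB t t.+1 Y)) by rewrite capp_cat.
  apply: (retr_nul1 (D := bB t t.+1 Y)); first by apply: retr_TB; lia.
  have := ih Y bY; rewrite capp_cat; apply: nul_le; lia.
Qed.

Lemma gpow_lg n0 v ts t r (n := - r%:Z) : good n0 v ts -> n0 <= n ->
  lg n (tw (gpow v t r)) t.
Proof.
rewrite {}/n => -[sv g]; elim: r => [|r ih] h Y bY.
  by apply: bnded_nul; exact: (bnded_capp (A := _ :: _)).
have {}ih : lg (- r%:Z) (tw (gpow v t r)) t by apply: ih; lia.
rewrite gpow_alt tw_cat -cat_cons capp_cat -cat1s.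
set Z := capp (tw (gpow v t r)) Y.
have bZ : bnded Z by exact: bnded_capp.
have nt : nul (- r%:Z) (capp [:: Bl t] Z) by exact: ih bY.
have e : capp (tw (t :: gpow v t r)) Y = tT t t.+1 Z by [].
rewrite e; apply: expand_r.
- move=> j jv; have [A eA] := gpowP' v t r.
  have [_ hl] := g _ (sv _ jv).
  rewrite -[capp _ _]/(capp (rcons [:: Bl j] (T t)) Z); apply: nul_T.
    rewrite /Z eA tw_cat; apply: (@nul_le n0); first lia.
    exact: (lg_cat hl bY).
  rewrite -cats1 capp_cat; apply: nul_capp; apply: nul_le nt; lia.
- apply: (@retr_nul1 _ [::] _ (bB t t.+1 Z)); first by apply: retr_BT; lia.
  by apply: nul_le nt; lia.
Qed.

Lemma good_gpow n v t ts : good (- `|n|%:Z) v ts -> good n (gpow v t `|n|%N) (t :: ts).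
Proof.
move=> [sv g]; have hn : - `|n|%N%:Z <= n by lia.
have [A eA] := gpowP v t `|n|%N; have [A' eA'] := gpowP' v t `|n|%N.
split=> [j|j].
  elim: `|n|%N => [/sv|r ihr /=]; first by rewrite inE orbC => ->.
  by rewrite mem_cat !inE => /or3P[/ihr||/sv ->]; rewrite ?inE ?orbT // => ->.
rewrite inE => /orP[/eqP -> | jt].
  split=> Y bY; apply: (nul_le hn).
    exact: (gpow_rg (conj sv g)).
  exact: (gpow_lg (conj sv g)).
have [hr hl] := g j jt; split=> Y bY; apply: (nul_le hn).
  by rewrite eA tw_cat; apply: rg_cat.
by rewrite eA' tw_cat; apply: lg_cat.
Qed.

Lemma good_exists ts n : exists v, good n v ts.
Proof.
elim: ts n => [|t ts ih] n; first by exists [::]; split.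
by have [v /good_gpow gv] := ih (- `|n|%:Z); exists (gpow v t `|n|%N).
Qed.

(** By [retr_slide] all terms of a complex containing T_j T_i B_j as a retract begin with B_i. The
    inner statement fixes one orientation of the three strands; both cases of adjacency reduce to it
    by swapping the two strands of a letter. *)
Lemma nul_slide n G i j Y : adj i j -> bnded Y -> rg n G i ->
  nul n (capp (G ++ [:: T j; T i; Bl j]) Y).
Proof.
move=> ij bY h.
have key p q r : p != q -> p != r -> q != r -> weq [:: T j] [:: (true, (r, q))] ->
    weq [:: T i] [:: (true, (p, q))] -> weq [:: Bl j] [:: (false, (r, q))] ->
    weq [:: Bl i] [:: (false, (p, q))] ->
    nul n (capp (G ++ [:: T j; T i; Bl j]) Y).
  move=> pq pr qr wj wi bj bi.
  have qp : q != p by rewrite eq_sym.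
  have rp : r != p by rewrite eq_sym.
  have rq : r != q by rewrite eq_sym.
  have w : weq (G ++ [:: T j; T i; Bl j])
      (G ++ [:: (true, (r, q)); (true, (p, q)); (false, (r, q))]).
    by apply: weq_catl; apply: (weq1 wj); apply: (weq1 wi).
  have hk m Z : n <= m -> bnded Z -> nul m (capp G (bB p q Z)).
    move=> nm bZ; apply: (nul_le nm); have := h Z bZ; rewrite capp_cat.
    by move/(nul_heq _ (heq_capp G (bi Z))).
  apply/(nul_heq _ (w Y)); rewrite capp_cat.
  apply: nul_retr (retr_capp G (@retr_slide p q r Y pq pr qr rq rp qp)) _.
  apply/(nul_heq _ (capp_sh G 1 _))/nul_sh.
  apply/(nul_heq _ (capp_cone G _)); apply: nul_cone.
    by apply: hk; [lia | exact: (bnded_lapp (l := (false, (r, q))))].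
  apply: hk; first lia.
  exact: (bnded_lapp (l := (false, (r, q))) (bnded_lapp (l := (false, (p, q))) bY)).
case/orP: ij => /eqP e.
- rewrite e in key *; apply: (key i i.+1 i.+2); try lia; try exact: weq_refl;
    by apply: weq_swap; lia.
- rewrite e in key *; apply: (key j.+2 j.+1 j); try lia; try exact: weq_refl;
    by apply: weq_swap; lia.
Qed.

Lemma bfh0 (B B' : bic) (f : bmor 0 B B') k x : bh k x -> bh k (f x).
Proof. by move=> h; apply: bfh; rewrite addr0. Qed.

(** * Division by a locally nilpotent operator *)

Section Nilpotent.
Variables (R : zmodType) (D Y : R -> R).
Hypotheses (DD : additive_fun D) (YD : additive_fun Y).
Hypothesis DY : forall x, D (Y x) = Y (D x).
Hypothesis Dnil : forall x, exists N, iter N D x = 0.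

Definition nilN x := sval (cid (Dnil x)).
Definition dsum N x := \sum_(i < N) iter i Y (iter i.+1 D x).
(* The sum of Y ^ i D ^ (i + 1) over all i. *)
Definition divp x := dsum (nilN x) x.

Lemma iter_add (f : R -> R) n : additive_fun f -> additive_fun (iter n f).
Proof. by move=> fD; elim: n => [//|n ih] x y /=; rewrite ih fD. Qed.
Lemma iter0 (f : R -> R) n : additive_fun f -> iter n f 0 = 0.
Proof. by move=> fD; exact: additive_fun0 (iter_add n fD). Qed.

Lemma nil_le x N N' : iter N D x = 0 -> (N <= N')%N -> iter N' D x = 0.
Proof. by move=> h /subnK <-; rewrite iterD h iter0. Qed.

Lemma dsum_le x N N' : iter N D x = 0 -> (N <= N')%N -> dsum N' x = dsum N x.
Proof.
move=> h /subnK <-; elim: (N' - N)%N => [//|d ih].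
rewrite addSn /dsum big_ord_recr /= -/(dsum _ _) ih.
by rewrite [D _](@nil_le x N (d + N).+1) ?iter0 ?addr0 //; lia.
Qed.

Lemma divpE x N : iter N D x = 0 -> divp x = dsum N x.
Proof.
rewrite /divp /nilN; case: cid => M hM hN /=.
by rewrite -(dsum_le hM (leq_maxl M N)) -(dsum_le hN (leq_maxr M N)).
Qed.

Lemma nil2 x y : exists N, iter N D x = 0 /\ iter N D y = 0.
Proof.
have [N hN] := Dnil x; have [M hM] := Dnil y; exists (maxn N M).
by rewrite (nil_le hN (leq_maxl N M)) (nil_le hM (leq_maxr N M)).
Qed.

Lemma dsumD N : additive_fun (dsum N).
Proof.
move=> x y; rewrite /dsum -big_split; apply: eq_bigr => i _.
by rewrite (iter_add i.+1 DD) (iter_add i YD).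
Qed.

Lemma divpD : additive_fun divp.
Proof.
move=> x y; have [N [hx hy]] := nil2 x y.
rewrite (divpE hx) (divpE hy) (@divpE _ N) ?dsumD //.
by rewrite (iter_add N DD) hx hy addr0.
Qed.

Lemma iterC (f g : R -> R) n x : (forall x, f (g x) = g (f x)) ->
  iter n f (g x) = g (iter n f x).
Proof. by move=> h; elim: n => [//|n ih] /=; rewrite ih h. Qed.

(** With X a right inverse of D, [divp] divides by X - Y: since D^(i+1) (X x - Y x) = D^i x - Y
    D^(i+1) x, the sum telescopes to x. *)
Lemma divp_mul X : (forall x, D (X x) = x) -> forall x, divp (X x - Y x) = x.
Proof.
move=> DX x; have [N hN] := Dnil x.
have DB a b : D (a - b) = D a - D b by exact: additive_funB.
have e i : iter i.+1 D (X x - Y x) = iter i D x - Y (iter i.+1 D x).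
  by rewrite (iterSr i) DB DX DY (additive_funB (iter_add i DD)) iterC // -iterSr.
rewrite (@divpE _ N.+1); last first.
  by rewrite e hN /= hN (additive_fun0 DD) (additive_fun0 YD) subr0.
rewrite /dsum; transitivity (\sum_(i < N.+1) (iter i Y (iter i D x) -
    iter i.+1 Y (iter i.+1 D x))).
  apply: eq_bigr => i _; rewrite e (additive_funB (iter_add i YD)).
  by rewrite -(iterSr i Y).
rewrite -(big_mkord xpredT (fun i => iter i Y (iter i D x) - iter i.+1 Y (iter i.+1 D x))).
have -> : \sum_(0 <= i < N.+1) (iter i Y (iter i D x) - iter i.+1 Y (iter i.+1 D x)) =
   - \sum_(0 <= i < N.+1) (iter i.+1 Y (iter i.+1 D x) - iter i Y (iter i D x)).
  by rewrite -sumrN; apply: eq_bigr => i _; rewrite opprB.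
have hN1 : iter N.+1 D x = 0 by rewrite /= hN (additive_fun0 DD).
by rewrite telescope_sumr // hN1 (iter0 N.+1 YD) sub0r opprK.
Qed.

Lemma divp_comm f : additive_fun f -> (forall x, D (f x) = f (D x)) ->
  (forall x, Y (f x) = f (Y x)) -> forall x, divp (f x) = f (divp x).
Proof.
move=> fD Df Yf x; have [N hN] := Dnil x.
rewrite (divpE hN) (@divpE _ N); last by rewrite iterC // hN (additive_fun0 fD).
rewrite /dsum (additive_fun_sum fD); apply: eq_bigr => i _.
by rewrite (@iterC D f) // (@iterC Y f).
Qed.

Lemma divp_pred (Q : R -> Prop) : Q 0 -> (forall x y, Q x -> Q y -> Q (x + y)) ->
  (forall x, Q x -> Q (D x)) -> (forall x, Q x -> Q (Y x)) ->
  forall x, Q x -> Q (divp x).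
Proof.
move=> Q0 QD QDD QY x Qx; rewrite /divp /dsum; apply: big_ind => // i _.
elim: (nat_of_ord i) => [|j ih] /=; first exact: QDD.
have Qi M : Q (iter M D x) by elim: M => [//|M ihM] /=; exact: QDD.
have Yi M z : Q z -> Q (iter M Y z) by move=> Qz; elim: M => [//|M ihM] /=; exact: QY.
by apply: (QY); apply: Yi; apply: (QDD); apply: (QDD).
Qed.

Lemma divp_ker x : D x = 0 -> divp x = 0.
Proof.
by move=> h; rewrite (@divpE x 1%N) //= /dsum big_ord_recl big_ord0 /= h addr0.
Qed.

(** The induction expands x in powers of X: x - X D x is killed by D, and D x needs one application
    of D less to vanish. The predicate G allows everything to be restricted to cycles. *)
Lemma nil_ind X (Q : R -> Prop) : additive_fun X -> (forall x, D (X x) = x) ->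
  Q 0 -> (forall x y, Q x -> Q y -> Q (x + y)) -> (forall x, Q x -> Q (X x)) ->
  forall (G : R -> Prop), (forall x, G x -> G (D x)) -> (forall x, G x -> G (X x)) ->
  (forall x y, G x -> G y -> G (x - y)) ->
  (forall x, G x -> D x = 0 -> Q x) -> forall x, G x -> Q x.
Proof.
move=> XD DX Q0 QD QX G GD GX GB h x; have [N] := Dnil x.
elim: N x => [|N ih] x; first by move=> /= -> _.
rewrite iterSr => hN Gx.
have -> : x = (x - X (D x)) + X (D x) by rewrite subrK.
apply: QD; last by apply: QX; apply: ih => //; exact: GD.
apply: h; first by apply: GB => //; apply: GX; apply: GD.
by rewrite (additive_funB DD) DX subrr.
Qed.

End Nilpotent.

(** * The Markov move *)

Section MarkovBic.
Variables (R P : bic) (m : bmor 0 P R) (ka : bmor 0 R P) (ph : bmor 0 P P).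
Variables (X Y D : bmor 0 R R) (s : R -> P) (t : P -> R).
(** R stands for a complex on which strand c acts equally from both sides, P for the same complex
    with B inserted on the strands c and b. The difference [ph] of the two actions of c on P has
    kernel ka(R) and cokernel R, through m. The Koszul factor of c thus has homology R in both
    degrees, and m ka = X - Y is multiplication by x_c - x_b. *)
Hypotheses (ms : forall x, m (s x) = x) (mph : forall x, m (ph x) = 0).
Hypothesis mker : forall x, m x = 0 -> x = ph (s (t x)).
Hypothesis phker : forall x, ph x = 0 -> x = ka (t x).
Hypotheses (tka : forall x, t (ka x) = x) (phka : forall x, ph (ka x) = 0).
Hypothesis mka : forall x, m (ka x) = X x - Y x.
Hypotheses (DX : forall x, D (X x) = x) (DY : forall x, D (Y x) = Y (D x)).
Hypotheses (Dnil : forall x, exists N, iter N D x = 0).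
Hypotheses (sh : forall k x, bh k x -> bh k (s x)) (th : forall k x, bh k x -> bh k (t x)).

Let DD := bfD D. Let YD := bfD Y.
Let Dp : R -> R := divp Y Dnil.
Let DpD : additive_fun Dp. Proof. exact: divpD. Qed.
Let DpB x y : Dp (x - y) = Dp x - Dp y. Proof. exact: additive_funB DpD x y. Qed.
Let DpN x : Dp (- x) = - Dp x. Proof. exact: additive_funN DpD x. Qed.
Let Dp0 : Dp 0 = 0. Proof. exact: additive_fun0 DpD. Qed.
Let Dpm x : Dp (m (ka x)) = x. Proof. by rewrite mka; exact: divp_mul. Qed.
Let Dpl x : Dp (bl x) = bl (Dp x).
Proof. exact: (divp_comm DD YD Dnil (@blD R) (bfl D) (bfl Y)). Qed.
Let Dpd x : Dp (bd x) = bd (Dp x).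
Proof. exact: (divp_comm DD YD Dnil (@bdD R) (bfd D) (bfd Y)). Qed.
Let Dph k x : bh k x -> bh k (Dp x).
Proof.
apply: divp_pred; first exact: bh0.
- by move=> *; exact: bhD.
- by move=> *; exact: bfh0.
- by move=> *; exact: bfh0.
Qed.
Let ka_inj x : ka x = 0 -> x = 0.
Proof. by move=> h; rewrite -(tka x) h -(bf0 ka) tka. Qed.

(* Lifts a central class through the quotient of multiplication.              *)
Lemma mk_lift k e : bh k e -> bl e = 0 -> exists f0 f1,
  [/\ bh k f0, bh k f1, m f1 = e, bl f1 = ph f0 & bl f0 = 0].
Proof.
move=> he le; pose f1 := s e; pose f0 := s (t (bl f1)).
have hf1 : bh k f1 by exact: sh.
have hf0 : bh k f0 by apply: sh; apply: th; apply: bhl.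
have e1 : bl f1 = ph f0 by apply: mker; rewrite bfl ms.
have [q eq] : exists q, bl f0 = ka q.
  exists (t (bl f0)); apply: phker; rewrite bfl -e1; exact: bll.
have qE : q = bl (Dp (m f0)) by rewrite -Dpl -bfl eq Dpm.
exists (f0 - ka (Dp (m f0))), f1; split=> //.
- by apply: bhB => //; apply: bfh0; apply: Dph; apply: bfh0.
- exact: ms.
- by rewrite bfB phka subr0.
- by rewrite blB -bfl -qE eq subrr.
Qed.

(** Substitution of x_b for x_c: it kills the multiples of X - Y and differs from the identity by
    such a multiple. The quotient of R by X - Y is therefore a retract of R. *)
Let ev x := x - m (ka (Dp x)).
Let evD : additive_fun ev.
Proof. by move=> x y; rewrite /ev DpD !bfD; zlin. Qed.
Let evB x y : ev (x - y) = ev x - ev y. Proof. exact: additive_funB evD x y. Qed.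
Let evz : ev 0 = 0. Proof. exact: additive_fun0 evD. Qed.
Let evl x : ev (bl x) = bl (ev x).
Proof. by rewrite /ev Dpl !bfl blB. Qed.
Let evd x : ev (bd x) = bd (ev x).
Proof. by rewrite /ev Dpd !bfd bdB. Qed.
Let ev0 x : ev (m (ka x)) = 0. Proof. by rewrite /ev Dpm subrr. Qed.
Let evh k x : bh k x -> bh k (ev x).
Proof. by move=> h; apply: bhB => //; do 2!apply: bfh0; apply: Dph. Qed.

(** On the cokernel of [ph] the crossing induces the identity of R, on the kernel it induces X - Y,
    which is injective. Only R modulo X - Y survives, a retract of R through [ev]. The hypotheses on
    the eight elements spell out a cycle of the Koszul complex extended by c. *)
Lemma mk_fwd k (y0 y1 : R) (w0 w1 : P) (g0 g1 : R) (h0 h1 : P) : vb R k ->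
  bh k y0 -> bh k y1 -> bh (k + 1) w0 -> bh (k + 1) w1 ->
  bh (k + 1) g0 -> bh (k + 1) g1 -> bh (k + 2) h0 -> bh (k + 2) h1 ->
  bl y0 = 0 -> bl w0 = 0 -> bl y1 = 0 -> ph w0 = bl w1 ->
  bd y0 + m w0 = bl g0 -> - bd w0 = bl h0 -> bd y1 + m w1 = - bl g1 ->
  - bd w1 = ph h0 - bl h1 ->
  exists e0 e1 f0 f1 a0 a1 b0 b1,
    [/\ [/\ bh (k - 1) e0, bh (k - 1) e1, bh k f0 & bh k f1],
        [/\ bh k a0, bh k a1, bh (k + 1) b0 & bh (k + 1) b1],
        [/\ bl e0 = 0, bl e1 = 0, bl f0 = 0 & ph f0 = bl f1] &
        [/\ y0 = bd e0 + m f0 + bl a0, y1 = bd e1 + m f1 - bl a1,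
            w0 = - bd f0 + bl b0 & w1 = - bd f1 + ph b0 - bl b1]].
Proof.
move=> vR hy0 hy1 hw0 hw1 hg0 hg1 hh0 hh1 ly0 lw0 ly1 pw0 dy0 dw0 dy1 dw1.
have [F0 [F1 [hF0 hF1 mF1 lF1 lF0]]] := mk_lift hy1 ly1.
pose w1' := w1 + bd F1.
have mw1' : m w1' = - bl g1 by rewrite bfD bfd mF1 -dy1 addrC.
pose b1 := s g1; have hb1 : bh (k + 1) b1 by exact: sh.
pose b0 := s (t (w1' + bl b1)).
have hb0 : bh (k + 1) b0.
  by apply: sh; apply: th; apply: bhD; [apply: bhD => //; exact: bhd | exact: bhl].
have w1E : w1' + bl b1 = ph b0 by apply: mker; rewrite bfD mw1' bfl ms addNr.
pose w0' := w0 + bd F0.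
have pw0' : ph w0' = bl w1' by rewrite bfD pw0 bfd -lF1 blD bld.
have [q0 q0E] : exists q0, w0' - bl b0 = ka q0.
  exists (t (w0' - bl b0)); apply: phker.
  by rewrite bfB pw0' bfl -w1E blD bll addr0 subrr.
have hq0 : bh (k + 1) q0.
  rewrite -(tka q0) -q0E; apply: th; apply: bhB; last exact: bhl.
  by apply: bhD => //; exact: bhd.
pose y0' := y0 - m F0.
have ly0' : bl y0' = 0 by rewrite blB ly0 -bfl lF0 bf0 subr0.
have hy0' : bh k y0' by apply: bhB => //; exact: bfh0.
pose g0' := g0 - m b0.
have hg0' : bh (k + 1) g0' by apply: bhB => //; exact: bfh0.
have dy0' : bd y0' + m (ka q0) = bl g0'.
  by rewrite -q0E !bfB !bdB bfD blB -bfl -bfd -dy0; zlin.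
have cev : cyc k (ev y0').
  split; first exact: evh.
    by rewrite -evl ly0' evz.
  exists (ev g0'); first exact: evh.
  by rewrite -evl -evd -dy0' evD ev0 addr0.
have [e [a [he ha le evE]]] := vR _ cev.
have y0E : y0' = bd e + bl a + m (ka (Dp y0')) by rewrite -evE /ev subrK.
exists e, 0, (F0 + ka (Dp y0')), F1, a, 0, (b0 + ka (Dp g0')), b1.
have hDy : bh k (ka (Dp y0')) by apply: bfh0; exact: Dph.
split; split=> //; try by [exact: bh0 | exact: bl0].
- exact: bhD.
- by apply: bhD => //; apply: bfh0; exact: Dph.
- by rewrite blD lF0 add0r -bfl -Dpl ly0' Dp0 bf0.
- by rewrite bfD phka addr0.
- by rewrite bfD; move: y0E; rewrite /y0' => y0E; zlin y0E.
- by rewrite bdz bl0 mF1 add0r subr0.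
- have qE : q0 = bl (Dp g0') - bd (Dp y0').
    by rewrite -(Dpm q0) -Dpl -Dpd -DpB -dy0'; congr Dp; zlin.
  by move: q0E; rewrite qE bfB bfl bfd bdD blD /w0' => q0E; zlin q0E.
- by rewrite bfD phka -w1E /w1'; zlin.
Qed.

(** The roles are exchanged for the negative crossing: [ka] is an isomorphism onto the kernel of
    [ph], and on the cokernel it induces X - Y. *)
Lemma mk_star k (y0 y1 : R) (w0 w1 : P) (g0 g1 : R) (h0 h1 : P) : vb R k ->
  bh (k + 1) y0 -> bh (k + 1) y1 -> bh k w0 -> bh k w1 ->
  bh (k + 2) g0 -> bh (k + 2) g1 -> bh (k + 1) h0 -> bh (k + 1) h1 ->
  bl y0 = 0 -> bl w0 = 0 -> bl y1 = 0 -> ph w0 = bl w1 ->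
  bd w0 + ka y0 = bl h0 -> bd w1 + ka y1 = ph h0 - bl h1 ->
  - bd y0 = bl g0 -> - bd y1 = - bl g1 ->
  exists e0 e1 f0 f1 a0 a1 b0 b1,
    [/\ [/\ bh k e0, bh k e1, bh (k - 1) f0 & bh (k - 1) f1],
        [/\ bh (k + 1) a0, bh (k + 1) a1, bh k b0 & bh k b1],
        [/\ bl e0 = 0, bl e1 = 0, bl f0 = 0 & ph f0 = bl f1] &
        [/\ w0 = bd f0 + ka e0 + bl b0, w1 = bd f1 + ka e1 + ph b0 - bl b1,
            y0 = - bd e0 + bl a0 & y1 = - bd e1 - bl a1]].
Proof.
move=> vR hy0 hy1 hw0 hw1 hg0 hg1 hh0 hh1 ly0 lw0 ly1 pw0 dw0 dw1 dy0 dy1.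
pose v := m w1.
have hv : bh k v by exact: bfh0.
have lv : bl v = 0 by rewrite -bfl -pw0 mph.
have dv : bd v = - bl (m h1) - m (ka y1).
  by have := f_equal m dw1; rewrite bfD bfB mph bfd bfl /v => e; zlin e.
have cev : cyc k (ev v).
  split; first exact: evh.
    by rewrite -evl lv evz.
  exists (- ev (m h1)); first by apply: bhN; apply: evh; exact: bfh0.
  by rewrite -evd dv evB ev0 subr0 (additive_funN evD) evl blN.
have [e [a [he ha le evE]]] := vR _ cev.
have [f0 [f1 [hf0 hf1 mf1 lf1 lf0]]] := mk_lift he le.
pose b1 := - s a; have hb1 : bh k b1 by apply: bhN; exact: sh.
pose e1 := Dp v; have he1 : bh k e1 by exact: Dph.
have le1 : bl e1 = 0 by rewrite -Dpl lv Dp0.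
pose w1' := w1 - bd f1 - ka e1 + bl b1.
have hw1' : bh k w1'.
  apply: bhD; last exact: bhl.
  by apply: bhB; [apply: bhB => //; exact: bhd1 | exact: bfh0].
pose b0 := s (t w1'); have hb0 : bh k b0 by apply: sh; exact: th.
have w1E : w1' = ph b0.
  apply: mker; rewrite /w1' bfD !bfB bfd mf1 bfl bfN ms blN -/v.
  by move: evE; rewrite /ev -/e1 => evE; zlin evE.
pose w0' := w0 - bd f0 - bl b0.
have [e0 e0E] : exists e0, w0' = ka e0.
  exists (t w0'); apply: phker; rewrite /w0' !bfB bfd -lf1 bfl -w1E pw0 /w1'.
  by rewrite !blD !blN -bfl le1 bf0 bll bld; zlin.
have he0 : bh k e0.
  rewrite -(tka e0) -e0E; apply: th; apply: bhB; last exact: bhl.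
  by apply: bhB => //; exact: bhd1.
have le0 : bl e0 = 0.
  by apply: ka_inj; rewrite bfl -e0E /w0' !blB lw0 bld lf0 bdz bll !subr0.
exists e0, e1, f0, f1, (Dp (m (h0 - bd b0))), (Dp (m (h1 - bd b1))), b0, b1.
split; split=> //.
- by apply: Dph; apply: bfh0; apply: bhB => //; exact: bhd.
- by apply: Dph; apply: bfh0; apply: bhB => //; exact: bhd.
- by move: e0E; rewrite /w0' => e0E; zlin e0E.
- by move: w1E; rewrite /w1' => w1E; zlin w1E.
- rewrite -Dpl -bfl -[y0 in LHS]Dpm.
  have -> : bl (h0 - bd b0) = ka (y0 + bd e0).
    rewrite bfD bfd -e0E /w0' !bdB bdd subr0 blB bld -dw0; zlin.
  by rewrite Dpm Dpm; zlin.
- have : ka (y1 + bd e1) = ph (h0 - bd b0) - bl (h1 - bd b1).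
    rewrite bfD bfB blB bld [ph (bd b0)]bfd -w1E /w1' !bdD !bdN bdd bfd.
    by zlin dw1.
  move/(f_equal m); rewrite bfB mph sub0r => /(f_equal Dp).
  by rewrite Dpm bfl DpN Dpl => e'; zlin e'.
Qed.

(** By [nil_ind] only a cycle y with D y = 0 has to be treated, since X preserves boundaries. Such a
    y does not involve x_c and is fixed by [ev]; applying [ev] to the boundary found in the larger
    complex removes the multiples of X - Y. *)
Lemma mk_conv k (y : R) : cyc k y ->
  (forall y, cyc k y -> exists e0 e1 f0 f1 a0 a1 b0 b1,
    [/\ [/\ bh (k - 1) e0, bh (k - 1) e1, bh k f0 & bh k f1],
        [/\ bh k a0, bh k a1, bh (k + 1) b0 & bh (k + 1) b1],
        [/\ bl e0 = 0, bl e1 = 0, bl f0 = 0 & ph f0 = bl f1] &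
        [/\ y = bd e0 + m f0 + bl a0, 0 = bd e1 + m f1 - bl a1,
            0 = - bd f0 + bl b0 & 0 = - bd f1 + ph b0 - bl b1]]) ->
  bnd k y.
Proof.
move=> cy h.
apply: (@nil_ind R D DD Dnil X (bnd k) (bfD X) DX (@bnd0 R k) (@bndD R k) _ (cyc k)) cy.
- by move=> x bx; apply: bnd_mor; rewrite addr0.
- by move=> x cx; apply: cyc_mor; rewrite addr0.
- by move=> x cx; apply: cyc_mor; rewrite addr0.
- by move=> *; exact: cycB.
move=> {}y cy Dy0.
have [e0 [e1 [f0 [f1 [a0 [a1 [b0 [b1 [[he0 he1 hf0 hf1] [ha0 ha1 hb0 hb1]
  [le0 le1 lf0 pf0] [ye e1E f0E f1E]]]]]]]]]] := h y cy.
have yev : ev y = y by rewrite /ev /Dp divp_ker // !bf0 subr0.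
have [F0 [F1 [hF0 hF1 mF1 lF1 lF0]]] := mk_lift he1 le1.
pose u := f1 + bd F1 - bl (s a1).
have uE : u = ph (s (t u)).
  by apply: mker; rewrite /u bfB bfD bfd mF1 bfl ms; zlin e1E.
set t0 := s (t u) in uE.
have hu : bh k u.
  by apply: bhB; [apply: bhD => //; exact: bhd1 | apply: bhl; exact: sh].
have ht0 : bh k t0 by apply: sh; exact: th.
have [q qE] : exists q, f0 - bl t0 + bd F0 = ka q.
  exists (t (f0 - bl t0 + bd F0)); apply: phker.
  rewrite bfD bfB pf0 bfl -uE bfd -lF1 /u !blD !blN bll bld; zlin.
rewrite -yev ye 2!evD evd evl.
have -> : ev (m f0) = bl (ev (m t0)) - bd (ev (m F0)).
  have -> : f0 = ka q + bl t0 - bd F0 by zlin qE.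
  by rewrite bfB bfD evB evD ev0 add0r bfl bfd evl evd.
apply: bndD; last by apply: bnd_l; exact: evh.
apply: bndD.
  by apply: bnd_d; [exact: evh | rewrite -evl le0 evz].
apply: bndB; first by apply: bnd_l; apply: evh; exact: bfh0.
apply: bnd_d; first by apply: evh; exact: bfh0.
by rewrite -evl -bfl lF0 bf0 evz.
Qed.

End MarkovBic.

Section CapAdd.
Variables (A : seq letter).

Lemma lmap_add e l (C D : cx) (f : C -> D) : additive_fun f -> additive_fun (lmap e l f).
Proof.
move=> fD; case: l => [[] [a b]]; last by move=> x y; apply: pairE; rewrite /= fD.
by move=> x y; rewrite /= /tmap /= !fD !lsignD.
Qed.

Lemma capf_add e (C D : cx) (f : C -> D) : additive_fun f -> additive_fun (capf e A f).
Proof. by move=> fD; elim: A => [//|l A' ih]; exact: lmap_add. Qed.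

Lemma capf_comp' e e' (C D E : cx) (g : D -> E) (f : C -> D) z : additive_fun g ->
  capf e A g (capf e' A f z) = capf (e (+) e') A (fun x => g (f x)) z.
Proof.
move=> gD; elim: A z => [//|l A' ih] z /=.
rewrite lmap_comp; first exact: lmap_ext.
by elim: A' {ih z} => [//|l' A' ih]; exact: lmap_add.
Qed.

Definition avoid c (A : seq letter) := all (fun l => (l.2.1 != c) && (l.2.2 != c)) A.

Lemma lmap_dS e l (C D : cx) (f : C -> D) : additive_fun f ->
  (forall x, f (op true l.2.1 x) = op true l.2.1 (f x)) ->
  (forall x, f (dd x) = lsign e (dd (f x))) ->
  forall x, lmap e l f (dd x) = lsign e (dd (lmap e l f x)).
Proof.
move=> fD fl fd; have fN := additive_funN fD; case: l fl => [[] [a b]] /= fl.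
  move=> [x [y z]] /=; rewrite /tmap /= !(fD, fN, fl) // !fd.
  by case: e {fd} => /=; apply: pairE => /=; [cxlin D| |cxlin D|];
    apply: pairE => /=; cxlin D.
by move=> [y z] /=; rewrite /bmap /= !fd; case: e {fd}.
Qed.

Lemma op_lapp t c l (C : cx) (x : lapp l C) : l.2.1 != c -> l.2.2 != c ->
  op t c x = lmap false l (op t c) x.
Proof.
case: l x => [[] [a b]] /= x ac bc; last first.
  by rewrite /bB_op ![c == _]eq_sym (negPf ac) (negPf bc) !andbF.
by rewrite /tmap /bB_op ![c == _]eq_sym (negPf ac) (negPf bc) !andbF.
Qed.

End CapAdd.

Lemma op_capp t c A (C : cx) (x : capp A C) : avoid c A ->
  op t c x = capf false A (op t c) x.
Proof.
elim: A x => [//|l A ih] x /= /andP[/andP[h1 h2] h3].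
by rewrite op_lapp //; apply: lmap_ext => y; exact: ih.
Qed.

Lemma phi_capp c A (C : cx) (x : capp A C) : avoid c A ->
  phi c x = capf false A (@phi C c) x.
Proof.
move=> h; rewrite /phi !(op_capp _ _ h) -capf_oppf -capf_addf.
exact: capf_ext.
Qed.

(* A complex free over the polynomials in the variable [c], which acts in the *)
(* same way on both sides; [D] is division by this variable.                  *)
Record freel c (Q : cx) (D : Q -> Q) : Prop := Freel {
  fl_XY : forall x : Q, op true c x = op false c x;
  fl_add : additive_fun D;
  fl_op : forall t j x, j != c -> D (op t j x) = op t j (D x);
  fl_dd : forall x, D (dd x) = dd (D x);
  fl_hd : forall k x, hd k x -> hd k (D x);
  fl_X : forall x, D (op true c x) = x;
  fl_nil : forall x, exists N, iter N D x = 0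
}.

Lemma freel_lapp c l Q D : (l.2.1 != c) && (l.2.2 != c) -> freel c D ->
  freel c (@lmap false l Q Q D).
Proof.
move=> /andP[ac bc] [h1 h2 h3 h4 h5 h6 h7].
have lS : lin (fun _ j => j != c) D by split.
split.
- move=> x; rewrite !op_lapp //; exact: lmap_ext.
- exact: lmap_add.
- by move=> t j x jc; apply: (lmap_lin false _ _ lS).2.
- by apply: (@lmap_dS false) => // x; exact: h3.
- move=> k x hx; rewrite -[k]addr0 in hx; apply: lmap_hd hx => j y.
  by rewrite addr0; exact: h5.
- move=> x; rewrite op_lapp // lmap_comp // -[RHS]lmap_id.
  exact: lmap_ext.
- have dn := nil2 h2 h7.
  have it N y z : iter N (@bmap Q Q D) (y, z) = (iter N D y, iter N D z).
    by elim: N => [//|N /= ->].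
  case: l {ac bc} => [[] [a b]] /=; last first.
    by move=> [y z]; have [N [e1 e2]] := dn y z; exists N; rewrite it e1 e2.
  move=> [x [y z]]; have [N [e1 e2]] := dn y z; have [M e3] := h7 x.
  have it3 K : iter K (@tmap false Q Q D) (x, (y, z)) = (iter K D x, (iter K D y, iter K D z)).
    by elim: K => [//|K /= ->].
  exists (maxn N M); rewrite it3 (nil_le h2 e3 (leq_maxr N M)).
  by rewrite (nil_le h2 e1 (leq_maxl N M)) (nil_le h2 e2 (leq_maxl N M)).
Qed.

Lemma freel_capp c A Q D : avoid c A -> freel c D -> freel c (@capf false A Q Q D).
Proof.
by move=> + h; elim: A => [//|l A ih] /= /andP[hl /ih]; exact: freel_lapp.
Qed.

Program Definition opm t j (C : cx) : cmor 0 C C := @Cmor 0 C C (op t j) _ _ _ _.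
Next Obligation. by move=> t j C; exact: opD. Qed.
Next Obligation. by move=> t j C t' j' x; exact: opC. Qed.
Next Obligation. by move=> t j C x; rewrite opdd. Qed.
Next Obligation. by move=> t j C k x; rewrite addr0; exact: hdop. Qed.
Program Definition phim j (C : cx) : cmor 0 C C := @Cmor 0 C C (@phi C j) _ _ _ _.
Next Obligation. by move=> j C; exact: phiD. Qed.
Next Obligation. by move=> j C t' j' x; rewrite /phi; cxlin C. Qed.
Next Obligation. by move=> j C x; rewrite phid. Qed.
Next Obligation. by move=> j C k x; rewrite addr0 /phi => h; hdsolve. Qed.

Lemma kosm_nil L (M : zmodType) (g : M -> M) : additive_fun g ->
  (forall x, exists N, iter N g x = 0) ->
  forall x : kosT L M, exists N, iter N (kosm L g) x = 0.
Proof.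
move=> gD gn; elim: L => [//|c L ih] [x y].
have [N [e1 e2]] := nil2 (kosmD L gD) ih x y; exists N.
have it K : iter K (fun z => (kosm L g z.1, kosm L g z.2)) (x, y) =
    (iter K (kosm L g) x, iter K (kosm L g) y) by elim: K => [//|K /= ->].
by rewrite [LHS]it e1 e2.
Qed.

Section MarkovCx.
Variables (c b : nat) (A : seq letter) (L : seq nat) (Q : cx) (D : Q -> Q).
Hypotheses (cb : c != b) (Ac : avoid c A) (Lc : c \notin L) (fD : freel c D).

Let R := kosb L (capp A Q).
Let P := kosb L (capp A (bB c b Q)).
Let F (C E : cx) (f : C -> E) : kosb L (capp A C) -> kosb L (capp A E) :=
  kosm L (capf false A f).
Let FE s (C E : cx) (f : cmor s C E) x : kosbm L (capm A f) x = F f x.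
Proof. by apply: kosm_ext => y; exact: capmE. Qed.
Let Fcomp (C E G : cx) (g : E -> G) (f : C -> E) x : additive_fun g ->
  F g (F f x) = F (fun x => g (f x)) x.
Proof.
by move=> gD; rewrite /F kosm_comp; apply: kosm_ext => y; rewrite capf_comp'.
Qed.
Let Fext (C E : cx) (f g : C -> E) : f =1 g -> F f =1 F g.
Proof. by move=> e x; apply: kosm_ext => y; exact: capf_ext. Qed.
Let Fid (C : cx) x : F (@id C) x = x.
Proof. by rewrite /F -[RHS]kosm_id; apply: kosm_ext => y; exact: capf_id. Qed.
Let Fadd (C E : cx) (f g : C -> E) x : F (fun z => f z + g z) x = F f x + F g x.
Proof. by rewrite /F -kosm_addf; apply: kosm_ext => y; rewrite capf_addf. Qed.
Let Fopp (C E : cx) (f : C -> E) x : F (fun z => - f z) x = - F f x.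
Proof. by rewrite /F -kosm_oppf; apply: kosm_ext => y; rewrite capf_oppf. Qed.
Let F0 (C E : cx) x : F (fun=> 0 : E) (x : kosb L (capp A C)) = 0.
Proof. by rewrite -(subrr (F (fun=> 0 : E) x)) -Fopp -Fadd; apply: Fext => y; rewrite subr0. Qed.
Let Fhd (C E : cx) (f : C -> E) : (forall k x, hd k x -> hd k (f x)) ->
  forall k x, @bh (kosb L (capp A C)) k x -> bh k (F f x).
Proof.
move=> h k x hx; apply: kosm_hd hx => y hy; rewrite -[k]addr0 in hy.
by apply: capf_hd hy => j z; rewrite addr0; exact: h.
Qed.

Let m := kosbm L (capm A (mB c b Q)).
Let ka := kosbm L (capm A (dB Q cb)).
Let ph := kosbm L (capm A (phim c (bB c b Q))).
Let X := kosbm L (capm A (opm true c Q)).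
Let Y := kosbm L (capm A (opm true b Q)).
Let flD := freel_capp Ac fD.

Program Definition mkD : bmor 0 R R := @Bmor 0 R R (F D) _ _ _ _.
Next Obligation. by apply: kosmD; exact: (fl_add flD). Qed.
Next Obligation.
move=> x; apply: kosm_kdel => [|j y jL]; first exact: (fl_add flD).
have jc : j != c by apply: contra Lc => /eqP <-.
by rewrite /phi (additive_funB (fl_add flD)) !(fl_op flD).
Qed.
Next Obligation.
move=> x; rewrite /F /= !kosm_comp; apply: kosm_ext => y; exact: (fl_dd flD).
Qed.
Next Obligation.
by move=> k x; rewrite addr0; apply: kosm_hd => y; exact: (fl_hd flD).
Qed.

Let s : R -> P := F (fun q : Q => (q, 0) : bB c b Q).
Let t : P -> R := F (fun z : bB c b Q => z.2 : Q).

Transparent mB.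
Let XY (x : Q) : op true c x = op false c x. Proof. exact: (fl_XY fD). Qed.
Let bc : b != c. Proof. by rewrite eq_sym. Qed.
Let phE (z : bB c b Q) : phi c z = (- op true c (z.1 + op true b z.2), z.1 + op true b z.2).
Proof.
rewrite /phi /= /bB_op /= eqxx /=; apply: pairE => /=; rewrite -!XY; cxlin Q.
Qed.
Let snd_add : additive_fun (fun z : bB c b Q => z.2 : Q). Proof. by []. Qed.
Let fst_add : additive_fun (fun q : Q => (q, 0) : bB c b Q).
Proof. by move=> x y; apply: pairE; rewrite //= addr0. Qed.

Let phs_add : additive_fun (fun q : Q => phim c (bB c b Q) ((q, 0) : bB c b Q)).
Proof. by move=> x y; rewrite -mfD; congr (phim _ _ _); exact: fst_add. Qed.
Let st_add : additive_fun (fun z : bB c b Q => (z.2, 0) : bB c b Q).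
Proof. by move=> x y; exact: fst_add. Qed.
Ltac fcomp := do ?(rewrite Fcomp; last by (exact: mfD || exact: fst_add ||
  exact: snd_add || exact: phs_add || exact: st_add)).
Let h_ms x : m (s x) = x.
Proof.
rewrite /m FE /s; fcomp; rewrite -[RHS]Fid; apply: Fext => y /=.
by rewrite (additive_fun0 (opD _ _)) addr0.
Qed.
Let h_mph x : m (ph x) = 0.
Proof.
rewrite /m /ph !FE; fcomp; rewrite -[RHS](@F0 (bB c b Q) Q x); apply: Fext => y.
by rewrite [phim _ _ _]phE /=; cxlin Q.
Qed.
Let h_mker x : m x = 0 -> x = ph (s (t x)).
Proof.
move=> mx; have e : x = s (m x) + ph (s (t x)).
  rewrite /m /ph !FE /s /t; fcomp; rewrite -Fadd -[LHS]Fid; apply: Fext => z.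
  rewrite [phim _ _ _]phE; apply: pairE => /=; cxlin Q.
have s0 : s 0 = 0 by apply: (additive_fun0 (kosmD L (@capf_add A false Q (bB c b Q) _ fst_add))).
by rewrite {1}e mx s0 add0r.
Qed.
Let h_phker x : ph x = 0 -> x = ka (t x).
Proof.
move=> px; have e : x = ka (t x) + s (t (ph x)).
  rewrite /ka /ph !FE /s /t; fcomp; rewrite -Fadd -[LHS]Fid; apply: Fext => z.
  rewrite [phim _ _ _]phE; apply: pairE => /=; cxlin Q.
have t0 : t 0 = 0 by apply: (additive_fun0 (kosmD L (@capf_add A false (bB c b Q) Q _ snd_add))).
have s0 : s 0 = 0 by apply: (additive_fun0 (kosmD L (@capf_add A false Q (bB c b Q) _ fst_add))).
by rewrite {1}e px t0 s0 addr0.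
Qed.
Let h_tka x : t (ka x) = x.
Proof. by rewrite /ka FE /t; fcomp; rewrite -[RHS]Fid; apply: Fext. Qed.
Let h_phka x : ph (ka x) = 0.
Proof.
rewrite /ka /ph !FE; fcomp; rewrite -[RHS](@F0 Q (bB c b Q) x); apply: Fext => y.
rewrite [phim _ _ _]phE; apply: pairE => /=; cxlin Q.
Qed.
Let h_mka x : m (ka x) = X x - Y x.
Proof.
rewrite /m /ka /X /Y !FE; fcomp; rewrite -Fopp -Fadd; apply: Fext => y /=; cxlin Q.
Qed.
Let h_DX x : mkD (X x) = x.
Proof.
rewrite /X FE [mkD _]Fcomp; last exact: (fl_add fD).
by rewrite -[RHS]Fid; apply: Fext => y; exact: (fl_X fD).
Qed.
Let h_DY x : mkD (Y x) = Y (mkD x).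
Proof.
rewrite /Y !FE [mkD _]Fcomp; last exact: (fl_add fD).
rewrite Fcomp; last exact: opD.
by apply: Fext => y; exact: (fl_op fD).
Qed.
Let h_nil x : exists N, iter N mkD x = 0.
Proof.
exact: (@kosm_nil L (capp A Q) (capf false A D) (fl_add flD) (fl_nil flD) x).
Qed.
Let h_s k x : bh k x -> bh k (s x).
Proof. by apply: Fhd => j y hy; split=> //; exact: hd0. Qed.
Let h_t k x : bh k x -> bh k (t x).
Proof. by apply: Fhd => j [y z] []. Qed.

Let phR (y : R) : kosm L (@phi (capp A Q) c) y = 0.
Proof.
rewrite -[RHS](kosm_zero L (capp A Q) y); apply: kosm_ext => x.
by rewrite /phi (fl_XY flD) subrr.
Qed.
Let phP (y : P) : kosm L (@phi (capp A (bB c b Q)) c) y = ph y.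
Proof.
rewrite /ph FE; apply: kosm_ext => x; rewrite phi_capp //.
Qed.

Lemma van_markov k : van L k (capp A Q) -> van (c :: L) k (capp A (tT c b Q)).
Proof.
move=> v; apply/(van_capp_cone (c :: L)) => -[[y0 y1] [w0 w1]].
move=> [[/= [hy0 hy1] [hw0 hw1]] [ly0 ly1 lw0 lw1] [[[g0 g1] [h0 h1]] [/= [hg0 hg1] [hh0 hh1]] [dy0 dy1 dw0 dw1]]].
move: ly1; rewrite phR sub0r => /(f_equal -%R); rewrite opprK oppr0 => ly1.
move: lw1; rewrite phP => /eqP; rewrite subr_eq0 => /eqP lw1.
move: dy1; rewrite phR sub0r => dy1; move: dw1; rewrite phP => dw1.
rewrite !addr0 in hw0 hw1 hh0 hh1 *.
have e2 : k + 1 + 1 = k + 2 by clear; lia.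
rewrite e2 in hh0 hh1.
have [e0 [e1 [f0 [f1 [a0 [a1 [b0 [b1 [[he0 he1 hf0 hf1] [ha0 ha1 hb0 hb1]
  [le0 le1 lf0 pf0] [E1 E2 E3 E4]]]]]]]]]] :=
  mk_fwd h_ms h_mker h_phker h_tka h_phka h_mka h_DX h_DY h_nil h_s h_t v hy0 hy1 hw0 hw1 hg0 hg1 hh0 hh1
    ly0 lw0 ly1 lw1 dy0 dw0 dy1 dw1.
have e3 : k - 1 + 0 + 1 = k by clear; lia.
have e4 : k + 0 + 1 = k + 1 by clear; lia.
exists ((e0, e1), (f0, f1)), ((a0, a1), (b0, b1)); split.
- by split; split=> //; rewrite e3.
- by split; split=> //; rewrite e4.
- apply: pairE; apply: pairE => //=; rewrite ?phR ?phP ?pf0 ?subrr //.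
  by rewrite [kdel L e1]le1 subr0.
- apply: pairE; apply: pairE => /=; rewrite ?phR ?phP.
  + exact: E1.
  + by rewrite sub0r; exact: E2.
  + exact: E3.
  + by rewrite addrA; exact: E4.
Qed.

Lemma van_markov_star k : van L k (capp A Q) -> van (c :: L) k (capp A (tS Q cb)).
Proof.
move=> v; apply/(van_capp_cone (c :: L)) => -[[w0 w1] [y0 y1]].
move=> [[/= [hw0 hw1] [hy0 hy1]] [lw0 lw1 ly0 ly1] [[[h0 h1] [g0 g1]] [/= [hh0 hh1] [hg0 hg1]] [dw0 dw1 dy0 dy1]]].
move: ly1; rewrite phR sub0r => /(f_equal -%R); rewrite opprK oppr0 => ly1.
move: lw1; rewrite phP => /eqP; rewrite subr_eq0 => /eqP lw1.
move: dy1; rewrite phR sub0r => dy1; move: dw1; rewrite phP => dw1.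
rewrite !addr0 in hy0 hy1 hg0 hg1 *.
have e2 : k + 1 + 1 = k + 2 by clear; lia.
rewrite e2 in hg0 hg1.
have [e0 [e1 [f0 [f1 [a0 [a1 [b0 [b1 [[he0 he1 hf0 hf1] [ha0 ha1 hb0 hb1]
  [le0 le1 lf0 pf0] [E1 E2 E3 E4]]]]]]]]]] :=
  mk_star h_ms h_mph h_mker h_phker h_tka h_phka h_mka h_DX h_DY h_nil h_s h_t v hy0 hy1 hw0 hw1 hg0 hg1 hh0 hh1
    ly0 lw0 ly1 lw1 dw0 dw1 dy0 dy1.
have e3 : k - 1 + 0 + 1 = k by clear; lia.
have e4 : k + 0 + 1 = k + 1 by clear; lia.
exists ((f0, f1), (e0, e1)), ((b0, b1), (a0, a1)); split.
- by split; split=> //; rewrite e3.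
- by split; split=> //; rewrite e4.
- apply: pairE; apply: pairE => //=; rewrite ?phR ?phP ?pf0 ?subrr //.
  by rewrite [kdel L e1]le1 subr0.
- apply: pairE; apply: pairE => /=; rewrite ?phR ?phP.
  + exact: E1.
  + by rewrite addrA; exact: E2.
  + exact: E3.
  + by rewrite sub0r; exact: E4.
Qed.

Lemma van_markov_conv k : van (c :: L) k (capp A (tT c b Q)) -> van L k (capp A Q).
Proof.
move=> v y0 cy0.
apply: (mk_conv h_ms h_mker h_phker h_phka h_mka h_DX h_DY h_nil h_s h_t cy0).
move=> {cy0} {}y0 [hy0 ly0 [g hg dy0]].
have {}v : vb (bcone (kosbm (c :: L) (capm A (mB c b Q)))) k.
  by apply/(van_capp_cone (c :: L)).
have z0R := @bh0 R; have z0P := @bh0 P; have m0 := bf0 m.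
have := v ((y0, 0), (0, 0)); case.
  split.
  - by split; split=> //=; [exact: z0R | exact: z0P | exact: z0P].
  - apply: pairE; apply: pairE => //=; rewrite ?phR ?phP ?(bf0 ph).
    + by rewrite [X in _ - X](@bl0 R) subr0.
    + exact: (@bl0 P).
    + by rewrite [X in _ - X](@bl0 P) subr0.
  - exists ((g, 0), (0, 0)).
      by split; split=> //=; [exact: z0R | exact: z0P | exact: z0P].
    apply: pairE; apply: pairE => //=; rewrite ?phR ?phP.
    + by rewrite [X in _ + X]m0 addr0; exact: dy0.
    + by rewrite [X in _ + X]m0 [X in X + _](@bdz R) [X in _ - X](@bl0 R) addr0 subr0.
    + by rewrite [X in - X](@bdz P) [RHS](@bl0 P) oppr0.
    + have a1 := @bdz P; have a2 := @bl0 P; rewrite /= in a1 a2.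
      by rewrite a1 a2 (bf0 ph) !oppr0 addr0.
move=> [[e0 e1] [f0 f1]] [[[a0 a1] [b0 b1]] [/= [[he0 he1] [hf0 hf1]] [[ha0 ha1] [hb0 hb1]]
  [le0 le1 lf0 lf1] [E1 E2 E3 E4]]].
move: le1 lf1; rewrite phR phP sub0r => /(f_equal -%R); rewrite opprK oppr0 => le1.
move=> /eqP; rewrite subr_eq0 => /eqP lf1.
have e3 : k - 1 + 0 + 1 = k by clear; lia.
have e4 : k + 0 + 1 = k + 1 by clear; lia.
rewrite e3 in hf0 hf1; rewrite e4 in hb0 hb1.
exists e0, e1, f0, f1, a0, a1, b0, b1; split; split=> //.
- by rewrite [LHS]E2 phR sub0r.
- by rewrite [LHS]E4 phP addrA.
Qed.
End MarkovCx.

(** * Central cycles *)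

(* A functor on complexes, acting on all maps compatible with the left         *)
(* multiplications; [fm true] differs from [fm false] by the Koszul sign.     *)
Definition linl (C D : cx) (f : C -> D) := lin (fun t _ => t) f.

Definition ddiff (C D : cx) e (f : C -> D) x := dd (f x) - lsign e (f (dd x)).

Record sfun := Sfun {
  fo :> cx -> cx;
  fm : bool -> forall C D : cx, (C -> D) -> fo C -> fo D;
  fm_ext : forall e (C D : cx) (f g : C -> D), f =1 g -> @fm e C D f =1 @fm e C D g;
  fm_comp : forall e e' (C D E : cx) (g : D -> E) (f : C -> D) x, linl g ->
    fm e g (fm e' f x) = fm (e (+) e') (fun y => g (f y)) x;
  fm_id : forall (C : cx) x, @fm false C C id x = x;
  fm_addf : forall e (C D : cx) (f g : C -> D) x,
    fm e (fun y => f y + g y) x = fm e f x + fm e g x;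
  fm_oppf : forall e (C D : cx) (f : C -> D) x, fm e (fun y => - f y) x = - fm e f x;
  fm_lin : forall (S : bool -> nat -> bool) e (C D : cx) (f : C -> D),
    (forall j, S true j) -> lin S f -> lin S (@fm e C D f);
  fm_d : forall e (C D : cx) (f : C -> D) x, linl f ->
    dd (fm e f x) = lsign e (fm e f (dd x)) + fm (~~ e) (ddiff e f) x;
  fm_hd : forall s e (C D : cx) (f : C -> D), (forall k x, hd (k + s) x -> hd k (f x)) ->
    forall k x, hd (k + s) x -> hd k (@fm e C D f x);
  fm_par : forall (C D : cx) (f f' : C -> D),
    (forall k x, hd k x -> f' x = lsign (odd (absz k)) (f x)) ->
    forall k x, hd k x -> fm true f' x = lsign (odd (absz k)) (fm false f x)
}.

Arguments fm F e {C D} f x : rename.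
Arguments fm_lin F {S} e {C D f} _ _ : rename.
Arguments fm_d F e {C D f} x _ : rename.

Section SfunTheory.
Variable F : sfun.

Lemma fm_aS e (C D : cx) (f : C -> D) : lin aS f -> lin aS (fm F e f).
Proof. exact: fm_lin. Qed.
Lemma fm_linl e (C D : cx) (f : C -> D) : linl f -> linl (fm F e f).
Proof. exact: fm_lin. Qed.

Lemma fm_zero e (C D : cx) (f : C -> D) x : (forall y, f y = 0) -> fm F e f x = 0.
Proof.
move=> h; have e0 : fm F e f x = - fm F e f x.
  by rewrite -fm_oppf; apply: fm_ext => y; rewrite h oppr0.
rewrite (@fm_ext F e _ _ f (fun y => f y + (- f y))); last by move=> y; rewrite !h subr0.
by rewrite fm_addf fm_oppf subrr.
Qed.

Lemma linl_aS (C D : cx) (f : C -> D) : lin aS f -> linl f.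
Proof. exact: lin_sub. Qed.

Program Definition fmor s (C D : cx) (f : cmor s C D) : cmor s (F C) (F D) :=
  @Cmor s (F C) (F D) (fm F false f) _ _ _ _.
Next Obligation. by move=> s C D f; exact: (fm_aS false (mf_lin f)).1. Qed.
Next Obligation. by move=> s C D f t j x; apply: (fm_aS false (mf_lin f)).2. Qed.
Next Obligation.
move=> s C D f x /=; rewrite fm_d; last exact: linl_aS (mf_lin f).
by rewrite [X in _ + X]fm_zero ?addr0 // => y; rewrite /ddiff /= mfd subrr.
Qed.
Next Obligation. by move=> s C D f; apply: fm_hd; exact: mfhd. Qed.

Lemma retr_fm C D : retr C D -> retr (F C) (F D).
Proof.
move=> [f [g [H [Hl Hh Hg]]]].
exists (fmor f), (fmor g), (fm F true H); split.
- exact: fm_aS.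
- exact: fm_hd.
- move=> x /=; rewrite fm_comp; last exact: linl_aS (mf_lin g).
  rewrite (@fm_ext F _ _ _ _ _ Hg) (fm_d F true x (linl_aS Hl)) /=.
  have -> : fm F false (ddiff true H) x =
      fm F false (fun y => dd (H y)) x + fm F false (fun y => H (dd y)) x.
    by rewrite -fm_addf; apply: fm_ext => y; rewrite /ddiff /= opprK.
  by rewrite !fm_addf !fm_oppf fm_id; zlin.
Qed.

Lemma heq_fm C D : heq C D -> heq (F C) (F D).
Proof. by move=> [h1 h2]; split; exact: retr_fm. Qed.

Lemma fm_sh s C : heq (F (sh s C)) (sh s (F C)).
Proof.
pose i := (fun x : sh s C => x : C); pose j := (fun x : C => x : sh s C).
have il : lin aS i by []. have jl : lin aS j by [].
have [ID Il] := fm_aS true il; have [JD Jl] := fm_aS true jl.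
have Id x : fm F true i (dd x) = - dd (fm F true i x).
  rewrite (fm_d F true x (linl_aS il)) /= [X in - (_ + X)]fm_zero ?addr0 ?opprK //.
  by move=> y; rewrite /ddiff /= opprK subrr.
have Jd x : fm F true j (dd x) = - dd (fm F true j x).
  rewrite (fm_d F true x (linl_aS jl)) /= [X in - (_ + X)]fm_zero ?addr0 ?opprK //.
  by move=> y; rewrite /ddiff /= opprK addNr.
have Ih k x : hd k x -> hd (k + s) (fm F true i x).
  move=> hx; apply: (@fm_hd F (- s)); last by rewrite addrK.
  by move=> l y hy; have {}hy : @hd C (l - s + s) y := hy; apply: hdE hy _; lia.
have Jh k x : hd (k + s) x -> hd k (fm F true j x) by apply: fm_hd.
have @f : cmor 0 (F (sh s C)) (sh s (F C)).
  refine (@Cmor 0 (F (sh s C)) (sh s (F C)) (fm F true i) ID (fun t l x => Il t l x isT) _ _).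
  - by move=> x; rewrite Id.
  - by move=> k x hx; apply: Ih; rewrite addr0 in hx.
have @g : cmor 0 (sh s (F C)) (F (sh s C)).
  refine (@Cmor 0 (sh s (F C)) (F (sh s C)) (fm F true j) JD (fun t l x => Jl t l x isT) _ _).
  - by move=> x /=; rewrite (additive_funN JD) Jd opprK.
  - by move=> k x hx; apply: Jh; have := hdE hx (addr0 k).
by apply: (@heq_inv _ _ f g) => x /=; rewrite fm_comp ?fm_id //; exact: linl_aS.
Qed.

Section FmCone.
Variables (s : int) (C D : cx) (f : cmor s C D).
Let fst' (z : cone f) : D := z.1.
Let snd' (z : cone f) : C := z.2.
Let inl' (x : D) : cone f := (x, 0).
Let inr' (x : C) : cone f := (0, x).
Let fl : lin aS fst'. Proof. by []. Qed.
Let sl : lin aS snd'. Proof. by []. Qed.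
Let il : lin aS inl'.
Proof.
split=> [x y|t j x _]; apply: pairE => //=; first by rewrite addr0.
by rewrite (additive_fun0 (opD _ _)).
Qed.
Let rl : lin aS inr'.
Proof.
split=> [x y|t j x _]; apply: pairE => //=; first by rewrite addr0.
by rewrite (additive_fun0 (opD _ _)).
Qed.

Let u (x : F (cone f)) : cone (fmor f) := (fm F false fst' x, fm F true snd' x).
Let v (z : cone (fmor f)) : F (cone f) := fm F false inl' z.1 + fm F true inr' z.2.

Let ud x : u (dd x) = dd (u x).
Proof.
apply: pairE => /=.
  rewrite (fm_d F false x (linl_aS fl)) fm_comp; last exact: linl_aS (mf_lin f).
  rewrite -addrA -fm_addf /= [X in _ + X]fm_zero ?addr0 // => y.
  by rewrite /ddiff /= opprD addrA subrr sub0r addNr.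
rewrite (fm_d F true x (linl_aS sl)) /= [X in _ + X]fm_zero ?addr0 ?opprK // => y.
by rewrite /ddiff /= opprK subrr.
Qed.

Let uv z : u (v z) = z.
Proof.
have [fD _] := fm_aS false fl; have [sD _] := fm_aS true sl.
rewrite /u /v; apply: pairE => /=.
  rewrite fD !fm_comp; [|exact: linl_aS|exact: linl_aS].
  by rewrite fm_id [X in _ + X]fm_zero ?addr0.
rewrite sD !fm_comp; [|exact: linl_aS|exact: linl_aS].
by rewrite fm_id [X in X + _]fm_zero ?add0r.
Qed.

Let vu x : v (u x) = x.
Proof.
rewrite /u /v /= !fm_comp; [|exact: linl_aS|exact: linl_aS].
rewrite -fm_addf -[RHS]fm_id; apply: fm_ext => -[y z].
by apply: pairE; rewrite /= ?addr0 ?add0r.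
Qed.

Lemma fm_cone : heq (F (cone f)) (cone (fmor f)).
Proof.
have [fD fo] := fm_aS false fl; have [sD so] := fm_aS true sl.
have [iD io] := fm_aS false il; have [rD ro] := fm_aS true rl.
have uD : additive_fun u by move=> x y; apply: pairE; [exact: fD | exact: sD].
have vD : additive_fun v by move=> x y; rewrite /v /= iD rD; zlin.
have uo t j x : u (op t j x) = op t j (u x) by apply: pairE; [exact: fo | exact: so].
have vo t j x : v (op t j x) = op t j (v x) by rewrite /v /= io // ro // opD.
have vd x : v (dd x) = dd (v x) by rewrite -[x in LHS]uv -ud vu.
have @f1 : cmor 0 (F (cone f)) (cone (fmor f)).
  refine (@Cmor 0 (F (cone f)) (cone (fmor f)) u uD uo ud _).
  move=> k x hx; split; first by apply: (@fm_hd F 0) hx => l y; rewrite addr0 => -[].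
  apply: (@fm_hd F (- s - 1)); last by apply: hdE hx _; lia.
  by move=> l y [_ hy]; apply: hdE hy _; lia.
have @g1 : cmor 0 (cone (fmor f)) (F (cone f)).
  refine (@Cmor 0 (cone (fmor f)) (F (cone f)) v vD vo vd _).
  move=> k [x y] [hx hy]; apply: hdD.
    apply: (@fm_hd F 0) hx => l z hz; rewrite addr0 in hz; split=> //; exact: hd0.
  apply: (@fm_hd F (s + 1)); last by apply: hdE hy _; lia.
  by move=> l z hz; split; [exact: hd0 | apply: hdE hz _; lia].
exact: (@heq_inv _ _ f1 g1).
Qed.
End FmCone.

End SfunTheory.

Section ConeInc.
Variables (s : int) (C D : cx) (f : cmor s C D).

Program Definition cinc : cmor 0 D (cone f) :=
  @Cmor 0 D (cone f) (fun x => (x, 0)) _ _ _ _.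
Next Obligation. by move=> x y; apply: pairE; rewrite //= addr0. Qed.
Next Obligation.
by move=> t j x; apply: pairE; rewrite //= (additive_fun0 (opD _ _)).
Qed.
Next Obligation.
by move=> x; apply: pairE; rewrite /= ?mf0 ?addr0 // (additive_fun0 (@ddD C)) oppr0.
Qed.
Next Obligation. by move=> k x; rewrite addr0 => h; split=> //; exact: hd0. Qed.

Lemma retr_cinc : retr (cone cinc) (sh (s + 1) C).
Proof.
have @g : cmor 0 (cone cinc) (sh (s + 1) C).
  refine (@Cmor 0 (cone cinc) (sh (s + 1) C) (fun z => z.1.2) _ _ _ _) => //.
  - by move=> [[x y] w] /=; rewrite addr0.
  - by move=> k [[x y] w] /= [[_ h] _]; apply: hdE h _; lia.
have @h : cmor 0 (sh (s + 1) C) (cone cinc).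
  refine (@Cmor 0 (sh (s + 1) C) (cone cinc) (fun z => ((0, z), - f z)) _ _ _ _).
  - move=> x y; apply: pairE => /=; last by rewrite mfD opprD.
    by apply: pairE; rewrite //= addr0.
  - move=> t j x; apply: pairE => /=; last by rewrite mfop (additive_funN (opD _ _)).
    by apply: pairE; rewrite //= (additive_fun0 (opD _ _)).
  - move=> x; apply: pairE => /=.
      apply: pairE => /=; last by rewrite addr0.
      by rewrite (additive_fun0 (@ddD D)) add0r subrr.
    by rewrite mfN mfd (additive_funN (@ddD D)) !opprK.
  - move=> k x hx; have {}hx : @hd C (k + 0 + (s + 1)) x := hx; split; first split.
    + exact: hd0.
    + by apply: hdE hx _; lia.
    + by apply: hdN; apply: mfhd; apply: hdE hx _; lia.
exists g, h, (fun z => ((0, 0), z.1.1)); split.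
- split=> [[[x y] w] [[x' y'] w']|t j [[x y] w] _]; apply: pairE => //=.
    by apply: pairE; rewrite /= addr0.
  by apply: pairE; rewrite /= (additive_fun0 (opD _ _)).
- move=> k [[x y] w] /= [[hx hy] hw]; split; first by split; exact: hd0.
  by apply: hdE hx _; lia.
- move=> [[x y] w] /=; apply: pairE => /=; last by zlin.
  apply: pairE => /=; rewrite ?mf0 ?(additive_fun0 (@ddD C)) ?(additive_fun0 (@ddD D)); zlin.
Qed.
End ConeInc.

Lemma lmap_dd e l (C D : cx) (f : C -> D) x : linl f ->
  dd (lmap e l f x) = lsign e (lmap e l f (dd x)) + lmap (~~ e) l (ddiff e f) x.
Proof.
move=> [fD fl]; have fN := additive_funN fD; have {}fl j y : f (op true j y) = op true j (f y).
  by rewrite fl.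
case: l x => [[] [a b]] /=.
  move=> [x [y z]]; case: e; rewrite /tmap /ddiff /= !(fD, fN, fl);
    by do ?apply: pairE => /=; cxlin D.
by move=> [y z]; case: e; rewrite /bmap /ddiff /=; apply: pairE => /=; cxlin D.
Qed.

Lemma linl_capf e A (C D : cx) (f : C -> D) : linl f -> linl (capf e A f).
Proof. by move=> fl; apply: capf_lin fl; exact: okl_sub. Qed.

Lemma capf_d e A (C D : cx) (f : C -> D) x : linl f ->
  dd (capf e A f x) = lsign e (capf e A f (dd x)) + capf (~~ e) A (ddiff e f) x.
Proof.
move=> fl; elim: A x => [|l A ih] x; first by rewrite /= /ddiff addrC subrK.
rewrite /= lmap_dd; last exact: linl_capf.
by congr (_ + _); apply: lmap_ext => y; rewrite /ddiff ih addrC addKr.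
Qed.

Lemma op_false_capf j A (C : cx) (x : capp A C) :
  op false j x = capf false A (@op C false j) x.
Proof.
elim: A x => [//|l A ih] x /=.
rewrite (_ : op false j x = lmap false l (@op (capp A C) false j) x).
  by apply: lmap_ext => y; exact: ih.
by case: l x => [[] [a b]] /=.
Qed.

Lemma lmap_par l (C D : cx) (f f' : C -> D) :
  (forall k x, hd k x -> f' x = lsign (odd (absz k)) (f x)) ->
  forall k x, hd k x -> lmap true l f' x = lsign (odd (absz k)) (lmap false l f x).
Proof.
move=> h k x; case: l x => [[] [a b]] /=.
  move=> [x [y z]] [hx [hy hz]]; rewrite /tmap /= (h _ _ hx) (h _ _ hy) (h _ _ hz).
  have -> : odd (absz (k + 0 + 1)) = ~~ odd (absz k) by clear; lia.
  by case: (odd (absz k)); rewrite /= ?opprK.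
by move=> [y z] [hy hz]; rewrite /bmap /= (h _ _ hy) (h _ _ hz); case: (odd (absz k)).
Qed.

Program Definition csf (A : seq letter) : sfun :=
  @Sfun (capp A) (fun e C D f => @capf e A C D f) _ _ _ _ _ _ _ _ _.
Next Obligation. by move=> A e C D f g; exact: capf_ext. Qed.
Next Obligation. by move=> A e e' C D E g f x; exact: capf_comp. Qed.
Next Obligation. by move=> A C x; exact: capf_id. Qed.
Next Obligation. by move=> A e C D f g x; exact: capf_addf. Qed.
Next Obligation. by move=> A e C D f x; exact: capf_oppf. Qed.
Next Obligation. by move=> A S e C D f h; apply: capf_lin; exact: okl_sub. Qed.
Next Obligation. by move=> A e C D f x; exact: capf_d. Qed.
Next Obligation. by move=> A s e C D f; exact: capf_hd. Qed.
Next Obligation.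
by move=> A C D f f' h; elim: A => [//|l A ih] k x; exact: lmap_par.
Qed.

Program Definition scomp (F G : sfun) : sfun :=
  @Sfun (fun C => F (G C)) (fun e C D f => fm F e (fm G e f)) _ _ _ _ _ _ _ _ _.
Next Obligation. by move=> F G e C D f g E; apply: fm_ext; exact: fm_ext. Qed.
Next Obligation.
move=> F G e e' C D E g f x gl /=; rewrite fm_comp; last exact: fm_linl.
by apply: fm_ext => y; exact: fm_comp.
Qed.
Next Obligation.
move=> F G C x /=; rewrite -[RHS](fm_id x); apply: fm_ext => y; exact: fm_id.
Qed.
Next Obligation.
move=> F G e C D f g x /=; rewrite -fm_addf; apply: fm_ext => y; exact: fm_addf.
Qed.
Next Obligation.
move=> F G e C D f x /=; rewrite -fm_oppf; apply: fm_ext => y; exact: fm_oppf.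
Qed.
Next Obligation. by move=> F G S e C D f h fl; do 2!apply: fm_lin => //. Qed.
Next Obligation.
move=> F G e C D f x fl /=; rewrite fm_d; last exact: fm_linl.
congr (_ + _); apply: fm_ext => y; rewrite /ddiff fm_d //.
by rewrite addrC addKr.
Qed.
Next Obligation. by move=> F G s e C D f h; do 2!apply: fm_hd. Qed.
Next Obligation.
by move=> F G C D f f' h; apply: fm_par; exact: fm_par.
Qed.

Definition opfs (F : sfun) := forall (C : cx) j (x : F C),
  op false j x = fm F false (@op C false j) x.
Lemma opfs_csf A : opfs (csf A). Proof. by move=> C j x; exact: op_false_capf. Qed.
Lemma opfs_scomp F G : opfs F -> opfs G -> opfs (scomp F G).
Proof.
by move=> hF hG C j x; rewrite /= hF; apply: fm_ext => y; exact: hG.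
Qed.

(** P lives in degree 0, so an element of F P owes its degree to F alone, and the Koszul sign is
    determined by this degree. *)
Lemma fm_parity (F : sfun) (P Q : cx) (g : P -> Q) k x :
  (forall i (p : P), hd i p -> i = 0 \/ p = 0) -> additive_fun g -> hd k x ->
  fm F true g x = lsign (odd (absz k)) (fm F false g x).
Proof.
move=> P0 gD; apply: fm_par => i p /P0 [->|->] //.
by rewrite (additive_fun0 gD); case: odd; rewrite /= ?oppr0.
Qed.

(** * Polynomials, their action on complexes, and the unit complex *)

Section LinearExtension.
Variables (K : nat) (M : zmodType).
Implicit Types (h : 'X_{1..K} -> M) (p q : {mpoly int[K]}).

Definition lext h p : M := \sum_(m <- msupp p) h m *~ p@_m.

Lemma lextE h p (s : seq 'X_{1..K}) : uniq s -> {subset msupp p <= s} ->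
  lext h p = \sum_(m <- s) h m *~ p@_m.
Proof.
move=> us sp; rewrite /lext -(@big_uniq_sub _ _ (msupp p) s) //.
by move=> m /memN_msupp_eq0 ->; rewrite mulr0z.
Qed.

Lemma lextD h : additive_fun (lext h).
Proof.
move=> p q; pose s := undup (msupp p ++ msupp q).
have us : uniq s by exact: undup_uniq.
rewrite !(@lextE h _ s) //; try by move=> m mp; rewrite mem_undup mem_cat mp ?orbT.
  by rewrite -big_split; apply: eq_bigr => m _; rewrite mcoeffD mulrzDr.
by move=> m /msuppD_le; rewrite mem_undup.
Qed.

Lemma lextX h m : lext h 'X_[m] = h m.
Proof. by rewrite /lext msuppX big_seq1 mcoeffX eqxx mulr1z. Qed.

Lemma mpoly_span (Q : {mpoly int[K]} -> Prop) : Q 0 ->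
  (forall p q, Q p -> Q q -> Q (p - q)) -> (forall m, Q 'X_[m]) -> forall p, Q p.
Proof.
move=> Q0 QB QX; have QN p : Q p -> Q (- p) by move=> h; rewrite -sub0r; exact: QB.
have QD p q : Q p -> Q q -> Q (p + q).
  by move=> hp hq; rewrite -[q]opprK; apply: QB => //; exact: QN.
elim/mpolyind => // c m p _ _; apply: (QD).
have QMn k : Q ('X_[m] *+ k).
  by elim: k => [//|k ih]; rewrite mulrS; apply: (QD).
have -> : c *: 'X_[m] = 'X_[m] *~ c by rewrite -[c in LHS]intz scaler_int.
case: c => k; [exact: QMn | rewrite NegzE mulrNz; exact: QN (QMn _)].
Qed.

Lemma mpoly_eqf (f g : {mpoly int[K]} -> M) : additive_fun f -> additive_fun g ->
  (forall m, f 'X_[m] = g 'X_[m]) -> f =1 g.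
Proof.
move=> fD gD e; apply: mpoly_span => // [|p q hp hq].
- by rewrite (additive_fun0 fD) (additive_fun0 gD).
- by rewrite (additive_funB fD) (additive_funB gD) hp hq.
Qed.
End LinearExtension.

Section PolyAction.
Variables (K : nat) (C : cx).

Definition monact (m : 'X_{1..K}) (y : C) : C :=
  foldr (fun i z => iter (m i) (op true (val i)) z) y (enum 'I_K).

Lemma iter_opC t i n j (y : C) : iter n (op t i) (op true j y) = op true j (iter n (op t i) y).
Proof. by elim: n => [//|n ih] /=; rewrite ih opC. Qed.

Lemma monactU m i y : monact (U_(i) + m) y = op true (val i) (monact m y).
Proof.
rewrite /monact; have := enum_uniq 'I_K; have := mem_enum 'I_K i.
rewrite inE /=; elim: (enum _) => [//|j s ih] /=; rewrite inE.
rewrite mnmDE mnm1E iterD; case: (eqVneq i j) => [<-|ij] /=.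
  move=> _ /andP[is_ us]; congr op; congr (iter _ _ _).
  elim: s is_ {us ih} => [//|j' s ih] /=; rewrite inE negb_or => /andP[ij' /ih ->].
  by rewrite mnmDE mnm1E (negPf ij').
by move=> h /andP[_ us]; rewrite ih // iter_opC.
Qed.

Lemma monact0 y : monact 0 y = y.
Proof.
by rewrite /monact; elim: (enum _) => [//|j s ih] /=; rewrite ih mnm0E.
Qed.

Definition mact (p : {mpoly int[K]}) (y : C) : C := lext (monact ^~ y) p.

Lemma mactDl y : additive_fun (mact ^~ y).
Proof. exact: lextD. Qed.
Lemma mact1 y : mact 1 y = y.
Proof. by rewrite -mpolyX0 /mact lextX monact0. Qed.
Lemma mactX i p y : mact ('X_i * p) y = op true (val i) (mact p y).
Proof.
move: p; apply: (mpoly_eqf (f := fun p => mact ('X_i * p) y)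
  (g := fun p => op true (val i) (mact p y))).
- by move=> p q; rewrite mulrDr mactDl.
- by move=> p q; rewrite mactDl opD.
- by move=> m; rewrite -mpolyXD /mact !lextX monactU.
Qed.
End PolyAction.

Lemma monact_nat K (C D : cx) (f : C -> D) m y : linl f ->
  f (@monact K C m y) = monact m (f y).
Proof.
move=> [fD fl]; rewrite /monact; elim: (enum _) => [//|j s /= <-].
by elim: (m j) => [//|k ih] /=; rewrite fl // ih.
Qed.
Lemma mact_nat K (C D : cx) (f : C -> D) p y : linl f ->
  f (@mact K C p y) = mact p (f y).
Proof.
move=> fl; move: p; apply: (mpoly_eqf (f := fun p => f (mact p y))).
- by move=> p q; rewrite mactDl fl.1.
- exact: mactDl.
- by move=> m; rewrite /mact !lextX monact_nat.
Qed.
Lemma linl_op (C : cx) t j : linl (@op C t j).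
Proof. by split=> [|t' j' x _]; [exact: opD | exact: opC]. Qed.
Lemma linl_dd (C : cx) : linl (@dd C).
Proof. by split=> [|t' j' x _]; [exact: ddD | rewrite opdd]. Qed.
Lemma mactDr K (C : cx) p : additive_fun (@mact K C p).
Proof.
move=> x y; move: p.
apply: (mpoly_eqf (f := fun p => mact p (x + y)) (g := fun p => mact p x + mact p y)).
- exact: mactDl.
- by move=> p q; rewrite !mactDl; zlin.
move=> m; rewrite /mact !lextX /monact; elim: (enum _) => [//|j s /= ->].
by elim: (m j) => [//|k ih] /=; rewrite ih opD.
Qed.
Lemma mact_op K (C : cx) t j p y : op t j (@mact K C p y) = mact p (op t j y).
Proof. exact: mact_nat (linl_op C t j). Qed.
Lemma mact_dd K (C : cx) p y : dd (@mact K C p y) = mact p (dd y).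
Proof. exact: mact_nat (linl_dd C). Qed.
Lemma mact_hd K (C : cx) k p y : hd k y -> hd k (@mact K C p y).
Proof.
move=> hy; rewrite /mact /lext; apply: big_ind; [exact: hd0|by move=> *; exact: hdD|].
move=> m _; have h : hd k (monact m y).
  rewrite /monact; elim: (enum _) => [//|j s /= ih].
  by elim: (m j) => [//|n ihn] /=; apply: hdop.
have hn n : hd k (monact m y *+ n).
  by elim: n => [|n ih]; [exact: hd0 | rewrite mulrS; exact: hdD].
case: (p@_m) => n; [exact: hn | rewrite NegzE mulrNz; apply: hdN; exact: hn].
Qed.

Section Base.
Variable K : nat.

(** Indices from K on act by zero. This default is what the conditions [okK] and the truncation [tr]
    below take care of. *)
Definition Uop (j : nat) (p : {mpoly int[K]}) : {mpoly int[K]} :=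
  if insub j is Some i then 'X_i * p else 0.

Lemma UopD j : additive_fun (Uop j).
Proof. by move=> p q; rewrite /Uop; case: insub => [i|]; rewrite ?mulrDr ?addr0. Qed.
Lemma UopC i j p : Uop i (Uop j p) = Uop j (Uop i p).
Proof.
by rewrite /Uop; case: (insub i) => [a|]; case: (insub j) => [b|];
  rewrite ?mulr0 // mulrCA.
Qed.
Lemma UopE (i : 'I_K) p : Uop (val i) p = 'X_i * p.
Proof. by rewrite /Uop valK. Qed.

(* Z[x_1, ..., x_K] as a bimodule over itself, in degree 0 *)
Program Definition U : cx := @Cx {mpoly int[K]} (fun _ => Uop) (fun=> 0)
  (fun k p => k = 0 \/ p = 0) _ _ _ _ _ _ _ _ _.
Next Obligation. by move=> t j; exact: UopD. Qed.
Next Obligation. by move=> p q; rewrite addr0. Qed.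
Next Obligation. by move=> t i t' j p; exact: UopC. Qed.
Next Obligation. by move=> t j p; exact: additive_fun0 (UopD j). Qed.
Next Obligation. by []. Qed.
Next Obligation. by right. Qed.
Next Obligation.
by move=> k p q [|->]; [left | move=> [|->]; [left|right; rewrite subr0]].
Qed.
Next Obligation. by move=> t j k p [|->]; [left|right; exact: additive_fun0 (UopD j)]. Qed.
Next Obligation. by right. Qed.

Lemma bnded_U : bnded U.
Proof. by move=> k p k0 [k1|//]; rewrite k1 in k0. Qed.

Definition mdrop (c : 'I_K) (m : 'X_{1..K}) : {mpoly int[K]} :=
  if m c is _.+1 then 'X_[m - U_(c)] else 0.
Definition Ddiv (c : 'I_K) (p : U) : U := lext (mdrop c) p.

Lemma Ddiv_add c : additive_fun (Ddiv c). Proof. exact: lextD. Qed.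
Lemma Ddiv_X c p : Ddiv c ('X_c * p) = p.
Proof.
move: p; apply: (mpoly_eqf (f := fun p => Ddiv c ('X_c * p)) (g := id)) => //.
  by move=> p q; rewrite mulrDr Ddiv_add.
move=> m; rewrite -mpolyXD /Ddiv lextX /mdrop mnmDE mnm1E eqxx add1n.
by congr 'X_[_]; apply/mnmP => i; rewrite mnmBE mnmDE addKn.
Qed.
Lemma Ddiv_op c i p : i != c -> Ddiv c ('X_i * p) = 'X_i * Ddiv c p.
Proof.
move=> ic; move: p.
apply: (mpoly_eqf (f := fun p => Ddiv c ('X_i * p)) (g := fun p => 'X_i * Ddiv c p)).
- by move=> p q; rewrite mulrDr Ddiv_add.
- by move=> p q; rewrite Ddiv_add mulrDr.
move=> m; rewrite -mpolyXD /Ddiv !lextX /mdrop mnmDE mnm1E (negPf ic) add0n.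
case mc: (m c) => [|k]; first by rewrite mulr0.
rewrite -mpolyXD; congr 'X_[_]; apply/mnmP => j.
rewrite !(mnmBE, mnmDE, mnm1E); case: (eqVneq c j) => [e|]; last by rewrite !subn0.
by rewrite -e mc (negPf ic).
Qed.
Lemma Ddiv_nil c p : exists N, iter N (Ddiv c) p = 0.
Proof.
have D0 n : iter n (Ddiv c) 0 = 0 by exact: iter0 (Ddiv_add c).
move: p; apply: (@mpoly_span K (fun p => exists N, iter N (Ddiv c) p = 0)).
  by exists 0%N.
- move=> p q [N hN] [N' hN']; exists (N' + N)%N.
  have DB := additive_funB (iter_add (N' + N) (Ddiv_add c)).
  by rewrite DB iterD hN D0 addnC iterD hN' D0 subr0.
move=> m; move: {2}(m c) (leqnn (m c)) => n; elim: n m => [|n ih] m mn.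
  by exists 1%N; rewrite /= /Ddiv lextX /mdrop; move: mn; rewrite leqn0 => /eqP ->.
case mc : (m c) => [|k]; first by exists 1%N; rewrite /= /Ddiv lextX /mdrop mc.
have [|N hN] := ih (m - U_(c))%MM.
  by rewrite mnmBE mnm1E eqxx mc; rewrite mc in mn; lia.
by exists N.+1; rewrite iterSr /Ddiv lextX /mdrop mc.
Qed.

Lemma freel_U c (hc : (c < K)%N) : @freel c U (Ddiv (Ordinal hc)).
Proof.
have opE t p : @op U t c p = 'X_(Ordinal hc) * p by exact: (UopE (Ordinal hc)).
split=> //.
- exact: Ddiv_add.
- move=> t j p jc /=; rewrite /Uop; case: insubP => [i _ ij|_].
    by apply: Ddiv_op; apply: contra jc => /eqP e; rewrite -ij e.
  exact: additive_fun0 (Ddiv_add _).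
- by move=> p; exact: additive_fun0 (Ddiv_add _).
- by move=> k p [->|->]; [left|right; exact: additive_fun0 (Ddiv_add _)].
- by move=> p; rewrite opE; exact: Ddiv_X.
- exact: Ddiv_nil.
Qed.

Lemma U_mact (C : cx) (y : C) t j p : (j < K)%N ->
  @mact K C (@op U t j p) y = op true j (mact p y).
Proof. by move=> hj; rewrite -(mactX (Ordinal hj)) -UopE. Qed.
Lemma U_mact_big (C : cx) (y : C) t j p : (K <= j)%N -> @mact K C (@op U t j p) y = 0.
Proof.
move=> hj; rewrite /= /Uop insubF ?(additive_fun0 (mactDl y)) //.
by apply: negbTE; rewrite -leqNgt.
Qed.

End Base.

(** * Renaming the strands *)

Section Relabel.
Variables (s : nat -> nat).
Hypothesis sI : injective s.

Program Definition cxre (C : cx) : cx := @Cx C (fun t j => op t (s j)) (@dd C) (@hd C)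
  _ _ _ _ _ _ _ _ _.
Next Obligation. by move=> C t j; exact: opD. Qed.
Next Obligation. by move=> C; exact: ddD. Qed.
Next Obligation. by move=> C *; exact: opC. Qed.
Next Obligation. by move=> C *; exact: opdd. Qed.
Next Obligation. by move=> C; exact: dd0. Qed.
Next Obligation. by move=> C; exact: hd0. Qed.
Next Obligation. by move=> C; exact: hdB. Qed.
Next Obligation. by move=> C t j; exact: hdop. Qed.
Next Obligation. by move=> C; exact: hddd. Qed.

Definition lre (l : letter) : letter := (l.1, (s l.2.1, s l.2.2)).

Let sE i j : (s i == s j) = (i == j). Proof. exact: inj_eq. Qed.

Lemma lapp_re l (C : cx) : heq (lapp l (cxre C)) (cxre (lapp (lre l) C)).
Proof.
case: l => [[] [a b]] /=.
- have @f : cmor 0 (tT a b (cxre C)) (cxre (tT (s a) (s b) C)).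
    refine (@Cmor 0 (tT a b (cxre C)) (cxre (tT (s a) (s b) C)) (fun z => z) _ _ _ _) => //.
    + by move=> t j z /=; rewrite /bB_op !sE.
    + by move=> k z; rewrite addr0.
  have @g : cmor 0 (cxre (tT (s a) (s b) C)) (tT a b (cxre C)).
    refine (@Cmor 0 (cxre (tT (s a) (s b) C)) (tT a b (cxre C)) (fun z => z) _ _ _ _) => //.
    + by move=> t j z /=; rewrite /bB_op !sE.
    + by move=> k z; rewrite addr0.
  exact: (@heq_inv _ _ f g).
- have @f : cmor 0 (bB a b (cxre C)) (cxre (bB (s a) (s b) C)).
    refine (@Cmor 0 (bB a b (cxre C)) (cxre (bB (s a) (s b) C)) (fun z => z) _ _ _ _) => //.
    + by move=> t j z /=; rewrite /bB_op !sE.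
    + by move=> k z; rewrite addr0.
  have @g : cmor 0 (cxre (bB (s a) (s b) C)) (bB a b (cxre C)).
    refine (@Cmor 0 (cxre (bB (s a) (s b) C)) (bB a b (cxre C)) (fun z => z) _ _ _ _) => //.
    + by move=> t j z /=; rewrite /bB_op !sE.
    + by move=> k z; rewrite addr0.
  exact: (@heq_inv _ _ f g).
Qed.

Lemma capp_re A (C : cx) : heq (capp A (cxre C)) (cxre (capp (map lre A) C)).
Proof.
elim: A => [|l A ih] /=; first exact: heq_refl.
exact: heq_trans (heq_lapp l ih) (lapp_re l _).
Qed.

Lemma van_re L k (C : cx) : van (map s L) k C -> van L k (cxre C).
Proof.
pose F := fix F (L : seq nat) : kosT L C -> kosT (map s L) C :=
  match L with [::] => id | c :: L' => fun z => (F L' z.1, F L' z.2) end.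
pose G := fix G (L : seq nat) : kosT (map s L) C -> kosT L C :=
  match L with [::] => id | c :: L' => fun z => (G L' z.1, G L' z.2) end.
have FG L' z : F L' (G L' z) = z by elim: L' z => [//|c L' ih] [x y] /=; rewrite !ih.
have GF L' z : G L' (F L' z) = z by elim: L' z => [//|c L' ih] [x y] /=; rewrite !ih.
have FD L' : additive_fun (F L').
  by elim: L' => [//|c L' ih] [x y] [x' y'] /=; rewrite !ih.
have GD L' : additive_fun (G L').
  by elim: L' => [//|c L' ih] [x y] [x' y'] /=; rewrite !ih.
have Fm L' (f : C -> C) z : F L' (kosm L' f z) = kosm (map s L') f (F L' z).
  by elim: L' z => [//|c L' ih] [x y] /=; rewrite !ih.
have Fl L' z : F L' (@kdel L' (cxre C) z) = @kdel (map s L') C (F L' z).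
  elim: L' z => [//|c L' ih] [x y] /=; rewrite (additive_funB (FD L')) !ih.
  by congr (_, _ - _); exact: (Fm L' (@phi C (s c))).
have Fh L' j z : @khd L' (cxre C) j z <-> @khd (map s L') C j (F L' z).
  by elim: L' z => [//|c L' ih] [x y] /=; rewrite !ih.
move=> v z [/Fh hz lz [g hg e]]; rewrite /= in lz e.
have [|x [y [hx hy lx ez]]] := v (F L z).
  split=> //=.
    by rewrite -Fl lz (additive_fun0 (FD L)).
  by exists (F L g); [exact/Fh | rewrite /= -Fm -Fl; congr (F L _)].
exists (G L x), (G L y); split.
- by apply/Fh; rewrite FG.
- by apply/Fh; rewrite FG.
- rewrite /= -[LHS]GF Fl FG; have -> : kdel (map s L) x = 0 by exact: lx.
  exact: additive_fun0 (GD L).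
- apply: (can_inj (GF L)); rewrite ez FD; congr (_ + _).
    by rewrite [RHS](Fm L (@dd C)) FG.
  by rewrite [RHS]Fl FG.
Qed.

End Relabel.
Section RelabelU.
Variables (K : nat) (p : 'S_K).

Definition nperm (j : nat) : nat := if insub j is Some i then val (p i) else j.

Lemma nperm_ord (i : 'I_K) : nperm (val i) = val (p i).
Proof. by rewrite /nperm valK. Qed.
Lemma nperm_big j : (K <= j)%N -> nperm j = j.
Proof. by move=> h; rewrite /nperm insubF // ltnNge h. Qed.

Lemma nperm_inj : injective nperm.
Proof.
move=> i j; case: (ltnP i K) => hi; case: (ltnP j K) => hj.
- rewrite -[i]/(val (Ordinal hi)) -[j]/(val (Ordinal hj)) !nperm_ord.
  by move=> /val_inj /perm_inj ->.
- rewrite -[i]/(val (Ordinal hi)) nperm_ord (nperm_big hj) => e.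
  by have := ltn_ord (p (Ordinal hi)); rewrite e; lia.
- rewrite -[j]/(val (Ordinal hj)) nperm_ord (nperm_big hi) => e.
  by have := ltn_ord (p (Ordinal hj)); rewrite -e; lia.
- by rewrite !nperm_big.
Qed.

Lemma heq_U_re : heq (U K) (cxre nperm (U K)).
Proof.
have sX (i : 'I_K) (q : {mpoly int[K]}) : msym p ('X_i * q) = 'X_(p i) * msym p q.
  rewrite msymM msymX; congr ('X_[_] * _); apply/mnmP => j.
  by rewrite mnmE !mnm1E -(inj_eq (@perm_inj _ p) i) permKV.
have sX' (i : 'I_K) (q : {mpoly int[K]}) :
    msym (p^-1)%g ('X_(p i) * q) = 'X_i * msym (p^-1)%g q.
  rewrite msymM msymX; congr ('X_[_] * _); apply/mnmP => j.
  by rewrite mnmE !mnm1E invgK (inj_eq (@perm_inj _ p)).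
have @f : cmor 0 (U K) (cxre nperm (U K)).
  refine (@Cmor 0 (U K) (cxre nperm (U K)) (msym p) _ _ _ _).
  - by move=> x y; exact: raddfD.
  - move=> t j q /=; case: (ltnP j K) => hj.
      rewrite -[j]/(val (Ordinal hj)) nperm_ord !UopE; exact: sX.
    by rewrite nperm_big // /Uop insubF ?raddf0 // ltnNge hj.
  - by move=> q; exact: raddf0.
  - by move=> k q; rewrite addr0 => -[->|->]; [left|right; exact: raddf0].
have @g : cmor 0 (cxre nperm (U K)) (U K).
  refine (@Cmor 0 (cxre nperm (U K)) (U K) (msym (p^-1)%g) _ _ _ _).
  - by move=> x y; exact: raddfD.
  - move=> t j q /=; case: (ltnP j K) => hj.
      rewrite -[j]/(val (Ordinal hj)) nperm_ord !UopE; exact: sX'.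
    by rewrite nperm_big // /Uop insubF ?raddf0 // ltnNge hj.
  - by move=> q; exact: raddf0.
  - by move=> k q; rewrite addr0 => -[->|->]; [left|right; exact: raddf0].
apply: (@heq_inv _ _ f g) => q /=.
- by rewrite -msymMm mulgV msym1m.
- by rewrite -msymMm mulVg msym1m.
Qed.

Lemma van_relabel L k A :
  van (map nperm L) k (capp (map (lre nperm) A) (U K)) -> van L k (capp A (U K)).
Proof.
move=> h; apply/(van_heq _ _ (heq_capp A heq_U_re)).
by apply/(van_heq _ _ (capp_re nperm_inj A _)); apply: van_re.
Qed.
End RelabelU.

(** * Reordering the closed strands *)

Definition kper (L L' : seq nat) := exists (F : forall M : zmodType, kosT L M -> kosT L' M)
  (G : forall M : zmodType, kosT L' M -> kosT L M),
  [/\ [/\ forall M, additive_fun (F M), forall M z, G M (F M z) = z & forall M z, F M (G M z) = z],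
    forall (M N : zmodType) (f : M -> N) z, additive_fun f ->
      F N (kosm L f z) = kosm L' f (F M z),
    forall (C : cx) z, F C (@kdel L C z) = kdel L' (F C z) &
    forall (C : cx) k z, @khd L C k z <-> khd L' k (F C z)].

Lemma kper_refl L : kper L L.
Proof. by exists (fun _ => id), (fun _ => id); do !split. Qed.
Lemma kper_sym L L' : kper L L' -> kper L' L.
Proof.
move=> [F [G [[FD FG GF] Fm Fl Fh]]]; exists G, F; split.
- split=> // M x y; apply: (can_inj (FG M)); by rewrite FD !GF.
- by move=> M N f z fD; apply: (can_inj (FG N)); rewrite Fm // !GF.
- by move=> C z; apply: (can_inj (FG C)); rewrite Fl !GF.
- by move=> C k z; rewrite Fh GF.
Qed.
Lemma kper_trans L1 L2 L3 : kper L1 L2 -> kper L2 L3 -> kper L1 L3.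
Proof.
move=> [F [G [[FD FG GF] Fm Fl Fh]]] [F' [G' [[FD' FG' GF'] Fm' Fl' Fh']]].
exists (fun M x => F' M (F M x)), (fun M x => G M (G' M x)); split.
- by split=> [M x y|M z|M z]; rewrite ?FD ?FD' ?FG' ?GF ?FG ?GF'.
- by move=> M N f z fD; rewrite Fm // Fm'.
- by move=> C z; rewrite Fl Fl'.
- by move=> C k z; rewrite Fh Fh'.
Qed.
Lemma kper_cons c L L' : kper L L' -> kper (c :: L) (c :: L').
Proof.
move=> [F [G [[FD FG GF] Fm Fl Fh]]].
exists (fun M (x : kosT (c :: L) M) => (F M x.1, F M x.2)),
  (fun M (x : kosT (c :: L') M) => (G M x.1, G M x.2)); split.
- split=> [M x y|M [x y]|M [x y]] /=; rewrite ?FD ?FG ?GF //.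
- by move=> M N f [x y] fD /=; rewrite !Fm.
- move=> C [x y] /=; rewrite (additive_funB (FD C)) !Fl Fm //; exact: phiD.
- by move=> C k [x y] /=; rewrite !Fh.
Qed.
Lemma kper_swap c c' L : kper [:: c, c' & L] [:: c', c & L].
Proof.
exists (fun M (z : kosT [:: c, c' & L] M) => ((z.1.1, z.2.1), (z.1.2, - z.2.2))),
  (fun M (z : kosT [:: c', c & L] M) => ((z.1.1, z.2.1), (z.1.2, - z.2.2))); split.
- split.
  + by move=> M [[x1 x2] [x3 x4]] [[y1 y2] [y3 y4]] /=; rewrite opprD.
  + by move=> M [[x1 x2] [x3 x4]] /=; rewrite opprK.
  + by move=> M [[x1 x2] [x3 x4]] /=; rewrite opprK.
- move=> M N f [[x1 x2] [x3 x4]] fD /=; by rewrite (additive_funN (kosmD L fD)).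
- move=> C [[x1 x2] [x3 x4]] /=; rewrite (additive_funN (@kdelD L C)).
  by do !apply: pairE => //=; zlin.
- move=> C k [[x1 x2] [x3 x4]] /=; split=> -[[h1 h2] [h3 h4]]; do !split=> //.
    by apply: (@bhN (kosb L C)).
  by rewrite -[x4]opprK; apply: (@bhN (kosb L C)).
Qed.

Lemma kper_move c L1 L2 : kper (L1 ++ c :: L2) (c :: L1 ++ L2).
Proof.
elim: L1 => [|d L1 ih] /=; first exact: kper_refl.
exact: kper_trans (kper_cons d ih) (kper_swap _ _ _).
Qed.

Lemma kper_perm L L' : perm_eq L L' -> kper L L'.
Proof.
elim: L L' => [|c L ih] L' h.
  by move: h; rewrite perm_sym => /perm_nilP ->; exact: kper_refl.
have cL' : c \in L' by rewrite -(perm_mem h) mem_head.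
case/splitPr: cL' h => L1 L2 h.
have {}h : perm_eq L (L1 ++ L2).
  rewrite -(perm_cons c); apply: (perm_trans h).
  by rewrite perm_catC /= perm_cons perm_catC.
exact: kper_trans (kper_cons c (ih _ h)) (kper_sym (kper_move _ _ _)).
Qed.

Lemma kper_van L L' k C : kper L L' -> van L' k C -> van L k C.
Proof.
move=> [F [G [[FD FG GF] Fm Fl Fh]]] v z [/Fh hz lz [g hg e]]; rewrite /= in lz e.
have [|x [y [hx hy lx ez]]] := v (F C z).
  split=> //=; first by rewrite -Fl lz (additive_fun0 (FD C)).
  by exists (F C g); [exact/Fh | rewrite /= -Fm ?e ?Fl //; exact: ddD].
exists (G C x), (G C y); split.
- by apply/Fh; rewrite GF.
- by apply/Fh; rewrite GF.
- by apply: (can_inj (FG C)); rewrite [LHS]Fl GF (additive_fun0 (FD C)).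
- apply: (can_inj (FG C)); rewrite ez FD; congr (_ + _).
    by rewrite [RHS]Fm ?GF //; exact: ddD.
  by rewrite [RHS]Fl GF.
Qed.

Lemma van_perm L L' k C : perm_eq L L' -> van L k C <-> van L' k C.
Proof.
move=> h; split; apply: kper_van; apply: kper_perm => //; by rewrite perm_sym.
Qed.

(** * Central elements as Koszul classes of degree zero *)

Fixpoint kfst (L : seq nat) (M : zmodType) : kosT L M -> M :=
  match L return kosT L M -> M with
  | [::] => id
  | _ :: L' => fun z => kfst z.1
  end.
Fixpoint kin (L : seq nat) (M : zmodType) (x : M) : kosT L M :=
  match L return kosT L M with
  | [::] => x
  | _ :: L' => (kin L' x, 0)
  end.
Arguments kfst {L M} z.

Lemma kfstD L (M : zmodType) : additive_fun (@kfst L M).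
Proof. by elim: L => [//|c L ih] [x y] [x' y'] /=; exact: ih. Qed.
Lemma kfst_kosm L (M N : zmodType) (f : M -> N) z : kfst (kosm L f z) = f (kfst z).
Proof. by elim: L z => [//|c L ih] [x y] /=; exact: ih. Qed.
Lemma kfst_kdel L (C : cx) (z : kosT L C) : kfst (kdel L z) = 0.
Proof. by elim: L z => [//|c L ih] [x y] /=; exact: ih. Qed.
Lemma kfst_kin L (M : zmodType) (x : M) : kfst (kin L x) = x.
Proof. by elim: L => [//|c L ih]. Qed.
Lemma kfst_hd L (C : cx) k (z : kosT L C) : khd L k z -> hd k (kfst z).
Proof. by elim: L z => [//|c L ih] [x y] /= [/ih]. Qed.
Lemma kfst_central L (C : cx) (z : kosT L C) c : kdel L z = 0 -> c \in L ->
  phi c (kfst z) = 0.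
Proof.
elim: L z => [//|c' L ih] [x y] /= [e1 e2]; rewrite inE => /orP[/eqP ->|]; last exact: ih.
rewrite -kfst_kosm; have -> : kosm L (@phi C c') x = kdel L y by zlin e2.
exact: kfst_kdel.
Qed.
Lemma kin_kosm L (M N : zmodType) (f : M -> N) x : additive_fun f ->
  kosm L f (kin L x) = kin L (f x).
Proof.
move=> fD; elim: L => [//|c L ih] /=; rewrite ih; congr pair.
exact: additive_fun0 (kosmD L fD).
Qed.
Lemma kin0 L (M : zmodType) : kin L (0 : M) = 0.
Proof. by elim: L => [//|c L ih] /=; rewrite ih. Qed.
Lemma kin_kdel L (C : cx) (x : C) : (forall c, c \in L -> phi c x = 0) ->
  kdel L (kin L x) = 0.
Proof.
elim: L => [//|c L ih] h /=; rewrite ih; last by move=> d dL; apply: h; rewrite inE dL orbT.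
rewrite (additive_fun0 (@kdelD L C)) subr0 kin_kosm; last exact: phiD.
by rewrite h ?mem_head // kin0.
Qed.
Lemma kin_hd L (C : cx) k (x : C) : hd k x -> khd L k (kin L x).
Proof. by move=> h; elim: L => [//|c L ih] /=; split=> //; exact: (@bh0 (kosb L C)). Qed.

(** On a strand that acts equally from both sides the Koszul factor has zero differential, leaving
    two copies of the same complex. *)
Lemma van_free c L k (C : cx) : (forall x : C, phi c x = 0) ->
  van L k C -> van (c :: L) k C.
Proof.
move=> h v; have m0 z : kosm L (@phi C c) z = 0.
  by rewrite -[RHS](kosm_zero L C z); exact: kosm_ext.
have kN z : kdel L (- z) = - @kdel L C z by exact: (additive_funN (@kdelD L C)).
have dN z : kosm L (@dd C) (- z) = - kosm L (@dd C) z.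
  exact: (additive_funN (kosmD L (@ddD C))).
move=> [x y] [[/= hx hy] []]; rewrite m0 sub0r => lx ly [[g1 g2] [/= hg1 hg2] []].
rewrite m0 sub0r => e1 e2.
have [|a [b [ha hb la ex]]] := v x; first by split=> //; exists g1.
have [|a' [b' [ha' hb' la' ey]]] := v y.
  split=> //; first by apply: oppr_inj; rewrite oppr0.
  by exists (- g2); [exact: (@bhN (kosb L C)) | rewrite [RHS]kN].
exists (a, a'), (b, - b'); split.
- by [].
- by split=> //=; exact: (@bhN (kosb L C)).
- by apply: pairE => //=; rewrite m0 sub0r [kdel L a']la' oppr0.
- by apply: pairE => //=; rewrite m0 sub0r kN opprK.
Qed.

(* The maps y |-> W(kap y)(x) given by a central element x of W(P).            *)
Section CentralMap.
Variables (W : sfun) (P Y Q : cx) (kap : Y -> P -> Q).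
Hypothesis Wop : opfs W.
Hypothesis kD : forall p, additive_fun (kap ^~ p).
Hypothesis kl : forall y, linl (kap y).
Hypothesis kX : forall j y p, kap (op true j y) p = kap y (op false j p).
Hypothesis kY : forall j y p, kap (op false j y) p = op false j (kap y p).
Hypothesis kd : forall y p, kap (dd y) p = dd (kap y p) - kap y (dd p).
Hypothesis kh : forall i k y p, hd i y -> hd k p -> hd (i + k) (kap y p).
Variable x : W P.
Hypothesis xc : forall j, op true j x = op false j x.

Definition cz e (y : Y) : W Q := fm W e (kap y) x.

Lemma czD e : additive_fun (cz e).
Proof. by move=> y y'; rewrite /cz -fm_addf; apply: fm_ext => p; exact: kD. Qed.

Lemma cz_op e t j y : cz e (op t j y) = op t j (cz e y).
Proof.
case: t; rewrite /cz.
  rewrite (@fm_ext W e _ _ _ _ (kX j y) x) -[e in LHS]addbF.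
  rewrite -(@fm_comp W e false P P Q (kap y) (op false j) x (kl y)).
  by rewrite -Wop -xc (fm_linl W e (kl y)).2.
rewrite (@fm_ext W e _ _ _ _ (kY j y) x) Wop fm_comp //.
exact: linl_op.
Qed.

Lemma cz_lin e : lin aS (cz e).
Proof. by split=> [|t j y _]; [exact: czD | exact: cz_op]. Qed.

Lemma cz_d y : dd (cz false y) = fm W false (kap y) (dd x) + cz true (dd y).
Proof.
rewrite /cz fm_d //; congr (_ + _); apply: fm_ext => p.
by rewrite kd /ddiff.
Qed.

Lemma cz_hd e k i y : hd k x -> hd i y -> hd (i + k) (cz e y).
Proof.
move=> hx hy; apply: (@fm_hd W (- i)); last by apply: hdE hx _; lia.
by move=> j p hp; apply: hdE (kh hy hp) _; lia.
Qed.
End CentralMap.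

Section Trunc.
Variable K : nat.

Definition okK (Y : cx) := forall t j (y : Y), (K <= j)%N -> op t j y = 0.

(** Multiplication by a central element of W(U K) is linear only on complexes where the strands from
    K on act by zero, as they do on [U K]. An [sfun] has to be defined on all complexes, so this
    action is forced. *)
Program Definition tr (C : cx) : cx :=
  @Cx C (fun t j x => if (j < K)%N then op t j x else 0) (@dd C) (@hd C)
  _ _ _ _ _ _ _ _ _.
Next Obligation. cbv beta; by move=> C t j x y; case: ifP => _; rewrite ?opD ?addr0. Qed.
Next Obligation. by move=> C; exact: ddD. Qed.
Next Obligation.
move=> C t i t' j x; case: (i < K)%N; case: (j < K)%N;
  rewrite ?(additive_fun0 (opD _ _)) //.
exact: opC.
Qed.
Next Obligation.
cbv beta; move=> C t j x; case: ifP => _; first exact: opdd.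
by rewrite (additive_fun0 (@ddD C)).
Qed.
Next Obligation. by move=> C; exact: dd0. Qed.
Next Obligation. by move=> C; exact: hd0. Qed.
Next Obligation. by move=> C; exact: hdB. Qed.
Next Obligation. cbv beta; by move=> C t j k x h; case: ifP => _; [exact: hdop | exact: hd0]. Qed.
Next Obligation. by move=> C; exact: hddd. Qed.

Lemma okK_tr C : okK (tr C).
Proof. by move=> t j y hj /=; rewrite ltnNge hj. Qed.

Lemma tr_lin (S : bool -> nat -> bool) (C D : cx) (f : C -> D) :
  lin S f -> lin S (f : tr C -> tr D).
Proof.
move=> [fD fl]; split=> // t j x Sj /=; case: ifP => _; first exact: fl.
exact: additive_fun0.
Qed.

Definition trin (C : cx) : C -> tr C := id.
Definition trout (C : cx) : tr C -> C := id.
Lemma trin_lin C : okK C -> lin aS (@trin C).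
Proof. by move=> h; split=> // t j x _; rewrite /trin /=; case: ltnP => // /h ->. Qed.
Lemma trout_lin C : okK C -> lin aS (@trout C).
Proof. by move=> h; split=> // t j x _; rewrite /trout /=; case: ltnP => // /h ->. Qed.

Lemma heq_tr C : okK C -> heq (tr C) C.
Proof.
move=> h; have [_ il] := trin_lin h; have [_ ol] := trout_lin h.
have @f : cmor 0 (tr C) C.
  by refine (@Cmor 0 (tr C) C (@trout C) _ (fun t j x => ol t j x isT) _ _) => // k x; rewrite addr0.
have @g : cmor 0 C (tr C).
  by refine (@Cmor 0 C (tr C) (@trin C) _ (fun t j x => il t j x isT) _ _) => // k x; rewrite addr0.
exact: (@heq_inv _ _ f g).
Qed.

Definition kletter (l : letter) := (l.2.1 < K)%N && (l.2.2 < K)%N.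

Lemma okK_capp A C : all kletter A -> okK C -> okK (capp A C).
Proof.
move=> + h; elim: A => [//|[[] [a b]] A ih] /= /andP[/andP[/= ha hb] /ih {}ih] t j.
  case=> x [y z] hj; have ja : j != a by apply: contraL hj => /eqP ->; rewrite -ltnNge.
  have jb : j != b by apply: contraL hj => /eqP ->; rewrite -ltnNge.
  by rewrite /= /bB_op (negPf ja) (negPf jb) !andbF /= !ih.
case=> y z hj; have ja : j != a by apply: contraL hj => /eqP ->; rewrite -ltnNge.
have jb : j != b by apply: contraL hj => /eqP ->; rewrite -ltnNge.
by rewrite /= /bB_op (negPf ja) (negPf jb) !andbF /= !ih.
Qed.

Lemma okK_U : okK (U K).
Proof. by move=> t j y hj; rewrite /= /Uop insubF // ltnNge hj. Qed.
End Trunc.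

Section CentralCone.
Variables (K : nat) (W : sfun) (s : int) (z0 : W (U K)).
Hypothesis Wop : opfs W.
Hypothesis sE : odd `|s|%N = false.
Hypothesis z0h : hd (- s) z0.
Hypothesis z0d : dd z0 = 0.
Hypothesis z0c : forall j, op true j z0 = op false j z0.

Definition ev (Y : cx) (y : Y) (p : U K) : Y := mact p y.

Lemma ev_linl (Y : cx) (y : Y) : okK K Y -> linl (ev y).
Proof.
move=> h; split=> [p q|[] // j p _]; first exact: mactDl.
case: (ltnP j K) => hj; first by rewrite /ev U_mact.
by rewrite /ev U_mact_big // h.
Qed.
Lemma ev_X (Y : cx) j (y : Y) p : okK K Y -> ev (op true j y) p = ev y (@op (U K) false j p).
Proof.
move=> h; case: (ltnP j K) => hj; first by rewrite /ev U_mact // mact_op.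
by rewrite /ev U_mact_big // h // (additive_fun0 (mactDr p)).
Qed.
Lemma ev_hd (Y : cx) i k (y : Y) (p : U K) : hd i y -> hd k p -> hd (i + k) (ev y p).
Proof.
move=> hy [->|->]; first by rewrite addr0; exact: mact_hd.
by rewrite /ev (additive_fun0 (mactDl y)); exact: hd0.
Qed.
Lemma ev_d (Y : cx) (y : Y) (p : U K) : ev (dd y) p = dd (ev y p) - ev y (dd p).
Proof. by rewrite /ev mact_dd (additive_fun0 (mactDl y)) subr0. Qed.
Lemma ev_nat (C D : cx) (f : C -> D) y p : linl f -> f (ev y p) = ev (f y) p.
Proof. exact: mact_nat. Qed.

(** Since [U K] is the unit, an element y is a left linear map from [U K] to Y, and W applied to it
    sends z0 to z0 ⊗ y. Centrality of z0 makes the result linear in y for both actions. *)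
Definition zfun (Y : cx) (y : Y) : W Y := fm W false (ev y) z0.

Lemma fm_even (Q : cx) (g : U K -> Q) e : additive_fun g -> fm W e g z0 = fm W false g z0.
Proof.
case: e => // gD; rewrite (fm_parity _ gD z0h); last by [].
by rewrite (_ : odd _ = false) //; lia.
Qed.

Section Zok.
Variables (Y : cx) (h : okK K Y).

Let lin_z : lin aS (@zfun Y).
Proof.
apply: (@cz_lin W (U K) Y Y (@ev Y)) => //.
- by move=> p y y'; exact: mactDr.
- by move=> y; exact: ev_linl.
- by move=> j y p; exact: ev_X.
- by move=> j y p; rewrite /ev mact_op.
Qed.

Program Definition zok : cmor s Y (W Y) := @Cmor s Y (W Y) (@zfun Y) _ _ _ _.
Next Obligation. exact: lin_z.1. Qed.
Next Obligation. by move=> t j y; exact: lin_z.2. Qed.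
Next Obligation.
move=> y; rewrite -[RHS]/(dd (cz (@ev Y) z0 false y)) cz_d; first last.
- exact: ev_d.
- by move=> y'; exact: ev_linl.
rewrite z0d (additive_fun0 (fm_linl W false (ev_linl y h)).1) add0r /cz.
by rewrite fm_even //; exact: mactDl.
Qed.
Next Obligation.
move=> k y hy; rewrite -[k](addrK s).
by apply: (@cz_hd W (U K) Y Y (@ev Y)) => //; exact: ev_hd.
Qed.
End Zok.

Definition Ecx (Y : cx) : cx := cone (zok (@okK_tr K Y)).
(** The summand C of the cone is shifted by the odd number s + 1, so an odd map changes sign on
    it. *)
Definition Efm e (C D : cx) (f : C -> D) (x : Ecx C) : Ecx D :=
  (fm W e (f : tr K C -> tr K D) x.1, lsign e (f x.2)).

Lemma linl_tr (C D : cx) (f : C -> D) : linl f -> linl (f : tr K C -> tr K D).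
Proof. exact: tr_lin. Qed.

Program Definition Esf : sfun := @Sfun Ecx Efm _ _ _ _ _ _ _ _ _.
Next Obligation.
move=> e C D f g E x; rewrite /Efm E; congr pair; exact: fm_ext.
Qed.
Next Obligation.
move=> e e' C D E g f x gl; rewrite /Efm /=; congr pair.
  by rewrite fm_comp //; exact: linl_tr.
by rewrite (lsign_fun _ _ gl.1); case: e; case: e'; rewrite /= ?opprK.
Qed.
Next Obligation. by move=> C [w y]; rewrite /Efm /=; congr pair; exact: fm_id. Qed.
Next Obligation.
by move=> e C D f g x; apply: pairE; rewrite /= ?lsignD // -fm_addf.
Qed.
Next Obligation.
by move=> e C D f x; apply: pairE; rewrite /= -?fm_oppf //; case: e.
Qed.
Next Obligation.
move=> S e C D f S1 fl; have fl' := @tr_lin K _ _ _ _ fl.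
have [gD gl] : lin S (fm W e (f : tr K C -> tr K D)) by exact: fm_lin.
split=> [x y|t j x Sj]; apply: pairE; rewrite /= ?gD ?gl ?fl.1 ?lsignD //.
have := fl'.2 t j x.2 Sj => /= ->.
by case: e {gD gl}; rewrite //= -?(additive_funN (@opD (tr K D) t j)).
Qed.
Next Obligation.
move=> e C D f [w y] fl; have fl' := linl_tr fl; have fN := additive_funN fl.1.
have s1 (x : Ecx D) : (lsign e x).1 = lsign e x.1 by case: (e).
have s2 (x : Ecx D) : (lsign e x).2 = lsign e x.2 by case: (e).
apply: pairE; rewrite /= ?s1 ?s2 /=; last first.
  by rewrite /ddiff; case: e {s1 s2}; rewrite /= !fN ?opprK; cxlin D.
rewrite fm_d // (fm_linl W e fl').1 lsignD -!addrA; congr (_ + _).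
rewrite addrC; congr (_ + _).
rewrite [in RHS]/zfun fm_comp // addbF fm_even; last first.
  by move=> p q; rewrite /ev mactDl fl.1.
have e1 : fm W false (fun p => (f : tr K C -> tr K D) (@ev (tr K C) y p)) z0 =
    @zfun (tr K D) (f y) by apply: fm_ext => p; exact: ev_nat.
rewrite e1; case: (e) => //=.
by rewrite -[LHS]/(zok (@okK_tr K D) (- f y)) mfN.
Qed.
Next Obligation.
move=> s' e C D f fh k [w y] /= [hw hy]; split.
  exact: (@fm_hd W s' e (tr K C) (tr K D)).
have {}hy : hd (k + s + 1) (f y) by apply: fh; apply: hdE hy _; lia.
by case: e => //; apply: hdN.
Qed.
Next Obligation.
move=> C D f f' h k [w y] /= [hw hy]; apply: pairE.
  rewrite /= (@fm_par W (tr K C) (tr K D) f f' h _ _ hw).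
  by case: (odd _).
rewrite /= (h _ _ hy) (_ : odd (absz (k + s + 1)) = ~~ odd (absz k)); last first.
  by move: sE; clear; lia.
by case: (odd (absz k)); rewrite /= ?opprK.
Qed.

Lemma heq_Ezok (Y : cx) (h : okK K Y) : heq (Ecx Y) (cone (zok h)).
Proof.
have il := trin_lin h; have ol := trout_lin h.
pose I := fm W false (@trin K Y); pose O := fm W false (@trout K Y).
have [ID Il] : lin aS I by exact: fm_aS.
have [OD Ol] : lin aS O by exact: fm_aS.
have d0 (x : Y) : ddiff false (@trin K Y) x = 0 by rewrite /ddiff /= subrr.
have d0' (x : tr K Y) : ddiff false (@trout K Y) x = 0 by rewrite /ddiff /= subrr.
have Id x : I (dd x) = dd (I x) by rewrite /I fm_d ?(fm_zero _ _ d0) ?addr0 //; exact: linl_aS.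
have Od x : O (dd x) = dd (O x) by rewrite /O fm_d ?(fm_zero _ _ d0') ?addr0 //; exact: linl_aS.
have OI x : O (I x) = x by rewrite /O /I fm_comp ?fm_id //; exact: linl_aS.
have IO x : I (O x) = x by rewrite /O /I fm_comp ?fm_id //; exact: linl_aS.
have Oz y : O (@zfun (tr K Y) y) = @zfun Y y.
  rewrite /O /zfun fm_comp; last exact: linl_aS.
  by apply: fm_ext => p; rewrite (@ev_nat (tr K Y) Y) //; exact: linl_aS.
have @f : cmor 0 (Ecx Y) (cone (zok h)).
  refine (@Cmor 0 (Ecx Y) (cone (zok h)) (fun x => (O x.1, x.2)) _ _ _ _).
  - by move=> x y; apply: pairE => //=; exact: OD.
  - by move=> t j x; apply: pairE => /=; [exact: Ol | exact: (ol.2 t j x.2 isT)].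
  - by move=> x; apply: pairE => //=; rewrite OD Od Oz.
  - move=> k [w y] /= [hw hy]; rewrite addr0 in hw hy; split=> //.
    by apply: (@fm_hd W 0) => [j p|]; rewrite addr0.
have @g : cmor 0 (cone (zok h)) (Ecx Y).
  refine (@Cmor 0 (cone (zok h)) (Ecx Y) (fun x => (I x.1, x.2)) _ _ _ _).
  - by move=> x y; apply: pairE => //=; exact: ID.
  - by move=> t j x; apply: pairE => /=; [exact: Il | exact: (il.2 t j x.2 isT)].
  - by move=> x; apply: pairE => //=; rewrite ID Id -Oz IO.
  - move=> k [w y] /= [hw hy]; rewrite addr0 in hw hy; split=> //.
    by apply: (@fm_hd W 0) => [j p|]; rewrite addr0.
apply: (@heq_inv _ _ f g) => -[w y] /=; [by rewrite IO | by rewrite OI].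
Qed.
End CentralCone.

Transparent mB jB rB sB piB ioB uB bBm.

Definition comp0 (C D E : cx) (g : cmor 0 D E) (f : cmor 0 C D) : cmor 0 C E :=
  ccast (addr0 0) (ccomp g f).
Lemma comp0E (C D E : cx) (g : cmor 0 D E) (f : cmor 0 C D) x : comp0 g f x = g (f x).
Proof. exact: ccastE. Qed.

Lemma eqv_ext n s (C D : cx) (f f' : cmor s C D) : f =1 f' -> eqv n f -> eqv n f'.
Proof.
move=> e; apply: (@eqv_homotopic n s C D f f' (fun=> 0)).
- by split=> [x y|t j x _]; rewrite ?addr0 // (additive_fun0 (opD _ _)).
- by move=> k x _; exact: hd0.
- by move=> x; rewrite e subrr (additive_fun0 (@ddD D)) addr0.
Qed.

(* [f] becomes a quasi-isomorphism above degree [n] after applying [G] *)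
Definition eqg n G s (C D : cx) (f : cmor s C D) := nul n (capp G (cone f)).

Section Eqg.
Variables (n : int) (G : seq letter).

Lemma eqg_eqv s (C D : cx) (f : cmor s C D) : eqg n G f <-> eqv n (capm G f).
Proof. exact: nul_heq (capp_cone G f). Qed.

Lemma eqg_comp s s' (C D E : cx) (g : cmor s' D E) (f : cmor s C D) :
  eqg n G g -> eqg (n + s') G f -> eqg n G (ccomp g f).
Proof.
move=> /eqg_eqv hg hf; apply/eqg_eqv.
have {}hf : eqv (n + s') (capm G f) by apply/(nul_heq _ (capp_cone G f)).
by apply: (eqv_ext _ (eqv_comp hg hf)) => x; rewrite capm_comp.
Qed.

Lemma eqg_cast s s' (C D : cx) (e : s = s') (f : cmor s C D) :
  eqg n G (ccast e f) <-> eqg n G f.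
Proof. by case: s' / e. Qed.

Lemma eqg_comp0 (C D E : cx) (g : cmor 0 D E) (f : cmor 0 C D) :
  eqg n G g -> eqg n G f -> eqg n G (comp0 g f).
Proof. by move=> hg hf; apply/eqg_cast; apply: eqg_comp => //; rewrite addr0. Qed.

Lemma eqg_ext s (C D : cx) (f f' : cmor s C D) : f =1 f' -> eqg n G f -> eqg n G f'.
Proof.
move=> e /eqg_eqv h; apply/eqg_eqv; apply: eqv_ext h => x.
by rewrite !capmE; exact: capf_ext.
Qed.
End Eqg.

Lemma eqg_cancel n G s s' (C D E : cx) (g : cmor s' D E) (f : cmor s C D) :
  eqg n G (ccomp g f) -> eqg n G g -> eqg (n + s' + 1) G f.
Proof.
move=> /eqg_eqv hgf /eqg_eqv hg; apply/eqg_eqv; apply: (@eqv_cancel _ _ _ _ _ (capm G g)) => //.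
by apply: eqv_ext hgf => x; rewrite capm_comp.
Qed.

(** Homotopic maps have isomorphic cones, through the shear (x, y) ↦ (x + H y, y). *)
Lemma eqg_homotopic n G s (C D : cx) (f f' : cmor s C D) (H : C -> D) :
  lin aS H -> (forall k x, hd (k + s + 1) x -> hd k (H x)) ->
  (forall x, f x - f' x = dd (H x) + H (dd x)) -> eqg n G f -> eqg n G f'.
Proof.
move=> [HD Hl] Hh Hg; apply: nul_retr; apply: retr_capp.
have @g : cmor 0 (cone f') (cone f).
  refine (@Cmor 0 (cone f') (cone f) (fun z => (z.1 - H z.2, z.2)) _ _ _ _).
  - by move=> [x y] [x' y']; apply: pairE => //=; rewrite HD; zlin.
  - by move=> t j [x y]; apply: pairE => //=; rewrite Hl // (additive_funB (opD _ _)).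
  - move=> [x y]; apply: pairE => //=; rewrite (additive_funB (@ddD D)).
    by rewrite (additive_funN HD); have := Hg y => e; zlin e.
  - move=> k [x y] /= [h1 h2]; rewrite !addr0 in h1 h2; split=> //.
    by apply: hdB => //; exact: (Hh).
have @g' : cmor 0 (cone f) (cone f').
  refine (@Cmor 0 (cone f) (cone f') (fun z => (z.1 + H z.2, z.2)) _ _ _ _).
  - by move=> [x y] [x' y']; apply: pairE => //=; rewrite HD; zlin.
  - by move=> t j [x y]; apply: pairE => //=; rewrite Hl // opD.
  - move=> [x y]; apply: pairE => //=; rewrite ddD.
    by rewrite (additive_funN HD); have := Hg y => e; zlin e.
  - move=> k [x y] /= [h1 h2]; rewrite !addr0 in h1 h2; split=> //.
    by apply: hdD => //; exact: (Hh).
by apply: (@retr_inv _ _ g g') => -[x y] /=; rewrite subrK.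
Qed.

Lemma nul_contr n (C : cx) (H : C -> C) : lin aS H ->
  (forall k x, hd (k + 1) x -> hd k (H x)) ->
  (forall x, x = dd (H x) + H (dd x)) -> nul n C.
Proof.
(* By its contraction C is a retract, through zero maps, of any complex. A shift of [U 0] that is
   zero above degree n serves for this. *)
move=> Hl Hh Hg; have bU : nul n (sh (- n) (U 0)).
  by apply/nul_sh; rewrite subrr; apply: bnded_nul; exact: bnded_U.
apply: (nul_retr _ bU).
have @f : cmor 0 C (sh (- n) (U 0)).
  refine (@Cmor 0 C (sh (- n) (U 0)) (fun=> 0 : {mpoly int[0]}) _ _ _ _).
  - by move=> x y; rewrite addr0.
  - by move=> t j x; rewrite (additive_fun0 (opD _ _)).
  - by move=> x /=; rewrite oppr0.
  - by move=> k x _; right.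
have @g : cmor 0 (sh (- n) (U 0)) C.
  refine (@Cmor 0 (sh (- n) (U 0)) C (fun=> 0) _ _ _ _).
  - by move=> x y; rewrite addr0.
  - by move=> t j x; rewrite (additive_fun0 (opD _ _)).
  - by move=> x /=; rewrite (additive_fun0 (@ddD C)).
  - by move=> k x _; exact: hd0.
by exists f, g, H; split=> // x /=; rewrite {1}(Hg x) -addrA -opprD subrr.
Qed.

Lemma eqg_inv n G s (C D : cx) (f : cmor s C D) (g : cmor (- s) D C) (h : C -> C) :
  lin aS h -> (forall k x, hd (k + 1) x -> hd k (h x)) ->
  (forall x, f (g x) = x) -> (forall x, g (f x) = x - dd (h x) - h (dd x)) ->
  (forall x, f (h x) = 0) -> eqg n G f.
Proof.
move=> [hD hl] hh fg gf fh; apply: nul_capp.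
apply: (@nul_contr _ (cone f) (fun z => (0, g z.1 - h z.2))).
- split=> [[x y] [x' y']|t j [x y] _]; apply: pairE => /=; rewrite ?addr0 //.
  + by rewrite mfD hD; zlin.
  + by rewrite (additive_fun0 (opD _ _)).
  + by rewrite mfop hl // (additive_funB (opD _ _)).
- move=> k [x y] /= [h1 h2]; split; first exact: hd0.
  apply: hdB; first by apply: mfhd; apply: hdE h1 _; lia.
  by apply: hh; apply: hdE h2 _; lia.
- move=> [x y]; apply: pairE => /=.
    by rewrite mfB fg fh (additive_fun0 (@ddD D)); zlin.
  rewrite mfD gf (additive_funN hD) (additive_funB (@ddD C)) mfd; zlin.
Qed.

Lemma eqg_iso n G s (C D : cx) (f : cmor s C D) (g : cmor (- s) D C) :
  (forall x, f (g x) = x) -> (forall x, g (f x) = x) -> eqg n G f.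
Proof.
move=> fg gf; apply: (@eqg_inv n G s C D f g (fun=> 0)) => //.
- by split=> [x y|t j x _]; rewrite ?addr0 // (additive_fun0 (opD _ _)).
- by move=> k x _; exact: hd0.
- by move=> x; rewrite gf (additive_fun0 (@ddD C)) !subr0.
- by move=> x; rewrite mf0.
Qed.

Program Definition shm s0 s (C D : cx) (f : cmor s C D) : cmor s (sh s0 C) (sh s0 D) :=
  @Cmor s (sh s0 C) (sh s0 D) f _ _ _ _.
Next Obligation. by move=> s0 s C D f; exact: (mfD f). Qed.
Next Obligation. by move=> s0 s C D f; exact: (mfop f). Qed.
Next Obligation. by move=> s0 s C D f x /=; rewrite mfN mfd. Qed.
Next Obligation.
by move=> s0 s C D f k x /= h; apply: mfhd; apply: hdE h _; lia.
Qed.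

Lemma eqg_shm n G s0 s (C D : cx) (f : cmor s C D) :
  eqg (n + s0) G f -> eqg n G (shm s0 f).
Proof.
move=> h; have {}h : nul n (capp G (sh s0 (cone f))).
  by apply/(nul_heq _ (capp_sh G s0 _)); apply/nul_sh.
apply: (nul_retr (retr_capp G _) h).
have @f1 : cmor 0 (cone (shm s0 f)) (sh s0 (cone f)).
  refine (@Cmor 0 (cone (shm s0 f)) (sh s0 (cone f)) (fun z => (z.1, - z.2)) _ _ _ _).
  - by move=> x y; apply: pairE => //=; rewrite opprD.
  - by move=> t j x; apply: pairE => //=; rewrite (additive_funN (opD _ _)).
  - move=> x; apply: pairE => /=; first by rewrite mfN opprD !opprK.
    by rewrite (additive_funN (@ddD C)) !opprK.
  - move=> k x /= [h1 h2]; split; first by apply: hdE h1 _; lia.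
    by apply: hdN; apply: hdE h2 _; lia.
have @g1 : cmor 0 (sh s0 (cone f)) (cone (shm s0 f)).
  refine (@Cmor 0 (sh s0 (cone f)) (cone (shm s0 f)) (fun z => (z.1, - z.2)) _ _ _ _).
  - by move=> x y; apply: pairE => //=; rewrite opprD.
  - by move=> t j x; apply: pairE => //=; rewrite (additive_funN (opD _ _)).
  - move=> x; apply: pairE => /=; first by rewrite mfN opprD.
    by rewrite (additive_funN (@ddD C)) !opprK.
  - move=> k x /= [h1 h2]; split; first by apply: hdE h1 _; lia.
    by apply: hdN; apply: hdE h2 _; lia.
by apply: (@retr_inv _ _ f1 g1) => -[x y] /=; rewrite opprK.
Qed.

Section Fshc.
Variables (F : sfun) (s : int) (C : cx).
Let i := (fun x : sh s C => x : C).
Let j := (fun x : C => x : sh s C).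
Let il : lin aS i. Proof. by []. Qed.
Let jl : lin aS j. Proof. by []. Qed.

Program Definition fshc : cmor 0 (F (sh s C)) (sh s (F C)) :=
  @Cmor 0 (F (sh s C)) (sh s (F C)) (fm F true i) _ _ _ _.
Next Obligation. exact: (fm_aS F true il).1. Qed.
Next Obligation. by move=> t l x; exact: ((fm_aS F true il).2 t l x isT). Qed.
Next Obligation.
move=> x /=; rewrite (fm_d F true x (linl_aS il)) /= [X in - (_ + X)]fm_zero ?addr0 ?opprK //.
by move=> y; rewrite /ddiff /= opprK subrr.
Qed.
Next Obligation.
move=> k x; rewrite addr0 => hx; apply: (@fm_hd F (- s)); last by rewrite addrK.
by move=> l y hy; have {}hy : @hd C (l - s + s) y := hy; apply: hdE hy _; lia.
Qed.
Program Definition fshc' : cmor 0 (sh s (F C)) (F (sh s C)) :=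
  @Cmor 0 (sh s (F C)) (F (sh s C)) (fm F true j) _ _ _ _.
Next Obligation. exact: (fm_aS F true jl).1. Qed.
Next Obligation. by move=> t l x; exact: ((fm_aS F true jl).2 t l x isT). Qed.
Next Obligation.
move=> x /=; rewrite (additive_funN (fm_aS F true jl).1) (fm_d F true x (linl_aS jl)) /=.
rewrite [X in _ + X]fm_zero ?addr0 //.
by move=> y; rewrite /ddiff /= opprK addNr.
Qed.
Next Obligation.
by move=> k x h; apply: (@fm_hd F s) => //; apply: hdE h _; rewrite addr0.
Qed.

Lemma fshcK x : fshc' (fshc x) = x.
Proof. by rewrite /= fm_comp ?fm_id //; exact: linl_aS. Qed.
Lemma fshc'K x : fshc (fshc' x) = x.
Proof. by rewrite /= fm_comp ?fm_id //; exact: linl_aS. Qed.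

Lemma eqg_fshc n G : eqg n G fshc.
Proof.
have e : 0 = - 0 :> int by rewrite oppr0.
by apply: (@eqg_iso _ _ _ _ _ _ (ccast e fshc')) => x; rewrite ccastE ?fshcK ?fshc'K.
Qed.
End Fshc.

Section Cpr.
Variables (s s' : int) (es : s' = s + 1) (C D : cx) (f : cmor s C D).

Program Definition cpr : cmor 0 (cone f) (sh s' C) :=
  @Cmor 0 (cone f) (sh s' C) (fun z => z.2) _ _ _ _.
Next Obligation. by []. Qed.
Next Obligation. by []. Qed.
Next Obligation. by []. Qed.
Next Obligation. by move=> k x [_ h]; apply: hdE h _; lia. Qed.

Lemma retr_cpr : retr (cone cpr) (sh 1 D).
Proof.
have @u : cmor 0 (cone cpr) (sh 1 D).
  refine (@Cmor 0 (cone cpr) (sh 1 D) (fun z => z.2.1 + f z.1) _ _ _ _).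
  - by move=> x y; rewrite /= mfD; zlin.
  - by move=> t j x; rewrite /= mfop opD.
  - by move=> x; rewrite /= mfD mfN mfd ddD; zlin.
  - move=> k [c [d c']] /= [h1 [h2 h3]]; apply: hdD; first by apply: hdE h2 _; lia.
    by apply: mfhd; apply: hdE h1 _; lia.
have @v : cmor 0 (sh 1 D) (cone cpr).
  refine (@Cmor 0 (sh 1 D) (cone cpr) (fun d => (0, (d, 0))) _ _ _ _).
  - by move=> x y; do !apply: pairE => /=; rewrite ?addr0.
  - by move=> t j x; do !apply: pairE => //=; rewrite (additive_fun0 (opD _ _)).
  - move=> x; do !apply: pairE => //=; rewrite ?(additive_fun0 (@ddD C)) ?mf0 ?oppr0 ?addr0 //.
  - move=> k x /= h; split; first exact: hd0.
    by split; [apply: hdE h _; lia | exact: hd0].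
exists u, v, (fun z => (0, (0, z.1))); split.
- split=> [x y|t j x _]; do !apply: pairE => //=; rewrite ?addr0 //;
    by rewrite (additive_fun0 (opD _ _)).
- move=> k [c [d c']] /= [h1 _]; split; first exact: hd0.
  by split; [exact: hd0 | apply: hdE h1 _; lia].
- move=> [c [d c']]; do !apply: pairE => /=; rewrite ?(additive_fun0 (@ddD C)) ?(additive_fun0 (@ddD D)) ?oppr0 ?subr0 ?add0r; zlin.
Qed.

Lemma eqg_cpr n G : nul (n + 1) (capp G D) -> eqg n G cpr.
Proof.
move=> h; apply: (nul_retr (retr_capp G retr_cpr)).
by apply/(nul_heq _ (capp_sh G 1 D)); apply/nul_sh.
Qed.
End Cpr.

Lemma eqg_fmor n G (F : sfun) s (C D : cx) (f : cmor s C D) :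
  nul n (capp G (F (cone f))) -> eqg n G (fmor F f).
Proof. by move/(nul_heq _ (heq_capp G (fm_cone F f))). Qed.

Lemma neqS t : t != t.+1. Proof. by rewrite neq_ltn ltnSn. Qed.
Notation B t := (bB t t.+1).

Lemma add01 : 1 = 0 + 1 :> int. Proof. by rewrite add0r. Qed.
Definition prT t (Y : cx) : cmor 0 (tT t t.+1 Y) (sh 1 (B t Y)) :=
  cpr add01 (mB t t.+1 Y).
(** The equivalence behind [retr_TB], in the form used for naturality: projection to the term B_t
    B_t, then the divided difference. *)
Definition rhoT t (Y : cx) : cmor 0 (tT t t.+1 (B t Y)) (sh 1 (B t Y)) :=
  comp0 (shm 1 (rB Y (neqS t))) (prT t (B t Y)).

Ltac labt t j := bsplit j t; [|bsplit j t.+1].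

Lemma eqg_rhoT n G t Y : eqg n G (rhoT t Y).
Proof.
have tS := neqS t.
have @g : cmor (- 0) (sh 1 (B t Y)) (tT t t.+1 (B t Y)).
  refine (@Cmor (- 0) (sh 1 (B t Y)) (tT t t.+1 (B t Y)) (fun z => ((0, 0),
  ((op true t (op true t.+1 z.2), z.1), (- z.1 - op true t z.2 - op true t.+1 z.2, z.2)))) _ _ _ _).
  - by move=> [x y] [x' y']; pcx Y.
  - by move=> t0 j [x y]; oplin Y t0 j ltac:(fun k => labt t k).
  - by move=> [x y]; pcx Y.
  - by move=> k [x y] /=; rewrite oppr0 !addr0 => -[h1 h2]; repeat split; hdsolve.
apply: (@eqg_inv n G 0 _ _ (rhoT t Y) g (fun z => ((0, 0), ((z.1.1, 0), (z.1.2, 0))))).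
- split; first by move=> [[x1 x2] [[y1 y2] [z1 z2]]] [[x1' x2'] [[y1' y2'] [z1' z2']]]; pcx Y.
  by move=> t0 j [[x1 x2] [[y1 y2] [z1 z2]]] _; oplin Y t0 j ltac:(fun k => labt t k).
- by move=> k [[x1 x2] [[y1 y2] [z1 z2]]] /= [[h1 h2] _]; rewrite !addr0; repeat split; hdsolve.
- by move=> [x y]; rewrite comp0E.
- by move=> [[x y] [[z00 z01] [z10 z11]]]; rewrite comp0E; pcx Y.
- by move=> [[x y] [[z00 z01] [z10 z11]]]; rewrite comp0E.
Qed.

(** Up to the order of the two strands in each letter and a sign, this is [piB] on three consecutive
    strands. *)
Definition muB t t' (Y : cx) : cmor 0 (B t (B t' (B t Y))) (B t Y) :=
  comp0 (rB Y (neqS t)) (bBm t t.+1 (mB t' t'.+1 (B t Y))).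

Lemma muBE t t' (Y : cx) z :
  muB t t' Y z = rB Y (neqS t) (bBm t t.+1 (mB t' t'.+1 (B t Y)) z).
Proof. exact: comp0E. Qed.

Program Definition swB p q (C : cx) (pq : p != q) : cmor 0 (bB p q C) (bB q p C) :=
  @Cmor 0 (bB p q C) (bB q p C)
    (fun z => (z.1 + op true p z.2 + op true q z.2, - z.2)) _ _ _ _.
Next Obligation. by move=> p q C pq [x y] [x' y']; pcx C. Qed.
Next Obligation.
move=> p q C pq t j [x y]; oplin C t j ltac:(fun j => bsplit j p; [|bsplit j q]).
Qed.
Next Obligation. by move=> p q C pq [x y]; pcx C. Qed.
Next Obligation.
by move=> p q C pq k [x y] /=; rewrite addr0 => -[h1 h2]; repeat split; hdsolve.
Qed.

(** [piB] is split surjective, and [uB] embeds its kernel into B_a B_b B_a as a summand. The cone is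
    therefore killed by everything that kills B_a on its right. *)
Lemma retr_cone_piB p q r (M : cx) (pq : p != q) (pr : p != r) (qr : q != r) :
  retr (cone (piB M pq pr qr)) (sh 1 (bB p q (bB r q (bB p q M)))).
Proof.
have qp : q != p by rewrite eq_sym.
have rp : r != p by rewrite eq_sym.
have rq : r != q by rewrite eq_sym.
pose u := uB M pq pr qr; pose u' := uB M rq rp qp; pose io := ioB M pq pr qr.
have e1 z : u' (u z) = z - io (piB M pq pr qr z) by exact: uBB.
have e2 z : piB M pq pr qr (u' z) = 0.
  by rewrite /u'; have := @pi_uB r q p M rq rp qp pq pr qr z; apply.
have @f : cmor 0 (cone (piB M pq pr qr)) (sh 1 (bB p q (bB r q (bB p q M)))).
  refine (@Cmor 0 (cone (piB M pq pr qr)) (sh 1 (bB p q (bB r q (bB p q M)))) (fun z => u z.2) _ _ _ _).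
  - by move=> x y; exact: (mfD u).
  - by move=> t j x; exact: (mfop u).
  - by move=> x; rewrite -[RHS]/(- dd (u x.2)) -mfd -mfN.
  - by move=> k x [_ h]; apply: (@mfhd0 _ _ u); apply: hdE h _; lia.
have @g : cmor 0 (sh 1 (bB p q (bB r q (bB p q M)))) (cone (piB M pq pr qr)).
  refine (@Cmor 0 (sh 1 (bB p q (bB r q (bB p q M)))) (cone (piB M pq pr qr))
    (fun w => (0, u' (w : bB p q (bB r q (bB p q M))))) _ _ _ _).
  - by move=> x y; apply: pairE; [rewrite /= addr0 | exact: (mfD u')].
  - by move=> t j x; apply: pairE; [rewrite [RHS](additive_fun0 (opD _ _)) | exact: (mfop u')].
  - move=> x; apply: pairE => /=.
      by rewrite [X in _ + X]e2 addr0; apply: pairE; exact: (esym (additive_fun0 (@ddD M))).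
    rewrite -[RHS]/(- dd (u' (x : bB p q (bB r q (bB p q M))))) -mfd -mfN //.
  - move=> k x h; split; first exact: (@hd0 (bB r q M)).
    by apply: (@mfhd0 _ _ u'); apply: hdE h _; lia.
exists f, g, (fun z => (0, io z.1)); split.
- split=> [x y|t j x _]; apply: pairE; rewrite /= ?addr0 //; try exact: (mfD io); try exact: (mfop io).
  by apply: (esym (additive_fun0 (@opD (bB r q M) t j))).
- move=> k x [h _]; split; first exact: (@hd0 (bB r q M)).
  by apply: (@mfhd0 _ _ io); apply: hdE h _; lia.
- move=> [n z]; apply: pairE.
    rewrite -[LHS]/0 -[RHS]/(n - (dd (0 : bB r q M) + piB M pq pr qr (io n)) - 0).
    by rewrite piioB (additive_fun0 (@ddD (bB r q M))) add0r subrr subr0.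
  rewrite -[LHS]/(u' (u z)) e1.
  rewrite -[RHS]/(z - (- dd (io n)) - io (dd n + piB M pq pr qr z)) mfD mfd; zlin.
Qed.

Program Definition oppm (C : cx) : cmor 0 C C := @Cmor 0 C C -%R _ _ _ _.
Next Obligation. by move=> C x y; rewrite opprD. Qed.
Next Obligation. by move=> C t j x; rewrite (additive_funN (opD _ _)). Qed.
Next Obligation. by move=> C x; rewrite (additive_funN (@ddD C)). Qed.
Next Obligation. by move=> C k x; rewrite addr0; exact: hdN. Qed.

Lemma retr_cone_conj s (C D C' D' : cx) (f : cmor s C D) (f' : cmor s C' D')
    (a : cmor 0 C C') (a' : cmor 0 C' C) (b : cmor 0 D D') (b' : cmor 0 D' D) :
  (forall x, a' (a x) = x) -> (forall x, b' (b x) = x) -> (forall x, a (a' x) = x) ->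
  (forall x, b (f x) = f' (a x)) ->
  retr (cone f) (cone f').
Proof.
move=> aK bK aK' e.
have @u : cmor 0 (cone f) (cone f').
  refine (@Cmor 0 (cone f) (cone f') (fun z => (b z.1, a z.2)) _ _ _ _).
  - by move=> x y; apply: pairE => /=; rewrite mfD.
  - by move=> t j x; apply: pairE => /=; rewrite mfop.
  - by move=> x; apply: pairE => /=; rewrite ?mfD ?mfN mfd ?e.
  - by move=> k x [h1 h2]; split; apply: mfhd0; [apply: hdE h1 _|apply: hdE h2 _]; lia.
have @v : cmor 0 (cone f') (cone f).
  refine (@Cmor 0 (cone f') (cone f) (fun z => (b' z.1, a' z.2)) _ _ _ _).
  - by move=> x y; apply: pairE => /=; rewrite mfD.
  - by move=> t j x; apply: pairE => /=; rewrite mfop.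
  - by move=> x; apply: pairE => /=; rewrite ?mfD ?mfN mfd -1?[in X in X = _](aK' x.2) -?e ?bK ?aK.
  - by move=> k x [h1 h2]; split; apply: mfhd0; [apply: hdE h1 _|apply: hdE h2 _]; lia.
by apply: (@retr_inv _ _ u v) => -[x y] /=; rewrite aK bK.
Qed.

Lemma eqg_muB n G t t' (Y : cx) : adj t t' -> bnded Y -> rg (n + 1) G t' ->
  eqg n G (muB t t' Y).
Proof.
move=> tt' bY hG.
have key p q r (Z : cx) (pq : p != q) (pr : p != r) (qr : q != r) :
    retr (cone (muB t t' Y)) (cone (piB Y pq pr qr)) ->
    heq (bB p q (bB r q (bB p q Y))) (B t' Z) -> bnded Z -> eqg n G (muB t t' Y).
  move=> h1 h2 bZ; apply: (nul_retr (retr_capp G h1)).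
  apply: (nul_retr (retr_capp G (retr_cone_piB Y pq pr qr))).
  apply/(nul_heq _ (capp_sh G 1 _)); apply/nul_sh.
  apply/(nul_heq _ (heq_capp G h2)).
  by have := hG Z bZ; rewrite capp_cat.
have idK (C : cx) (x : C) : cid_mor C (cid_mor C x) = x by [].
case/orP: tt' => /eqP e.
- have pq : t.+2 != t.+1 by lia.
  have pr : t.+2 != t by lia.
  have qr : t.+1 != t by lia.
  have st : t.+1 != t.+2 by lia.
  rewrite e in hG key *.
  apply: (@key _ _ _ (bB t t.+1 (bB t.+2 t.+1 Y)) pq pr qr).
  + apply: (@retr_cone_conj _ _ _ _ _ _ _
      (bBm t t.+1 (swB (B t Y) st)) (bBm t t.+1 (swB (B t Y) pq)) (cid_mor _) (cid_mor _)) => //.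
    * by move=> [[[a1 a2] [a3 a4]] [[a5 a6] [a7 a8]]]; pcx Y.
    * by move=> [[[a1 a2] [a3 a4]] [[a5 a6] [a7 a8]]]; pcx Y.
    * by move=> [[[a1 a2] [a3 a4]] [[a5 a6] [a7 a8]]]; rewrite muBE; pcx Y.
  + exact: heq_swapB.
  + apply: (@bnded_lapp (false, (t, t.+1))); exact: (@bnded_lapp (false, (t.+2, t.+1))).
- have pq : t' != t'.+1 by lia.
  have pr : t' != t'.+2 by lia.
  have qr : t'.+1 != t'.+2 by lia.
  have st : t'.+2 != t'.+1 by lia.
  rewrite e in key *.
  apply: (@key _ _ _ (bB t'.+2 t'.+1 (bB t' t'.+1 Y)) pq pr qr).
  (* The outer pair is now read in reverse order, and the divided difference changes sign with the
     order; hence [oppm]. *)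
  + apply: (@retr_cone_conj _ _ _ _ _ _ _
      (comp0 (swB _ qr) (bBm t'.+1 t'.+2 (bBm t' t'.+1 (swB Y qr))))
      (comp0 (swB _ st) (bBm t'.+2 t'.+1 (bBm t' t'.+1 (swB Y st))))
      (comp0 (oppm _) (swB Y qr)) (comp0 (oppm _) (swB Y st))) => //.
    * by move=> [[[a1 a2] [a3 a4]] [[a5 a6] [a7 a8]]]; rewrite !comp0E; pcx Y.
    * by move=> [a1 a2]; rewrite !comp0E; pcx Y.
    * by move=> [[[a1 a2] [a3 a4]] [[a5 a6] [a7 a8]]]; rewrite !comp0E; pcx Y.
    * by move=> [[[a1 a2] [a3 a4]] [[a5 a6] [a7 a8]]]; rewrite [LHS]comp0E [X in _ = piB _ _ _ _ X]comp0E muBE; pcx Y.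
  + exact: heq_refl.
  + apply: (@bnded_lapp (false, (t'.+2, t'.+1))); exact: (@bnded_lapp (false, (t', t'.+1))).
Qed.

Lemma rg_le n n' G i : n <= n' -> rg n G i -> rg n' G i.
Proof. by move=> h hG Y bY; apply: nul_le (hG Y bY). Qed.

(** * The loop of a new strand around a block *)

Lemma rg_far n G i v : all (far i) v -> rg n G i -> rg n (G ++ tw v) i.
Proof.
move=> + hG; elim/last_ind: v => [|v j ih]; first by rewrite cats0.
rewrite all_rcons => /andP[ij /ih {}ih] Y bY.
rewrite /tw map_rcons -cats1 -!catA capp_cat.
have w : weq [:: T j; Bl i] [:: Bl i; T j].
  by apply: weq_sym; exact: (@weq_far false true i j ij).
rewrite [map _ _ ++ _](_ : _ = tw v ++ [:: T j; Bl i]) // capp_cat.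
apply/(nul_heq _ (heq_capp G (heq_capp (tw v) (w Y)))).
have := ih _ (bnded_lapp (l := T j) bY).
by rewrite -[lapp _ _]/(capp [:: T j] Y) -capp_cat -!catA !capp_cat.
Qed.

Lemma rg_slide n G i j : adj i j -> rg n G i -> rg n (G ++ tw [:: j; i]) j.
Proof. by move=> ij hG Y bY; rewrite -catA; exact: nul_slide. Qed.

(** On a chain this is the pure braid in which the newest strand runs once around all the others. *)
Fixpoint pal (ts : seq nat) : seq nat :=
  if ts is t :: ts' then t :: pal ts' ++ [:: t] else [::].

(* The crossings of a chain of strands, starting with the newest strand.      *)
Fixpoint chn (t : nat) (ts : seq nat) : bool :=
  if ts is t' :: ts' then [&& adj t t', all (far t) ts' & chn t' ts'] else true.

Lemma pal_sub ts : {subset pal ts <= ts}.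
Proof.
elim: ts => [//|t ts ih] s; rewrite /= !inE mem_cat inE.
by case/or3P=> [->|/ih ->|->]; rewrite ?orbT.
Qed.

Lemma all_pal (p : pred nat) ts : all p ts -> all p (pal ts).
Proof. by move/allP => h; apply/allP => s /pal_sub /h. Qed.

Lemma rg_pal_head n G t t' ts : chn t (t' :: ts) -> rg n G t' ->
  rg n (G ++ tw (t :: t' :: pal ts)) t.
Proof.
move=> /and3P[tt' ft _] hG.
rewrite -[t :: t' :: pal ts]/([:: t; t'] ++ pal ts) tw_cat catA.
by apply: rg_far; [exact: all_pal | apply: rg_slide; rewrite // adj_sym].
Qed.

(** A context that kills the block still kills it after the loop. For the first crossing t' of the
    block, two slides are used: killing of t' becomes killing of t after t t', and killing of t'
    again after t' t. The far crossings of the loop in between do no harm. *)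
Lemma rg_pal n G t ts : chn t ts -> (forall s, s \in ts -> rg n G s) ->
  forall s, s \in ts -> rg n (G ++ tw (pal (t :: ts))) s.
Proof.
elim: ts t G => [//|t' ts ih] t G c hG s.
have [tt' ft c'] := and3P c.
rewrite inE => /orP[/eqP ->|st].
  have h : rg n (G ++ tw (t :: t' :: pal ts)) t.
    by apply: rg_pal_head => //; apply: hG; exact: mem_head.
  have := rg_slide (j := t') _ h; rewrite -catA -tw_cat => hh.
  rewrite [pal _](_ : _ = (t :: t' :: pal ts) ++ [:: t'; t]); last by rewrite /= -catA.
  exact: hh.
have fs : far s t by rewrite far_sym; exact: (allP ft).
rewrite [pal _](_ : _ = [:: t] ++ pal (t' :: ts) ++ [:: t]) // !tw_cat !catA.
apply: rg_far; first by rewrite /= fs.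
apply: ih => // r rt; apply: rg_far; first by rewrite /= far_sym (allP ft).
by apply: hG; rewrite inE rt orbT.
Qed.

(* The functor T_t ... T_1 T_1 ... T_(t-1) of a chain. *)
Fixpoint Jsf (t : nat) (ts : seq nat) : sfun :=
  if ts is t' :: ts' then scomp (csf [:: T t]) (scomp (Jsf t' ts') (csf [:: T t']))
  else csf [:: T t].

Lemma capp_tcons t v (X : cx) : capp [:: T t] (capp (tw v) X) = capp (tw (t :: v)) X.
Proof. by []. Qed.

Lemma JsfE t ts (Y : cx) : Jsf t ts Y = capp (tw (t :: pal ts)) Y.
Proof.
elim: ts t Y => [//|t' ts ih] t Y /=.
rewrite ih -[tT t' _ Y]/(capp [:: T t'] Y) -capp_cat.
by rewrite -[[:: T t']]/(tw [:: t']) -tw_cat.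
Qed.

(** The shift that B_t acquires when it is taken out of [Jsf t ts]: one for each of the 2 |ts| + 1
    crossings. *)
Fixpoint pis (ts : seq nat) : int := if ts is _ :: ts' then 1 + pis ts' + 1 else 1.
Lemma pisE ts : pis ts = (2 * size ts).+1%:Z.
Proof. by elim: ts => [//|t ts /= ->]; lia. Qed.

(** Every [sh] negates the differential once, so three nested shifts agree with one shift, whereas
    two would not. *)
Program Definition unsh3 s (X : cx) : cmor 0 (sh 1 (sh s (sh 1 X))) (sh (1 + s + 1) X) :=
  @Cmor 0 (sh 1 (sh s (sh 1 X))) (sh (1 + s + 1) X) (fun x => x) _ _ _ _.
Next Obligation. by []. Qed.
Next Obligation. by []. Qed.
Next Obligation. by move=> s X x /=; rewrite opprK. Qed.
Next Obligation. by move=> s X k x /= h; apply: hdE h _; lia. Qed.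
Lemma eqg_unsh3 n G s X : eqg n G (unsh3 s X).
Proof.
have @g : cmor (- 0) (sh (1 + s + 1) X) (sh 1 (sh s (sh 1 X))).
  refine (@Cmor (- 0) (sh (1 + s + 1) X) (sh 1 (sh s (sh 1 X))) (fun x => x) _ _ _ _) => //.
  - by move=> x /=; rewrite opprK.
  - by move=> k x /= h; apply: hdE h _; lia.
exact: (@eqg_iso _ _ _ _ _ _ g).
Qed.

Definition recast t t' (G : sfun) (X D : cx)
    (f : cmor 0 (scomp (csf [:: T t]) G (tT t' t'.+1 X)) D) :
  cmor 0 (scomp (csf [:: T t]) (scomp G (csf [:: T t'])) X) D := f.

Definition prF t (Y : cx) (w : tT t t.+1 Y) : B t Y := w.2.
Lemma prF_linl t (Y : cx) : linl (@prF t Y). Proof. by []. Qed.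
Definition shF s (C D : cx) (f : cmor 0 C (sh s D)) (x : C) : D := f x.
Lemma shF_linl s (C D : cx) (f : cmor 0 C (sh s D)) : linl (shF f).
Proof. exact: linl_aS (mf_lin f). Qed.

Definition jx t t' (G : sfun) (X : cx)
  (x : scomp (csf [:: T t]) (scomp G (csf [:: T t'])) X) :
  scomp (csf [:: T t]) G (tT t' t'.+1 X) := x.
Lemma recastE t t' (G : sfun) (X D : cx)
    (f : cmor 0 (scomp (csf [:: T t]) G (tT t' t'.+1 X)) D) x :
  recast f x = f (jx x).
Proof. by []. Qed.
Lemma eqg_recast n A t t' (G : sfun) (X D : cx)
    (f : cmor 0 (scomp (csf [:: T t]) G (tT t' t'.+1 X)) D) :
  eqg n A f -> eqg n A (recast f).
Proof. by []. Qed.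
Lemma jx_fm t t' (G : sfun) (C D : cx) (g : C -> D) x :
  jx (fm (scomp (csf [:: T t]) (scomp G (csf [:: T t']))) false g x) =
  fm (scomp (csf [:: T t]) G) false (fm (csf [:: T t']) false g : tT t' t'.+1 C -> tT t' t'.+1 D) (jx x).
Proof. by []. Qed.

Section PimStep.
Variables (t t' : nat) (F' : sfun) (s' : int) (Y : cx).
Local Notation Z := (B t' (B t Y)).
Variable P' : cmor 0 (F' Z) (sh s' Z).
Local Notation F := (scomp (csf [:: T t]) F').

Definition pst1 : cmor 0 (F (tT t' t'.+1 (B t Y))) (F (sh 1 Z)) := fmor F (prT t' (B t Y)).
Definition pst2 : cmor 0 (F (sh 1 Z)) (sh 1 (F Z)) := fshc F 1 Z.
Definition pst3 : cmor 0 (F Z) (csf [:: T t] (sh s' Z)) := fmor (csf [:: T t]) P'.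
Definition pst4 : cmor 0 (csf [:: T t] (sh s' Z)) (sh s' (csf [:: T t] Z)) :=
  fshc (csf [:: T t]) s' Z.
Definition pst5 : cmor 0 (csf [:: T t] Z) (sh 1 (B t Z)) := prT t Z.
Definition pst6 : cmor 0 (B t Z) (B t Y) := muB t t' Y.
Definition pst56 : cmor 0 (csf [:: T t] Z) (sh 1 (B t Y)) := comp0 (shm 1 pst6) pst5.
Definition pst36 : cmor 0 (F Z) (sh s' (sh 1 (B t Y))) :=
  comp0 (shm s' pst56) (comp0 pst4 pst3).
Definition PimS0 : cmor 0 (F (tT t' t'.+1 (B t Y))) (sh (1 + s' + 1) (B t Y)) :=
  comp0 (unsh3 s' (B t Y)) (comp0 (shm 1 pst36) (comp0 pst2 pst1)).
Definition PimS : cmor 0 (scomp (csf [:: T t]) (scomp F' (csf [:: T t'])) (B t Y))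
    (sh (1 + s' + 1) (B t Y)) := recast PimS0.

(** The map exchanging F with a shift turns F of a map into a shift into F of the underlying odd
    map. The composite thereby loses all intermediate shifts, at the price of the flags [true]. *)
Lemma PimSE x : PimS x = muB t t' Y (prF (fm (csf [:: T t]) true (shF P')
    (fm F true (@prF t' (B t Y)) (jx x)))).
Proof.
rewrite /PimS recastE; move: (jx x) => {}x.
have e0 : comp0 pst2 pst1 x = fm F true (@prF t' (B t Y)) x.
  by rewrite comp0E [LHS]fm_comp.
rewrite /PimS0 comp0E -[LHS]/(comp0 _ _ x) comp0E e0 -[LHS]/(pst36 (fm F true _ _)).
have e y : comp0 pst4 pst3 y = fm (csf [:: T t]) true (shF P') y.
  by rewrite comp0E [LHS]fm_comp.
rewrite /pst36 comp0E e -[LHS]/(pst56 (fm _ true _ _)).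
by rewrite /pst56 comp0E.
Qed.
End PimStep.

(** With J' the functor of the shorter chain, the composite is T_t J' T_t' B_t → T_t J' B_t' B_t →
    T_t B_t' B_t → B_t B_t' B_t → B_t, up to shifts. The cone of each arrow vanishes, in the
    relevant degrees, after a left factor that kills the block. *)
Fixpoint Pim (t : nat) (ts : seq nat) :
    forall Y : cx, cmor 0 (Jsf t ts (B t Y)) (sh (pis ts) (B t Y)) :=
  match ts return forall Y : cx, cmor 0 (Jsf t ts (B t Y)) (sh (pis ts) (B t Y)) with
  | [::] => rhoT t
  | t' :: ts' => fun Y => @PimS t t' (Jsf t' ts') (pis ts') Y (Pim t' ts' (B t Y))
  end.

Lemma PimE t t' ts Y x : Pim t (t' :: ts) Y x =
  muB t t' Y (prF (fm (csf [:: T t]) true (shF (Pim t' ts (B t Y)))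
    (fm (scomp (csf [:: T t]) (Jsf t' ts)) true (@prF t' (B t Y)) (jx x)))).
Proof. exact: PimSE. Qed.

Lemma linl_mf s (C D : cx) (f : cmor s C D) : linl f.
Proof. exact: linl_aS (mf_lin f). Qed.

Lemma linl_bmap t (C D : cx) (g : C -> D) : linl g -> linl (bmap g : B t C -> B t D).
Proof. exact: (@fm_linl (csf [:: Bl t]) false C D g). Qed.

(** Naturality is needed for maps between B_t C and B_t D that are not induced from maps C → D,
    namely the pairing maps [kapE y] below. Commuting with the divided difference is enough. *)
Lemma Pim_nat t ts (C D : cx) (g : B t C -> B t D) x : linl g ->
  (forall z, rB D (neqS t) (bmap g z) = g (rB C (neqS t) z)) ->
  Pim t ts D (fm (Jsf t ts) false g x) = g (Pim t ts C x).
Proof.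
elim: ts t C D g x => [|t' ts ih] t C D g x gl gr.
  rewrite [LHS]comp0E [X in _ = g X]comp0E.
  exact: (gr x.2).
rewrite !PimE.
set F := scomp (csf [:: T t]) (Jsf t' ts).
pose h := bmap g : B t' (B t C) -> B t' (B t D).
have hl : linl h by exact: linl_bmap.
have e1 : fm F true (@prF t' (B t D)) (jx (fm (Jsf t (t' :: ts)) false g x)) =
    fm F false h (fm F true (@prF t' (B t C)) (jx x)).
  rewrite -[fm (Jsf t (t' :: ts)) false g x]/(fm (scomp (csf [:: T t]) (scomp (Jsf t' ts) (csf [:: T t']))) false g x) jx_fm.
  rewrite (@fm_comp F true false _ _ _ (@prF t' (B t D)) (fm (csf [:: T t']) false g)) //.
  by rewrite fm_comp.
rewrite e1; move: (fm F true _ _) => {x e1} x.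
rewrite -[fm F false h x]/(fm (csf [:: T t]) false (fm (Jsf t' ts) false h) x).
have e2 : fm (csf [:: T t]) true (shF (Pim t' ts (B t D))) (fm (csf [:: T t]) false (fm (Jsf t' ts) false h) x) =
    fm (csf [:: T t]) false h (fm (csf [:: T t]) true (shF (Pim t' ts (B t C))) x).
  rewrite fm_comp; last exact: shF_linl.
  rewrite fm_comp //; apply: fm_ext => z.
  by apply: (ih t' (B t C) (B t D) h) => // -[[a1 a2] [a3 a4]].
rewrite e2; move: (fm (csf [:: T t]) true _ _) => y.
rewrite [LHS]muBE [in RHS]muBE.
rewrite -gr; congr (rB _ _ _).
case: y => [y0 [y1 y2]]; case: gl => gD gl.
by apply: pairE; rewrite /= gD gl.
Qed.

Lemma eqg_Pim n G t ts Y : chn t ts -> bnded Y -> (forall s, s \in ts -> rg n G s) ->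
  forall n', n <= n' -> eqg n' G (Pim t ts Y).
Proof.
elim: ts n G t Y => [|t' ts ih] n G t Y c bY hG n' nn'; first exact: eqg_rhoT.
have [tt' ft c'] := and3P c.
have hp : 0 <= pis ts by rewrite pisE.
have hG' m s : n <= m -> s \in t' :: ts -> rg m G s.
  by move=> nm st; apply: rg_le nm (hG s st).
have bB t0 Z : bnded Z -> bnded (B t0 Z) by exact: (@bnded_lapp (false, (t0, t0.+1))).
apply: eqg_recast.
apply: eqg_comp0; first exact: eqg_unsh3.
apply: eqg_comp0.
  apply: eqg_shm; apply: eqg_comp0.
    apply: eqg_shm; apply: eqg_comp0.
      apply: eqg_shm; apply: eqg_muB => //.
      by apply: hG'; [lia | exact: mem_head].
    apply: eqg_cpr.
    have := hG' (n' + 1 + pis ts + 1) t' _ (mem_head _ _) (B t Y) (bB _ _ bY).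
    rewrite capp_cat; apply; lia.
  apply: eqg_comp0; first exact: eqg_fshc.
  apply: eqg_fmor.
  have := ih n (G ++ tw [:: t]) t' (B t Y) c' (bB _ _ bY) _ (n' + 1); rewrite /eqg capp_cat.
  apply; last lia.
  move=> s st; apply: rg_far; first by rewrite /= far_sym (allP ft).
  by apply: hG; rewrite inE st orbT.
apply: eqg_comp0; first exact: eqg_fshc.
apply: eqg_fmor.
(* The term lost by the projection from T_t' to B_t' is T_t J' B_t, and G kills it by sliding B_t
   through the beginning of the loop. *)
apply: (nul_retr (retr_capp G (retr_fm (scomp (csf [:: T t]) (Jsf t' ts)) (retr_cpr _ _)))).
rewrite -[fo _ _]/(capp [:: T t] (Jsf t' ts (sh 1 (B t Y)))) JsfE.
rewrite capp_tcons.
apply/(nul_heq _ (heq_capp G (capp_sh _ 1 _))); apply/(nul_heq _ (capp_sh G 1 _)).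
apply/nul_sh; rewrite -capp_cat.
have h := rg_pal_head c (hG t' (mem_head _ _)) bY; rewrite capp_cat in h.
have e : n <= n' + 1 by lia.
exact: (nul_le e h).
Qed.

Definition inlT t (X : cx) (x : X) : tT t t.+1 X := (x, 0).
Definition inrT t (X : cx) (b : B t X) : tT t t.+1 X := (0, b).
Lemma inlT_lin t X : lin aS (@inlT t X).
Proof.
split=> [x y|u j x _]; apply: pairE => //=; first by rewrite addr0.
by rewrite [RHS](additive_fun0 (@opD (B t X) u j)).
Qed.
Lemma inrT_lin t X : lin aS (@inrT t X).
Proof.
split=> [x y|u j x _]; apply: pairE => //=; first by rewrite addr0.
by rewrite (additive_fun0 (@opD X u j)).
Qed.

(** * Construction of the central cycle *)

Section BuildZ.
Variables (F : sfun) (t : nat) (X : cx) (s : int) (z' : F X) (g : F (B t X)).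
Hypotheses (hz : hd (- s) z') (hg : hd (- s + 1) g) (dg : dd g = 0).
Hypothesis dz : dd z' + fm F false (mB t t.+1 X) g = 0.
Hypotheses (cz' : forall j, op true j z' = op false j z').
Hypotheses (cg : forall j, op true j g = op false j g).

(** F(T_t X) is a cone only up to isomorphism, as F is abstract. The element with components z' and
    g is therefore assembled from the images of the two inclusions, the second one being odd because
    B_t X enters in degree -1. *)
Definition bz : scomp F (csf [:: T t]) X := fm F false (@inlT t X) z' + fm F true (@inrT t X) g.

Lemma bz_hd : hd (- s) bz.
Proof.
apply: hdD.
  apply: (@fm_hd F 0); last by rewrite addr0.
  by move=> k x h; rewrite addr0 in h; split=> //; exact: (@hd0 (B t X)).
apply: (@fm_hd F 1) => // k x h; split; first exact: hd0.
by apply: hdE h _; lia.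
Qed.

Lemma bz_d : dd bz = 0.
Proof.
rewrite /bz ddD (fm_d F false z' (linl_aS (inlT_lin t X))) (fm_d F true g (linl_aS (inrT_lin t X))).
rewrite [X in _ + X + _]fm_zero; last first.
  move=> x; rewrite /ddiff; apply: pairE.
    by rewrite /= (additive_fun0 (@opD X true t)) !addr0 subrr.
  by rewrite /= !(additive_fun0 (@ddD X)) ?subr0 ?oppr0.
rewrite dg (additive_fun0 (fm_aS F true (inrT_lin t X)).1) /= oppr0 add0r addr0.
have e b : ddiff true (@inrT t X) b = inlT t (mB t t.+1 X b).
  rewrite /ddiff; apply: pairE.
    by rewrite /= (additive_fun0 (@ddD X)) add0r oppr0 subr0.
  by rewrite /= opprK addNr.
rewrite (@fm_ext F _ _ _ _ _ e) -(@fm_comp F false false _ _ _ (@inlT t X) (mB t t.+1 X)); last first.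
  exact: linl_aS (inlT_lin t X).
rewrite -(fm_aS F false (inlT_lin t X)).1 dz.
exact: (additive_fun0 (fm_aS F false (inlT_lin t X)).1).
Qed.

Lemma bz_central j : op true j bz = op false j bz.
Proof.
have [iD il] := fm_aS F false (inlT_lin t X).
have [rD rl] := fm_aS F true (inrT_lin t X).
rewrite /bz; rewrite [LHS](opD _ _) [RHS](opD _ _).
by rewrite -!(il _ j z' isT) -!(rl _ j g isT) cz' cg.
Qed.

Lemma bz_pr : fm F true (@prF t X) bz = g.
Proof.
rewrite /bz (fm_linl F true (@prF_linl t X)).1.
rewrite (@fm_comp F true false _ _ _ (@prF t X)) // (@fm_comp F true true _ _ _ (@prF t X)) //.
by rewrite [X in X + _]fm_zero // add0r [RHS](esym (fm_id _)).
Qed.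
End BuildZ.

(** The unit of the approximate projector: X enters as the term in which every crossing contributes
    its identity part. *)
Fixpoint etam (v : seq nat) (X : cx) : cmor 0 X (capp (tw v) X) :=
  match v return cmor 0 X (capp (tw v) X) with
  | [::] => cid_mor X
  | i :: v' => comp0 (cinc (mB i i.+1 (capp (tw v') X))) (etam v' X)
  end.

Lemma etamE i v X x : etam (i :: v) X x = (etam v X x, 0).
Proof. by rewrite /= comp0E. Qed.

Lemma capf_etam e v (C D : cx) (f : C -> D) x : linl f ->
  capf e (tw v) f (etam v C x) = etam v D (f x).
Proof.
move=> fl; elim: v => [//|i v ih]; rewrite !etamE /= /tmap /= ih.
have f0 : capf e (tw v) f 0 = 0 by exact: additive_fun0 (linl_capf e (tw v) fl).1.
by rewrite f0; case: e {ih f0}; rewrite /= ?oppr0.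
Qed.

Lemma eqg_etam n G v (X : cx) : bnded X -> (forall j, j \in v -> rg (n + 1) G j) ->
  eqg n G (etam v X).
Proof.
move=> bX; elim: v => [|i v ih] h.
  have @f : cmor (- 0) X X by rewrite oppr0; exact: cid_mor.
  apply: (@eqg_inv n G 0 X X (cid_mor X) (ccast (esym (oppr0 _)) (cid_mor X)) (fun=> 0)).
  - by split=> [x y|t j x _]; rewrite ?addr0 // (additive_fun0 (opD _ _)).
  - by move=> k x _; exact: hd0.
  - by move=> x; rewrite ccastE.
  - by move=> x; rewrite ccastE /= (additive_fun0 (@ddD X)) !subr0.
  - by [].
apply: eqg_comp0; last by apply: ih => j jv; apply: h; rewrite inE jv orbT.
apply: (nul_retr (retr_capp G (@retr_cinc _ _ _ _))).
apply/(nul_heq _ (capp_sh G _ _)); apply/nul_sh; rewrite add0r.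
have := h i (mem_head _ _) _ (bnded_capp (A := tw v) bX).
by rewrite capp_cat.
Qed.

Lemma central_capp j A (C : cx) : avoid j A -> (forall x : C, op true j x = op false j x) ->
  forall x : capp A C, op true j x = op false j x.
Proof.
by move=> h hC x; rewrite !(op_capp _ _ h); apply: capf_ext => y; exact: hC.
Qed.

Section ExistsZ.
Variables (K t : nat) (ts v : seq nat) (n0 : int) (L : seq nat).
Hypotheses (ct : chn t ts) (gv : good n0 v ts) (n0s : n0 < - pis ts).
Hypothesis av : forall j, j \notin L -> avoid j (tw (t :: ts)).
Hypothesis vz : van L (- pis ts) (capp (tw (v ++ t :: pal ts)) (U K)).
Local Notation Om := (csf (tw v)).
Local Notation F := (scomp Om (Jsf t ts)).

Let FE (X : cx) : F X = capp (tw (v ++ t :: pal ts)) X.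
Proof. by rewrite tw_cat capp_cat -JsfE. Qed.

Let av' j : j \notin L -> avoid j (tw (v ++ t :: pal ts)).
Proof.
move=> /av /allP h; apply/allP => l; rewrite /tw => /mapP[i iv ->]; apply: h.
apply/mapP; exists i => //; move: iv; rewrite mem_cat !inE.
by case/or3P=> [/(gv.1) ->|->|/pal_sub ->]; rewrite ?orbT.
Qed.

Let cU j (x : U K) : op true j x = op false j x. Proof. by []. Qed.

Let cFU j (x : F (U K)) : j \notin L -> op true j x = op false j x.
Proof.
move=> jL; move: x.
suff : forall x : F (U K), op true j x = op false j x by [].
rewrite FE; apply: central_capp; [exact: av' | exact: cU].
Qed.

Let cB j (x : B t (U K)) : j \notin L -> op true j x = op false j x.
Proof.
move=> jL; apply: (@central_capp j [:: Bl t] (U K)); last exact: cU.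
by have := av jL => /= /andP[-> _].
Qed.

Let cFB j (x : F (B t (U K))) : j \notin L -> op true j x = op false j x.
Proof.
move=> jL; move: x.
suff : forall x : F (B t (U K)), op true j x = op false j x by [].
by rewrite FE; apply: central_capp; [exact: av' | move=> x; exact: cB].
Qed.

Let cOB j (x : Om (B t (U K))) : j \notin L -> op true j x = op false j x.
Proof.
move=> jL; apply: (@central_capp j (tw v) (B t (U K))); last by move=> y; exact: cB.
apply/allP => l lv; have /allP := av' jL; apply.
by rewrite tw_cat mem_cat lv.
Qed.

(** The element x_t ⊗ 1 - 1 ⊗ x_(t+1) of B_t, which is the unit for the pairing [kapE] below. *)
Definition delta1 : B t (U K) := dB (U K) (neqS t) (1 : {mpoly int[K]}).

(** After the approximate projector, [Pim] is surjective on homology in degree -pis, so [delta1]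
    lifts up to a boundary. The lift is made in Koszul degree zero, by [kin] and [kfst], and is
    therefore central for the strands of L; the remaining strands do not occur in the word. *)
Lemma exists_g : exists (g : F (B t (U K))) (e0 : Om (B t (U K))),
  [/\ [/\ hd (- pis ts) g, dd g = 0 & forall j, op true j g = op false j g],
      hd (-1) e0, forall j, op true j e0 = op false j e0 &
      fm Om true (shF (Pim t ts (U K))) g = etam v _ delta1 - dd e0].
Proof.
pose f := capm (tw v) (Pim t ts (U K)).
have hf : eqv n0 f.
  apply/eqg_eqv; apply: (@eqg_Pim n0) => //; first exact: bnded_U.
  by move=> s /gv.2 [].
move/eqvP: hf => /(_ [::] L (- pis ts) n0s) [fs _].
pose D := etam v (sh (pis ts) (B t (U K))) delta1.
have cD j : op true j delta1 = op false j delta1 by rewrite /delta1 -!mfop.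
have hD : hd (- pis ts) D.
  apply: (@mfhd0 _ _ (etam v _)).
  rewrite -[hd _ _]/(@hd (B t (U K)) (- pis ts + pis ts) delta1) addNr.
  by apply: (@mfhd0 _ _ (dB (U K) (neqS t))); left.
have dD : dd D = 0.
  rewrite /D -mfd -[dd _]/(- @dd (B t (U K)) delta1) /delta1 -mfd.
  by rewrite -[dd _]/(0 : {mpoly int[K]}) mf0 oppr0 mf0.
have [|gg [hgg lgg [w hw ew]] [e [h [he hh le eg]]]] := fs (kin L D).
  split.
  - exact: kin_hd.
  - apply: kin_kdel => c _; rewrite /phi /D -!mfop; apply/eqP; rewrite subr_eq0.
    by apply/eqP; congr (etam _ _ _); exact: cD.
  - exists 0; first exact: bh0.
    by rewrite bl0 /= kin_kosm ?dD ?kin0 //; exact: ddD.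
have ehd := kfst_hd he; have eg' := f_equal (@kfst L _) eg.
rewrite /= (additive_funB (@kfstD L _)) kfst_kosm kfst_kin (@kfstD L _) kfst_kosm kfst_kdel addr0 in eg'.
pose e0 := fshc Om (pis ts) (B t (U K)) (kfst e).
exists (kfst gg : F (B t (U K))), (- - e0); split.
- split.
  + have := kfst_hd hgg; rewrite addr0; exact.
  + by have := f_equal (@kfst L _) ew; rewrite /= kfst_kosm kfst_kdel.
  + move=> j; case: (boolP (j \in L)) => jL; last exact: cFB.
    by apply/eqP; rewrite -subr_eq0; apply/eqP; exact: (kfst_central lgg jL).
- rewrite opprK.
  have := @mfhd 0 _ _ (fshc Om (pis ts) (B t (U K))) (- pis ts - 1) (kfst e).
  rewrite addr0 => /(_ ehd); rewrite -[hd _ _]/(@hd (Om (B t (U K))) (- pis ts - 1 + pis ts) e0).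
  by move/hdE; apply; lia.
- move=> j; rewrite opprK; case: (boolP (j \in L)) => jL; last exact: cOB.
  have := kfst_central le jL; rewrite /phi => /eqP; rewrite subr_eq0 => /eqP ec.
  have := mfop (fshc Om (pis ts) (B t (U K))) true j (kfst e).
  by rewrite ec (mfop (fshc Om (pis ts) (B t (U K))) false j (kfst e)).
- have := f_equal (fshc Om (pis ts) (B t (U K))) eg'.
  rewrite mfB mfd -[dd (fshc _ _ _ _)]/(- @dd (Om (B t (U K))) e0) => E.
  have e1 : fshc Om (pis ts) (B t (U K)) D = etam v _ delta1 by exact: capf_etam.
  have e2 : fshc Om (pis ts) (B t (U K)) (capm [::] f (kfst gg)) =
      fm Om true (shF (Pim t ts (U K))) (kfst gg).
    rewrite /f /= capmE; exact: (@capf_comp true false).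
  rewrite e1 e2 in E; rewrite opprK.
  by zlin E.
Qed.

(** Completing g to a cycle of the cone F(T_t U) requires a central primitive of F(m) g. This
    obstruction lies in the odd degree -pis of the closure without the last crossing of the loop,
    where the homology vanishes by assumption. *)
Lemma exists_z : exists (z0 : scomp F (csf [:: T t]) (U K)) (e0 : Om (B t (U K))),
  [/\ [/\ hd (- (pis ts + 1)) z0, dd z0 = 0 & forall j, op true j z0 = op false j z0],
      hd (-1) e0, forall j, op true j e0 = op false j e0 &
      fm Om true (shF (Pim t ts (U K))) (fm F true (@prF t (U K)) z0) =
        etam v _ delta1 - dd e0].
Proof.
have [g [e0 [[hg dg cg] he ce eg]]] := exists_g.
pose mg := fm F false (mB t t.+1 (U K)) g.
have ml : lin aS (mB t t.+1 (U K)) by exact: mf_lin.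
have hmg : hd (- pis ts) mg.
  apply: (@fm_hd F 0); last by rewrite addr0.
  by move=> k x; rewrite addr0; exact: mfhd0.
have dmg : dd mg = 0.
  rewrite /mg fm_d; last exact: linl_aS.
  have dm x : ddiff false (mB t t.+1 (U K)) x = 0 by rewrite /ddiff mfd subrr.
  by rewrite (fm_zero _ _ dm) addr0 dg (additive_fun0 (fm_aS F false ml).1).
have cmg j : op true j mg = op false j mg.
  by rewrite /mg -!((fm_aS F false ml).2 _ j g isT) cg.
have vz' : van L (- pis ts) (F (U K)) by rewrite FE.
have [|e [h [he' hh le em]]] := vz' (kin L mg).
  split.
  - exact: kin_hd.
  - by apply: kin_kdel => c _; rewrite /phi cmg subrr.
  - exists 0; first exact: bh0.
    by rewrite bl0 /= kin_kosm ?dmg ?kin0 //; exact: ddD.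
have {}em := f_equal (@kfst L _) em.
rewrite /= kfst_kin (@kfstD L _) kfst_kosm kfst_kdel addr0 in em.
have hz' : hd (- (pis ts + 1)) (- kfst e).
  by apply: hdN; apply: hdE (kfst_hd he') _; lia.
have hg' : hd (- (pis ts + 1) + 1) g by apply: hdE hg _; lia.
have dz : dd (- kfst e) + mg = 0 by rewrite (additive_funN (@ddD (F (U K)))) em addNr.
have cz' j : op true j (- kfst e) = op false j (- kfst e).
  case: (boolP (j \in L)) => jL; last exact: cFU.
  have := kfst_central le jL; rewrite /phi => /eqP; rewrite subr_eq0 => /eqP ec.
  by rewrite !(additive_funN (opD _ _)) ec.
exists (bz (- kfst e) g), e0; split => //.
- split; [exact: bz_hd | exact: bz_d | exact: bz_central].
- by rewrite bz_pr.
Qed.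
End ExistsZ.

Definition wx t (F : sfun) (X : cx) (x : scomp F (csf [:: T t]) X) : F (tT t t.+1 X) := x.
Definition wcast s t (F : sfun) (X D : cx) (f : cmor s (F (tT t t.+1 X)) D) :
  cmor s (scomp F (csf [:: T t]) X) D := f.
Lemma wcastE s t (F : sfun) (X D : cx) (f : cmor s (F (tT t t.+1 X)) D) x :
  wcast f x = f (wx x).
Proof. by []. Qed.
Lemma wx_fm t (F : sfun) (C D : cx) e (f : C -> D) x :
  wx (fm (scomp F (csf [:: T t])) e f x) =
  fm F e (fm (csf [:: T t]) e f : tT t t.+1 C -> tT t t.+1 D) (wx x).
Proof. by []. Qed.
Lemma eqg_wcast n A s t (F : sfun) (X D : cx) (f : cmor s (F (tT t t.+1 X)) D) :
  eqg n A f -> eqg n A (wcast f).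
Proof. by []. Qed.
Definition scast (A B : sfun) (X D : cx) (f : cmor 0 (A (B X)) D) :
  cmor 0 (scomp A B X) D := f.

Lemma retr_TS_cap t v (Y : cx) :
  retr (capp (tw (rcons v t)) (tS Y (neqS t))) (sh 1 (capp (tw v) Y)).
Proof.
rewrite /tw map_rcons -cats1 capp_cat.
apply: retr_trans (capp_sh (tw v) 1 Y).1.
by apply: retr_capp; exact: retr_TS.
Qed.

Lemma opfs_J t ts : opfs (Jsf t ts).
Proof.
elim: ts t => [|t' ts' ih] t; first exact: opfs_csf.
by apply: opfs_scomp; [exact: opfs_csf | apply: opfs_scomp; [exact: ih | exact: opfs_csf]].
Qed.
Lemma opfs_W v t ts : opfs (scomp (scomp (csf (tw v)) (Jsf t ts)) (csf [:: T t])).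
Proof.
apply: opfs_scomp; last exact: opfs_csf.
by apply: opfs_scomp; [exact: opfs_csf | exact: opfs_J].
Qed.
Lemma pis_even ts : odd (absz (pis ts + 1)) = false.
Proof. by rewrite pisE; lia. Qed.

(** * The cone of the central cycle kills the enlarged block *)

Section EKill.
Variables (K t : nat) (ts v : seq nat) (n0 : int).
Hypotheses (ct : chn t ts) (gv : good n0 v ts) (tK : (t.+1 < K)%N).
Local Notation Om := (csf (tw v)).
Local Notation F := (scomp Om (Jsf t ts)).
Local Notation W := (scomp F (csf [:: T t])).
Local Notation s := (pis ts + 1).
Variables (z0 : W (U K)) (e0 : Om (B t (U K))).
Hypotheses (z0h : hd (- s) z0) (z0d : dd z0 = 0).
Hypothesis (z0c : forall j, op true j z0 = op false j z0).
Hypotheses (e0h : hd (- 1) e0) (e0c : forall j, op true j e0 = op false j e0).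
Hypothesis z0e : fm Om true (shF (Pim t ts (U K))) (fm F true (@prF t (U K)) z0) =
  etam v _ (delta1 K t) - dd e0.

Local Notation Wop := (@opfs_W v t ts).
Local Notation sE := (pis_even ts).

Local Notation zk h := (zok Wop sE z0h z0d z0c h).
Local Notation E := (Esf Wop sE z0h z0d z0c).

Lemma WE (X : cx) : W X = capp (tw (v ++ pal (t :: ts))) X.
Proof.
rewrite -[fo W X]/(capp (tw v) (Jsf t ts (capp [:: T t] X))) JsfE -!capp_cat.
by rewrite -[[:: T t]]/(tw [:: t]) -!tw_cat -catA.
Qed.

Section KillNew.
Variable Y : cx.
Hypotheses (hY : okK K (B t Y)) (bY : bnded Y).

(** The pairing of B_t Y with B_t: insert y, then apply the divided difference to the middle factor.
    By the Frobenius relation between [rB] and [dB] it returns y on [delta1]. *)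
Definition kapE (y : B t Y) (b : B t (U K)) : B t Y :=
  rB Y (neqS t) (bmap (ev y) b).

Let kapEE y b : kapE y b = ((ev y b.1).2, (ev y b.2).2). Proof. by []. Qed.

Let k_D b : additive_fun (kapE ^~ b).
Proof. by move=> y y'; rewrite !kapEE /ev !mactDr. Qed.
Let k_l y : linl (kapE y).
Proof.
split=> [b b'|u j b uj]; first by rewrite !kapEE /ev !mactDl.
have h := linl_bmap t (ev_linl y hY).
rewrite /kapE -mfop; congr (rB _ _ _); exact: h.2.
Qed.
Let k_X j y b : kapE (op true j y) b = kapE y (op false j b).
Proof. by rewrite !kapEE !ev_X. Qed.
Let k_Y j y b : kapE (op false j y) b = op false j (kapE y b).
Proof. by rewrite !kapEE /ev -!mact_op. Qed.
Let k_d y b : kapE (dd y) b = dd (kapE y b) - kapE y (dd b).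
Proof.
by rewrite !kapEE !ev_d /ev /=; rewrite !(additive_fun0 (mactDl y)) !subr0.
Qed.
Let k_h i k y b : hd i y -> hd k b -> hd (i + k) (kapE y b).
Proof.
move=> hy [hb1 hb2]; split; rewrite kapEE /=.
  by have [] := ev_hd hy hb1.
by have [] := ev_hd hy hb2.
Qed.

(** This takes B_t out of the whole loop: the innermost crossing T_t is removed by [rhoT], the
    others by [Pim], and only the approximate projector remains. *)
Let out : cmor 0 (W (B t Y)) (sh 1 (sh (pis ts) (Om (B t Y)))) :=
  wcast (comp0 (shm 1 (scast (comp0 (fshc Om (pis ts) (B t Y)) (fmor Om (Pim t ts Y)))))
    (comp0 (fshc F 1 (B t Y)) (fmor F (rhoT t Y)))).

Let outE x : out x = fm Om true (shF (Pim t ts Y)) (fm F true (shF (rhoT t Y)) (wx x)).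
Proof.
rewrite /out wcastE comp0E.
have -> : comp0 (fshc F 1 (B t Y)) (fmor F (rhoT t Y)) (wx x) =
    fm F true (shF (rhoT t Y)) (wx x).
  by rewrite comp0E [LHS](@fm_comp F true false).
move: (fm F true _ _) => y.
rewrite -[LHS]/(comp0 (fshc Om (pis ts) (B t Y)) (fmor Om (Pim t ts Y)) y) comp0E.
exact: (@fm_comp Om true false).
Qed.

Let rho_ev y : (fun x => shF (rhoT t Y) (fm (csf [:: T t]) false (ev y) x)) =1
  (fun x => kapE y (@prF t (U K) x)).
Proof. by move=> [x b]; rewrite /shF /rhoT comp0E. Qed.

Let kap_delta y : kapE y (delta1 K t) = y.
Proof.
have [eD el] := ev_linl y hY.
rewrite kapEE /delta1; apply: pairE.
  rewrite -[(dB _ _ _).1]/(- @op (U K) true t.+1 1) (additive_funN eD) el // /ev mact1.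
  have tS := neqS t; clear eD el; case: y => y1 y2; bop; exact: opprK.
by rewrite -[(dB _ _ _).2]/(1 : {mpoly int[K]}) /ev mact1.
Qed.

Let Hh (y : B t Y) : Om (B t Y) := fm Om false (kapE y) e0.

(** Multiplication by z0 followed by the way out is homotopic to the unit. By naturality of [Pim]
    both sides are given by pairing y with an element of the case of [U K]; there the difference is
    the boundary of e0, which supplies the homotopy. *)
Let out_z y : etam v (B t Y) y - out (zk hY y) = dd (Hh y) + Hh (dd y).
Proof.
have -> : out (zk hY y) = etam v (B t Y) y - fm Om false (kapE y) (dd e0).
  rewrite outE -[zk hY y]/(fm W false (ev y) z0) wx_fm.
  rewrite (@fm_comp F true false _ _ _ (shF (rhoT t Y))); last exact: shF_linl.
  rewrite (@fm_ext F true _ _ _ _ (rho_ev y)).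
  rewrite -(@fm_comp F false true _ _ _ (kapE y) (@prF t (U K))) //.
  move: z0e; rewrite -[z0]/(wx z0); move: (fm F true (@prF t (U K)) (wx z0)) => g ge.
  rewrite -[fm F false _ g]/(fm Om false (fm (Jsf t ts) false (kapE y)) g).
  rewrite (@fm_comp Om true false); last exact: shF_linl.
  have e x : shF (Pim t ts Y) (fm (Jsf t ts) false (kapE y) x) =
      kapE y (shF (Pim t ts (U K)) x).
    by apply: (Pim_nat x (k_l y)) => -[[a1 a2] [a3 a4]].
  rewrite (@fm_ext Om _ _ _ _ _ e) -(@fm_comp Om false true _ _ _ (kapE y)) // ge.
  rewrite (additive_funB (fm_linl Om false (k_l y)).1) [X in X - _]capf_etam //.
  by rewrite kap_delta.
have -> : dd (Hh y) = fm Om false (kapE y) (dd e0) + fm Om true (kapE (dd y)) e0.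
  exact: (@cz_d Om _ _ _ kapE k_l k_d e0 y).
rewrite (fm_parity _ (k_l (dd y)).1 e0h); last first.
  move=> i [b1 b2] [[->|h1] [e|h2]]; try by left.
  by right; move: h1 h2 => /= -> ->.
rewrite [odd _](_ : _ = true) // -[fm Om false (kapE (dd y)) e0]/(Hh (dd y)) /lsign; zlin.
Qed.

Program Definition etas : cmor (s + 0) (B t Y) (sh 1 (sh (pis ts) (Om (B t Y)))) :=
  @Cmor (s + 0) (B t Y) (sh 1 (sh (pis ts) (Om (B t Y)))) (etam v (B t Y)) _ _ _ _.
Next Obligation. exact: (mfD (etam v (B t Y))). Qed.
Next Obligation. exact: (mfop (etam v (B t Y))). Qed.
Next Obligation. by move=> x; rewrite mfd -[RHS]/(- - dd (etam v (B t Y) x)) opprK. Qed.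
Next Obligation.
move=> k x hx; apply: (@mfhd0 _ _ (etam v (B t Y))); apply: hdE hx _.
by move: (pis ts) => p; clear; lia.
Qed.

(** The unit and the way out are both equivalences in the context G, hence so is multiplication by
    z0 on B_t Y. The cancellation costs one degree, which is why n0 < n is strict and the argument
    runs at n - 1. *)
Lemma kill_new G n : n0 < n -> (forall j, j \in ts -> rg n0 G j) ->
  nul n (capp G (cone (zk hY))).
Proof.
move=> nn hG; have bB : bnded (B t Y) by exact: (@bnded_lapp (false, (t, t.+1))).
have hG' m j : n0 <= m -> j \in ts -> rg m G j.
  by move=> nm jt; apply: rg_le nm (hG j jt).
pose n1 := n - 1; have n01 : n0 <= n1 by rewrite /n1; lia.
have eta_eqg : eqg n1 G etas.
  have @i : cmor s (Om (B t Y)) (sh 1 (sh (pis ts) (Om (B t Y)))).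
    refine (@Cmor s (Om (B t Y)) (sh 1 (sh (pis ts) (Om (B t Y)))) (fun x => x) _ _ _ _) => //.
    - by move=> x; rewrite -[RHS]/(- - dd x) opprK.
    - by move=> k x hx; apply: hdE hx _; lia.
  have @i' : cmor (- s) (sh 1 (sh (pis ts) (Om (B t Y)))) (Om (B t Y)).
    refine (@Cmor (- s) (sh 1 (sh (pis ts) (Om (B t Y)))) (Om (B t Y)) (fun x => x) _ _ _ _) => //.
    - by move=> x; rewrite -[dd x in LHS]/(- - @dd (Om (B t Y)) x) opprK.
    - move=> k x hx; have {}hx : @hd (Om (B t Y)) (k - s + 1 + pis ts) x := hx.
      by apply: hdE hx _; lia.
  have e : 0 + s = s + 0 by rewrite addrC.
  apply: (@eqg_ext n1 G _ _ _ (ccast e (ccomp i (etam v (B t Y))))).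
    by move=> x; rewrite ccastE.
  apply/eqg_cast; apply: eqg_comp; first exact: (@eqg_iso _ _ _ _ _ _ i').
  apply: eqg_etam => // j /(gv.1) jt; apply: hG' => //.
  by have h := n01; rewrite pisE; clear -h; lia.
have out_eqg m : n0 <= m -> eqg m G out.
  move=> n0m; apply: eqg_wcast; apply: eqg_comp0.
    apply: eqg_shm; apply: eqg_comp0; first exact: eqg_fshc.
    apply: eqg_fmor; rewrite -[fo Om _]/(capp (tw v) (cone (Pim t ts Y))) -capp_cat.
    apply: (@eqg_Pim n0) => //; last lia.
    by move=> j jt; apply: rg_cat; have [] := gv.2 j jt.
  apply: eqg_comp0; first exact: eqg_fshc.
  apply: eqg_fmor; rewrite -[fo F _]/(capp (tw v) (Jsf t ts (cone (rhoT t Y)))) JsfE.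
  by rewrite -!capp_cat; exact: eqg_rhoT.
have e : n1 + 0 + 1 = n by rewrite /n1 addr0 subrK.
rewrite -[nul n _]/(eqg n G (zk hY)) -e; apply: (@eqg_cancel n1 G _ _ _ _ _ out); last exact: out_eqg.
apply: (@eqg_homotopic n1 G _ _ _ etas _ (Hh : B t Y -> sh 1 (sh (pis ts) (Om (B t Y)))) _ _ _ eta_eqg).
- exact: (@cz_lin Om _ _ _ kapE (@opfs_csf _) k_D k_l k_X k_Y e0 e0c false).
- move=> k x hx.
  have := @cz_hd Om _ _ _ kapE k_h e0 false (- 1) _ x e0h hx.
  by move/hdE; apply; lia.
- move=> x.
  have -> : @dd (sh 1 (sh (pis ts) (Om (B t Y)))) (Hh x) = @dd (Om (B t Y)) (Hh x).
    exact: opprK.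
  exact: out_z.
Qed.
End KillNew.

(** For a crossing of the old block both ends of the cone vanish: B_i Y next to G directly, and B_i
    behind the loop by [rg_pal]. *)
Lemma kill_old G n (Y : cx) i (hY : okK K (B i Y)) : i \in ts -> bnded Y -> n0 <= n ->
  rg n0 G i -> nul n (capp G (cone (zk hY))).
Proof.
move=> it bY nn hG; apply/(nul_heq _ (capp_cone G _)); apply: nul_cone.
  rewrite WE -capp_cat; apply: (nul_le nn).
  have : rg n0 (G ++ tw (v ++ pal (t :: ts))) i.
    rewrite tw_cat catA; apply: rg_pal => // j jt; apply: rg_cat.
    by have [] := gv.2 j jt.
  by move=> /(_ Y bY); rewrite capp_cat.
have := hG Y bY; rewrite capp_cat; apply: nul_le.
by rewrite pisE; lia.
Qed.

Lemma kill G n (Y : cx) i : i \in t :: ts -> okK K (B i Y) -> bnded Y -> n0 < n ->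
  (forall j, j \in ts -> rg n0 G j) -> nul n (capp G (E (B i Y))).
Proof.
rewrite inE => it hY bY nn hG.
apply/(nul_heq _ (heq_capp G (heq_Ezok Wop sE z0h z0d z0c hY))).
case/orP: it hY => [/eqP ->|it] hY; first exact: kill_new.
by apply: kill_old => //; [exact: ltW | exact: hG].
Qed.

Lemma eqg_Eeta G n v' (Y : cx) : {subset v' <= t :: ts} -> okK K Y -> bnded Y ->
  (forall j, j \in t :: ts -> (j.+1 < K)%N) ->
  n0 < n -> (forall j, j \in ts -> rg n0 G j) -> eqg n G (fmor E (etam v' Y)).
Proof.
move=> sv hY bY hK nn hG; elim: v' sv => [|i v' ih] sv.
  have e : (- 0 : int) = 0 by rewrite oppr0.
  apply: (@eqg_iso _ _ _ _ _ _ (ccast (esym e) (cid_mor _))) => x; rewrite ccastE.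
    exact: fm_id.
  exact: fm_id.
have sv' : {subset v' <= t :: ts} by move=> j jv; apply: sv; rewrite inE jv orbT.
have it : i \in t :: ts by apply: sv; exact: mem_head.
have {}ih := ih sv'.
have kv : all (kletter K) (tw v').
  apply/allP => l /mapP[j jv ->]; have := hK j (sv' _ jv).
  by rewrite /kletter /=; lia.
apply: (@eqg_ext n G _ _ _ (comp0 (fmor E (cinc (mB i i.+1 (capp (tw v') Y)))) (fmor E (etam v' Y)))).
  move=> x; rewrite comp0E [LHS](@fm_comp E false false); last exact: linl_mf.
  by apply: fm_ext => y; rewrite etamE.
apply: eqg_comp0 => //; apply: eqg_fmor.
apply: (nul_retr (retr_capp G (retr_fm E (@retr_cinc _ _ _ _)))).
apply/(nul_heq _ (heq_capp G (fm_sh E _ _))); apply/(nul_heq _ (capp_sh G _ _)).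
apply/nul_sh; apply: (kill it); last by []; last by rewrite add0r; lia.
  apply: (@okK_capp K [:: Bl i]); last exact: okK_capp.
  by have := hK i it; rewrite /kletter /=; lia.
exact: bnded_capp.
Qed.
End EKill.

Lemma okK_tS K t (Y : cx) : (t.+1 < K)%N -> okK K Y -> okK K (tS Y (neqS t)).
Proof.
move=> tK hY u j [y x] hj; apply: pairE; last exact: hY.
apply: (@okK_capp K [:: Bl t]) => //=.
by rewrite /kletter /= tK ltnW.
Qed.

Program Definition trm K s (C D : cx) (f : cmor s C D) : cmor s (tr K C) (tr K D) :=
  @Cmor s (tr K C) (tr K D) f _ _ _ _.
Next Obligation. by move=> K s C D f; exact: (mfD f). Qed.
Next Obligation.
by move=> K s C D f t j x; exact: ((@tr_lin K aS C D f (mf_lin f)).2 t j x isT).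
Qed.
Next Obligation. by move=> K s C D f; exact: (mfd f). Qed.
Next Obligation. by move=> K s C D f; exact: (mfhd f). Qed.

Lemma van_bnded L k (C : cx) : 0 < k -> bnded C -> van L k C.
Proof. by move=> k0 /bnded_nul /(_ [::] L k k0). Qed.

(** * The two triangles *)

Section Triangle.
Variables (K t : nat) (ts v v' : seq nat) (n0 : int).
Hypotheses (ct : chn t ts) (gv : good n0 v ts) (gv' : good n0 v' (t :: ts)).
Hypothesis (hK : forall j, j \in t :: ts -> (j.+1 < K)%N).
Local Notation Om := (csf (tw v)).
Local Notation F := (scomp Om (Jsf t ts)).
Local Notation W := (scomp F (csf [:: T t])).
Local Notation s := (pis ts + 1).
Variables (z0 : W (U K)) (e0 : Om (B t (U K))).
Hypotheses (z0h : hd (- s) z0) (z0d : dd z0 = 0).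
Hypothesis (z0c : forall j, op true j z0 = op false j z0).
Hypotheses (e0h : hd (- 1) e0) (e0c : forall j, op true j e0 = op false j e0).
Hypothesis z0e : fm Om true (shF (Pim t ts (U K))) (fm F true (@prF t (U K)) z0) =
  etam v _ (delta1 K t) - dd e0.

Let tK : (t.+1 < K)%N. Proof. by apply: hK; exact: mem_head. Qed.
Local Notation Wop := (@opfs_W v t ts).
Local Notation sE := (pis_even ts).
Local Notation E := (Esf Wop sE z0h z0d z0c).

Variables (A : seq letter) (M : seq nat) (Y : cx).
Hypotheses (hA : forall j, j \in ts -> rg n0 A j) (hY : okK K Y) (bY : bnded Y).

Let okw u : {subset u <= t :: ts} -> all (kletter K) (tw u).
Proof.
move=> su; apply/allP => l /mapP[j ju ->]; have := hK (su _ ju).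
by rewrite /kletter /=; lia.
Qed.

Let killE G n (Z : cx) i : i \in t :: ts -> okK K Z -> bnded Z -> n0 < n ->
  (forall j, j \in ts -> rg n0 G j) -> nul n (capp G (E (B i Z))).
Proof.
move=> it hZ bZ nn hG; apply: (kill ct gv tK e0h e0c z0e) => //.
by apply: (@okK_capp K [:: Bl i]) => //=; have := hK it; rewrite /kletter /=; lia.
Qed.

Let etaE G n (Z : cx) : okK K Z -> bnded Z -> n0 < n ->
  (forall j, j \in ts -> rg n0 G j) -> eqg n G (fmor E (etam v' Z)).
Proof. by move=> hZ bZ nn hG; apply: (eqg_Eeta ct gv tK e0h e0c z0e) => //; exact: gv'.1. Qed.

(** E kills B_t and [tS] is the cone of Y → B_t Y, so E Y is E of [tS] up to a shift. In the
    triangle that defines the latter, the last crossing of the loop cancels against the negative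
    crossing, leaving the open word of the first hypothesis. *)
Lemma van_E k : n0 + 1 < k ->
  van M k (capp (A ++ tw (v ++ t :: pal ts)) Y) ->
  van M (k + s) (capp A (tS Y (neqS t))) -> van M k (capp A (E Y)).
Proof.
move=> nk h1 h2; have hS := okK_tS tK hY.
have v1 : van M (k - 1) (capp A (E (tS Y (neqS t)))).
  apply/(van_heq _ _ (heq_capp A (heq_Ezok Wop sE z0h z0d z0c hS))).
  apply/van_capp_cone; apply: bcone_mid; last first.
    by apply: vbE h2 _; move: (pis ts) => p; clear; lia.
  rewrite -/(van M (k - 1) (capp A (W (tS Y (neqS t))))) WE.
  rewrite (_ : v ++ pal (t :: ts) = rcons (v ++ t :: pal ts) t); last by rewrite /= -cats1 -catA.
  apply: (retr_van (retr_capp A (retr_TS_cap t _ Y))).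
  apply/(van_heq _ _ (capp_sh A 1 _)); apply/van_sh.
  by rewrite subrK -capp_cat.
have {}v1 : van M (k - 1) (capp A (cone (fmor E (dB Y (neqS t))))).
  by apply/(van_heq _ _ (heq_capp A (fm_cone E (dB Y (neqS t))))).
have {}v1 := (van_capp_cone M (k - 1) A (fmor E (dB Y (neqS t)))).1 v1.
have e : k - 1 + 0 + 1 = k by rewrite addr0 subrK.
have := vb_bcone_right v1; rewrite subrK => h; apply: vbE e; apply: h.
have nul1 : nul (n0 + 1) (capp A (E (B t Y))).
  by apply: killE => //; [exact: mem_head | clear; lia].
by have := nul1 [::] M k nk.
Qed.

Let etaE_van k : n0 + 1 < k ->
  vb (bcone (kosbm M (capm A (fmor E (etam v' Y))))) k.
Proof.
move=> nk; apply/van_capp_cone.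
have h : nul (n0 + 1) (capp A (cone (fmor E (etam v' Y)))).
  by apply: etaE => //; clear; lia.
exact: (h [::] M k nk).
Qed.

(** Descending induction on odd k, starting in positive degrees where all terms are zero. Let Z be Y
    behind the larger projector. The unit identifies E Z with E Y, and the loop in W Z is absorbed,
    so the triangle of Z, W Z and E Z deduces degree k from degree k + s, which is odd as well. *)
Lemma van_proj_down : (forall k, odd (absz k) -> n0 + 1 < k -> van M k (capp A (E Y))) ->
  forall k, odd (absz k) -> n0 + 1 < k -> van M k (capp A (capp (tw v') Y)).
Proof.
move=> hE k; have : exists d : nat, 0 < k + d%:Z by exists (absz k).+1; clear; lia.
move=> [d]; elim: d k => [|d ih] k kd ok nk.
  apply: van_bnded; first by rewrite addr0 in kd.
  by do 2!apply: bnded_capp.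
set Z := capp (tw v') Y.
have hZ : okK K Z by apply: okK_capp => //; apply: okw; exact: gv'.1.
have bZ : bnded Z by exact: bnded_capp.
have p0 : 0 <= pis ts by rewrite pisE.
have vE : van M k (capp A (E Z)).
  apply: (vb_bcone_left (etaE_van nk)).
  by apply: vbE (hE k ok nk) _; rewrite addr0.
have {}vE : van M k (capp A (cone (zok Wop sE z0h z0d z0c hZ))).
  by apply/(van_heq _ _ (heq_capp A (heq_Ezok Wop sE z0h z0d z0c hZ))).
have {}vE := (van_capp_cone M k A (zok Wop sE z0h z0d z0c hZ)).1 vE.
have vW : van M k (capp A (W Z)).
  apply: (vb_bcone_left vE); apply: ih.
  - by move: p0 kd; clear; lia.
  - by move: ok; rewrite pisE; clear; lia.
  - by move: p0 nk; clear; lia.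
have sW : {subset v ++ pal (t :: ts) <= t :: ts}.
  by move=> j; rewrite mem_cat => /orP[/(gv.1) jt|/pal_sub //]; rewrite inE jt orbT.
move: vW; rewrite WE /Z -!capp_cat -catA (@abs_l n0 M k A (tw v')) //.
- by move: nk; clear; lia.
- by move=> j /sW /gv'.2 [].
Qed.

(** The map W Y → E Y is injective on homology in degree k because Y contributes nothing in degree k
    + s, and E Y → E Z is injective since the unit becomes an equivalence under E. The composite
    factors through W Z, which has no homology in degree k. *)
Lemma van_loop k : n0 + 2 < k -> van M (k + s) (capp A Y) ->
  van M k (capp A (W (capp (tw v') Y))) -> van M k (capp A (W Y)).
Proof.
move=> nk h1 h2; set Z := capp (tw v') Y in h2.
have hZ : okK K Z by apply: okK_capp => //; apply: okw; exact: gv'.1.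
have {}h1 : van M (k + s) (capp A (tr K Y)).
  by apply/(van_heq _ _ (heq_capp A (heq_tr hY))).
have {}h2 : van M k (capp A (W (tr K Z))).
  by apply/(van_heq _ _ (heq_capp A (heq_fm W (heq_tr hZ)))).
apply/(van_heq _ _ (heq_capp A (heq_fm W (heq_sym (heq_tr hY))))).
pose i1 : cmor 0 (W (tr K Y)) (E Y) := cinc (zok Wop sE z0h z0d z0c (@okK_tr K Y)).
pose i2 : cmor 0 (W (tr K Z)) (E Z) := cinc (zok Wop sE z0h z0d z0c (@okK_tr K Z)).
pose fE := fmor E (etam v' Y); pose fW := fmor W (trm K (etam v' Y)).
have b1 : binj (kosbm M (capm A i1)) k.
  apply: binj_cone; apply/van_capp_cone.
  apply: (retr_van (retr_capp A (@retr_cinc _ _ _ _))).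
  apply/(van_heq _ _ (capp_sh A _ _)); apply/van_sh.
  by apply: vbE h1 _; move: (pis ts) => p; clear; lia.
have b2 : binj (kosbm M (capm A fE)) k.
  by apply: binj_cone; apply: etaE_van; move: nk; clear; lia.
have k0 : k + 0 = k by rewrite addr0.
move=> y cy; apply: (bndE _ k0); apply: b1; first exact: (cycE cy (esym k0)).
apply: (bndE _ k0); apply: b2.
  by apply: cycE (cyc_mor _ _) (esym k0); exact: (cycE cy (esym k0)).
have -> : kosbm M (capm A fE) (kosbm M (capm A i1) y) =
    kosbm M (capm A i2) (kosbm M (capm A fW) y).
  rewrite /= !kosm_comp; apply: kosm_ext => x.
  rewrite -!capm_comp !capmE; apply: capf_ext => w.
  apply: pairE => //; exact: (mf0 (etam v' Y)).
apply: bnd_mor; apply: (bndE _ (esym k0)); apply: h2.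
by apply: cyc_mor; exact: (cycE cy (esym k0)).
Qed.
End Triangle.

Definition edge t c b := ((t == c) && (t.+1 == b)) || ((t == b) && (t.+1 == c)).

Lemma edge_neq t c b : edge t c b -> c != b.
Proof. by rewrite /edge; lia. Qed.

Lemma weq_edge e t c b : edge t c b -> weq [:: (e, (c, b))] [:: (e, (t, t.+1))].
Proof.
case/orP=> /andP[/eqP <- /eqP <-]; first exact: weq_refl.
by apply: weq_swap; rewrite eq_sym neqS.
Qed.

Lemma swB_dB p q (pq : p != q) (qp : q != p) (Y : cx) :
  retr (tS Y pq) (tS Y qp).
Proof.
apply: (@retr_cone_conj 0 Y (bB p q Y) Y (bB q p Y) (dB Y pq) (dB Y qp)
  (oppm Y) (oppm Y) (swB Y pq) (swB Y qp)).
- by move=> x; exact: opprK.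
- by move=> [x y]; pcx Y.
- by move=> x; exact: opprK.
- by move=> x; pcx Y.
Qed.

Section MarkovEdge.
Variables (t c b : nat) (A : seq letter) (L : seq nat) (Q : cx) (D : Q -> Q) (k : int).
Hypotheses (tcb : edge t c b) (Ac : avoid c A) (Lc : c \notin L) (fD : freel c D).

Lemma markovT : van L k (capp A Q) -> van (c :: L) k (capp A (tT t t.+1 Q)).
Proof.
have w : heq (tT c b Q) (tT t t.+1 Q) := weq_edge true tcb Q.
move=> h; apply: (van_heq _ _ (heq_capp A w)).1.
exact: (@van_markov c b A L Q D (edge_neq tcb) Ac Lc fD).
Qed.
Lemma markovT_conv : van (c :: L) k (capp A (tT t t.+1 Q)) -> van L k (capp A Q).
Proof.
have w : heq (tT c b Q) (tT t t.+1 Q) := weq_edge true tcb Q.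
move=> h; apply: (@van_markov_conv c b A L Q D (edge_neq tcb) Ac Lc fD).
exact: (van_heq _ _ (heq_capp A w)).2.
Qed.
Lemma markovS : van L k (capp A Q) -> van (c :: L) k (capp A (tS Q (neqS t))).
Proof.
have cb := edge_neq tcb.
move=> h0; have h := @van_markov_star c b A L Q D cb Ac Lc fD k h0.
move: tcb cb h; case/orP=> /andP[/eqP <- /eqP <-] cb.
  by rewrite (bool_irrelevance cb (neqS t)).
by apply: (retr_van (retr_capp A _)); exact: swB_dB.
Qed.
End MarkovEdge.

(** * The recursion *)

Section Rules.
Variable K : nat.

(** Vanishing for the projector on the block ts, placed between A and R, with the strands of M
    closed. All good words are allowed; by [Ev_intro] it suffices to exhibit one for every bound. *)
Definition Ev (M : seq nat) (A : seq letter) (ts : seq nat) (R : seq letter) :=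
  forall n v k, good n v ts -> odd (absz k) -> n < k ->
    van M k (capp (A ++ tw v ++ R) (U K)).

Lemma good_le n n' v ts : n <= n' -> good n v ts -> good n' v ts.
Proof.
move=> nn [sv h]; split=> // i it; have [h1 h2] := h i it.
by split=> Y bY; [apply: nul_le (h1 Y bY) | apply: nul_le (h2 Y bY)].
Qed.

Lemma bnded_cU R : bnded (capp R (U K)).
Proof. exact: bnded_capp (@bnded_U K). Qed.

Lemma Ev_intro M A ts R :
  (forall n, exists n0 v, [/\ n0 <= n, good n0 v ts & forall k, odd (absz k) -> n < k ->
    van M k (capp (A ++ tw v ++ R) (U K))]) -> Ev M A ts R.
Proof.
move=> h n v k gv ok nk; have [n0 [v' [nn gv' h']]] := h n.
rewrite catA capp_cat (@good_change n M k A v v' ts) //; last exact: good_le gv'.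
  by rewrite -capp_cat -catA; exact: h'.
exact: bnded_cU.
Qed.

(** The strands are listed from the newest to the oldest, and each crossing joins neighbours in the
    list. A strand avoids all crossings after its own, which lets the Markov move remove it. *)
Fixpoint chl (c : nat) (Ls ts : seq nat) : bool :=
  match Ls, ts with
  | [::], [::] => true
  | b :: Ls', t :: ts' =>
    [&& edge t c b, c \notin Ls, avoid c (tw ts'), chn t ts' & chl b Ls' ts']
  | _, _ => false
  end.

Lemma chl_avoid c Ls ts j : chl c Ls ts -> j \notin c :: Ls -> avoid j (tw ts).
Proof.
elim: ts c Ls => [//|t ts ih] c [//|b Ls] /= /and5P[tcb _ _ _ h].
rewrite inE negb_or => /andP[jc jLs]; rewrite (ih _ _ h jLs) andbT.
move: jLs; rewrite inE negb_or => /andP[jb _].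
by move: tcb jc jb; rewrite /edge; clear; lia.
Qed.

Lemma chl_edge c Ls ts t : chl c Ls ts -> t \in ts -> (t \in c :: Ls) && (t.+1 \in c :: Ls).
Proof.
elim: ts c Ls => [//|t' ts ih] c [//|b Ls] /= /and5P[tcb _ _ _ h].
rewrite inE => /orP[/eqP ->|/(ih _ _ h) /andP[h1 h2]].
  by case/orP: tcb => /andP[/eqP -> /eqP ->]; rewrite !inE !eqxx ?orbT.
by rewrite inE h1 orbT inE h2 orbT.
Qed.

Lemma avoid_sub c u w : {subset u <= w} -> avoid c (tw w) -> avoid c (tw u).
Proof.
move=> s /allP h; apply/allP => l /mapP[j ju ->]; apply: h.
by apply/mapP; exists j => //; exact: s.
Qed.

Definition Cl c Ls ts := Ev (c :: Ls) [::] ts [::].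

Section Step.
Variables (c b t : nat) (Ls ts M : seq nat) (A R : seq letter).
Hypotheses (ch : chl c (b :: Ls) (t :: ts)) (hK : all (gtn K) [:: c, b & Ls]).
Hypothesis cl : Cl b Ls ts.
Hypothesis BK : all (kletter K) R.

Let ct : chn t ts. Proof. by case/and5P: ch. Qed.
Let tcb : edge t c b. Proof. by case/and5P: ch. Qed.
Let cL : c \notin b :: Ls. Proof. by case/and5P: ch. Qed.
Let cts : avoid c (tw ts). Proof. by case/and5P: ch. Qed.
Let cK : (c < K)%N. Proof. by case/andP: hK. Qed.

Let tsK j : j \in t :: ts -> (j.+1 < K)%N.
Proof. by move=> /(chl_edge ch) /andP[_ h]; exact: (allP hK _ h). Qed.

(** In the closure without the last crossing of the loop, strand c meets only the first t. The
    Markov move removes it, the rest of the loop is absorbed, and the closed projector on the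
    smaller block remains, where odd degrees vanish. *)
Let exz n0 v : good n0 v ts -> n0 < - pis ts ->
  exists (z0 : scomp (scomp (csf (tw v)) (Jsf t ts)) (csf [:: T t]) (U K))
         (e0 : csf (tw v) (B t (U K))),
  [/\ [/\ hd (- (pis ts + 1)) z0, dd z0 = 0 & forall j, op true j z0 = op false j z0],
      hd (-1) e0, forall j, op true j e0 = op false j e0 &
      fm (csf (tw v)) true (shF (Pim t ts (U K)))
        (fm (scomp (csf (tw v)) (Jsf t ts)) true (@prF t (U K)) z0) =
        etam v _ (delta1 K t) - dd e0].
Proof.
move=> gv n0s; apply: (@exists_z K t ts v n0 [:: c, b & Ls]) => //.
  by move=> j; exact: chl_avoid ch.
have fU := freel_capp (A := tw (pal ts)) (avoid_sub (@pal_sub ts) cts) (freel_U cK).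
have op_ : odd (absz (- pis ts)) by rewrite pisE; clear; lia.
rewrite tw_cat capp_cat -[capp (tw (t :: pal ts)) _]/(tT t t.+1 (capp (tw (pal ts)) (U K))).
apply: (markovT tcb _ cL fU); first exact: (avoid_sub gv.1).
rewrite -capp_cat (@abs_r n0 (b :: Ls) (- pis ts) [::] (tw v)) //; last 2 first.
- exact: bnded_U.
- by move=> j /pal_sub /gv.2 [].
by have := cl gv op_ n0s; rewrite cats0.
Qed.

(** Closing the newest strand of a projector. The cone E reduces the larger projector to the smaller
    one, at the price of two diagrams in which c meets a single crossing, positive in one and
    negative in the other. The Markov move removes c from both, and the rest is absorbed. *)
Lemma rule_two : c \notin M -> avoid c A -> avoid c R -> Ev M A ts R ->
  Ev (c :: M) A (t :: ts) R.
Proof.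
move=> cM cA cB h; apply: Ev_intro => n.
(* N has to lie below -pis for the existence of z0, and a few units below every k considered; 5 is
   slack for the degrees lost by cancellation. *)
pose N : int := - ((absz n)%:Z + pis ts + 5).
have p0 : 0 <= pis ts by rewrite pisE.
have [v gv] := good_exists ts N; have [v' gv'] := good_exists (t :: ts) N.
exists N, v'; split=> [||k ok nk] //; first by rewrite /N; move: p0; clear; lia.
have Ns : N < - pis ts by rewrite /N; clear; lia.
have Nk : N + 1 < k by rewrite /N; move: p0 nk; clear; lia.
have [z0 [e0 [[hz dz cz] he ce ez]]] := exz gv Ns.
set Y := capp R (U K).
have hY : okK K Y by apply: okK_capp => //; exact: okK_U.
have bY : bnded Y by exact: bnded_cU.
have fY : freel c (capf false R (Ddiv (Ordinal cK))) := freel_capp cB (freel_U cK).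
(* A alone need not kill the block, so a copy of v is inserted after it; absorption removes it at
   the end. *)
have rA j : j \in ts -> rg N (A ++ tw v) j by move=> /gv.2 [h1 _]; exact: rg_cat.
have cv : avoid c (tw v) := avoid_sub gv.1 cts.
have cAv : avoid c (A ++ tw v) by rewrite /avoid all_cat; apply/andP.
have hM j : odd (absz j) -> N < j -> van M j (capp (A ++ tw v) Y).
  by move=> oj nj; have := h N v j gv oj nj; rewrite catA capp_cat.
have key : van (c :: M) k (capp (A ++ tw v) (capp (tw v') Y)).
  apply: (@van_proj_down K t ts v v' N ct gv gv' tsK z0 e0 hz dz cz he ce ez (A ++ tw v) (c :: M) Y rA hY bY) => // j oj nj.
  have Nj : N < j by move: nj; clear; lia.
  apply: (@van_E K t ts v N ct gv tsK z0 e0 hz dz cz he ce ez (A ++ tw v) (c :: M) Y rA hY bY) => //.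
    rewrite tw_cat catA capp_cat -[capp (tw (t :: pal ts)) _]/(tT t t.+1 (capp (tw (pal ts)) Y)).
    have fP := freel_capp (A := tw (pal ts)) (avoid_sub (@pal_sub ts) cts) fY.
    apply: (markovT tcb _ cM fP); first by rewrite /avoid all_cat; apply/andP.
    rewrite -capp_cat -!catA.
    rewrite (_ : tw v ++ tw v ++ _ = (tw v ++ tw v) ++ tw (pal ts)) ?catA //.
    rewrite -[(A ++ _) ++ _]catA -catA.
    rewrite (@abs_r N M j A (tw v ++ tw v)) //; last first.
      by move=> i /pal_sub /gv.2 [h1 _]; exact: rg_cat.
    rewrite (@abs_r N M j A (tw v)) //; last by move=> i /gv.1 /gv.2 [].
    exact: hM.
  apply: (markovS tcb cAv cM fY); apply: hM.
    by move: oj; rewrite pisE; clear; lia.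
  by move: Nj p0; clear; lia.
move: key; rewrite -capp_cat -!catA (@abs_l N (c :: M) k A (tw v')) //.
- by rewrite /Y -capp_cat -catA.
- by move: Nk; clear; lia.
- by move=> i /gv.1 it; have [] := gv'.2 i _; rewrite // inE it orbT.
Qed.

(** The loop of a new strand around a block carrying a projector is resolved, by [van_loop], into
    the diagram without the loop and the one with the projector enlarged by this strand. *)
Lemma rule_five : Ev M A ts R -> Ev M A (t :: ts) R ->
  Ev M A ts (tw (pal (t :: ts)) ++ R).
Proof.
move=> h h'; apply: Ev_intro => n.
pose N : int := - ((absz n)%:Z + pis ts + 5).
have p0 : 0 <= pis ts by rewrite pisE.
have [v gv] := good_exists ts N; have [v' gv'] := good_exists (t :: ts) N.
exists N, v; split=> [||k ok nk] //; first by rewrite /N; move: p0; clear; lia.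
have Ns : N < - pis ts by rewrite /N; clear; lia.
have Nk : N + 2 < k by rewrite /N; move: p0 nk; clear; lia.
have Nk0 : N < k by move: Nk; clear; lia.
have [z0 [e0 [[hz dz cz] he ce ez]]] := exz gv Ns.
set Y := capp R (U K).
have hY : okK K Y by apply: okK_capp => //; exact: okK_U.
have bY : bnded Y by exact: bnded_cU.
have rA j : j \in ts -> rg N (A ++ tw v) j by move=> /gv.2 [h1 _]; exact: rg_cat.
have sW : {subset v ++ pal (t :: ts) <= t :: ts}.
  by move=> j; rewrite mem_cat => /orP[/(gv.1) jt|/pal_sub //]; rewrite inE jt orbT.
pose W := scomp (scomp (csf (tw v)) (Jsf t ts)) (csf [:: T t]).
suff : van M k (capp (A ++ tw v) (W Y)).
  rewrite /W WE -!capp_cat -!catA.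
  rewrite (_ : tw v ++ tw (v ++ pal (t :: ts)) ++ R = tw v ++ (tw v ++ tw (pal (t :: ts)) ++ R)); last by rewrite tw_cat -!catA.
  rewrite (@abs_l N M k A (tw v ++ tw (pal (t :: ts)) ++ R) v) //; last 1 first.
  - by move=> j /gv.1 /gv.2 [_ h2]; exact: lg_cat.
  - exact: bnded_U.
apply: (@van_loop K t ts v v' N ct gv gv' tsK z0 e0 hz dz cz he ce ez (A ++ tw v) M Y rA hY bY k Nk).
  rewrite -capp_cat -catA; apply: (h N) => //; first by move: ok; rewrite pisE; clear; lia.
  by move: Nk p0; clear; lia.
rewrite WE -!capp_cat -!catA.
have lv i : i \in t :: ts -> lg N (tw v' ++ R) i by move=> /gv'.2 [_ h1]; exact: lg_cat.
rewrite catA (@abs_l N M k (A ++ tw v) (tw v' ++ R)) //; last 2 first.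
- exact: bnded_U.
- by move=> j /sW /lv.
rewrite -catA (@abs_l N M k A (tw v' ++ R)) //; last 2 first.
- exact: bnded_U.
- by move=> j /gv.1 jt; apply: lv; rewrite inE jt orbT.
have {}h' : van M k (capp (A ++ tw v' ++ R) (U K)) by exact: (h' N).
exact: h'.
Qed.
End Step.

Lemma Ev_nil M A R : (forall k, odd (absz k) -> van M k (capp (A ++ R) (U K))) -> Ev M A [::] R.
Proof.
move=> h; apply: Ev_intro => n; have [v gv] := good_exists [::] n.
exists n, v; split=> // k ok nk; have vn : v = [::].
  by case: v gv => [//|j v] [/(_ j (mem_head _ _))].
by rewrite vn; exact: h.
Qed.

Lemma van_U L k : odd (absz k) -> van L k (U K).
Proof.
move=> ok z [hz _ _]; suff -> : z = 0 by exact: bnd0.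
elim: L z hz => [|c L ih] /= z; last by case: z => x y /= [/ih -> /ih ->].
by case=> // k0; move: ok; rewrite k0.
Qed.

Lemma chl_Cl c Ls ts : chl c Ls ts -> all (gtn K) (c :: Ls) -> Cl c Ls ts.
Proof.
elim: ts c Ls => [|t ts ih] c [//|b Ls] //.
  by move=> _ _; apply: Ev_nil => k ok; exact: van_U.
move=> ch hK; have [_ hL] := andP hK.
case/and5P: (ch) => tcb cL ct cts chb.
have cl := ih b Ls chb hL.
by apply: (rule_two ch hK cl _ cL).
Qed.
End Rules.

(** * Positive braid words and the words of the diagrams *)

Local Open Scope nat_scope.

Inductive beq : seq nat -> seq nat -> Prop :=
| beq_refl u : beq u u
| beq_sym u v : beq u v -> beq v u
| beq_trans v u w : beq u v -> beq v w -> beq u w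
| beq_far u v i j : far i j -> beq (u ++ [:: i, j & v]) (u ++ [:: j, i & v])
| beq_braid u v i : beq (u ++ [:: i, i.+1, i & v]) (u ++ [:: i.+1, i, i.+1 & v]).

Lemma beq_weq u v : beq u v -> weq (tw u) (tw v).
Proof.
elim=> {u v} [u|u v _ h|v u w _ h1 _ h2|u v i j h|u v i].
- exact: weq_refl.
- exact: weq_sym.
- exact: weq_trans h1 h2.
- rewrite !tw_cat; apply: weq_catl.
  by apply: (@weq_catr (tw v) [:: T i; T j] [:: T j; T i]); exact: weq_far.
- rewrite !tw_cat; apply: weq_catl.
  apply: (@weq_catr (tw v) [:: T i; T i.+1; T i] [:: T i.+1; T i; T i.+1]).
  exact: weq_braid1.
Qed.

Lemma beq_catl w u v : beq u v -> beq (w ++ u) (w ++ v).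
Proof.
elim=> {u v} [u|u v _ h|v u x _ h1 _ h2|u v i j h|u v i].
- exact: beq_refl.
- exact: beq_sym.
- exact: beq_trans h1 h2.
- by rewrite !catA; exact: beq_far.
- by rewrite !catA; exact: beq_braid.
Qed.

Lemma beq_catr w u v : beq u v -> beq (u ++ w) (v ++ w).
Proof.
elim=> {u v} [u|u v _ h|v u x _ h1 _ h2|u v i j h|u v i].
- exact: beq_refl.
- exact: beq_sym.
- exact: beq_trans h1 h2.
- by rewrite -!catA; exact: beq_far.
- by rewrite -!catA; exact: beq_braid.
Qed.

Lemma beq_cat u u' v v' : beq u u' -> beq v v' -> beq (u ++ v) (u' ++ v').
Proof. by move=> h1 h2; apply: (beq_trans (beq_catr _ h1)); exact: beq_catl. Qed.

Lemma beq_cons i u v : beq u v -> beq (i :: u) (i :: v).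
Proof. exact: (@beq_catl [:: i]). Qed.

Lemma beq_rev u v : beq u v -> beq (rev u) (rev v).
Proof.
elim=> {u v} [u|u v _ h|v u x _ h1 _ h2|u v i j h|u v i].
- exact: beq_refl.
- exact: beq_sym.
- exact: beq_trans h1 h2.
- rewrite !rev_cat !rev_cons -!cats1 -!catA; apply: beq_far.
  by move: h; rewrite /far orbC.
- by rewrite !rev_cat !rev_cons -!cats1 -!catA; apply: beq_braid.
Qed.

Lemma beq_shift u v : beq u v -> beq (map S u) (map S v).
Proof.
elim=> {u v} [u|u v _ h|v u x _ h1 _ h2|u v i j h|u v i].
- exact: beq_refl.
- exact: beq_sym.
- exact: beq_trans h1 h2.
- by rewrite !map_cat; apply: beq_far; move: h; rewrite /far; lia.
- by rewrite !map_cat; apply: beq_braid.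
Qed.

Definition wfar (u v : seq nat) := forall i j, i \in u -> j \in v -> far i j.

Lemma beq_wfar u v : wfar u v -> beq (u ++ v) (v ++ u).
Proof.
elim: u => [|i u ih] h; first by rewrite cats0; exact: beq_refl.
have {ih} : beq (u ++ v) (v ++ u) by apply: ih => a b au; apply: h; rewrite inE au orbT.
move=> /(beq_cons i) hu; apply: (beq_trans hu).
have {h} : forall j, j \in v -> far i j by move=> j; apply: h; exact: mem_head.
elim: v {hu} => [|j v ih] h; first exact: beq_refl.
apply: (beq_trans (@beq_far [::] (v ++ u) i j (h _ (mem_head _ _)))).
by apply: beq_cons; apply: ih => b bv; apply: h; rewrite inE bv orbT.
Qed.

Lemma beq_wfar1 i v : (forall j, j \in v -> far i j) -> beq (i :: v) (rcons v i).
Proof.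
move=> h; rewrite -cats1; apply: (@beq_wfar [:: i]) => a b.
by rewrite inE => /eqP ->; exact: h.
Qed.

Notation up := iota.
Definition dn a k := rev (up a k).

Lemma mem_dn a k i : (i \in dn a k) = (a <= i < a + k).
Proof. by rewrite mem_rev mem_iota. Qed.

Lemma dnS a k : dn a k.+1 = (a + k) :: dn a k.
Proof. by rewrite /dn -addn1 iotaD rev_cat /=. Qed.
Lemma upS a k : up a k.+1 = rcons (up a k) (a + k).
Proof. by rewrite -addn1 iotaD /= cats1. Qed.
Lemma up_shift a k : up a.+1 k = map S (up a k).
Proof. by rewrite -add1n iotaDl. Qed.
Lemma dn_shift a k : dn a.+1 k = map S (dn a k).
Proof. by rewrite /dn up_shift map_rev. Qed.

(** The letter i+1 commutes with the letters before i, becomes i by one braid relation with the pair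
    i, i+1, and commutes with the rest. *)
Lemma slide_up a k i : a <= i -> i.+1 < a + k -> beq (i.+1 :: up a k) (rcons (up a k) i).
Proof.
move=> ai ik; have -> : k = (i - a) + (2 + (k - (i - a) - 2)) by lia.
rewrite iotaD iotaD /= subnKC // addn2 -cats1 -!catA.
set r := iota i.+2 _.
apply: beq_trans (_ : beq _ (up a (i - a) ++ i.+1 :: [:: i, i.+1 & r])) _.
  rewrite -cat_cons -[_ ++ i.+1 :: _]cat_rcons; apply: beq_catr; apply: beq_wfar1 => j.
  by rewrite mem_iota /far; lia.
apply: beq_catl; apply: beq_trans (beq_sym (@beq_braid [::] r i)) _.
apply: (@beq_catl [:: i; i.+1] (i :: r) (r ++ [:: i])); rewrite cats1; apply: beq_wfar1 => j.
by rewrite mem_iota /far; lia.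
Qed.

Lemma slide_ups a k v : (forall i, i \in v -> a <= i /\ i.+1 < a + k) ->
  beq (map S v ++ up a k) (up a k ++ v).
Proof.
elim: v => [|i v ih] h /=; first by rewrite cats0; exact: beq_refl.
apply: beq_trans (beq_cons i.+1 (ih _)) _.
  by move=> j jv; apply: h; rewrite inE jv orbT.
have [h1 h2] := h i (mem_head _ _).
by rewrite -cat_cons -cat_rcons; apply: beq_catr; exact: slide_up.
Qed.

Lemma slide_dns a k v : (forall i, i \in v -> a <= i /\ i.+1 < a + k) ->
  beq (dn a k ++ map S v) (v ++ dn a k).
Proof.
move=> h; have := beq_rev (@slide_ups a k (rev v) _).
rewrite !rev_cat -map_rev revK; apply=> i; rewrite mem_rev; exact: h.
Qed.

(** Both palindromes lift the transposition of the positions a and a + k + 1. One of them contains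
    the lowest crossing only once, the other the highest, and this single crossing is what the
    Markov move removes. *)
Lemma beq_palindrome a k :
  beq (dn a.+1 k ++ a :: up a.+1 k) (up a k ++ (a + k) :: dn a k).
Proof.
elim: k => [|k ih]; first by rewrite addn0; exact: beq_refl.
rewrite dnS upS -!cats1 -cat1s -!catA.
have {}ih : beq ([:: a.+1 + k] ++ (dn a.+1 k ++ a :: up a.+1 k) ++ [:: a.+1 + k])
    ([:: a.+1 + k] ++ (up a k ++ (a + k) :: dn a k) ++ [:: a.+1 + k]).
  by apply: beq_catl; apply: beq_catr.
apply: beq_trans (_ : beq _ _) _; first by move: ih; rewrite -!catA; exact.
have far_ j : j \in up a k -> far (a.+1 + k) j by rewrite mem_iota /far; lia.
have far' j : j \in dn a k -> far (a.+1 + k) j by rewrite mem_dn /far; lia.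
rewrite upS dnS -cats1 -!catA /=.
rewrite -cat_cons; apply: beq_trans (beq_catr _ (beq_wfar1 far_)) _.
rewrite -cats1 -catA; apply: beq_catl; rewrite cats1 /=.
apply: beq_trans (beq_cons _ (beq_cons _ (beq_sym (beq_wfar1 far')))) _.
by rewrite addnS addSn; exact: beq_sym (@beq_braid [::] _ _).
Qed.

Fixpoint Xw m n := if m is m'.+1 then up m' n ++ Xw m' n else [::].

Lemma XwS m n : Xw m.+1 n = up m n ++ Xw m n. Proof. by []. Qed.

Lemma mem_Xw m n i : i \in Xw m n -> i.+1 < m + n.
Proof.
elim: m => [//|m ih] /=; rewrite mem_cat mem_iota => /orP[|/ih]; lia.
Qed.

Lemma Xw_shift m n : Xw m.+1 n = map S (Xw m n) ++ up 0 n.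
Proof.
elim: m => [|m ih]; first by rewrite /= cats0.
by rewrite XwS {1}ih [in RHS]XwS map_cat -up_shift catA.
Qed.

Lemma Xw_right m n : beq (Xw m n.+1) (Xw m n ++ dn n m).
Proof.
elim: m => [|m ih]; first exact: beq_refl.
rewrite !XwS upS dnS cat_rcons -catA.
apply: beq_catl; apply: beq_trans (beq_cons _ ih) _.
rewrite -cat_cons -cat_rcons addnC; apply: beq_catr; apply: beq_wfar1 => j /mem_Xw.
by rewrite /far; lia.
Qed.

Lemma Xw_slide m n i : i.+1 < n -> beq (rcons (Xw m n) i) ((i + m) :: Xw m n).
Proof.
move=> h; elim: m => [|m ih]; first by rewrite addn0; exact: beq_refl.
rewrite /= rcons_cat; apply: beq_trans (beq_catl _ ih) _.
rewrite -cat_rcons -cat_cons addnS; apply: beq_catr.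
by apply: beq_sym; apply: slide_up; lia.
Qed.

Lemma Xw_slides m n k : k < n -> beq (Xw m n ++ up 0 k) (up m k ++ Xw m n).
Proof.
elim: k => [|k ih] h; first by rewrite cats0; exact: beq_refl.
rewrite !upS -!cats1 catA; apply: beq_trans (beq_catr _ (ih _)) _; first lia.
rewrite -!catA; apply: beq_catl; rewrite cats1 add0n cat1s addnC; exact: Xw_slide.
Qed.

Definition ones (w : seq bool) := count id w.
Definition zeros (w : seq bool) := count negb w.

(* The last letter of the binary word comes first.                            *)
Fixpoint al m (w : seq bool) : seq nat :=
  match w with
  | [::] => [::]
  | true :: w' => al m w'
  | false :: w' => al m w' ++ dn (m + zeros w') (ones w')
  end.

Lemma al_cons m w : al m (false :: w) = al m w ++ dn (m + zeros w) (ones w).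
Proof. by []. Qed.
Lemma zerosS w : zeros (false :: w) = (zeros w).+1. Proof. by []. Qed.

Lemma zeros_ones w : zeros w + ones w = size w.
Proof. by rewrite addnC; exact: count_predC. Qed.
Lemma zeros_rcons b w : zeros (rcons w b) = zeros w + ~~ b.
Proof. by rewrite /zeros -cats1 count_cat /= addn0. Qed.
Lemma ones_rcons b w : ones (rcons w b) = ones w + b.
Proof. by rewrite /ones -cats1 count_cat /= addn0. Qed.

Lemma mem_al m w i : i \in al m w -> m <= i /\ i.+1 < m + size w.
Proof.
elim: w => [//|[] w ih] /=; first by move=> /ih; lia.
rewrite mem_cat mem_dn => /orP[/ih|]; first lia.
by rewrite -(zeros_ones w); lia.
Qed.

Lemma al_shift m w : al m.+1 w = map S (al m w).
Proof. by elim: w => [//|[] w ih] //=; rewrite map_cat ih addSn dn_shift. Qed.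

Lemma al_false m w : al m (rcons w false) = al m.+1 w.
Proof.
elim: w => [|[] w ih] //=.
by rewrite ih zeros_rcons ones_rcons addn0 addnA addn1 addSn.
Qed.

Lemma al_true m w : beq (al m (rcons w true)) (al m.+1 w ++ up m (zeros w)).
Proof.
elim: w => [|[] w ih]; first exact: beq_refl.
  by rewrite /= add0n.
rewrite rcons_cons !al_cons zeros_rcons ones_rcons addn0 addn1 dnS zerosS upS.
set z := zeros w in ih *; set o := ones w.
apply: beq_trans (beq_catr _ ih) _; rewrite -!catA; apply: beq_catl.
rewrite -cats1 -dnS; apply: beq_trans (_ : beq _ (up m z ++ dn (m + z).+1 o ++ [:: m + z])) _.
  apply: beq_catl; rewrite /dn /= rev_cons cats1; exact: beq_refl.
rewrite -/(dn _ _) addSn !catA; apply: beq_catr; apply: beq_wfar => i j.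
by rewrite mem_iota mem_dn /far; lia.
Qed.
Close Scope nat_scope.

(** A single recursion builds both words, so that the second is literally the first with all indices
    raised. Diagrams before and after a slide can then be compared with the same word for the
    projector. *)
Lemma good_shift ts n : exists v, good n v ts /\ good n (map S v) (map S ts).
Proof.
elim: ts n => [|t ts ih] n; first by exists [::]; split; split.
have [v [/good_gpow gv /good_gpow gv']] := ih (- `|n|%:Z).
exists (gpow v t `|n|%N); split=> //.
suff -> : map S (gpow v t `|n|%N) = gpow (map S v) t.+1 `|n|%N by [].
by elim: `|n|%N {gv gv'} => [//|r ih'] /=; rewrite map_cat /= ih'.
Qed.

(** * Diagrams with one projector, written as words *)

Section Words.
Variable K : nat.

Definition E M a ts r := Ev K M (tw a) ts (tw r).

Lemma E_intro M a ts r :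
  (forall n, exists v, good n v ts /\ forall k, odd (absz k) -> n < k ->
    van M k (capp (tw (a ++ v ++ r)) (U K))) -> E M a ts r.
Proof.
move=> h; apply: Ev_intro => n; have [v [gv hv]] := h n.
by exists n, v; split=> // k ok nk; rewrite -!tw_cat; exact: hv.
Qed.

Lemma E_elim M a ts r n v k : E M a ts r -> good n v ts -> odd (absz k) -> n < k ->
    van M k (capp (tw (a ++ v ++ r)) (U K)).
Proof. by move=> h gv ok nk; rewrite !tw_cat; exact: (h n v k gv ok nk). Qed.

Lemma van_beq M k u v : beq u v -> van M k (capp (tw u) (U K)) -> van M k (capp (tw v) (U K)).
Proof. by move=> /beq_weq /(_ (U K)) h /(van_heq M k h). Qed.

Lemma E_mono M M' a a' ts r r' :
  (forall v k, {subset v <= ts} -> odd (absz k) -> van M k (capp (tw (a ++ v ++ r)) (U K)) ->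
     van M' k (capp (tw (a' ++ v ++ r')) (U K))) -> E M a ts r -> E M' a' ts r'.
Proof.
move=> h hE; apply: E_intro => n; have [v gv] := good_exists ts n.
exists v; split=> // k ok nk; apply: h => //; first exact: gv.1.
exact: (E_elim hE gv ok nk).
Qed.

Lemma E_beq M a a' ts r r' : beq a a' -> beq r r' -> E M a ts r -> E M a' ts r'.
Proof.
move=> ha hr; apply: E_mono => v k _ _; apply: van_beq; apply: beq_cat => //.
exact: beq_catl.
Qed.

Lemma E_far_r M a ts u r : wfar u ts -> E M a ts (u ++ r) -> E M (a ++ u) ts r.
Proof.
move=> h; apply: E_mono => v k sv _; apply: van_beq; rewrite -!catA; apply: beq_catl.
rewrite !catA; apply: beq_catr; apply: beq_sym; apply: beq_wfar => i j iu jv.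
by apply: h => //; exact: sv.
Qed.

Lemma E_far_l M a ts u r : wfar u ts -> E M (a ++ u) ts r -> E M a ts (u ++ r).
Proof.
move=> h; apply: E_mono => v k sv _; apply: van_beq; rewrite -!catA; apply: beq_catl.
rewrite !catA; apply: beq_catr; apply: beq_wfar => i j iu jv.
by apply: h => //; exact: sv.
Qed.

Lemma E_abs_l M a ts u r : {subset u <= ts} -> E M a ts r -> E M (a ++ u) ts r.
Proof.
move=> su hE; apply: E_intro => n; have [v gv] := good_exists ts n.
exists v; split=> // k ok nk; have := E_elim hE gv ok nk.
rewrite -!catA !tw_cat (@abs_l n M k (tw a) _ u) //; first exact: bnded_U.
by move=> j /su /gv.2 [_ h2]; exact: lg_cat.
Qed.

Lemma E_abs_r M a ts u r : {subset u <= ts} -> E M a ts r -> E M a ts (u ++ r).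
Proof.
move=> su hE; apply: E_intro => n; have [v gv] := good_exists ts n.
exists v; split=> // k ok nk; have := E_elim hE gv ok nk.
rewrite !catA !tw_cat capp_cat [X in _ -> van _ _ X]capp_cat -[_ ++ tw u]catA.
rewrite (@abs_r n M k (tw a) _ u) //; first exact: bnded_cU.
by move=> j /su /gv.2 [h1 _].
Qed.

Lemma E_shift_mono M M' a a' ts r r' :
  (forall v k, {subset v <= ts} -> van M k (capp (tw (a ++ v ++ r)) (U K)) ->
     van M' k (capp (tw (a' ++ map S v ++ r')) (U K))) ->
  E M a ts r -> E M' a' (map S ts) r'.
Proof.
move=> h hE; apply: E_intro => n; have [v [gv gv']] := good_shift ts n.
exists (map S v); split=> // k ok nk; apply: h; first exact: gv.1.
exact: (E_elim hE gv ok nk).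
Qed.

Lemma E_unshift_mono M M' a a' ts r r' :
  (forall v k, {subset v <= ts} -> van M k (capp (tw (a ++ map S v ++ r)) (U K)) ->
     van M' k (capp (tw (a' ++ v ++ r')) (U K))) ->
  E M a (map S ts) r -> E M' a' ts r'.
Proof.
move=> h hE; apply: E_intro => n; have [v [gv gv']] := good_shift ts n.
exists v; split=> // k ok nk; apply: h; first exact: gv.1.
exact: (E_elim hE gv' ok nk).
Qed.

Lemma E_slide_up M x a k ts r : (forall i, i \in ts -> (a <= i)%N /\ (i.+1 < a + k)%N) ->
  E M (x ++ up a k) ts r -> E M x (map S ts) (up a k ++ r).
Proof.
move=> h; apply: E_shift_mono => v j sv; apply: van_beq; rewrite -!catA.
apply: beq_catl; rewrite !catA; apply: beq_catr; apply: beq_sym; apply: slide_ups.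
by move=> i /sv; exact: h.
Qed.

Lemma E_slide_dn M x a k ts r : (forall i, i \in ts -> (a <= i)%N /\ (i.+1 < a + k)%N) ->
  E M x ts (dn a k ++ r) -> E M (x ++ dn a k) (map S ts) r.
Proof.
move=> h; apply: E_shift_mono => v j sv; apply: van_beq; rewrite -!catA.
apply: beq_catl; rewrite !catA; apply: beq_catr; apply: beq_sym; apply: slide_dns.
by move=> i /sv; exact: h.
Qed.

Lemma E_perm M M' a ts r : perm_eq M M' -> E M a ts r -> E M' a ts r.
Proof. by move=> p; apply: E_mono => v k _ _; rewrite (van_perm k _ p). Qed.

Lemma E_eqts M a ts ts' r : ts =i ts' -> E M a ts r -> E M a ts' r.
Proof.
move=> e hE n v k [sv g] ok nk; apply: (hE n v k _ ok nk); split.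
  by move=> j /sv; rewrite e.
by move=> j jt; apply: g; rewrite -e.
Qed.

Definition av (c : nat) (u : seq nat) := forall i : nat, i \in u -> ((i != c) && (i.+1 != c))%N.
Lemma av_avoid c u : av c u -> avoid c (tw u).
Proof. by move=> h; rewrite /avoid all_map; apply/allP => i /h. Qed.
Lemma av_cat c u v : av c u -> av c v -> av c (u ++ v).
Proof. by move=> h1 h2 i; rewrite mem_cat => /orP[/h1|/h2]. Qed.

Lemma freel_w c u (cK : (c < K)%N) : av c u ->
  freel c (capf false (tw u) (Ddiv (Ordinal cK))).
Proof. by move=> /av_avoid h; exact: freel_capp h (freel_U cK). Qed.

Section Markov.
Variables (t c b : nat) (M ts a r : seq nat).
Hypotheses (tcb : edge t c b) (cK : (c < K)%N) (cM : c \notin M) (ct : av c ts).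

Lemma van_markov_w x y k : av c x -> av c y ->
  van M k (capp (tw (x ++ y)) (U K)) -> van (c :: M) k (capp (tw (x ++ t :: y)) (U K)).
Proof.
move=> cx_ cy; rewrite -[t :: y]cat1s !tw_cat !capp_cat.
exact: (markovT tcb (av_avoid cx_) cM (freel_w cK cy)).
Qed.

Lemma van_markov_w_conv x y k : av c x -> av c y ->
  van (c :: M) k (capp (tw (x ++ t :: y)) (U K)) -> van M k (capp (tw (x ++ y)) (U K)).
Proof.
move=> cx_ cy; rewrite -[t :: y]cat1s !tw_cat !capp_cat.
exact: (markovT_conv tcb (av_avoid cx_) cM (freel_w cK cy)).
Qed.

Lemma E_markov_r u : av c a -> av c u -> av c r ->
  E M a ts (u ++ r) -> E (c :: M) a ts (u ++ t :: r).
Proof.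
move=> ca cu cr; apply: E_mono => v k sv _ h.
have cv : av c v by move=> i /sv; exact: ct.
have := @van_markov_w (a ++ v ++ u) r k; rewrite -!catA; apply => //.
by do 2![apply: av_cat => //].
Qed.

Lemma E_markov_l u : av c a -> av c u -> av c r ->
  E M (a ++ u) ts r -> E (c :: M) (a ++ t :: u) ts r.
Proof.
move=> ca cu cr; apply: E_mono => v k sv _; rewrite -!catA cat_cons => h.
have cv : av c v by move=> i /sv; exact: ct.
by apply: van_markov_w => //; do 2![apply: av_cat => //].
Qed.

Lemma E_markov_conv u : av c a -> av c u -> av c r ->
  E (c :: M) (a ++ t :: u) ts r -> E M (a ++ u) ts r.
Proof.
move=> ca cu cr; apply: E_mono => v k sv _; rewrite -!catA cat_cons => h.
have cv : av c v by move=> i /sv; exact: ct.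
by apply: van_markov_w_conv => //; do 2![apply: av_cat => //].
Qed.
End Markov.

Lemma E_free c M a r : (c < K)%N -> av c a -> av c r -> E M a [::] r -> E (c :: M) a [::] r.
Proof.
move=> cK ca cr; apply: E_mono => v k sv _; apply: van_free => x.
have cA : avoid c (tw (a ++ v ++ r)).
  apply: av_avoid; do 2![apply: av_cat => //].
  by move=> i /sv.
by rewrite phi_capp //; apply: (@fm_zero (csf _) false) => y; exact: subrr.
Qed.

Lemma E_relabel M a ts r :
  (forall j, j \in M -> (j.+1 < K)%N) -> (forall j, j \in a ++ ts ++ r -> (j.+2 < K)%N) ->
  E (map S M) (map S a) (map S ts) (map S r) -> E M a ts r.
Proof.
move=> hM hw; apply: E_unshift_mono => v k sv; rewrite -!map_cat.
(* The renaming is the cyclic rotation of all K strands, which is the successor on every index that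
   occurs. *)
have shE j : (j.+1 < K)%N -> nperm (perm (@ordS_inj K)) j = j.+1%N.
  move=> jK; rewrite -[j]/(val (Ordinal (ltnW jK))) nperm_ord permE /=.
  by rewrite modn_small.
move=> h; apply: (@van_relabel K (perm (@ordS_inj K))); move: h.
rewrite (_ : map S M = map (nperm (perm (@ordS_inj K))) M); last first.
  by apply/eq_in_map => j /hM /shE ->.
rewrite (_ : tw (map S (a ++ v ++ r)) = map (lre (nperm (perm (@ordS_inj K)))) (tw (a ++ v ++ r))) //.
rewrite /tw -!map_comp; apply/eq_in_map => j jw /=; rewrite /T /lre /=.
have jK : (j.+2 < K)%N.
  apply: hw; move: jw; rewrite !mem_cat => /or3P[->|/sv ->|->]; rewrite ?orbT //.
by rewrite !shE // ltnW.
Qed.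

Definition bd_ N (u : seq nat) := forall i : nat, i \in u -> (i.+1 < N)%N.

Lemma bd_av N u : bd_ N u -> av N u.
Proof. by move=> h i /h; lia. Qed.
Lemma bd_cat N u v : bd_ N u -> bd_ N v -> bd_ N (u ++ v).
Proof. by move=> h1 h2 i; rewrite mem_cat => /orP[/h1|/h2]. Qed.
Lemma bd_up N a k : (a + k < N)%N -> bd_ N (up a k).
Proof. by move=> h i; rewrite mem_iota; move: h; clear; lia. Qed.
Lemma bd_dn N a k : (a + k < N)%N -> bd_ N (dn a k).
Proof. by move=> h i; rewrite mem_dn; move: h; clear; lia. Qed.

Lemma chn_dn p l : chn (p + l) (dn p l).
Proof.
elim: l => [//|l ih]; rewrite dnS /= ih andbT; apply/andP; split.
  by rewrite /adj; lia.
by apply/allP => i; rewrite mem_dn /far; lia.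
Qed.

Lemma chl_dn p l : chl (p + l) (dn p l) (dn p l).
Proof.
elim: l => [//|l ih]; rewrite dnS; apply/and5P; split; rewrite ?chn_dn //.
- by rewrite /edge; lia.
- by rewrite -dnS mem_dn; lia.
- by apply: av_avoid => i; rewrite mem_dn; lia.
Qed.

Lemma chn_up p l : chn p (up p.+1 l).
Proof.
elim: l p => [//|l ih] p; rewrite /= ih andbT; apply/andP; split.
  by rewrite /adj; lia.
by apply/allP => i; rewrite mem_iota /far; lia.
Qed.

Lemma chl_up p l : chl p (up p.+1 l) (up p l).
Proof.
elim: l p => [//|l ih] p; apply/and5P; split.
- by rewrite /edge; lia.
- by rewrite inE mem_iota; lia.
- by apply: av_avoid => i; rewrite mem_iota; lia.
- exact: chn_up.
- exact: ih.
Qed.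

Lemma bd_kletter N u : (N <= K)%N -> bd_ N u -> all (kletter K) (tw u).
Proof.
move=> hN h; apply/allP => l /mapP[i iu ->]; have := h i iu; rewrite /kletter /=.
by move: hN; clear; lia.
Qed.

Lemma perm_iotaS N : perm_eq (N :: iota 0 N) (iota 0 N.+1).
Proof. by rewrite upS add0n perm_sym perm_rcons. Qed.

Lemma iota_notin N : N \notin iota 0 N.
Proof. by rewrite mem_iota add0n ltnn. Qed.

Lemma E_two p l a r : (p + l < K)%N -> bd_ (p + l) a -> bd_ (p + l) r ->
  E (iota 0 (p + l)) a (iota p l.-1) r -> E (iota 0 (p + l).+1) a (iota p l) r.
Proof.
move=> pK ha hr h; apply: (E_perm (perm_iotaS _)).
case: l pK ha hr h => [|l] pK ha hr h.
  (* An empty block: the strand to be closed meets no crossing at all. *)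
  by apply: E_free => //; apply: bd_av.
apply: (@E_eqts _ _ (dn p l.+1)); first by move=> i; rewrite mem_rev.
rewrite dnS; have ch := chl_dn p l.+1; rewrite dnS in ch.
have hK : all (gtn K) ((p + l.+1)%N :: (p + l)%N :: dn p l).
  rewrite -dnS; apply/allP => i; rewrite inE mem_dn /=; move: pK; clear; lia.
have [_ hK'] := andP hK.
have cl : Cl K (p + l) (dn p l) (dn p l) by apply: chl_Cl => //; exact: chl_dn.
apply: (rule_two ch hK cl).
- by apply: (@bd_kletter (p + l.+1)) => //; exact: ltnW.
- exact: iota_notin.
- by apply: av_avoid; apply: bd_av.
- by apply: av_avoid; apply: bd_av.
- by apply: (@E_eqts _ _ (iota p l)) h => i; rewrite mem_rev.
Qed.

Lemma edge_last N : edge N N.+1%N N.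
Proof. by rewrite /edge !eqxx orbT. Qed.

(** Sliding the projector through the ascending word moves it one place to the left. The last strand
    then meets only the final crossing of this word, which the Markov move removes; the other
    crossings are absorbed. *)
Lemma E_right p l a r : (p + l.+1 < K)%N -> bd_ (p + l.+1) a -> bd_ (p + l.+1) r ->
  E (iota 0 (p + l.+1)) a (iota p l) r ->
  E (iota 0 (p + l.+2)) a (iota p.+1 l) (up p l.+1 ++ r).
Proof.
move=> pK ha hr h; rewrite up_shift; apply: E_slide_up.
  by move=> i; rewrite mem_iota; clear; lia.
rewrite addnS; apply: (E_perm (perm_iotaS _)).
rewrite upS -cats1 catA; apply: (@E_markov_l (p + l) _ (p + l)) => //.
- by rewrite addnS; exact: edge_last.
- exact: iota_notin.
- by apply: bd_av; apply: bd_up; lia.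
- by apply: bd_av; apply: bd_cat => //; apply: bd_up; lia.
- exact: bd_av.
- by rewrite cats0; apply: E_abs_l.
Qed.

Lemma E_left p l a r : (p + l.+1 < K)%N -> bd_ (p + l.+1) a -> bd_ (p + l.+1) r ->
  E (iota 0 (p + l.+1)) a (iota p l) r ->
  E (iota 0 (p + l.+2)) (a ++ dn p l.+1) (iota p.+1 l) r.
Proof.
move=> pK ha hr h; rewrite up_shift; apply: E_slide_dn.
  by move=> i; rewrite mem_iota; clear; lia.
rewrite addnS; apply: (E_perm (perm_iotaS _)).
rewrite dnS.
apply: (@E_markov_r (p + l) (p + l.+1) (p + l) _ _ _ (dn p l ++ r) _ _ _ _ [::]) => //.
- by rewrite addnS; exact: edge_last.
- exact: iota_notin.
- by apply: bd_av; apply: bd_up; lia.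
- exact: bd_av.
- by apply: bd_av; apply: bd_cat => //; apply: bd_dn; lia.
- by rewrite cat0s; apply: E_abs_r => // i; rewrite mem_dn mem_iota.
Qed.

Lemma pal_up p l : pal (up p l) = up p l ++ dn p l.
Proof.
elim: l p => [//|l ih] p; rewrite /= ih -catA /dn /= rev_cons cats1 //.
Qed.

(** After the slide, the crossings to the right of the projector form a palindrome, and its other
    form meets the last strand once. Removing that strand leaves the loop of strand p around the
    block, to which [rule_five] applies. *)
Lemma E_both p l a u x r : (p + l.+2 < K)%N -> bd_ (p + l.+2) a -> bd_ (p + l.+2) r ->
  (forall i, i \in u -> i < p)%N -> (forall i, i \in x -> i < p)%N ->
  E (iota 0 (p + l.+2)) (a ++ u) (iota p l.+1) (x ++ r) ->
  E (iota 0 (p + l.+2)) (a ++ u) (iota p.+1 l) (x ++ r) ->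
  E (iota 0 (p + l.+3)) (a ++ dn p.+1 l.+1 ++ u ++ p :: x) (iota p.+2 l) (up p.+1 l.+1 ++ r).
Proof.
move=> pK ha hr hu hx h1 h2; rewrite catA; apply: E_far_r.
  move=> i j; rewrite mem_cat inE mem_iota /far => /or3P[/hu|/eqP ->|/hx]; clear; lia.
rewrite (up_shift p.+1); apply: E_slide_dn.
  by move=> i; rewrite mem_iota; clear; lia.
pose r' := u ++ up p l.+1 ++ (p + l.+1)%N :: (dn p l.+1 ++ x ++ r).
have far_u : wfar (dn p.+1 l.+1) u.
  by move=> i j; rewrite mem_dn /far => ip /hu; move: ip; clear; lia.
have far_x : wfar x (up p.+1 l.+1).
  by move=> i j /hx; rewrite mem_iota /far => h; move: h; clear; lia.
apply: (@E_beq _ a a _ r') => //; first exact: beq_refl.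
  rewrite /r' -cat_cons !catA; apply: beq_catr; apply: beq_sym.
  rewrite -catA; apply: beq_trans (beq_catr _ (beq_wfar far_u)) _.
  rewrite -!catA; apply: beq_catl; rewrite cat_cons.
  apply: beq_trans (beq_catl _ (beq_cons p (beq_wfar far_x))) _.
  by have := beq_catr x (beq_palindrome p l.+1); rewrite -!catA.
rewrite addnS; apply: (E_perm (perm_iotaS _)).
rewrite /r' catA; apply: (@E_markov_r (p + l.+1) _ (p + l.+1)) => //.
- by rewrite (addnS p l.+1); exact: edge_last.
- exact: iota_notin.
- by apply: bd_av; apply: bd_up; lia.
- exact: bd_av.
- apply: bd_av; apply: bd_cat; last by apply: bd_up; lia.
  by move=> i /hu; clear; lia.
- apply: bd_av; apply: bd_cat; first by apply: bd_dn; lia.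
  by apply: bd_cat => // i /hx; clear; lia.
rewrite -catA; apply: E_far_l.
  by move=> i j /hu; rewrite mem_iota /far => h; move: h; clear; lia.
have hK : all (gtn K) (p :: p.+1%N :: up p.+2 l).
  apply/allP => i; rewrite -[_ :: _]/(up p l.+2) mem_iota /=; move: pK; clear; lia.
have [_ hK'] := andP hK.
have cl : Cl K p.+1 (up p.+2 l) (up p.+1 l) by apply: chl_Cl => //; exact: chl_up.
have := @rule_five K p p.+1 p (up p.+2 l) (up p.+1 l) (iota 0 (p + l.+2)) (tw (a ++ u))
  (tw (x ++ r)) (chl_up p l.+1) hK cl.
rewrite -tw_cat -[p :: up _ _]/(up p l.+1) pal_up -catA; apply=> //.
apply: (@bd_kletter (p + l.+2)); first exact: ltnW.
by apply: bd_cat => // i /hx; clear; lia.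
Qed.

Lemma E_zero p a u x r : (p.+1 < K)%N -> bd_ p.+1 a -> bd_ p.+1 r ->
  (forall i, i \in u -> i < p)%N -> (forall i, i \in x -> i < p)%N ->
  E (iota 0 p.+1) (a ++ u) [::] (x ++ r) ->
  E (iota 0 p.+2) (a ++ u ++ p :: x) [::] r.
Proof.
move=> pK ha hr hu hx h.
apply: (E_perm (perm_iotaS _)); rewrite catA; apply: (@E_markov_l p _ p) => //.
- exact: edge_last.
- exact: iota_notin.
- by apply: bd_av; apply: bd_cat => // i /hu; clear; lia.
- by apply: bd_av => i /hx; clear; lia.
- exact: bd_av.
- by apply: E_far_r => // i j; rewrite in_nil.
Qed.

(** This rotates the closed diagram. All indices are raised by one, and a closed strand 0 is
    attached by the single crossing 0 through the converse Markov move. In the larger diagram the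
    crossings of x and u can be rearranged around the new strand. *)
Lemma E_cyc N n a u x ts r : (N < K)%N -> bd_ N (a ++ u ++ ts ++ x ++ r) ->
  wfar x ts -> beq (map S x ++ up 1 n) (map S (u ++ x)) ->
  E (iota 0 N.+1) (map S a ++ map S x ++ 0%N :: up 1 n) (map S ts) (map S r) ->
  E (iota 0 N) (a ++ u) ts (x ++ r).
Proof.
move=> NK hb hx hu h; apply: E_far_l => //; apply: E_relabel.
- by move=> j; rewrite mem_iota; move: NK; clear; lia.
- move=> j hj; have : (j.+1 < N)%N; last by move: NK; clear; lia.
  apply: hb; move: hj; rewrite !mem_cat; do !case: (_ \in _) => //=.
rewrite -up_shift; apply: (@E_beq _ (map S a ++ map S x ++ up 1 n)).
- by rewrite map_cat map_cat -!catA; apply: beq_catl; rewrite -map_cat.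
- exact: beq_refl.
have S0 w : av 0 (map S w).
  move=> i /mapP[j _ ->] //.
rewrite catA; apply: (@E_markov_conv 0 0 1) => //.
- by apply: leq_ltn_trans NK.
- by rewrite mem_iota.
- by rewrite -map_cat.
- by rewrite up_shift.
- by rewrite -catA.
Qed.

Local Open Scope nat_scope.

Lemma E_cast N N' p p' l l' a r : E (iota 0 N) a (iota p l) r ->
  N = N' -> p = p' -> l = l' -> E (iota 0 N') a (iota p' l') r.
Proof. by move=> h <- <- <-. Qed.

(* The diagram alpha_w X omega beta_v of Hogancamp and Mellit, where omega is     *)
(* the projector on a block of [ones v] strands.                              *)
Definition St v w := E (iota 0 (zeros v + size w)) (al (zeros v) w ++ Xw (zeros v) (zeros w))
  (iota (zeros v + zeros w) (ones v).-1) (rev (al (zeros w) v)).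

Lemma bd_al N m w : m + size w <= N -> bd_ N (al m w).
Proof. by move=> h i /mem_al; move: h; clear; lia. Qed.
Lemma bd_Xw N m n : m + n <= N -> bd_ N (Xw m n).
Proof. by move=> h i /mem_Xw; move: h; clear; lia. Qed.
Lemma bd_rev N u : bd_ N u -> bd_ N (rev u).
Proof. by move=> h i; rewrite mem_rev; exact: h. Qed.

Lemma zerosT w : zeros (true :: w) = zeros w. Proof. by []. Qed.
Lemma onesT w : ones (true :: w) = (ones w).+1. Proof. by []. Qed.
Lemma onesF w : ones (false :: w) = ones w. Proof. by []. Qed.
Lemma sizeS (b : bool) w : size (b :: w) = (size w).+1. Proof. by []. Qed.
Lemma alT m w : al m (true :: w) = al m w. Proof. by []. Qed.

Lemma wfar_Xw m n k l : m + n <= k -> wfar (Xw m n) (up k l).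
Proof. by move=> h i j /mem_Xw; rewrite mem_iota /far; move: h; clear; lia. Qed.

Lemma al_Xw_r m n v : zeros v = m ->
  beq (Xw m n ++ rev (al n (rcons v true))) (Xw m n.+1 ++ rev (al n.+1 v)).
Proof.
move=> <-; apply: beq_trans (beq_catl _ (beq_rev (al_true _ _))) _.
rewrite rev_cat catA; apply: beq_catr; exact: beq_sym (Xw_right _ _).
Qed.

(** The rightmost strand of the projector closes directly onto itself, outside all other
    crossings. *)
Lemma step11 v w : zeros v + size w < K -> ones v = ones w ->
  St v w -> St (true :: v) (true :: w).
Proof.
rewrite /St !zerosT onesT sizeS !alT => hK e h.
have := zeros_ones w; have := zeros_ones v; rewrite e => zv zw.
apply: (E_cast (@E_two (zeros v + zeros w) (ones v) _ _ _ _ _ (E_cast h _ _ _))); try lia.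
  by apply: bd_cat; [apply: bd_al | apply: bd_Xw]; lia.
by apply: bd_rev; apply: bd_al; lia.
Qed.

(** The last strand meets the ascending word on the right of the projector. After the slide it is
    removed, and its crossings with the other group rotate the letter 1 of w to the other end. *)
Lemma step01 v w : zeros v + size w < K.-1 -> ones v = (ones w).+1 ->
  St v (rcons w true) -> St (false :: v) (true :: w).
Proof.
rewrite /St zerosT !zerosS onesF !sizeS alT al_cons size_rcons zeros_rcons addn0.
rewrite rev_cat revK => hK e h.
have := zeros_ones w; have := zeros_ones v; rewrite e => zv zw.
rewrite (addnC (zeros w)).
apply: (E_cast (@E_right (zeros v + zeros w) (ones w) _ _ _ _ _ (E_cast (E_beq _ (beq_refl _) h) _ _ _))); try lia.
- by apply: bd_cat; [apply: bd_al | apply: bd_Xw]; lia.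
- by apply: bd_rev; apply: bd_al; lia.
rewrite XwS catA; apply: beq_catr; exact: al_true.
Qed.

Lemma step10 v w : zeros v + size w < K -> ones w = (ones v).+1 ->
  St (rcons v true) w -> St (true :: v) (false :: w).
Proof.
rewrite /St zerosT !zerosS onesT sizeS alT al_cons zeros_rcons ones_rcons addn0 addn1.
rewrite [_.-1]/= [X in _ -> _ -> _ -> E _ _ (iota _ X) _]/= => hK e h.
have := zeros_ones w; have := zeros_ones v; rewrite e => zv zw.
rewrite addnS; apply: E_far_r.
  by move=> i j /mem_Xw; rewrite mem_iota /far; clear; lia.
have {}h := E_far_l (wfar_Xw (leqnn _)) h.
apply: (E_cast (@E_left (zeros v + zeros w) (ones v) _ _ _ _ _ (E_cast (E_beq (beq_refl _) (al_Xw_r _ erefl) h) _ _ _))); try lia.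
- by apply: bd_al; lia.
- apply: bd_cat; first by apply: bd_Xw; lia.
  by apply: bd_rev; apply: bd_al; lia.
Qed.

Lemma St_tt v w (m := zeros v) (n := zeros w) : St (rcons v true) (rcons w true) ->
  E (iota 0 (m + (size w).+1)) (al m.+1 w ++ up m n) (iota (m + n) (ones v))
    (Xw m n.+1 ++ rev (al n.+1 v)).
Proof.
rewrite /St !zeros_rcons size_rcons ones_rcons !addn0 addn1 -/m -/n => h.
have {}h := E_far_l (wfar_Xw (leqnn _)) h.
by apply: (E_beq _ _ h); [exact: al_true | exact: al_Xw_r].
Qed.

(** The extra letters 0 at the far ends add a strand in position 0, and removing it is exactly the
    rotation [E_cyc]. *)
Lemma St_ff v w (m := zeros v) (n := zeros w) : m + (size w).+1 < K -> ones v = ones w ->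
  0 < ones v -> St (rcons v false) (rcons w false) ->
  E (iota 0 (m + (size w).+1)) (al m.+1 w ++ up m n) (iota (m + n).+1 (ones v).-1)
    (Xw m n.+1 ++ rev (al n.+1 v)).
Proof.
have := zeros_ones w; have := zeros_ones v; rewrite -/m -/n => zv zw.
rewrite /St !zeros_rcons size_rcons ones_rcons !addn0 !addn1 -/m -/n => hK e o0 h.
apply: (@E_cyc _ n) => //.
- apply: bd_cat; first by apply: bd_al; lia.
  apply: bd_cat; first by apply: bd_up; lia.
  apply: bd_cat; first by apply: bd_up; lia.
  apply: bd_cat; first by apply: bd_Xw; lia.
  by apply: bd_rev; apply: bd_al; lia.
- by apply: wfar_Xw; lia.
- by rewrite up_shift -map_cat; apply: beq_shift; apply: Xw_slides.
move: h; rewrite !al_false !(al_shift _.+1) Xw_shift -map_rev !addSn !addnS -!up_shift //.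
Qed.

Lemma step00_0 v w : zeros v + size w < K.-1 -> ones v = 0 -> ones w = 0 ->
  St (rcons v true) (rcons w true) -> St (false :: v) (false :: w).
Proof.
move=> hK ev ew /St_tt; rewrite /St !zerosS onesF sizeS !al_cons ev ew /dn !cats0.
have := zeros_ones w; have := zeros_ones v; rewrite ev ew => zv zw h.
rewrite XwS upS cat_rcons.
have := @E_zero (zeros v + zeros w) (al (zeros v).+1 w) (up (zeros v) (zeros w))
  (Xw (zeros v) (zeros w).+1) (rev (al (zeros w).+1 v)).
rewrite (_ : (zeros v).+1 + (size w).+1 = (zeros v + zeros w).+2); last by lia.
apply.
- by lia.
- by apply: bd_al; lia.
- by apply: bd_rev; apply: bd_al; lia.
- by move=> i; rewrite mem_iota; lia.
- by move=> i /mem_Xw; lia.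
- by apply: (@E_cast _ _ (zeros v + zeros w) (zeros v + zeros w) 0 0 _ _ h); lia.
Qed.

Lemma step00 v w : zeros v + size w < K.-1 -> 0 < ones v -> ones v = ones w ->
  St (rcons v true) (rcons w true) -> St (rcons v false) (rcons w false) ->
  St (false :: v) (false :: w).
Proof.
move=> hK o0 e /St_tt h1 /St_ff h2.
have {}h2 : E (iota 0 (zeros v + (size w).+1)) (al (zeros v).+1 w ++ up (zeros v) (zeros w))
    (iota (zeros v + zeros w).+1 (ones v).-1) (Xw (zeros v) (zeros w).+1 ++ rev (al (zeros w).+1 v)).
  by apply: h2 => //; lia.
rewrite /St !zerosS onesF sizeS !al_cons -e rev_cat revK XwS upS cat_rcons.
have := zeros_ones w; have := zeros_ones v; move: o0 e h1 h2.
set a := al _ w; set r := rev _; set u := up (zeros v) (zeros w); set x := Xw _ _.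
case El : (ones v) => [//|l] _ e h1 h2 zv zw; rewrite -catA.
have := @E_both (zeros v + zeros w) l a u x r.
have -> : (zeros v).+1 + (size w).+1 = zeros v + zeros w + l.+3 by lia.
have -> : (zeros v).+1 + (zeros w).+1 = (zeros v + zeros w).+2 by lia.
have -> : (zeros v).+1 + zeros w = (zeros v + zeros w).+1 by lia.
have -> : (zeros w).+1 + zeros v = (zeros v + zeros w).+1 by lia.
apply.
- by lia.
- by apply: bd_al; lia.
- by apply: bd_rev; apply: bd_al; lia.
- by move=> i; rewrite mem_iota; lia.
- by move=> i /mem_Xw; lia.
- by apply: (E_cast h1); lia.
- by apply: (E_cast h2); lia.
Qed.

Lemma al_nil m w : ones w = 0 -> al m w = [::].
Proof. by elim: w => [//|[] w ih] // e; rewrite al_cons ih // (_ : ones w = 0). Qed.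

Lemma Xw0 m : Xw m 0 = [::]. Proof. by elim: m. Qed.

Lemma St_nil v w : ones v = 0 -> ones w = 0 -> zeros v = 0 \/ zeros w = 0 -> St v w.
Proof.
move=> ev ew h; rewrite /St ev !al_nil //.
have -> : Xw (zeros v) (zeros w) = [::] by case: h => -> //; rewrite Xw0.
by apply: Ev_nil => k ok; exact: van_U.
Qed.

(** Every step lowers zeros v + size w, except for the second diagram of [step00], which moves a 0
    from one end of v to the other. There the position of the first 1 in v drops, and this is the
    inner induction. *)
Lemma St_all v w : zeros v + size w <= K -> ones v = ones w -> St v w.
Proof.
have [N hN] := ubnP (zeros v + size w); elim: N v w hN => [//|N ih] v w hN.
have [j hj] := ubnP (find id v); elim: j v w hj hN => [//|j ihj] v w hj hN hK e.
case: v hj hN hK e => [|b v] hj hN hK e; first by apply: St_nil; rewrite -?e //; left.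
case: w hN hK e => [|b' w] hN hK e; first by apply: St_nil; rewrite ?e //; right.
have := zeros_ones w; have := zeros_ones v.
case: b b' hj hN hK e => [] [] hj; rewrite ?(zerosT, zerosS, onesT, onesF, sizeS) => hN hK e zv zw.
- by apply: step11; [lia | lia | apply: ih; lia].
- apply: step10; try lia; apply: ih; rewrite ?zeros_rcons ?ones_rcons ?sizeS; lia.
- apply: step01; try lia; apply: ih; rewrite ?zeros_rcons ?ones_rcons ?size_rcons; lia.
have [o0|o0] := posnP (ones v).
  apply: step00_0; try lia; apply: ih; rewrite ?zeros_rcons ?ones_rcons ?size_rcons; lia.
apply: step00; try lia.
  by apply: ih; rewrite ?zeros_rcons ?ones_rcons ?size_rcons; lia.
apply: ihj; rewrite ?zeros_rcons ?ones_rcons ?size_rcons; try lia.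
have : has id v by rewrite has_count.
rewrite -cats1 find_cat => hv; rewrite hv; move: hj => /=; lia.
Qed.

Lemma van_torus m n k : m + n = K -> odd (absz k) ->
  van (iota 0 K) k (capp (tw (Xw m n)) (U K)).
Proof.
move=> e ok; pose v := nseq m false; pose w := nseq n false.
have zv : zeros v = m by rewrite /zeros count_nseq mul1n.
have zw : zeros w = n by rewrite /zeros count_nseq mul1n.
have ov : ones v = 0 by rewrite /ones count_nseq.
have ow : ones w = 0 by rewrite /ones count_nseq.
have := @St_all v w; rewrite /St zv zw size_nseq ov ow !al_nil // e cat0s.
move=> /(_ (leqnn _) erefl) h.
have g0 : good (k - 1) [::] [::] by split.
have := E_elim h g0 ok; rewrite cats0; apply; lia.
Qed.

End Words.

Local Open Scope nat_scope.

(** * Reduced words of the torus permutation *)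

Section Colours.
Variable N : nat.
Implicit Types (c : nat -> bool) (u : seq nat).

Definition sx (i x : nat) := if x == i then i.+1 else if x == i.+1 then i else x.
Definition sw i c x := c (sx i x).
Definition enab c i := ~~ c i && c i.+1.

Lemma sxK i : involutive (sx i).
Proof. by move=> x; rewrite /sx; do !case: eqP => //; lia. Qed.

(** Only the group to which each strand belongs is remembered. A letter of the word moves a strand
    of the second group one place to the left across one of the first, and the word ends when no
    such move is left. *)
Fixpoint maxpath c u : Prop :=
  match u with
  | [::] => forall i, i.+1 < N -> ~~ enab c i
  | i :: u' => [/\ i.+1 < N, enab c i & maxpath (sw i c) u']
  end.

Definition pot c := \sum_(0 <= x < N) c x * x.

Lemma pot_sw i c : i.+1 < N -> pot (sw i c) + c i.+1 = pot c + c i.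
Proof.
move=> iN; have sp (F : nat -> nat) : \sum_(0 <= x < N) F x =
    \sum_(0 <= x < i) F x + (F i + (F i.+1 + \sum_(i.+2 <= x < N) F x)).
  rewrite (big_cat_nat (leq0n i) (ltnW (ltnW iN))) /=; congr (_ + _).
  by rewrite (big_ltn (ltnW iN)) (big_ltn iN).
rewrite /pot !sp /sw.
have -> : \sum_(0 <= x < i) c (sx i x) * x = \sum_(0 <= x < i) c x * x.
  apply: eq_big_nat => x hx; rewrite /sx ifN ?ifN //; lia.
have -> : \sum_(i.+2 <= x < N) c (sx i x) * x = \sum_(i.+2 <= x < N) c x * x.
  apply: eq_big_nat => x hx; rewrite /sx ifN ?ifN //; lia.
rewrite /sx !eqxx ifN; last by lia.
by case: (c i); case: (c i.+1); lia.
Qed.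

Lemma maxpath_exists c : exists u, maxpath c u.
Proof.
have [p hp] := ubnP (pot c); elim: p c hp => [//|p ih] c hp.
have [/existsP[i /andP[iN ci]]|h] := boolP [exists i : 'I_N, (i.+1 < N) && enab c i].
  have := pot_sw c iN; have /andP[ci0 ci1] := ci.
  rewrite ci1 (negbTE ci0) addn0 addn1 => e.
  by have [|u hu] := ih (sw i c); [lia | exists (val i :: u)].
exists [::] => i iN; move: h; rewrite negb_exists => /forallP /(_ (Ordinal (ltnW iN))).
by rewrite negb_and /= iN.
Qed.

Lemma swC i j c : far i j -> sw i (sw j c) = sw j (sw i c).
Proof.
move=> h; apply/funext => x; rewrite /sw; congr (c _); move: h.
by rewrite /sx /far; do !case: eqP => //; lia.
Qed.

Lemma beq_size u v : beq u v -> size u = size v.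
Proof. by elim=> {u v} // [u v w _ -> _ ->|u v i j _|u v i]; rewrite ?size_cat. Qed.

(** Two distinct enabled positions cannot be neighbours, as the colours would conflict. They are
    therefore far apart and their moves commute, so the diamond argument needs commutations only; a
    common continuation is compared with both words. *)
Lemma maxpath_beq c u u' : maxpath c u -> maxpath c u' -> beq u u'.
Proof.
have [p hp] := ubnP (size u); elim: p c u u' hp => [//|p ih] c [|i u] [|j u'] hp.
- by move=> _ _; exact: beq_refl.
- by move=> h [jN cj _]; have := h j jN; rewrite cj.
- by move=> [iN ci _] h; have := h i iN; rewrite ci.
move=> [iN ci hu] [jN cj hu'].
have [e|ij] := eqVneq i j.
  by move: hu' => /=; rewrite -e => hu'; apply: beq_cons; exact: (ih (sw i c)).
have fij : far i j.
  have [//|nf] := boolP (far i j); move: ci cj => /andP[a b] /andP[a' b'].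
  have : (j == i.+1) || (i == j.+1) by move: nf ij; rewrite /far; lia.
  by case/orP=> /eqP e; [rewrite e b in a' | rewrite e b' in a].
have sxf a b : far a b -> (sx a b = b) * (sx a b.+1 = b.+1).
  by rewrite /far /sx => h; split; do !case: eqP => //; lia.
have fji : far j i by move: fij; rewrite /far orbC.
have [v hv] := maxpath_exists (sw j (sw i c)).
have hi : maxpath (sw i c) (j :: v).
  by split=> //; rewrite /enab /sw !(sxf _ _ fij).
have hj : maxpath (sw j c) (i :: v).
  by split=> //; [rewrite /enab /sw !(sxf _ _ fji) | rewrite swC].
have e1 := ih _ _ _ hp hu hi.
have e2 : beq (i :: v) u'.
  by apply: (ih _ _ _ _ hj hu'); rewrite -[size _]/(size (j :: v)) -(beq_size e1).
apply: beq_trans (beq_cons i e1) _; apply: beq_trans (beq_cons j e2).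
exact: (@beq_far [::]).
Qed.

Lemma maxpath_le u c : all (fun i => i.+1 < N) u ->
  pot c <= pot (foldl (fun c i => sw i c) c u) + size u.
Proof.
elim: u c => [|i u ih] c /=; first by rewrite addn0.
move=> /andP[iN hu]; have := ih (sw i c) hu; have := pot_sw c iN.
by case: (c i); case: (c i.+1); lia.
Qed.

(** A swap lowers the potential by at most one, and by exactly one only if it is enabled. A word as
    short as the drop of the potential thus consists of enabled swaps. *)
Lemma maxpath_tight c u : all (fun i => i.+1 < N) u ->
  pot c = pot (foldl (fun c i => sw i c) c u) + size u ->
  (forall i, i.+1 < N -> ~~ enab (foldl (fun c i => sw i c) c u) i) -> maxpath c u.
Proof.
elim: u c => [//|i u ih] c /= /andP[iN hu] e h.
have l := @maxpath_le u (sw i c) hu; have p := pot_sw c iN.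
split=> //; first by rewrite /enab; move: e p l; case: (c i); case: (c i.+1); lia.
by apply: ih => //; move: e p l; case: (c i); case: (c i.+1); lia.
Qed.

End Colours.

Definition wfn (u : seq nat) (x : nat) := foldr sx x u.

Lemma foldl_sw c u x : foldl (fun c i => sw i c) c (rev u) (wfn u x) = c x.
Proof.
elim: u => [//|i u ih]; rewrite rev_cons foldl_rcons /sw /= sxK; exact: ih.
Qed.

Lemma wfn_cat u v x : wfn (u ++ v) x = wfn u (wfn v x).
Proof. by rewrite /wfn foldr_cat. Qed.

Lemma wfn_up a k x : wfn (up a k) x =
  if x == a + k then a else if a <= x < a + k then x.+1 else x.
Proof.
elim: k => [|k ih] in x *; first by rewrite addn0 /=; do !case: ifP; lia.
by rewrite upS -cats1 wfn_cat /= ih /sx; do !case: ifP; lia.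
Qed.

Lemma wfn_Xw m n x : wfn (Xw n m) x = if x < m then x + n else if x < m + n then x - m else x.
Proof.
elim: n => [|n ih] in x *; first by rewrite /= !addn0; do !case: ifP; lia.
by rewrite XwS wfn_cat ih wfn_up; do !case: ifP; lia.
Qed.

Lemma word_permE n (w : seq 'I_n.-1) (x : 'I_n) :
  val (word_perm w x) = wfn (map val w) (val x).
Proof.
elim: w => [|i w ih]; first by rewrite perm1.
rewrite /= permM -ih; set y := word_perm w x.
rewrite /sgen; case: tpermP => [->|->|/eqP h1 /eqP h2]; rewrite /sx /=.
- by rewrite eqxx.
- by rewrite eqxx ifN //; lia.
- by rewrite !ifN //.
Qed.

Lemma torus_permE m n (x : 'I_(m + n)) :
  val (torus_perm m n x) = if val x < m then x + n else x - m.
Proof.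
rewrite permE /torus_fun; case: splitP => j e /=; rewrite e.
  exact: addnC.
by rewrite addKn.
Qed.

Lemma size_Xw m n : size (Xw m n) = m * n.
Proof. by elim: m => [//|m ih]; rewrite XwS size_cat ih size_iota. Qed.

Lemma ord_word N (s : seq nat) : all (fun i => i < N) s -> exists w : seq 'I_N, map val w = s.
Proof.
elim: s => [_|i s ih /= /andP[iN /ih[w e]]]; first by exists [::].
by exists (Ordinal iN :: w); rewrite /= e.
Qed.

Lemma pot_mn m n : pot (m + n) (fun x => m <= x) = \sum_(0 <= x < m + n) (x < n) * x + m * n.
Proof.
rewrite /pot {1}(big_cat_nat (leq0n m) (leq_addr n m)) /=.
rewrite [X in X + _ = _](_ : _ = 0) ?add0n; last first.
  by rewrite big_nat_cond big1 // => x /andP[/andP[_ h] _]; rewrite leqNgt h.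
rewrite -{1}[m]add0n big_addn addKn.
rewrite (big_cat_nat (leq0n n) (leq_addl m n)) /=.
rewrite [X in _ = _ + X + _](_ : _ = 0) ?addn0; last first.
  by rewrite big_nat_cond big1 // => x /andP[/andP[h _] _]; rewrite ltnNge h.
rewrite (eq_big_nat _ _ (F2 := fun x => x + m)); last by move=> x _; rewrite leq_addl mul1n.
rewrite big_split /= sum_nat_const_nat subn0 [m * n]mulnC; congr (_ + _).
by apply: eq_big_nat => x /andP[_ ->]; rewrite mul1n.
Qed.

Lemma torus_maxpath m n u : all (fun i => i.+1 < m + n) u -> size u <= m * n ->
  (forall x, x < m + n -> wfn u x = if x < m then x + n else x - m) ->
  maxpath (m + n) (fun x => m <= x) (rev u).
Proof.
move=> hu su hw; set c := fun x => _.
have fin y : y < m + n -> foldl (fun c i => sw i c) c (rev u) y = (y < n).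
  move=> yN; pose x := if y < n then m + y else y - n.
  have xN : x < m + n by rewrite /x; case: ifP; lia.
  have <- : wfn u x = y by rewrite (hw _ xN) /x; do !case: ifP; lia.
  by rewrite foldl_sw (hw _ xN) /c /x; do !case: ifP; lia.
apply: maxpath_tight.
- by apply/allP => i; rewrite mem_rev => /(allP hu).
- set f := foldl _ _ _; have pf : pot (m + n) f = \sum_(0 <= x < m + n) (x < n) * x.
    by apply: eq_big_nat => x /andP[_ hx]; congr (_ * _); rewrite -(fin x hx).
  have e := @maxpath_le (m + n) (rev u) c.
  have pp : pot (m + n) c = pot (m + n) f + m * n by rewrite pf pot_mn.
  suff : size (rev u) = m * n by move=> ->.
  move: su e; rewrite pp size_rev leq_add2l => s1 s2; apply/eqP; rewrite eqn_leq s1.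
  by apply: s2; apply/allP => i; rewrite mem_rev => /(allP hu).
- by move=> i iN; rewrite /enab !fin ?(ltnW iN) //; lia.
Qed.

Lemma reduced_torus m n (w : seq 'I_(m + n).-1) : reduced_word (torus_perm m n) w ->
  beq (map val w) (Xw n m).
Proof.
move=> [hw hmin].
have [w' ew'] : exists w' : seq 'I_(m + n).-1, map val w' = Xw n m.
  by apply: ord_word; apply/allP => i /mem_Xw; lia.
have pw' : word_perm w' = torus_perm m n.
  apply/permP => x; apply/val_inj; rewrite word_permE torus_permE ew' wfn_Xw ltn_ord.
  by [].
(* Minimality is used only through this bound, against the explicit word; the potential gives the
   opposite inequality. *)
have sw' : size w <= m * n by rewrite mulnC -size_Xw -ew' size_map hmin.
have key (v : seq 'I_(m + n).-1) : word_perm v = torus_perm m n -> size v <= m * n ->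
    maxpath (m + n) (fun x => m <= x) (rev (map val v)).
  move=> hv sv; apply: torus_maxpath; rewrite ?size_map //.
    by apply/allP => _ /mapP[i _ ->] /=; have := ltn_ord i; lia.
  move=> x hx; rewrite -(torus_permE (Ordinal hx)) -hv.
  by rewrite word_permE.
have h1 := key w hw sw'; have h2 := key w' pw' _.
rewrite -[map val w]revK -[Xw n m]revK -ew'; apply: beq_rev.
apply: maxpath_beq h1 (h2 _).
by rewrite -(size_map val) ew' size_Xw mulnC.
Qed.
Close Scope nat_scope.

Local Notation ract := Pilot.Defs.ract.

(** * Comparison with Hochschild cohomology *)

Section OfComplex.
Variable n : nat.

Section Gs.
Variables (X : complex n) (T : zmodType) (F : int -> X -> T).
Hypothesis FD : forall k, additive_fun (F k).

Definition gs (x : X) : T := gsum (gr X) (fun g v => F g.2 v) x.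

Lemma gsD : additive_fun gs.
Proof. by apply: gsumD => g; [exact: additive_fun0 | exact: FD]. Qed.

Lemma gs_homog g x : gs (gr X g x) = F g.2 (gr X g x).
Proof. by apply: gsum_homog => h; exact: additive_fun0. Qed.
End Gs.

Section Pr.
Variable X : complex n.

Definition pr (k : int) : X -> X := gs (fun l v => if l == k then v else 0).

Lemma pr_sub k : forall l : int, additive_fun (fun v : X => if l == k then v else 0).
Proof. by move=> l x y; case: ifP; rewrite ?addr0. Qed.

Lemma prD k : additive_fun (pr k). Proof. exact: gsD (pr_sub k). Qed.

Lemma pr_homog k g x : pr k (gr X g x) = if g.2 == k then gr X g x else 0.
Proof. exact: gs_homog (pr_sub k) g x. Qed.

Lemma prK k l x : pr k (pr l x) = if k == l then pr l x else 0.
Proof.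
move: x; apply: (@homog_eqf n X X (fun x => pr k (pr l x)) (fun x => if k == l then pr l x else 0)).
- by move=> x y; rewrite !prD.
- by move=> x y; case: ifP; rewrite ?addr0 ?prD.
move=> g x; rewrite pr_homog; case: eqP => [<-|h]; first by rewrite pr_homog eq_sym.
by rewrite if_same (additive_fun0 (prD k)).
Qed.

Lemma pr_lact k i x : pr k (lact ('X_i : Rn n) x) = lact 'X_i (pr k x).
Proof.
have Xh : ('X_i : Rn n) \is 1.-homog by rewrite dhomogX /= mdeg1.
move: x; apply: homog_eqf => [x y|x y|g x].
- by rewrite lactDr prD.
- by rewrite prD lactDr.
rewrite pr_homog -(gr_lact _ _ Xh) pr_homog [(_ + _).2]/= addr0; case: ifP => _.
  by rewrite -(gr_lact _ _ Xh).
exact/esym/(additive_fun0 (lactDr _)).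
Qed.

Lemma pr_ract k i x : pr k (ract x ('X_i : Rn n)) = ract (pr k x) 'X_i.
Proof.
have Xh : ('X_i : Rn n) \is 1.-homog by rewrite dhomogX /= mdeg1.
move: x; apply: homog_eqf => [x y|x y|g x].
- by rewrite (ractDl _ x y) prD.
- by rewrite prD (ractDl _ (pr k x)).
rewrite pr_homog -(gr_ract _ _ Xh) pr_homog [(_ + _).2]/= addr0; case: ifP => _.
  by rewrite -(gr_ract _ _ Xh).
exact/esym/(additive_fun0 (@ractDl _ X _)).
Qed.

Lemma pr_diff k x : pr (k + 1) (diff x) = diff (pr k x).
Proof.
move: x; apply: homog_eqf => [x y|x y|g x].
- by rewrite diffD prD.
- by rewrite prD diffD.
rewrite pr_homog -diff_deg pr_homog /= (inj_eq (addIr _)); case: ifP => _.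
  by rewrite diff_deg.
exact/esym/(additive_fun0 (@diffD _ X)).
Qed.

Definition cop (s : bool) (j : nat) (x : X) : X :=
  if insub j is Some i then (if s then lact ('X_i : Rn n) x else ract x ('X_i : Rn n)) else 0.

Program Definition cxof : cx := @Cx X cop (@diff n X) (fun k x => pr k x = x)
  _ _ _ _ _ _ _ _ _.
Next Obligation.
move=> s j x y; rewrite /cop; case: insub => [i|]; last by rewrite addr0.
by case: s; [exact: lactDr | exact: ractDl].
Qed.
Next Obligation. exact: diffD. Qed.
Next Obligation.
have C (a b : Rn n) (x : X) : lact a (lact b x) = lact b (lact a x) by rewrite -!lactM mulrC.
have C' (a b : Rn n) (x : X) : ract (ract x a) b = ract (ract x b) a by rewrite -!ractM mulrC.
move=> s i t j x; rewrite /cop; case: (insub i) => [a|]; case: (insub j) => [b|] //.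
- by case: s; case: t; rewrite ?lract //.
- case: s; [exact: additive_fun0 (lactDr _) | exact: (additive_fun0 (@ractDl _ X _))].
- case: t; apply: esym; [exact: additive_fun0 (lactDr _) | exact: (additive_fun0 (@ractDl _ X _))].
Qed.
Next Obligation.
move=> s j x; rewrite /cop; have [_ dl dr] := diff_bimap X.
case: insub => [i|]; last by rewrite (additive_fun0 (@diffD _ X)).
by case: s; rewrite ?dl ?dr.
Qed.
Next Obligation. exact: diff2. Qed.
Next Obligation. by move=> k; exact: additive_fun0 (prD k). Qed.
Next Obligation. by move=> k x y hx hy; by have := additive_funB (prD k) x y; rewrite hx hy. Qed.
Next Obligation.
move=> s j k x hx; rewrite /cop; case: insub => [i|]; last exact: additive_fun0 (prD k).
by case: s; rewrite ?pr_lact ?pr_ract hx.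
Qed.
Next Obligation. by move=> k x hx; have := pr_diff k x; rewrite hx. Qed.

Lemma hd_gr g (x : X) : @hd cxof g.2 (gr X g x).
Proof. by rewrite /= pr_homog eqxx. Qed.

Lemma hd_pr k (x : X) : @hd cxof k (pr k x).
Proof. by rewrite /= prK eqxx. Qed.

Lemma gs_hd (T : zmodType) (F : int -> X -> T) k x : (forall l, additive_fun (F l)) ->
  pr k x = x -> gs F x = F k x.
Proof.
move=> FD <-; move: x; apply: homog_eqf => [x y|x y|g x].
- by rewrite prD (gsD FD).
- by rewrite prD FD.
rewrite pr_homog; case: eqP => [<-|_]; first exact: gs_homog.
by rewrite (additive_fun0 (FD k)) (additive_fun0 (gsD FD)).
Qed.

Lemma hd_eqf (T : zmodType) (f h : X -> T) : additive_fun f -> additive_fun h ->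
  (forall k x, @hd cxof k x -> f x = h x) -> f =1 h.
Proof. by move=> fD hD e; apply: homog_eqf => // g x; apply: e (hd_gr g x). Qed.
End Pr.

Lemma copT (X : complex n) (i : 'I_n) x : @op (cxof X) true (val i) x = lact ('X_i : Rn n) x.
Proof. by rewrite /= /cop valK. Qed.
Lemma copF (X : complex n) (i : 'I_n) x : @op (cxof X) false (val i) x = ract x ('X_i : Rn n).
Proof. by rewrite /= /cop valK. Qed.
Lemma cop_big (X : complex n) t j x : (n <= j)%N -> @op (cxof X) t j x = 0.
Proof. by move=> h; rewrite /= /cop insubF // ltnNge h. Qed.

Lemma gs_linl (X : complex n) (D : cx) (F : int -> cxof X -> D) :
  (forall k, lin aS (F k)) -> lin aS (gs F : cxof X -> D).
Proof.
move=> hF; have FD k := (hF k).1; split=> [|t j x _]; first exact: gsD.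
move: x; apply: hd_eqf => [x y|x y|k x hx].
- by rewrite opD (gsD FD).
- by rewrite (gsD FD) opD.
have hx' : pr k (op t j x) = op t j x := hdop (c := cxof X) t j hx.
by rewrite (gs_hd FD hx') (gs_hd FD hx) (hF k).2.
Qed.

Lemma mpoly_ops (N : nat) (Q : {mpoly int[N]} -> Prop) : Q 0 ->
  (forall p q, Q p -> Q q -> Q (p - q)) -> Q 1 -> (forall i p, Q p -> Q ('X_i * p)) ->
  forall p, Q p.
Proof.
move=> Q0 QB Q1 QX; apply: mpoly_span => // m.
have [d hd] := ubnP (mdeg m); elim: d m hd => [//|d ih] m hd.
have [->|m0] := eqVneq m 0%MM; first by rewrite mpolyX0.
have [i mi] : exists i, (0 < m i)%N.
  have [/existsP //|/existsPn h] := boolP [exists i, (0 < m i)%N].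
  by move/eqP: m0; case; apply/mnmP => i; rewrite mnm0E; have := h i; lia.
have e : m = (U_(i) + (m - U_(i)))%MM by rewrite addmC submK // lep1mP -lt0n.
rewrite e mpolyXD; apply: QX; apply: ih; move: hd; rewrite {1}e mdegD mdeg1; lia.
Qed.

Lemma linl_bimap (X Y : complex n) (f : X -> Y) :
  lin aS (f : cxof X -> cxof Y) <-> is_bimap f.
Proof.
split=> [[fD fl]|[fD fl fr]]; last first.
  split=> // t j x _; rewrite /= /cop; case: insub => [i|]; last exact: additive_fun0.
  by case: t; rewrite ?fl ?fr.
have lT i x : f (lact ('X_i : Rn n) x) = lact ('X_i : Rn n) (f x) by rewrite -!copT fl.
have lF i x : f (ract x ('X_i : Rn n)) = ract (f x) ('X_i : Rn n) by rewrite -!copF fl.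
have l0 (Z : complex n) (x : Z) : lact (0 : Rn n) x = 0.
  by rewrite -[0 : Rn n](subrr 0) (additive_funB (fun a b => lactDl a b x)) subrr.
have r0 (Z : complex n) (x : Z) : ract x (0 : Rn n) = 0.
  by rewrite -[0 : Rn n](subrr 0) (additive_funB (fun a b => ractDr a b x)) subrr.
have lB (Z : complex n) (x : Z) := additive_funB (fun a b => lactDl a b x).
have rB (Z : complex n) (x : Z) := additive_funB (fun a b => ractDr a b x).
split=> // a; move: a.
- apply: (mpoly_ops (Q := fun a => forall x, f (lact a x) = lact a (f x))) => [x|p q hp hq x|x|i p hp x].
  + by rewrite !l0 additive_fun0.
  + by rewrite !lB additive_funB // hp hq.
  + by rewrite !lact1.
  + by rewrite !lactM lT hp.
- apply: (mpoly_ops (Q := fun a => forall x, f (ract x a) = ract (f x) a)) => [x|p q hp hq x|x|i p hp x].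
  + by rewrite !r0 additive_fun0.
  + by rewrite !rB additive_funB // hp hq.
  + by rewrite !ract1.
  + by rewrite !ractM hp lF.
Qed.
End OfComplex.

(** * The Koszul resolution of the diagonal bimodule *)

Section Double.
Variable n : nat.

(* A bimodule over Z[x] is a module over Z[x, t], with [t] acting by [phi].   *)
Program Definition dbl (C : cx) : cx := @Cx C
  (fun _ j x => if (j < n)%N then op true j x else phi (j - n) x) (@dd C) (@hd C)
  _ _ _ _ _ _ _ _ _.
Next Obligation. by move=> C s j x y; cbv beta; case: ifP => _; [exact: opD | exact: phiD]. Qed.
Next Obligation. by move=> C; exact: ddD. Qed.
Next Obligation.
by move=> C s i t j x; cbv beta; case: (i < n)%N; case: (j < n)%N; rewrite /phi; cxlin C.
Qed.
Next Obligation. by move=> C s j x; cbv beta; case: ifP => _; rewrite ?opdd ?phid. Qed.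
Next Obligation. exact: dd0. Qed.
Next Obligation. exact: hd0. Qed.
Next Obligation. by move=> C k x y; exact: hdB. Qed.
Next Obligation. by move=> C s j k x hx; cbv beta; rewrite /phi; case: ifP => _; hdsolve. Qed.
Next Obligation. by move=> C k x; exact: hddd. Qed.

(** The way back: the right variable is x_j - t_j. *)
Program Definition und (C : cx) : cx := @Cx C
  (fun t j x => if (j < n)%N then (if t then op true j x else op true j x - op true (n + j)%N x) else 0)
  (@dd C) (@hd C) _ _ _ _ _ _ _ _ _.
Next Obligation.
by move=> C s j x y; cbv beta; case: ifP => _; [case: s; cxlin C | rewrite addr0].
Qed.
Next Obligation. by move=> C; exact: ddD. Qed.
Next Obligation.
have z (C : cx) s j : op s j (0 : C) = 0 by exact: additive_fun0 (opD s j).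
by move=> C s i t j x; cbv beta; case: (i < n)%N; case: (j < n)%N; case: s; case: t; rewrite ?z ?subrr //; cxlin C.
Qed.
Next Obligation.
by move=> C s j x; cbv beta; case: ifP => _; [case: s; cxlin C | exact: esym (additive_fun0 (@ddD C))].
Qed.
Next Obligation. exact: dd0. Qed.
Next Obligation. exact: hd0. Qed.
Next Obligation. by move=> C k x y; exact: hdB. Qed.
Next Obligation.
by move=> C s j k x hx; cbv beta; case: ifP => _; [case: s; hdsolve | exact: hd0].
Qed.
Next Obligation. by move=> C k x; exact: hddd. Qed.

Definition smalln (C : cx) := forall t j (x : C), (n <= j)%N -> op t j x = 0.

Lemma lin_dbl (C D : cx) (f : C -> D) : lin aS f -> linl (f : dbl C -> dbl D).
Proof.
move=> [fD fl]; split=> // t j x _ /=; rewrite /phi; case: ifP => _; rewrite ?(additive_funB fD) !fl //.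
Qed.

Lemma lin_und (C D : cx) (f : C -> D) : smalln D -> linl (f : C -> dbl D) -> lin aS (f : und C -> D).
Proof.
move=> sD [fD fl]; split=> // t j x _ /=; case: ltnP => jn; last by rewrite sD // additive_fun0.
have e1 := fl true j x isT; have e2 := fl true (n + j)%N x isT.
rewrite /= jn in e1; rewrite /= ltnNge leq_addr /= addKn in e2.
by case: t; rewrite ?(additive_funB fD) e1 ?e2 // /phi; cxlin D.
Qed.

Definition V : cx := U (n + n).

(** The Koszul complex of the variables t in L over Z[x, t], as iterated cones of multiplications.
    For all t it resolves Z[x]. *)
Fixpoint KU (L : seq nat) : cx := if L is t :: L' then cone (opm true t (KU L')) else V.

Fixpoint kb (L : seq nat) : KU L -> V :=
  if L is t :: L' return KU L -> V then fun z => kb (z.1 : KU L') else id.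
Fixpoint ki (L : seq nat) (p : V) : KU L :=
  if L is t :: L' return KU L then (ki L' p, 0) else p.

Definition Dt (t : nat) (p : V) : V := if insub t is Some c then Ddiv c p else 0.
Fixpoint kD (t : nat) (L : seq nat) : KU L -> KU L :=
  if L is t' :: L' return KU L -> KU L
  then fun z => (kD t (z.1 : KU L'), kD t (z.2 : KU L')) else Dt t.

(** The remainder modulo t, that is, the substitution t = 0. *)
Definition rt t (p : V) : V := p - op true t (Dt t p).
Definition rr (L : seq nat) (p : V) : V := foldl (fun p t => rt t p) p L.

Lemma freel_kD t L : (t < n + n)%N -> t \notin L -> freel t (@kD t L).
Proof.
move=> tn; elim: L => [_|t' L ih].
  have := freel_U tn; congr (freel t _); apply/funext => p; rewrite /= /Dt.
  by rewrite insubT.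
rewrite inE negb_or => /andP[tt' /ih h]; split.
- by move=> [x y] /=; rewrite !(fl_XY h).
- by move=> [x y] [x' y'] /=; rewrite !(fl_add h).
- by move=> s j [x y] js /=; rewrite !(fl_op h).
- move=> [x y]; apply: pairE => /=; last by rewrite (additive_funN (fl_add h)) (fl_dd h).
  by rewrite (fl_add h) (fl_dd h) (fl_op h) // eq_sym.
- by move=> k [x y] /= [h1 h2]; split; exact: (fl_hd h).
- by move=> [x y] /=; rewrite !(fl_X h).
- move=> [x y]; have [N [e1 e2]] := nil2 (fl_add h) (fl_nil h) x y; exists N.
  suff -> : iter N (@kD t (t' :: L)) (x, y) = (iter N (@kD t L) x, iter N (@kD t L) y).
    by rewrite e1 e2.
  by elim: (N) => [//|M /= ->].
Qed.

Lemma kb_kD t L z : kb (@kD t L z) = Dt t (kb z).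
Proof. by elim: L z => [//|t' L ih] z; exact: ih. Qed.
Lemma kbD L : additive_fun (@kb L).
Proof. by elim: L => [//|t L ih] [x y] [x' y'] /=; exact: ih. Qed.
Lemma kiD L : additive_fun (@ki L).
Proof.
by elim: L => [//|t L ih] x y; apply: pairE; rewrite /= ?addr0 // ih.
Qed.
Lemma kb_op L s j z : kb (op s j z : KU L) = op s j (kb z).
Proof. by elim: L z => [//|t L ih] z; exact: ih. Qed.
Lemma kb_ki L p : kb (ki L p) = p.
Proof. by elim: L => [//|t L ih] /=. Qed.
Lemma kb_hd L k z : hd k z -> hd k (@kb L z).
Proof. by elim: L k z => [//|t L ih] k z /= [h _]; exact: ih. Qed.
Lemma ki_hd L p : hd 0 (ki L p).
Proof. by elim: L => [|t L ih]; [left | split=> //; exact: hd0]. Qed.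

(** Division by each t in turn gives an explicit contraction, up to the remainder of the bottom
    component after setting all t in L to zero. *)
Lemma KU_exact L k (z : KU L) : uniq L -> all (gtn (n + n)) L -> dd z = 0 -> hd k z ->
  exists w, hd (k - 1) w /\ z = ki L (rr L (kb z)) + dd w.
Proof.
elim: L k z => [|t L ih] k.
  move=> p _ _ _ _; exists 0; split; first exact: hd0.
  by rewrite (additive_fun0 (@ddD (KU [::]))) addr0.
move=> [x y] /= /andP[tL uL] /andP[tn nL] [e1 e2] [hx hy].
have h := freel_kD tn tL; set D := @kD t L in h.
have hr : hd k (x - op true t (D x)).
  by apply: hdB => //; apply: hdop; exact: (fl_hd h).
have yE : y = - dd (D x).
  by rewrite -(fl_dd h) -{1}(fl_X h y) -(additive_funN (fl_add h)); congr (D _); zlin e1.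
have dr : dd (x - op true t (D x)) = 0.
  have -> : dd (x - op true t (D x)) = dd x + op true t (- dd (D x)) by cxlin (KU L).
  by rewrite -yE.
have [w [hw ew]] := ih k _ uL nL dr hr.
exists (w, D x); split; first by split; rewrite // addr0 subrK; exact: (fl_hd h).
apply: pairE; last by rewrite /= add0r.
rewrite /= -[LHS](subrK (op true t (D x))) {1}ew (additive_funB (@kbD L)) kb_op kb_kD.
by rewrite addrA.
Qed.

Lemma KU_bnded L k z : 0 < k -> hd k (z : KU L) -> z = 0.
Proof.
elim: L k z => [|t L ih] k z k0; first exact: bnded_U.
case: z => x y /= [/(ih _ _ k0) -> h]; rewrite (ih _ _ _ h) //.
by move: k0; clear; lia.
Qed.
End Double.

(* [C] followed by [R] in degree 1 *)
Section Augmented.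
Variables (C R : cx) (a : C -> R).
Hypotheses (al : lin aS a) (ad : forall x, a (dd x) = 0)
  (ah : forall k x, hd k x -> k = 0 \/ a x = 0).

Program Definition augc : cx := @Cx (R * C)%type (fun t j z => (op t j z.1, op t j z.2))
  (fun z => (a z.2, dd z.2)) (fun k z => (k = 1 \/ z.1 = 0) /\ hd k z.2) _ _ _ _ _ _ _ _ _.
Next Obligation. by move=> t j [x y] [x' y']; apply: pairE; exact: opD. Qed.
Next Obligation. by move=> [x y] [x' y']; apply: pairE; [exact: al.1 | exact: ddD]. Qed.
Next Obligation. by move=> s i t j [x y]; apply: pairE; exact: opC. Qed.
Next Obligation. by move=> s j [x y]; apply: pairE; [exact: esym (al.2 _ _ _ isT) | exact: opdd]. Qed.
Next Obligation. by move=> [x y]; apply: pairE; [exact: ad | exact: dd0]. Qed.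
Next Obligation. by move=> k; split; [right | exact: hd0]. Qed.
Next Obligation.
move=> k [x y] [x' y'] /= [h1 h2] [h3 h4]; split; last exact: hdB.
by case: h1 => [|->]; [left | case: h3 => [|->]; [left | right; rewrite subrr]].
Qed.
Next Obligation.
move=> s j k [x y] /= [h1 h2]; split; last exact: hdop.
by case: h1 => [|->]; [left | right; exact: additive_fun0 (opD _ _)].
Qed.
Next Obligation.
move=> k [x y] /= [_ h]; split; last exact: hddd.
by case: (ah h) => [->|->]; [left | right].
Qed.
End Augmented.

Definition acyclic (D : cx) := forall k (z : D), hd k z -> dd z = 0 ->
  exists y, hd (k - 1) y /\ z = dd y.

Lemma mactM N (C : cx) (a b : {mpoly int[N]}) (y : C) : mact (a * b) y = mact a (mact b y).
Proof.
move: a; apply: mpoly_ops => [|p q hp hq||i p hp].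
- by rewrite mul0r !(additive_fun0 (mactDl _)).
- by rewrite mulrBl !(additive_funB (mactDl _)) hp hq.
- by rewrite mul1r mact1.
- by rewrite -mulrA !mactX hp.
Qed.

Program Definition flip (C : cx) : cx := @Cx C (fun t => op (~~ t)) (@dd C) (@hd C) _ _ _ _ _ _ _ _ _.
Next Obligation. by move=> C s j; exact: opD. Qed.
Next Obligation. by move=> C; exact: ddD. Qed.
Next Obligation. by move=> C s i t j x; exact: opC. Qed.
Next Obligation. by move=> C s j x; exact: opdd. Qed.
Next Obligation. by move=> C; exact: dd0. Qed.
Next Obligation. by move=> C; exact: hd0. Qed.
Next Obligation. by move=> C k x y; exact: hdB. Qed.
Next Obligation. by move=> C s j k x; exact: hdop. Qed.
Next Obligation. by move=> C k x; exact: hddd. Qed.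

(** * Lifting along a projective resolution *)

Section SubBimodule.
Variables (n : nat) (D : cx) (b : bool) (k : int).

(** The elements of degree k, or the cycles among them, are made into a bimodule over [Rn n].
    Surjectivity of the differential onto cycles then becomes a statement to which projectivity
    applies. *)
Definition subD : Type := {x : D | hd k x /\ (b -> dd x = 0)}.
HB.instance Definition _ := gen_eqMixin subD.
HB.instance Definition _ := gen_choiceMixin subD.

Lemma subD_eq (x y : subD) : sval x = sval y -> x = y.
Proof. by case: x y => x px [y py] /= e; apply: eq_exist. Qed.

Program Definition sub0 : subD := exist _ 0 _.
Next Obligation. by split=> [|_]; [exact: hd0 | exact: (additive_fun0 (@ddD D))]. Qed.
Program Definition subN (x : subD) : subD := exist _ (- sval x) _.
Next Obligation.
move=> [x [h1 h2]] /=; split=> [|hb]; first exact: hdN.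
by rewrite (additive_funN (@ddD D)) h2 ?oppr0.
Qed.
Program Definition subA (x y : subD) : subD := exist _ (sval x + sval y) _.
Next Obligation.
move=> [x [h1 h2]] [y [h3 h4]] /=; split=> [|hb]; first exact: hdD.
by rewrite ddD h2 ?h4 ?addr0.
Qed.
Lemma subAA : associative subA.
Proof. by move=> x y z; apply: subD_eq; exact: addrA. Qed.
Lemma subAC : commutative subA.
Proof. by move=> x y; apply: subD_eq; exact: addrC. Qed.
Lemma subA0 : left_id sub0 subA.
Proof. by move=> x; apply: subD_eq; exact: add0r. Qed.
Lemma subAN : left_inverse sub0 subN subA.
Proof. by move=> x; apply: subD_eq; exact: addNr. Qed.
HB.instance Definition _ := GRing.isZmodule.Build subD subAA subAC subA0 subAN.

Program Definition sublact (a : Rn n) (x : subD) : subD := exist _ (@mact n D a (sval x)) _.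
Next Obligation.
move=> a [x [h1 h2]] /=; split=> [|hb]; first exact: mact_hd.
by rewrite mact_dd h2 // (additive_fun0 (mactDr _)).
Qed.
Program Definition subract (x : subD) (a : Rn n) : subD := exist _ (@mact n (flip D) a (sval x)) _.
Next Obligation.
move=> [x [h1 h2]] a /=; split=> [|hb]; first exact: (@mact_hd _ (flip D)).
by rewrite (@mact_dd _ (flip D)) /= h2 // (additive_fun0 (@mactDr n (flip D) a)).
Qed.

Lemma mact_flip (a c : Rn n) (x : D) :
  @mact n (flip D) c (@mact n D a x) = @mact n D a (@mact n (flip D) c x).
Proof.
have h : linl (@mact n (flip D) c : D -> D).
  split; first exact: (@mactDr n (flip D)).
  by move=> t j y _; have := @mact_op n (flip D) (~~ t) j c y; rewrite /= negbK => ->.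
exact: (@mact_nat n D D _ a x h).
Qed.

Definition sub_bimod : bimod (Rn n).
Proof.
refine (@Bimod (Rn n) subD sublact subract _ _ _ _ _ _ _ _ _).
- by move=> a x y; apply: subD_eq; exact: mactDr.
- by move=> a c x; apply: subD_eq; exact: mactDl.
- by move=> a c x; apply: subD_eq; exact: mactM.
- by move=> x; apply: subD_eq; exact: mact1.
- by move=> a x y; apply: subD_eq; exact: (@mactDr n (flip D)).
- by move=> x a c; apply: subD_eq; exact: (@mactDl n (flip D)).
- by move=> a c x; apply: subD_eq; rewrite /= mulrC (@mactM n (flip D)).
- by move=> x; apply: subD_eq; exact: (@mact1 n (flip D)).
- by move=> a c x; apply: subD_eq; exact: mact_flip.
Defined.
End SubBimodule.

Section NullHomotopy.
Variables (n : nat) (P : projective_resolution n) (D : cx).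
Hypotheses (sD : smalln n D) (aD : acyclic D).
Local Notation Pc := (cxof P).

Lemma lin_mact (v : Pc -> D) : lin aS v -> forall (a : Rn n) (x : P),
  v (lact a x) = mact a (v x) /\ v (ract x a) = @mact n (flip D) a (v x).
Proof.
move=> [vD vl] a; move: a.
have l0 (x : P) := additive_fun0 (fun a b => lactDl a b x).
have r0 (x : P) := additive_fun0 (fun a b => ractDr a b x).
have lB (x : P) := additive_funB (fun a b => lactDl a b x).
have rB (x : P) := additive_funB (fun a b => ractDr a b x).
apply: (mpoly_ops (Q := fun a => forall x : P, v (lact a x) = mact a (v x) /\
  v (ract x a) = @mact n (flip D) a (v x))) => [x|p q hp hq x|x|i p hp x].
- by rewrite l0 r0 (additive_fun0 (@mactDl n D _)) (additive_fun0 (@mactDl n (flip D) _)) additive_fun0.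
- rewrite lB rB (additive_funB (@mactDl n D _)) (additive_funB (@mactDl n (flip D) _)) !(additive_funB vD).
  by have [-> ->] := hp x; have [-> ->] := hq x.
- by rewrite lact1 ract1 mact1 (@mact1 n (flip D)).
- rewrite lactM mactX (@mactX n (flip D)) mulrC ractM -copT -copF !vl //=.
  by have [-> ->] := hp x.
Qed.

(** Projectivity is assumed for the whole of P, so v is first cut down to degree k by [pr k]. The
    lift is then defined on all of P and is correct in degree k. *)
Lemma lift_cycle (v : Pc -> D) k m : lin aS v ->
  (forall x, hd k x -> hd m (v x) /\ dd (v x) = 0) ->
  exists h : Pc -> D, [/\ lin aS h, forall x, hd (m - 1) (h x) &
    forall x, hd k x -> dd (h x) = v x].
Proof.
move=> vl hv.
have pl : lin aS (pr k : Pc -> Pc).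
  apply: (@gs_linl n P Pc) => l; split=> [|t j x _]; first exact: pr_sub.
  by case: ifP => // _; rewrite (additive_fun0 (@opD Pc _ _)).
pose M := sub_bimod n D false (m - 1); pose N := sub_bimod n D true m.
have pf (x : subD D false (m - 1)) : hd m (dd (sval x)) /\ (true -> dd (dd (sval x)) = 0).
  by split=> [|_]; [by have := hddd (svalP x).1; rewrite subrK | exact: dd0].
pose p (x : M) : N := exist _ (dd (sval (x : subD D false (m - 1)))) (pf x).
have ff (x : Pc) : hd m (v (pr k x)) /\ (true -> dd (v (pr k x)) = 0).
  by have [] := hv _ (hd_pr k x).
pose f (x : P) : N := exist _ (v (pr k x)) (ff x).
have fl : lin aS ((fun x : Pc => v (pr k x)) : Pc -> D).
  split=> [x y|t j x _]; first by rewrite pl.1 vl.1.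
  by rewrite pl.2 // vl.2.
have pB : is_bimap p.
  split=> [x y|a x|a x]; apply: subD_eq => /=.
  - exact: ddD.
  - exact: mact_dd.
  - exact: (@mact_dd n (flip D)).
have ps (y : N) : exists x, p x = y.
  have [w [hw ew]] := aD (svalP y).1 ((svalP y).2 isT).
  have qw : hd (m - 1) w /\ (false -> dd w = 0) by split.
  by exists (exist _ w qw); apply: subD_eq.
have fB : is_bimap f.
  split=> [x y|a x|a x]; apply: subD_eq => /=; first exact: fl.1.
  - exact: (lin_mact fl a x).1.
  - exact: (lin_mact fl a x).2.
have [h [hD hl hr] eh] := pres_projective pB ps fB.
exists (fun x => sval (h x : subD D false (m - 1))); split.
- split=> [x y|t j x _]; first by rewrite hD.
  case: (ltnP j n) => jn; last by rewrite sD // (cop_big _ _ jn) (additive_fun0 hD).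
  rewrite -[j]/(val (Ordinal jn)); case: t; first by rewrite copT hl /= -['X__]mulr1 mactX mact1.
  by rewrite copF hr /= -['X__]mulr1 (@mactX n (flip D)) (@mact1 n (flip D)).
- by move=> x; exact: (svalP (h x)).1.
- by move=> x hx; have /(f_equal sval) /= := eh x; rewrite hx.
Qed.

Lemma hd_posP k (x : Pc) : 0 < k -> hd k x -> x = 0.
Proof.
move=> k0; have e0 : (fun x : Pc => pr k x) =1 fun=> 0.
  apply: (@homog_eqf n P P) => [a b|a b|g y]; rewrite ?prD ?addr0 //.
  rewrite pr_homog; case: eqP => // gk.
  apply: (@pres_nonpos n P g.1 g.2); last by rewrite gk.
  by case: g {gk} => a l; rewrite /homog_of compK eqxx.
by move=> <-; exact: e0.
Qed.

(** The homotopy is built from degree 0 downwards. The last clause of [Inv] makes the error at the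
    next step take values in cycles, so that it can be lifted in the acyclic complex D. The flag e
    covers maps that commute and maps that anticommute with the differential. *)
Lemma null_homotopy (u : Pc -> D) (r : int) (e : bool) : lin aS u ->
  (forall k x, hd k x -> hd (k + r) (u x)) ->
  (forall x, dd (u x) = lsign e (u (dd x))) ->
  exists s : Pc -> D, [/\ lin aS s, forall k x, hd k x -> hd (k + r - 1) (s x) &
    forall x, u x = dd (s x) + lsign e (s (dd x))].
Proof.
move=> ul uh ud.
pose Inv (j : nat) (h : Pc -> D) := [/\ lin aS h, forall x, hd (- j%:Z + r - 1) (h x) &
  forall x, hd (- j%:Z) x -> dd x = 0 -> dd (h x) = u x].
have dpos x : @hd Pc 0 x -> dd x = 0.
  by move=> hx; apply: (@hd_posP (0 + 1)) => //; exact: hddd.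
have base : exists h, Inv 0%N h.
  have [|h [h1 h2 h3]] := @lift_cycle u 0 (0 + r) ul.
    move=> x hx; split; first exact: uh.
    by rewrite ud dpos // (additive_fun0 ul.1); case: (e); rewrite /= ?oppr0.
  by exists h; split=> // x hx _; exact: h3.
have step j h : Inv j h -> exists h', Inv j.+1%N h' /\
    forall x, hd (- j.+1%:Z) x -> dd (h' x) = u x - lsign e (h (dd x)).
  move=> [hl hh hc]; pose v (x : Pc) : D := u x - lsign e (h (dd x)).
  have vl : lin aS v.
    split=> [x y|t i x _].
      by rewrite /v ul.1 ddD hl.1 lsignD; zlin.
    by rewrite /v ul.2 // -opdd hl.2 //; case: (e); rewrite /=; cxlin D.
  have e1 : - j.+1%:Z + 1 = - j%:Z by lia.
  have [|h' [h1 h2 h3]] := @lift_cycle v (- j.+1%:Z) (- j.+1%:Z + r) vl.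
    move=> x hx; have hdx : hd (- j%:Z) (dd x) by rewrite -e1; exact: hddd.
    have hz : hd (- j.+1%:Z + r) (h (dd x)).
      by have := hh (dd x); rewrite (_ : - j%:Z + r - 1 = - j.+1%:Z + r) //; lia.
    split; first by apply: hdB; [exact: uh | case: (e) => //=; exact: hdN].
    have dh := hc _ hdx (dd0 x).
    rewrite /v (additive_funB (@ddD D)) ud; case: (e); rewrite /= ?(additive_funN (@ddD D)) dh ?subrr //.
  exists h'; split=> //; split=> // x hx dx.
  by rewrite h3 // /v dx (additive_fun0 hl.1); case: (e); rewrite /= !oppr0 addr0.
pose st := nat_rect (fun j => {h | Inv j h}) (cid base)
  (fun j hh => let c := cid (step j (sval hh) (svalP hh)) in exist _ (sval c) (svalP c).1).
have stS j x : hd (- j.+1%:Z) x ->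
    dd (sval (st j.+1%N) x) = u x - lsign e (sval (st j) (dd x)).
  exact: (svalP (cid (step j (sval (st j)) (svalP (st j))))).2.
pose F (k : int) : Pc -> D := sval (st `|k|%N).
have Fl k : lin aS (F k) by have [] := svalP (st `|k|%N).
have FD k := (Fl k).1.
have hdc k (x : Pc) : hd k x -> x = 0 \/ exists j : nat, k = - j%:Z.
  move=> hx; have [k0|k0] := ltP 0 k; first by left; exact: hd_posP hx.
  by right; exists `|k|%N; move: k0; clear; lia.
exists (gs F); split; first exact: gs_linl.
- move=> k x hx; rewrite (gs_hd FD hx).
  have [->|[j kj]] := hdc k x hx; first by rewrite (additive_fun0 (FD k)); exact: hd0.
  by have [_ h _] := svalP (st `|k|%N); have := h x; rewrite /F kj abszN.
have GD := (gs_linl Fl).1.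
apply: (@hd_eqf n P D) => [|x y|k x hx]; first exact: ul.1.
  by rewrite GD ddD ddD GD lsignD; zlin.
have hdx := hddd hx; rewrite (gs_hd FD hx) (gs_hd FD hdx).
have [->|[j kj]] := hdc k x hx.
  rewrite (additive_fun0 ul.1) (additive_fun0 (FD k)) (additive_fun0 (@ddD Pc)).
  rewrite (additive_fun0 (FD _)) (additive_fun0 (@ddD D)).
  by case: (e); rewrite /= ?oppr0 addr0.
case: j kj => [|j] kj.
  have dx : dd x = 0 by apply: dpos; rewrite -[0]oppr0 -kj.
  rewrite dx (additive_fun0 (FD _)) /F kj; have [_ _ h] := svalP (st 0%N).
  by rewrite h //; [case: (e); rewrite /= ?oppr0 addr0 | rewrite -kj].
rewrite /F (_ : `|(k + 1)%R|%N = j); last by rewrite kj; clear; lia.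
rewrite (_ : `|k|%N = j.+1%N); last by rewrite kj; clear; lia.
by rewrite stS ?subrK // -kj.
Qed.
End NullHomotopy.

Section Resolutions.
Variable n : nat.
Local Notation V := (V n).
Local Notation KU := (KU n).
Local Notation R := (cxof (conc (reg n))).

Lemma smalln_cxof (X : complex n) : smalln n (cxof X).
Proof. by move=> t j x; exact: cop_big. Qed.
Lemma smalln_und C : smalln n (und n C).
Proof. by move=> t j x jn /=; rewrite ltnNge jn. Qed.
Lemma smalln_augc C D a al ad ah : smalln n C -> smalln n D -> smalln n (@augc C D a al ad ah).
Proof. by move=> sC sD t j [x y] jn; apply: pairE; [exact: sD | exact: sC]. Qed.

Lemma phi_small (C : cx) j (x : C) : smalln n C -> (n <= j)%N -> phi j x = 0.
Proof. by move=> sC jn; rewrite /phi !sC // subrr. Qed.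

Lemma linl_mactV (C : cx) (y : C) : smalln n C ->
  linl ((fun p => @mact (n + n) (dbl n C) p y) : V -> dbl n C).
Proof.
move=> sC; split=> [p q|t j p _]; first exact: mactDl.
rewrite /= /Uop; case: insubP => [i _ ij|jn].
  by rewrite (@mactX (n + n) (dbl n C)) /= ij.
rewrite -leqNgt in jn; rewrite (additive_fun0 (@mactDl _ (dbl n C) y)).
rewrite ifN; last by rewrite -leqNgt (leq_trans _ jn) // leq_addr.
by rewrite phi_small //; move: jn; clear; lia.
Qed.

Lemma dbl_lo (C : cx) t j (x : C) : (j < n)%N -> @op (dbl n C) t j x = op true j x.
Proof. by move=> h; rewrite /= h. Qed.
Lemma dbl_hi (C : cx) t j (x : C) : (n <= j)%N -> @op (dbl n C) t j x = phi (j - n) x.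
Proof. by move=> h; rewrite /= ltnNge h. Qed.
Lemma opR (i : 'I_n) (x : {mpoly int[n]}) : @op R true (val i) x = 'X_i * x.
Proof. exact: (@copT n (conc (reg n))). Qed.

Lemma phi_lin (C : cx) c : lin aS (@phi C c).
Proof. by split=> [x y|t j x _]; [exact: phiD | rewrite /phi; cxlin C]. Qed.

Lemma phi_R c (x : R) : phi c x = 0.
Proof.
rewrite /phi /= /cop; case: insub => [i|]; last exact: subrr.
by rewrite /= mulrC subrr.
Qed.

Definition aK L (z : KU L) : R := @mact (n + n) (dbl n R) (kb z) (1 : {mpoly int[n]}).

Lemma linl_aK L : linl (@aK L : KU L -> dbl n R).
Proof.
have [hD hl] := @linl_mactV R (1 : {mpoly int[n]}) (@smalln_cxof (conc (reg n))).
split=> [x y|t j x tj]; rewrite /aK ?kbD ?kb_op; [exact: hD | exact: hl].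
Qed.

Lemma lin_aK L : lin aS (@aK L : und n (KU L) -> R).
Proof. exact: lin_und (@smalln_cxof (conc (reg n))) (@linl_aK L). Qed.

Lemma aK_dd L (z : KU L) : all (leq n) L -> aK (dd z) = 0.
Proof.
elim: L z => [|t L ih] z /=; first by move=> _; exact: (additive_fun0 (linl_aK [::]).1).
case: z => x y /andP[nt nL]; rewrite -[aK _]/(aK (dd x + op true t y : KU L)).
rewrite (linl_aK L).1 ih // add0r (linl_aK L).2 //= ifN -?leqNgt //; exact: phi_R.
Qed.

Lemma aK_hd L k (z : KU L) : hd k z -> k = 0 \/ aK z = 0.
Proof.
move=> /kb_hd /= [->|h]; first by left.
by right; rewrite /aK h; exact: (additive_fun0 (@mactDl _ (dbl n R) _)).
Qed.

Definition jV (q : {mpoly int[n]}) : V := @mact n V q (1 : {mpoly int[n + n]}).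

Lemma jVX (i : 'I_n) q : jV ('X_i * q) = op true (val i) (jV q).
Proof. exact: mactX. Qed.

Lemma jVD : additive_fun jV. Proof. exact: mactDl. Qed.

Lemma aK_jV q : @aK [::] (jV q) = q.
Proof.
move: q; apply: mpoly_ops => [|p q hp hq||i p hp].
- by rewrite (additive_fun0 jVD) (additive_fun0 (linl_aK [::]).1).
- by rewrite (additive_funB jVD) (additive_funB (linl_aK [::]).1) hp hq.
- by rewrite /jV mact1 /aK /= (@mact1 _ (dbl n R)).
- rewrite jVX (linl_aK [::]).2 // hp.
  by rewrite dbl_lo ?ltn_ord // opR.
Qed.

Definition Lt := map (addn n) (iota 0 n).

Lemma LtE : Lt = iota n n. Proof. by rewrite /Lt -iotaDl addn0. Qed.

Lemma rrD L : additive_fun (@rr n L).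
Proof.
elim: L => [//|t L ih] p q /=; rewrite -ih; congr foldl.
have DD : additive_fun (@Dt n t).
  by move=> x y; rewrite /Dt; case: insub => [c|]; [exact: Ddiv_add | rewrite addr0].
by rewrite /rt DD (@opD V); zlin.
Qed.

Lemma rt_op t j p : j != t -> rt t (op true j p : V) = op true j (rt t p).
Proof.
move=> jt; rewrite /rt /Dt; case: insubP => [c _ ct|_]; last first.
  by rewrite (additive_fun0 (@opD V true t)) !subr0.
have -> : Ddiv c (op true j p : V) = op true j (Ddiv c p).
  rewrite /= /Uop; case: insubP => [i _ ij|_]; last exact: (additive_fun0 (@Ddiv_add _ c)).
  by apply: Ddiv_op; apply: contra jt => /eqP e; rewrite -ij e ct.
by rewrite (additive_funB (@opD V true j)) (@opC V).
Qed.

Lemma rt_opt t p : rt t (op true t p : V) = 0.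
Proof.
rewrite /rt /Dt /= /Uop; case: insubP => [c _ ct|_]; last exact: subrr.
by rewrite Ddiv_X subrr.
Qed.

Lemma rr_opt L t p : t \in L -> rr L (op true t p : V) = 0.
Proof.
elim: L p => [//|t' L ih] p; rewrite inE /=; have [->|tt'] := eqVneq t t' => [_|/= tL].
  by rewrite rt_opt; exact: (additive_fun0 (@rrD L)).
by rewrite rt_op // ih.
Qed.

Lemma rr_op L j p : j \notin L -> rr L (op true j p : V) = op true j (rr L p).
Proof.
elim: L p => [//|t L ih] p; rewrite inE negb_or => /andP[jt jL] /=.
by rewrite rt_op // ih.
Qed.

Lemma rr1 L : rr L (1 : {mpoly int[n + n]}) = 1 :> {mpoly int[n + n]}.
Proof.
elim: L => [//|t L ih] /=; rewrite (_ : rt t _ = 1 :> {mpoly int[n + n]}) //.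
rewrite /rt (_ : Dt t _ = 0); first by rewrite (additive_fun0 (@opD V true t)) subr0.
rewrite /Dt; case: insub => [c|//]; rewrite -mpolyX0 /Ddiv lextX /mdrop mnm0E //.
Qed.

Lemma rr_aK p : rr Lt p = jV (@aK [::] p).
Proof.
have j0 := additive_fun0 jVD.
have jB := additive_funB jVD.
have aB := additive_funB (linl_aK [::]).1.
have a0 := additive_fun0 (linl_aK [::]).1.
move: p; apply: mpoly_ops => [|p q hp hq||i p hp].
- by rewrite a0 (additive_fun0 (@rrD _)) j0.
- by rewrite aB (additive_funB (@rrD _)) hp hq jB.
- by rewrite rr1 /aK /= (@mact1 _ (dbl n R)) /jV (@mact1 n V).
rewrite -[_ * p](UopE i p) -[Uop _ p]/(@op V true (val i) p) (linl_aK [::]).2 //.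
case: (ltnP (val i) n) => hi.
  rewrite rr_op; last by rewrite LtE mem_iota leqNgt hi.
  by rewrite hp dbl_lo // -[val i]/(val (Ordinal hi)) opR jVX.
rewrite rr_opt; last by rewrite LtE mem_iota hi ltn_ord.
by rewrite dbl_hi // phi_R j0.
Qed.

Lemma Lt_le : all (leq n) Lt.
Proof. by apply/allP => t; rewrite LtE mem_iota => /andP[]. Qed.

Lemma Lt_lt : all (gtn (n + n)) Lt.
Proof. by apply/allP => t; rewrite LtE mem_iota => /andP[]. Qed.

Definition augK := augc (@lin_aK Lt) (fun z => aK_dd z Lt_le) (@aK_hd Lt).

Lemma kb_aK L (z : KU L) : aK z = @aK [::] (kb z). Proof. by []. Qed.

Lemma ki_dd L p : dd (ki L p : KU L) = 0.
Proof.
elim: L => [//|t L ih]; apply: pairE; last by rewrite /= (additive_fun0 (@ddD _)) oppr0.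
by rewrite /= ih (additive_fun0 (opD _ _)) addr0.
Qed.

Lemma acyclic_augK : acyclic augK.
Proof.
move=> k [r z] [h1 h2] e; have ar : aK z = 0 := f_equal fst e.
have dz : dd z = 0 := f_equal snd e.
case: (eqVneq k 1) => [k1|k1].
  exists (0, ki Lt (jV r)); split; first by split; [right | rewrite k1; exact: ki_hd].
  apply: pairE; first by rewrite -[RHS]/(aK (ki Lt (jV r))) kb_aK kb_ki aK_jV.
  by rewrite -[RHS]/(dd (ki Lt (jV r))) ki_dd; apply: KU_bnded h2; rewrite k1.
have uL : uniq Lt by rewrite LtE iota_uniq.
have [w [hw]] := KU_exact uL Lt_lt dz h2.
rewrite rr_aK -kb_aK ar (additive_fun0 jVD) (additive_fun0 (@kiD n _)) add0r => ew.
have r0 : r = 0 by case: h1 => // h; rewrite h in k1.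
exists (0, w); split; first by split; [right | exact: hw].
apply: pairE; last exact: ew.
rewrite -[RHS]/(aK w) -[LHS]/r r0.
by case: (aK_hd hw) => [k0|->//]; move: k1; rewrite -[k](subrK 1) k0.
Qed.

Section Resolution.
Variable P : projective_resolution n.
Local Notation Pc := (cxof P).
Local Notation ag := (@aug n P : Pc -> R).

Lemma lin_aug : lin aS ag.
Proof. exact: (linl_bimap (Y := conc (reg n)) ag).2 (@aug_bimap n P). Qed.

Lemma aug_pr k x : ag (pr k x) = if k == 0 then ag x else 0.
Proof.
move: x; apply: (@homog_eqf n P (reg n)) => [x y|x y|g x].
- by rewrite prD lin_aug.1.
- by case: ifP => _; rewrite ?addr0 // lin_aug.1.
rewrite pr_homog; have := @aug_deg n P g x; rewrite /=.
case: (eqVneq g.2 0) => [->|g0] e; first by rewrite eq_sym; case: ifP => _ //; exact: (additive_fun0 lin_aug.1).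
by rewrite -e; case: ifP => _; rewrite ?if_same // ?(additive_fun0 lin_aug.1).
Qed.

Lemma aug_hd k (x : Pc) : hd k x -> k = 0 \/ ag x = 0.
Proof. by move=> <-; rewrite aug_pr; case: eqP => h; [left|right]. Qed.

Definition augP := augc lin_aug (@aug_diff n P) aug_hd.

Lemma acyclic_augP : acyclic augP.
Proof.
move=> k [r z] [h1 h2] e; have ar : ag z = 0 := f_equal fst e.
have dz : diff z = 0 := f_equal snd e.
case: (eqVneq k 1) => [k1|k1].
  have [y ey] := aug_surj P r.
  exists (0, pr 0 y); split; first by split; [right | rewrite k1; exact: hd_pr].
  apply: pairE; first by rewrite -[RHS]/(ag (pr 0 y)) aug_pr.
  rewrite -[RHS]/(@dd Pc (pr 0 y)) -[LHS]/z -[RHS]pr_diff add0r.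
  have -> : z = 0 by apply: (@hd_posP n P k) h2; rewrite k1.
  by apply: esym; apply: (@hd_posP n P 1) => //; exact: hd_pr.
have [y ey] := pres_exact dz ar.
have r0 : r = 0 by case: h1 => // h; rewrite h in k1.
exists (0, pr (k - 1) y); split; first by split; [right | exact: hd_pr].
apply: pairE; last by rewrite -[RHS]/(diff (pr (k - 1) y)) -pr_diff subrK -ey; exact: esym h2.
rewrite -[RHS]/(ag (pr (k - 1) y)) -[LHS]/r r0 aug_pr ifF //.
by apply/eqP => k0; move: k1; rewrite -[k](subrK 1) k0.
Qed.
End Resolution.
End Resolutions.

(** * Comparison of a projective resolution with the Koszul complex *)

Section Comparison.
Variables (n : nat) (P : projective_resolution n).
Local Notation Pc := (cxof P).
Local Notation KU := (KU n).
Local Notation R := (cxof (conc (reg n))).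
Local Notation ag := (@aug n P : Pc -> R).

(** A map that becomes zero after augmentation is a chain map into the augmented resolution, which
    is acyclic. For degree reasons the homotopy obtained is annihilated by the augmentation as
    well. *)
Lemma null_homotopic (u : Pc -> Pc) : lin aS u -> (forall k x, hd k x -> hd k (u x)) ->
  (forall x, dd (u x) = u (dd x)) -> (forall x, ag (u x) = 0) ->
  exists s : Pc -> Pc, [/\ lin aS s, forall k x, hd k x -> hd (k - 1) (s x),
    forall x, ag (s x) = 0 & forall x, u x = dd (s x) + s (dd x)].
Proof.
move=> ul uh ud ua.
have sA : smalln n (augP P) by apply: smalln_augc; exact: smalln_cxof.
pose u' (x : Pc) : augP P := (0, u x).
have [||x|s [sl sh se]] := @null_homotopy n P (augP P) sA (@acyclic_augP n P) u' 0 false.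
- split=> [x y|t j x _]; apply: pairE; rewrite //= ?addr0 ?ul.1 ?(ul.2 _ _ _ isT) //.
  exact: esym (additive_fun0 (@opD R _ _)).
- by move=> k x hx; split; [right | rewrite addr0; exact: uh].
- by apply: pairE; [exact: ua | exact: ud].
have s2l : lin aS ((fun x => (s x).2) : Pc -> Pc).
  by split=> [x y|t j x _]; rewrite ?sl.1 ?sl.2.
have s2h k x : @hd Pc k x -> @hd Pc (k - 1) (s x).2.
  by move=> /sh [_]; rewrite addr0.
exists (fun x => (s x).2); split=> //; last by move=> x; exact: (f_equal snd (se x)).
apply: (@hd_eqf n P R (fun x => ag (s x).2) (fun=> 0)) => [x y|x y|k x hx].
- by rewrite s2l.1 (lin_aug P).1.
- by rewrite addr0.
case: (aug_hd (s2h k x hx)) => // k0.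
have -> : x = 0 by apply: (@hd_posP n P k) hx; rewrite -[k](subrK 1) k0.
by rewrite (additive_fun0 s2l.1) (additive_fun0 (lin_aug P).1).
Qed.

Lemma phi_homotopy c : exists s : Pc -> Pc, [/\ lin aS s,
  forall k x, hd k x -> hd (k - 1) (s x), forall x, ag (s x) = 0 &
  forall x, phi c x = dd (s x) + s (dd x)].
Proof.
apply: null_homotopic.
- exact: phi_lin.
- by move=> k x hx; rewrite /phi; hdsolve.
- by move=> x; rewrite phid.
- move=> x; rewrite /phi (additive_funB (lin_aug P).1) !(lin_aug P).2 //; exact: phi_R.
Qed.

Definition sc c : Pc -> Pc := sval (cid (phi_homotopy c)).
Lemma sc_lin c : lin aS (sc c). Proof. by rewrite /sc; case: cid => s []. Qed.
Lemma sc_hd c k x : hd k x -> hd (k - 1) (sc c x).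
Proof. by move: k x; rewrite /sc; case: cid => s []. Qed.
Lemma sc_aug c x : ag (sc c x) = 0.
Proof. by move: x; rewrite /sc; case: cid => s []. Qed.
Lemma scE c x : phi c x = dd (sc c x) + sc c (dd x).
Proof. by move: x; rewrite /sc; case: cid => s []. Qed.

Lemma exists_a0 : exists a : Pc, hd 0 a /\ ag a = (1 : {mpoly int[n]}).
Proof.
have [a ea] := aug_surj P (1 : {mpoly int[n]}).
by exists (pr 0 a); split; [exact: hd_pr | rewrite aug_pr].
Qed.
Definition a0 : Pc := sval (cid exists_a0).
Lemma a0_hd : hd 0 a0. Proof. by rewrite /a0; case: cid => a []. Qed.
Lemma a0_aug : ag a0 = (1 : {mpoly int[n]}). Proof. by rewrite /a0; case: cid => a []. Qed.
Lemma a0_dd : dd a0 = 0.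
Proof. by apply: (@hd_posP n P (0 + 1)) => //; exact: hddd a0_hd. Qed.

Local Notation KL L := (KU (map (addn n) L)).

(** The Koszul generator of strand c goes to the homotopy [sc c]. The homotopies of different
    strands are composed in the order of L; since each of them commutes with all variables, this is
    a chain map without any further coherence between them. *)
Fixpoint alpha (L : seq nat) : KL L -> Pc :=
  if L is c :: L' return KL L -> Pc
  then fun z => alpha (z.1 : KL L') + sc c (alpha (z.2 : KL L'))
  else fun p => @mact (n + n) (dbl n Pc) p a0.

Lemma alpha_lin L : linl (@alpha L : KL L -> dbl n Pc).
Proof.
elim: L => [|c L ih]; first exact: linl_mactV (@smalln_cxof n P).
have sl := lin_dbl n (sc_lin c).
split=> [x y|t j x tj]; first by rewrite /= ih.1 ih.1 sl.1 addrACA.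
rewrite -[LHS]/(alpha (op t j x.1) + sc c (alpha (op t j x.2))) ih.2 // ih.2 // sl.2 //.
exact: esym (@opD (dbl n Pc) t j _ _).
Qed.

Lemma phi_dbl (C : cx) c (x : C) : @op (dbl n C) true (n + c) x = phi c x.
Proof. by rewrite dbl_hi ?leq_addr // addKn. Qed.

Lemma alpha_dd L z : dd (@alpha L z) = alpha (dd z).
Proof.
elim: L z => [|c L ih] z.
  rewrite [RHS](additive_fun0 (alpha_lin [::]).1).
  rewrite -[LHS]/(@dd (dbl n Pc) (@mact (n + n) (dbl n Pc) z a0)) mact_dd.
  by rewrite -[dd a0]/(@dd Pc a0) a0_dd; exact: (additive_fun0 (@mactDr _ (dbl n Pc) z)).
case: z => x y; have aD := (alpha_lin L).1.
rewrite [alpha (dd _)]/= aD (alpha_lin L).2 // phi_dbl scE -!ih.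
rewrite (additive_funN aD) (additive_funN (sc_lin c).1) -[LHS]/(dd (alpha x + sc c (alpha y))) ddD -ih; zlin.
Qed.

Lemma alpha_hd L k z : hd k z -> hd k (@alpha L z).
Proof.
elim: L k z => [|c L ih] k z.
  case=> [->|->]; last by rewrite (additive_fun0 (alpha_lin [::]).1); exact: hd0.
  exact: (@mact_hd _ (dbl n Pc)) a0_hd.
case: z => x y [/ih h1 /ih /(sc_hd c)]; rewrite addr0 addrK => h2; exact: hdD.
Qed.

Lemma alpha_aug L z : ag (@alpha L z) = aK z.
Proof.
elim: L z => [|c L ih] z; last by rewrite /= (lin_aug P).1 sc_aug addr0 ih.
have := @mact_nat (n + n) (dbl n Pc) (dbl n R) ag z a0 (lin_dbl n (lin_aug P)).
by rewrite a0_aug.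
Qed.

(** The augmentation of P, viewed as a map of degree 1 into the augmented Koszul complex,
    anticommutes with the differentials. The Koszul component of a null homotopy of it is precisely
    a chain map compatible with the augmentations. *)
Lemma exists_beta : exists b : Pc -> und n (KL (iota 0 n)), [/\ lin aS b,
  forall k x, hd k x -> hd k (b x), forall x, dd (b x) = b (dd x) & forall x, aK (b x) = ag x].
Proof.
have sA : smalln n (augK n).
  by apply: smalln_augc; [exact: smalln_und | exact: smalln_cxof].
pose u (x : Pc) : augK n := (ag x, 0).
have [||x|s [sl sh se]] := @null_homotopy n P (augK n) sA (@acyclic_augK n) u 1 true.
- split=> [x y|t j x _]; apply: pairE; rewrite /= ?addr0 ?(lin_aug P).1 ?((lin_aug P).2 _ _ _ isT) //.
  exact: esym (additive_fun0 (@opD (und n _) _ _)).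
- move=> k x hx; split; last exact: hd0.
  by case: (aug_hd hx) => [->|h]; [left | right].
- apply: pairE; first by rewrite -[LHS]/(aK (0 : KL _)) (additive_fun0 (linl_aK n _).1) /= (@aug_diff n P) oppr0.
  by rewrite /= (additive_fun0 (@ddD _)) oppr0.
have s1 x : (s x).1 = 0.
  move: x; apply: (@hd_eqf n P R (fun x => (s x).1) (fun=> 0)) => [x y|x y|k x hx].
  - by rewrite sl.1.
  - by rewrite addr0.
  have [] := sh _ _ hx; rewrite addrK => -[k1|//] _.
  have -> : x = 0 by apply: (@hd_posP n P k) hx; rewrite k1.
  exact: (f_equal fst (additive_fun0 sl.1)).
exists (fun x => (s x).2); split.
- by split=> [x y|t j x _]; rewrite ?sl.1 ?sl.2.
- by move=> k x /sh [_]; rewrite addrK.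
- move=> x; have := f_equal snd (se x); rewrite /= => h.
  by apply/eqP; rewrite -subr_eq0; apply/eqP; exact: esym h.
- move=> x; have := f_equal fst (se x); rewrite /= s1 subr0 => h; exact: esym h.
Qed.

Lemma exists_comparison : exists b : Pc -> und n (KL (iota 0 n)), exists s : Pc -> Pc,
  [/\ lin aS b, lin aS s, forall x, dd (b x) = b (dd x) &
    forall x, x - alpha (b x) = dd (s x) + s (dd x)].
Proof.
have [b [bl bh bd ba]] := exists_beta.
have al := lin_und (@smalln_cxof n P) (alpha_lin (iota 0 n)).
have [||x|x|s [sl sh sa se]] := @null_homotopic (fun x => x - alpha (b x)).
- split=> [x y|t j x tj]; first by rewrite bl.1 al.1; zlin.
  by rewrite bl.2 // al.2 //; cxlin (cxof P).
- by move=> k x hx; apply: hdB => //; apply: alpha_hd; exact: bh.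
- by rewrite (additive_funB (@ddD Pc)) alpha_dd bd.
- by rewrite (additive_funB (lin_aug P).1) alpha_aug ba subrr.
by exists b, s.
Qed.

Section Ext.
Variable X : complex n.
Local Notation Xc := (cxof X).

(** The values of f after [alpha] on the exterior basis. In the other direction, [hat] extends such
    a family of values linearly over Z[x, t]. *)
Fixpoint Phi (L : seq nat) (f : Pc -> Xc) : kosT L Xc :=
  if L is c :: L' return kosT L Xc then (Phi L' f, Phi L' (fun x => f (sc c x))) else f a0.

Fixpoint hat (L : seq nat) : kosT L Xc -> KL L -> Xc :=
  if L is c :: L' return kosT L Xc -> KL L -> Xc
  then fun h z => hat h.1 (z.1 : KL L') + hat h.2 (z.2 : KL L')
  else fun h p => @mact (n + n) (dbl n Xc) p h.

Lemma hatD L z : additive_fun (@hat L ^~ z).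
Proof.
elim: L z => [|c L ih] z h h'; first exact: (@mactDr _ (dbl n Xc)).
by rewrite /= !ih addrACA.
Qed.

Lemma hat_lin L h : linl (@hat L h : KL L -> dbl n Xc).
Proof.
elim: L h => [|c L ih] h; first exact: linl_mactV (@smalln_cxof n X).
have h1 := ih h.1; have h2 := ih h.2.
split=> [x y|t j x tj]; first by rewrite /= h1.1 h2.1 addrACA.
rewrite -[LHS]/(hat h.1 (op t j x.1) + hat h.2 (op t j x.2)) h1.2 // h2.2 //.
exact: esym (@opD (dbl n Xc) t j _ _).
Qed.

Lemma hat_nat L (F : Xc -> Xc) h z : lin aS F -> hat (kosm L F h) z = F (@hat L h z).
Proof.
move=> Fl; elim: L h z => [|c L ih] h z; last by rewrite /= !ih Fl.1.
exact: esym (mact_nat _ _ (lin_dbl n Fl)).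
Qed.

Lemma hat_kdel L h z : hat (kdel L h) z = @hat L h (dd z).
Proof.
elim: L h z => [|c L ih] h z.
  rewrite /= (additive_fun0 (@mactDr _ (dbl n Xc) z)).
  exact: esym (additive_fun0 (hat_lin (L := [::]) h).1).
case: h z => h1 h2 [x y]; have [a1 l1] := hat_lin h1; have [a2 _] := hat_lin h2.
rewrite /= ih (additive_funB (hatD y)) ih hat_nat; last exact: phi_lin.
by rewrite a1 l1 // phi_dbl (additive_funN a2); zlin.
Qed.

Lemma hat_Phi L f z : lin aS f -> hat (Phi L f) z = f (alpha z).
Proof.
elim: L f z => [|c L ih] f z fl /=; first exact: esym (mact_nat _ _ (lin_dbl n fl)).
rewrite !ih ?fl.1 //; have := sc_lin c => sl.
by split=> [x y|t j x tj]; rewrite ?sl.1 ?fl.1 ?sl.2 ?fl.2.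
Qed.

Lemma Phi_ext L f g : f =1 g -> Phi L f = Phi L g.
Proof. by move=> h; congr Phi; exact/funext. Qed.

Lemma Phi_nat L (F : Xc -> Xc) f : Phi L (fun x => F (f x)) = kosm L F (Phi L f).
Proof. by elim: L f => [//|c L ih] f /=; rewrite !ih. Qed.

Lemma Phi_sub L f g : Phi L (fun x => f x - g x) = Phi L f - Phi L g.
Proof. by elim: L f g => [//|c L ih] f g /=; rewrite !ih. Qed.

Lemma kdel_Phi L f : lin aS f -> kdel L (Phi L f) = Phi L (fun x => f (dd x)).
Proof.
elim: L f => [|c L ih] f fl; first by rewrite -[RHS]/(f (dd a0)) a0_dd (additive_fun0 fl.1).
have sl := sc_lin c; have fsl : lin aS (fun x => f (sc c x)).
  by split=> [x y|t j x tj]; rewrite ?sl.1 ?fl.1 ?sl.2 ?fl.2.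
rewrite /= !ih // -Phi_nat -Phi_sub; congr pair; apply: Phi_ext => x.
rewrite -[phi c (f x)]/(op true c (f x) - op false c (f x)) -!fl.2 // -(additive_funB fl.1).
by rewrite -[op true c x - _]/(phi c x) scE fl.1 addrK.
Qed.

Lemma Phi_hd L f k : (forall x, hd k (f x)) -> khd L k (Phi L f).
Proof.
elim: L f => [|c L ih] f h; first exact: h.
by split; apply: ih => // x; exact: h.
Qed.

(** Up to a homotopy, f is its restriction along [alpha] and back along b. The restriction is a
    cycle for the Koszul double structure, so [van] provides its primitives, and [hat] carries them
    back to P. *)
Lemma ext_vanish k (f g : Pc -> Xc) : van (iota 0 n) k Xc -> lin aS f -> lin aS g ->
  (forall x, hd k (f x)) -> (forall x, hd (k + 1) (g x)) ->
  (forall x, f (dd x) = 0) -> (forall x, dd (f x) = g (dd x)) ->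
  exists e h : Pc -> Xc, [/\ lin aS e, lin aS h, forall x, e (dd x) = 0 &
    forall x, f x = dd (e x) + h (dd x)].
Proof.
move=> hv fl gl fh gh fd df.
have [b [s [lb sl bd se]]] := exists_comparison.
have hl h := lin_und (@smalln_cxof n X) (@hat_lin (iota 0 n) h).
have [|e0 [h0 [_ _ e1 e2]]] := hv (Phi (iota 0 n) f).
  split; first exact: Phi_hd.
    by rewrite /= kdel_Phi // (_ : (fun x => f (dd x)) = fun x => f x - f x) ?Phi_sub ?subrr //; apply/funext => x; rewrite fd subrr.
  exists (Phi (iota 0 n) g); first exact: Phi_hd.
  by rewrite /= -Phi_nat kdel_Phi //; apply: Phi_ext.
pose e x := hat e0 (b x); pose h x := hat h0 (b x) + f (s x).
have lc (F : und n (KL (iota 0 n)) -> Xc) : lin aS F -> lin aS (fun x => F (b x)).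
  by move=> Fl; split=> [x y|t j x tj]; rewrite ?lb.1 ?Fl.1 ?lb.2 ?Fl.2.
have l1 := lc _ (hl h0); exists e, h; split; first exact: lc.
- by split=> [x y|t j x tj]; rewrite /h; [rewrite l1.1 sl.1 fl.1 addrACA | rewrite l1.2 // sl.2 // fl.2 // opD].
- move=> x; rewrite /e -bd -hat_kdel -[kdel _ e0]/(bl e0) e1.
  exact: (additive_fun0 (hatD (L := iota 0 n) _)).
move=> x; have := f_equal f (se x); rewrite (additive_funB fl.1) fl.1 fd add0r.
rewrite -hat_Phi // e2 (hatD (L := iota 0 n)) hat_nat; last first.
  by split=> [u v|t j u _]; [exact: ddD | rewrite opdd].
by rewrite hat_kdel bd /e /h => h1; zlin h1.
Qed.
End Ext.
End Comparison.

Section Component.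
Variables (n : nat) (P : projective_resolution n) (X : complex n).
Local Notation Pc := (cxof P).
Local Notation Xc := (cxof X).

(* The part of a bimodule map P -> X which is a cochain of tridegree (i, j, k). *)
Definition cmp (i j k : int) (e : P -> X) (x : P) : X :=
  gsum (gr P) (fun g v => if g.2 == - j then gr X (g.1 + i, k) (e v) else 0) x.

Section Cmp.
Variables (i j k : int) (e : P -> X).
Hypothesis el : lin aS (e : Pc -> Xc).

Let F0 g : (if (g : int * int).2 == - j then gr X (g.1 + i, k) (e 0) else 0) = 0.
Proof. by rewrite (additive_fun0 el.1) Defs.comp0 if_same. Qed.

Lemma cmpD : additive_fun (cmp i j k e).
Proof.
apply: gsumD => g; first exact: F0.
by move=> x y; case: ifP => _; rewrite ?addr0 // el.1 compD.
Qed.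

Lemma cmp_gr g x : cmp i j k e (gr P g x) =
  if g.2 == - j then gr X (g.1 + i, k) (e (gr P g x)) else 0.
Proof. exact: (@gsum_homog _ _ (gr P) _ (fun g v => if g.2 == - j then gr X (g.1 + i, k) (e v) else 0) F0). Qed.

Lemma cmp_lin : lin aS (cmp i j k e : Pc -> Xc).
Proof.
split=> [|t c x _]; first exact: cmpD.
have o0 (Y : complex n) : @op (cxof Y) t c 0 = 0 := additive_fun0 (@opD (cxof Y) t c).
move: x; apply: (@homog_eqf n P X (fun x => cmp i j k e (@op Pc t c x))
  (fun x => @op Xc t c (cmp i j k e x))) => [x y|x y|g x].
- by rewrite (@opD Pc) cmpD.
- by rewrite cmpD (@opD Xc).
case: (ltnP c n) => cn; last by rewrite !cop_big // (additive_fun0 cmpD).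
have Xh : ('X_(Ordinal cn) : Rn n) \is 1.-homog by rewrite dhomogX /= mdeg1.
rewrite -[c]/(val (Ordinal cn)); have eX := el.2 t (Ordinal cn) (gr P g x) isT.
have sh : ((g + bidelta *+ 1).1 + i, k) = (g.1 + i, k) + bidelta *+ 1.
  by congr pair; rewrite /= ?addr0 // addrAC.
case: t eX o0 => eX _.
  rewrite !copT in eX *; rewrite -(gr_lact _ _ Xh) cmp_gr cmp_gr (gr_lact _ _ Xh) eX.
  rewrite [(g + _).2]/= addr0 sh; case: ifP => _; first exact: gr_lact.
  exact: esym (additive_fun0 (lactDr _)).
rewrite !copF in eX *; rewrite -(gr_ract _ _ Xh) cmp_gr cmp_gr (gr_ract _ _ Xh) eX.
rewrite [(g + _).2]/= addr0 sh; case: ifP => _; first exact: gr_ract.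
exact: esym (additive_fun0 (@ractDl _ X _)).
Qed.

Lemma cmp_cochain : is_cochain i j k (cmp i j k e).
Proof.
split; first exact: (linl_bimap _).1 cmp_lin.
- by move=> a l x <- lj; rewrite cmp_gr ifN //; apply/eqP.
- by move=> a x <-; rewrite /homog_of cmp_gr eqxx compK eqxx.
Qed.
End Cmp.

Lemma cmp_id i j k (f : cochain P X i j k) : cmp i j k (sval f) =1 sval f.
Proof.
have [fb f0 fh] := svalP f; have fl := (linl_bimap _).2 fb.
apply: homog_eqf => [||g x]; [exact: cmpD | exact: fl.1 |].
rewrite cmp_gr //; case: eqP => [gj|gj]; last first.
  by rewrite (f0 g.1 g.2) //; case: g {gj} => a l; rewrite /homog_of compK eqxx.
by apply: fh; rewrite -gj /homog_of; case: g {gj} => a l; rewrite compK eqxx.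
Qed.

Lemma cmp_post i j k k' e : k' = k + 1 -> lin aS (e : Pc -> Xc) ->
  cmp i j k' (fun x => diff (e x)) =1 fun x => diff (cmp i j k e x).
Proof.
move=> -> el; have dl : lin aS ((fun x => diff (e x)) : Pc -> Xc).
  split=> [x y|t c x tc]; first by rewrite el.1 diffD.
  by rewrite el.2 //; exact: esym (@opdd Xc t c _).
apply: homog_eqf => [||g x]; first exact: cmpD.
  by move=> x y; rewrite (cmpD _ _ _ el) diffD.
rewrite !cmp_gr //; case: ifP => _; last exact: esym (additive_fun0 (@diffD n X)).
by rewrite -diff_deg; congr (gr X _ _); congr pair; rewrite /= addr0.
Qed.

Lemma cmp_pre i j j' k e : j' = j + 1 -> lin aS (e : Pc -> Xc) ->
  cmp i j' k (fun x => e (diff x)) =1 fun x => cmp i j k e (diff x).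
Proof.
move=> -> el; have dl : lin aS ((fun x => e (diff x)) : Pc -> Xc).
  split=> [x y|t c x tc]; first by rewrite diffD el.1.
  by rewrite -el.2 //; congr e; exact: esym (@opdd Pc t c _).
apply: homog_eqf => [||g x]; first exact: cmpD.
  by move=> x y; rewrite diffD (cmpD _ _ _ el).
rewrite cmp_gr // -(diff_deg g x) cmp_gr // diff_deg /= addr0.
by rewrite opprD -[_ == - j](inj_eq (addIr (-1))) addrK.
Qed.

Lemma cmp_add i j k e h x :
  cmp i j k (fun x => e x + h x) x = cmp i j k e x + cmp i j k h x.
Proof.
rewrite /cmp /gsum -big_split; apply: eq_bigr => g _.
by case: ifP => _; [exact: Defs.compD | exact: esym (addr0 _)].
Qed.

Lemma cmp0 i j k e : (forall x, e x = 0) -> forall x, cmp i j k e x = 0.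
Proof.
move=> e0; have el : lin aS (e : Pc -> Xc).
  split=> [x y|t c x _]; rewrite !e0 ?addr0 //; exact: esym (additive_fun0 (@opD Xc t c)).
apply: homog_eqf => [|x y|g x]; [exact: cmpD | by rewrite addr0 |].
by rewrite cmp_gr // e0 Defs.comp0 if_same.
Qed.

Lemma cochain_hd i j k (f : cochain P X i j k) x : @hd Xc k (sval f x).
Proof.
rewrite -(cmp_id f); have [/linl_bimap fl _ _] := svalP f; move: x.
apply: homog_eqf => [x y|x y|g x]; rewrite ?(cmpD _ _ _ fl) ?prD //.
rewrite cmp_gr //; case: ifP => _; last exact: additive_fun0 (prD k).
exact: (@hd_gr n X (g.1 + i, k)).
Qed.

Lemma HHH_van i j k : van (iota 0 n) k Xc -> forall c : HHH P X i j k, c = 0.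
Proof.
move=> hv; elim/quot_ind => -[c0]; elim/quot_ind: c0 => f hf; apply/clsE.
have [fb _ _] := svalP (sval f); have fl := (linl_bimap _).2 fb.
have fd x : sval (sval f) (diff x) = 0.
  by have := f_equal (fun h => sval h x) (svalP f).
have := hf; rewrite {1}HH_diffE => /clsE[g]; rewrite subr0 => eg.
have [/linl_bimap gl _ _] := svalP g.
have df x : diff (sval (sval f) x) = sval g (diff x).
  exact: (f_equal (fun h => sval h x) eg).
have [e [h [el hl ed ef]]] := ext_vanish hv fl gl (cochain_hd (sval f)) (cochain_hd g) fd df.
(* The primitives e and h need not be homogeneous. Their components of the right tridegrees satisfy
   the same equations, since taking components commutes with both differentials and fixes f. *)
pose e' : cochain P X i j (k - 1) := exist _ _ (cmp_cochain i j (k - 1) el).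
pose h' : cochain P X i (j - 1) k := exist _ _ (cmp_cochain i (j - 1) k hl).
have ce : coboundary (erefl (j + 1)) e' = 0.
  by apply: cochain_eq => x /=; rewrite -(cmp_pre i (k - 1) erefl el) cmp0.
exists (cls (exist _ e' ce : homology_setoid (coboundaryD _) (coboundaryD _))).
rewrite subr0 HH_diffE; apply/clsE; exists h'; apply: cochain_eq => x.
change (sval (sval f) x - diff (cmp i j (k - 1) e x) = cmp i (j - 1) k h (diff x)).
have ej : j = j - 1 + 1 by rewrite subrK.
have ek : k = k - 1 + 1 by rewrite subrK.
rewrite -(cmp_post i j ek el) -(cmp_pre i k ej hl) -cmp_id.
have -> : cmp i j k (sval (sval f)) x = cmp i j k (fun x => diff (e x) + h (diff x)) x.
  by congr cmp; apply/funext.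
by rewrite (cmp_add i j k (fun x => diff (e x)) (fun x => h (diff x))); zlin.
Qed.
End Component.

(** * Rouquier complexes in coordinates *)

Section Crossing.
Variables (n : nat) (i : 'I_n.-1).
Local Notation xa := (Ordinal (sgen_subproof0 i)).
Local Notation xb := (Ordinal (sgen_subproof1 i)).
Local Notation inv := (invariants i).
Implicit Types p q : {mpoly int[n]}.

Lemma sgen_X (j : 'I_n) : msym (sgen i) 'X_j = 'X_(sgen i j) :> {mpoly int[n]}.
Proof.
rewrite msymX; congr 'X_[_]; apply/mnmP => k.
by rewrite mnmE !mnm1E -(inj_eq (@perm_inj _ (sgen i)) j) permKV.
Qed.

Lemma inv1 : inv (1 : {mpoly int[n]}). Proof. exact: rmorph1. Qed.
Lemma inv0 : inv (0 : {mpoly int[n]}). Proof. exact: rmorph0. Qed.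
Lemma invD p q : inv p -> inv q -> inv (p + q).
Proof. by rewrite /invariants rmorphD /= => -> ->. Qed.
Lemma invN p : inv p -> inv (- p).
Proof. by rewrite /invariants rmorphN /= => ->. Qed.
Lemma invB p q : inv p -> inv q -> inv (p - q).
Proof. by move=> hp /invN; exact: invD. Qed.
Lemma invM p q : inv p -> inv q -> inv (p * q).
Proof. by rewrite /invariants rmorphM /= => -> ->. Qed.
Lemma invX (j : 'I_n) : j != xa -> j != xb -> inv ('X_j : {mpoly int[n]}).
Proof. by move=> ja jb; rewrite /invariants sgen_X tpermD // eq_sym. Qed.
Lemma inv_add : inv ('X_xa + 'X_xb : {mpoly int[n]}).
Proof. by rewrite /invariants rmorphD /= !sgen_X tpermL tpermR addrC. Qed.
Lemma inv_mul : inv ('X_xa * 'X_xb : {mpoly int[n]}).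
Proof. by rewrite /invariants rmorphM /= !sgen_X tpermL tpermR mulrC. Qed.

Lemma xab : xa != xb.
Proof. by rewrite -val_eqE /= neq_ltn ltnSn. Qed.

Lemma dec_exists p : exists q : {mpoly int[n]} * {mpoly int[n]},
  [/\ inv q.1, inv q.2 & p = q.1 + 'X_xa * q.2].
Proof.
move: p; apply: mpoly_ops.
- by exists (0, 0); split; rewrite ?mulr0 ?addr0 //; exact: inv0.
- move=> p q [[p0 p1] [h0 h1 ->]] [[q0 q1] [k0 k1 ->]]; exists (p0 - q0, p1 - q1).
  by split; [exact: invB | exact: invB | rewrite /=; ring].
- by exists (1, 0); split; rewrite ?mulr0 ?addr0 //; [exact: inv1 | exact: inv0].
move=> j p [[p0 p1] [h0 h1 ->]].
have [->|ja] := eqVneq j xa.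
  exists (- ('X_xa * 'X_xb * p1), p0 + ('X_xa + 'X_xb) * p1); split=> /=; last by ring.
  - by apply/invN/invM => //; exact: inv_mul.
  - by apply: invD => //; apply: invM => //; exact: inv_add.
have [->|jb] := eqVneq j xb.
  exists (('X_xa + 'X_xb) * p0 + 'X_xa * 'X_xb * p1, - p0); split=> /=; last by ring.
  - apply: invD; apply: invM => //; [exact: inv_add | exact: inv_mul].
  - exact: invN.
exists ('X_j * p0, 'X_j * p1); split=> /=; last by ring.
- by apply: invM => //; exact: invX.
- by apply: invM => //; exact: invX.
Qed.

(** Comparing the equation with its image under the transposition gives (x_a - x_b)(p1 - q1) = 0,
    and the polynomial ring is a domain. *)
Lemma dec_unique p0 p1 q0 q1 : inv p0 -> inv p1 -> inv q0 -> inv q1 ->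
  p0 + 'X_xa * p1 = q0 + 'X_xa * q1 -> p0 = q0 /\ p1 = q1.
Proof.
move=> hp0 hp1 hq0 hq1 e.
have := f_equal (msym (sgen i)) e; rewrite !rmorphD !rmorphM /= !sgen_X tpermL.
rewrite hp0 hp1 hq0 hq1 => e'.
have h : ('X_xa - 'X_xb) * (p1 - q1) = 0.
  have -> : ('X_xa - 'X_xb) * (p1 - q1) = (p0 + 'X_xa * p1) - (p0 + 'X_xb * p1)
    - (q0 + 'X_xa * q1) + (q0 + 'X_xb * q1) by ring.
  by rewrite e e'; ring.
move/eqP: h; rewrite mulf_eq0 subr_eq0 => /orP[/eqP h|/eqP h].
  have := f_equal (fun p => p@_U_(xa)) h; rewrite !mcoeffX eqxx.
  case: eqP => // /mnmP /(_ xa); rewrite !mnm1E eqxx eq_sym (negPf xab) //.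
have e1 : p1 = q1 by apply/eqP; rewrite -subr_eq0 h.
by split=> //; move: e; rewrite e1 => /addIr.
Qed.

Definition p0 p := (sval (cid (dec_exists p))).1.
Definition p1 p := (sval (cid (dec_exists p))).2.

Lemma inv_p0 p : inv (p0 p). Proof. by rewrite /p0; case: cid => q []. Qed.
Lemma inv_p1 p : inv (p1 p). Proof. by rewrite /p1; case: cid => q []. Qed.
Lemma decE p : p = p0 p + 'X_xa * p1 p. Proof. by rewrite /p0 /p1; case: cid => q []. Qed.

Lemma decP p q0 q1 : inv q0 -> inv q1 -> p = q0 + 'X_xa * q1 -> p0 p = q0 /\ p1 p = q1.
Proof.
by move=> h0 h1 e; apply: dec_unique => //; [exact: inv_p0 | exact: inv_p1 | rewrite -decE].
Qed.

Lemma decD p q : p0 (p + q) = p0 p + p0 q /\ p1 (p + q) = p1 p + p1 q.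
Proof.
apply: decP; [apply: invD; exact: inv_p0 | apply: invD; exact: inv_p1 |].
by rewrite {1}[p]decE {1}[q]decE; ring.
Qed.

Lemma decM c p : inv c -> p0 (p * c) = p0 p * c /\ p1 (p * c) = p1 p * c.
Proof.
move=> hc; apply: decP; [exact: invM (inv_p0 p) hc | exact: invM (inv_p1 p) hc |].
by rewrite {1}[p]decE; ring.
Qed.

Lemma dec_xa p : p0 ('X_xa * p) = - ('X_xa * 'X_xb * p1 p) /\
  p1 ('X_xa * p) = p0 p + ('X_xa + 'X_xb) * p1 p.
Proof.
apply: decP; last by rewrite {1}[p]decE; ring.
- by apply/invN/invM; [exact: inv_mul | exact: inv_p1].
- by apply: invD; [exact: inv_p0 | apply: invM; [exact: inv_add | exact: inv_p1]].
Qed.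

Lemma dec_xb p : p0 ('X_xb * p) = ('X_xa + 'X_xb) * p0 p + 'X_xa * 'X_xb * p1 p /\
  p1 ('X_xb * p) = - p0 p.
Proof.
apply: decP; last by rewrite {1}[p]decE; ring.
- by apply: invD; apply: invM; try exact: inv_p0; try exact: inv_p1; [exact: inv_add | exact: inv_mul].
- by apply: invN; exact: inv_p0.
Qed.

Lemma dec_x (j : 'I_n) p : j != xa -> j != xb ->
  p0 ('X_j * p) = 'X_j * p0 p /\ p1 ('X_j * p) = 'X_j * p1 p.
Proof.
move=> ja jb; have [h0 h1] := decM p (invX ja jb); rewrite [_ * p]mulrC h0 h1.
by split; exact: mulrC.
Qed.
End Crossing.

Section Coordinates.
Variables (n : nat) (i : 'I_n.-1).
Local Notation xa := (Ordinal (sgen_subproof0 i)).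
Local Notation xb := (Ordinal (sgen_subproof1 i)).
Local Notation Bt := (tens_bimod (invariants i) (reg n) (reg n)).

Definition pk (k : bool) (p : {mpoly int[n]}) := if k then p1 i p else p0 i p.
Definition coo (k : bool) : Bt -> {mpoly int[n]} :=
  tlift (fun f g : reg n => pk k f * (g : {mpoly int[n]})).

Lemma pkD k p q : pk k (p + q) = pk k p + pk k q.
Proof. by have [h0 h1] := decD i p q; case: k. Qed.

Lemma coo_balanced k : balanced (invariants i)
  (fun f g : reg n => pk k f * (g : {mpoly int[n]}) : {mpoly int[n]}).
Proof.
split=> [y x x'|x y y'|a x y ha]; first by rewrite pkD mulrDl.
  by rewrite mulrDr.
have [h0 h1] := decM x ha; rewrite -[ract x a]/((x : {mpoly int[n]}) * a).
by rewrite -[lact a y]/(a * (y : {mpoly int[n]})) mulrA; case: k; rewrite /pk ?h0 ?h1.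
Qed.

Lemma cooE k f g : coo k (@tprod _ _ (reg n) (reg n) f g) = pk k f * (g : {mpoly int[n]}).
Proof. exact: (tlift_tprod (coo_balanced k)). Qed.
Lemma cooD k : additive_fun (coo k).
Proof. exact: (tlift_additive (coo_balanced k)). Qed.

Lemma lactE (c : Rn n) (f g : reg n) :
  @lact _ Bt c (tprod f g) = @tprod _ _ (reg n) (reg n) (c * (f : {mpoly int[n]})) g.
Proof. exact: tens_lactE. Qed.
Lemma ractE (c : Rn n) (f g : reg n) :
  @ract _ Bt (tprod f g) c = @tprod _ _ (reg n) (reg n) f ((g : {mpoly int[n]}) * c).
Proof. exact: tens_ractE. Qed.

Lemma coo_ract k b c : coo k (@ract _ Bt b c) = coo k b * c.
Proof.
move: b; apply: tens_eqf => [x y|x y|f g].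
- by rewrite (@ractDl _ Bt c x y) cooD.
- by rewrite cooD mulrDl.
- by rewrite ractE !cooE mulrA.
Qed.

Lemma coo_xa b : coo false (@lact _ Bt ('X_xa : Rn n) b) = - ('X_xa * 'X_xb * coo true b) /\
  coo true (@lact _ Bt ('X_xa : Rn n) b) = coo false b + ('X_xa + 'X_xb) * coo true b.
Proof.
split; move: b; apply: tens_eqf => [x y|x y|f g]; rewrite ?(@lactDr _ Bt) ?cooD ?mulrDr ?opprD //.
- by rewrite lactE !cooE /pk (dec_xa i f).1; ring.
- by ring.
- by rewrite lactE !cooE /pk (dec_xa i f).2; ring.
Qed.

Lemma coo_xb b : coo false (@lact _ Bt ('X_xb : Rn n) b) =
    ('X_xa + 'X_xb) * coo false b + 'X_xa * 'X_xb * coo true b /\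
  coo true (@lact _ Bt ('X_xb : Rn n) b) = - coo false b.
Proof.
split; move: b; apply: tens_eqf => [x y|x y|f g]; rewrite ?(@lactDr _ Bt) ?cooD ?mulrDr ?opprD //.
- by ring.
- by rewrite lactE !cooE /pk (dec_xb i f).1; ring.
- by rewrite lactE !cooE /pk (dec_xb i f).2; ring.
Qed.

Lemma coo_x (j : 'I_n) k b : j != xa -> j != xb ->
  coo k (@lact _ Bt ('X_j : Rn n) b) = 'X_j * coo k b.
Proof.
move=> ja jb; move: b; apply: tens_eqf => [x y|x y|f g]; rewrite ?(@lactDr _ Bt) ?cooD ?mulrDr //.
by rewrite lactE !cooE /pk; have [h0 h1] := dec_x f ja jb; case: k; rewrite ?h0 ?h1; ring.
Qed.

Lemma Bmul_coo (b : Bt) : @Bmul n i b = coo false b + 'X_xa * coo true b :> {mpoly int[n]}.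
Proof.
move: b; apply: tens_eqf => [x y|x y|f g].
- exact: BmulD.
- by rewrite !cooD; ring.
- rewrite !cooE /pk -[LHS]/(@Bmul n i (tprod f g)) BmulE {1}[f](@decE n i) /=; ring.
Qed.

Definition u1 : Bt := @tprod _ _ (reg n) (reg n) (1 : {mpoly int[n]}) (1 : {mpoly int[n]}).
Definition u2 : Bt := @tprod _ _ (reg n) (reg n) ('X_xa : {mpoly int[n]}) (1 : {mpoly int[n]}).

Lemma inv_u (c f : {mpoly int[n]}) : invariants i c ->
  @tprod _ (invariants i) (reg n) (reg n) (c * f) (1 : {mpoly int[n]}) =
  @ract _ Bt (@tprod _ _ (reg n) (reg n) f (1 : {mpoly int[n]})) c.
Proof.
move=> hc; rewrite ractE mul1r.
have := @tprodA _ (invariants i) (reg n) (reg n) c f (1 : {mpoly int[n]}) hc.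
by rewrite -[ract _ c]/(f * c) -[lact c _]/(c * 1) mulr1 mulrC.
Qed.

Lemma coo_decomp b : b = @ract _ Bt u1 (coo false b) + @ract _ Bt u2 (coo true b).
Proof.
move: b; apply: tens_eqf => [x y|x y|f g]; first by [].
  rewrite !cooD !(@ractDr _ Bt); zlin.
rewrite !cooE /u1 /u2 !ractE !mul1r.
have h c d : invariants i c -> @tprod _ (invariants i) (reg n) (reg n) d (c * (g : {mpoly int[n]})) =
    @tprod _ _ (reg n) (reg n) (d * c) g.
  by move=> hc; exact: esym (@tprodA _ (invariants i) (reg n) (reg n) c d g hc).
rewrite !h; [|exact: inv_p1|exact: inv_p0].
by rewrite -tprodDl; congr tprod; rewrite mul1r -decE.
Qed.
End Coordinates.

Lemma hd_lact n (X : complex n) k (p : Rn n) (x : X) : @hd (cxof X) k x -> @hd (cxof X) k (lact p x).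
Proof.
move=> hx; move: p; apply: mpoly_ops.
- rewrite (additive_fun0 (fun a b => lactDl a b x)); exact: hd0.
- move=> p q hp hq; rewrite (additive_funB (fun a b => lactDl a b x)); exact: (@hdB (cxof X)).
- by rewrite lact1.
- by move=> j p hp; rewrite lactM -copT; exact: (@hdop (cxof X)).
Qed.

Section CTensorDegree.
Variables (n : nat) (Y X : complex n).
Local Notation T := (ctensor Y X).

Lemma gr_tprod g h (y : Y) (x : X) :
  gr T (g + h) (tprod (gr Y g y) (gr X h x)) = tprod (gr Y g y) (gr X h x).
Proof. by have := @tens_comp_homog _ _ _ _ (@all_of_graded n) Y X (g + h) g h y x; rewrite eqxx. Qed.

Lemma pr_tprod m g h (y : Y) (x : X) : pr m (tprod (gr Y g y) (gr X h x) : T) =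
  if (g + h).2 == m then tprod (gr Y g y) (gr X h x) else 0.
Proof. by rewrite -gr_tprod pr_homog. Qed.

Lemma tprod_hd l k (y : Y) (x : X) : @hd (cxof Y) l y -> @hd (cxof X) k x ->
  @hd (cxof T) (l + k) (tprod y x : T).
Proof.
move=> <- <-; rewrite (suppE (gr X) x) (additive_fun_sum (prD k)).
rewrite (additive_fun_sum (tprodDr _ _)); apply: big_ind; first exact: hd0.
  by move=> *; exact: (@hdD (cxof T)).
move=> h _; rewrite pr_homog; case: eqP => [hk|_]; last first.
  by rewrite (additive_fun0 (tprodDr _ _)); exact: (@hd0 (cxof T)).
rewrite (suppE (gr Y) y) (additive_fun_sum (prD l)).
rewrite (additive_fun_sum (tprodDl _ _)); apply: big_ind; first exact: hd0.
  by move=> *; exact: (@hdD (cxof T)).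
move=> g _; rewrite pr_homog; case: eqP => [gl|_]; last first.
  by rewrite (additive_fun0 (tprodDl _ _)); exact: (@hd0 (cxof T)).
by rewrite /= pr_tprod /= gl hk eqxx.
Qed.

(* Additive maps respecting degrees on products of homogeneous elements. *)
Lemma hd_tens (D : cx) (f : T -> D) : additive_fun f ->
  (forall g h y x, hd (g.2 + h.2) (f (tprod (gr Y g y) (gr X h x)))) ->
  forall k z, @hd (cxof T) k z -> hd k (f z).
Proof.
move=> fD fh k z <-; have pD := @prD n T k.
elim/tens_ind: z => [|p q hp hq|y x].
- by rewrite (additive_fun0 pD) (additive_fun0 fD); exact: hd0.
- by rewrite pD fD; exact: hdD.
rewrite (suppE (gr Y) y) (additive_fun_sum (tprodDl _ x)) (additive_fun_sum pD) (additive_fun_sum fD).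
apply: big_ind => [||g _]; [exact: hd0 | by move=> *; exact: hdD |].
rewrite (suppE (gr X) x) (additive_fun_sum (tprodDr _ _)) (additive_fun_sum pD) (additive_fun_sum fD).
apply: big_ind => [||h _]; [exact: hd0 | by move=> *; exact: hdD |].
rewrite pr_tprod; case: eqP => [<-|_]; first exact: fh.
by rewrite (additive_fun0 fD); exact: hd0.
Qed.
End CTensorDegree.

Section Crossing.
Variables (n : nat) (i : 'I_n.-1) (X : complex n).
Local Notation xa := (Ordinal (sgen_subproof0 i)).
Local Notation xb := (Ordinal (sgen_subproof1 i)).
Local Notation F := (rouquier_gen i).
Local Notation Xc := (cxof X).
Local Notation T := (ctensor F X).
Local Notation TX := (tT i i.+1 Xc).

Definition cross (y : F) (x : X) : TX :=
  (lact (y.2 : Rn n) x, (lact (coo false y.1 : Rn n) x, lact (coo true y.1 : Rn n) x)).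

Lemma cross_balanced : balanced (@all_of n) cross.
Proof.
split=> [x y y'|y x x'|a y x _].
- apply: pairE; last apply: pairE; rewrite /= ?cooD; exact: lactDl.
- by apply: pairE; last apply: pairE; exact: lactDr.
apply: pairE; last apply: pairE; rewrite /= -lactM //; congr lact; exact: coo_ract.
Qed.

Lemma ksign_gen (y : F) : ksign y = (- y.1, y.2) :> F.
Proof.
move: y; apply: homog_eqf => [x y|x y|g y]; first exact: ksignD.
  by apply: pairE => //=; rewrite opprD.
rewrite ksign_homog /ksign_term.
case: y => b r; rewrite [gr F g (b, r)]/= /two_term_comp /=.
case: eqP => [g1|g1]; case: eqP => [g0|g0].
- by rewrite g1 in g0.
- by rewrite g1 /=; apply: pairE; rewrite //= oppr0.
- by rewrite g0 /=; apply: pairE; rewrite //= oppr0.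
- by case: ifP => _; apply: pairE; rewrite //= oppr0.
Qed.

Definition crossT : T -> TX := tlift cross.
Lemma crossE y x : crossT (tprod y x) = cross y x.
Proof. exact: (tlift_tprod cross_balanced). Qed.
Lemma crossD : additive_fun crossT.
Proof. exact: (tlift_additive cross_balanced). Qed.

Lemma lactA (p q : Rn n) (x : X) : lact p (lact q x) = lact (p * q) x.
Proof. by rewrite lactM. Qed.

Lemma TX_op t j (w : TX) :
  @op TX t j w = (op t j w.1, bB_op i i.+1 t j (w.2 : Xc * Xc)).
Proof. by []. Qed.

Lemma bB_op_other t j (w : Xc * Xc) : ~~ t || (j != i :> nat) && (j != i.+1)%N ->
  bB_op i i.+1 t j w = (op t j w.1, op t j w.2).
Proof. by rewrite /bB_op; case: t => //= /andP[/negPf -> /negPf ->]. Qed.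

Lemma bB_op_a (u v : Xc) : bB_op i i.+1 true (val xa) (u, v) =
  (- op true (val xa) (op true (val xb) v), u + op true (val xa) v + op true (val xb) v).
Proof. by rewrite /bB_op /= eqxx. Qed.
Lemma bB_op_b (u v : Xc) : bB_op i i.+1 true (val xb) (u, v) =
  (op true (val xa) u + op true (val xb) u + op true (val xa) (op true (val xb) v), - u).
Proof. by rewrite /bB_op /= eqxx ifN //; apply/eqP; clear; lia. Qed.

Lemma cross_op t j (z : T) : crossT (@op (cxof T) t j z) = @op TX t j (crossT z).
Proof.
have ib := sgen_subproof1 i; case: (ltnP j n) => jn; last first.
  rewrite cop_big // (additive_fun0 crossD) TX_op bB_op_other; last by apply/orP; right; lia.
  by apply: pairE; last apply: pairE; apply: esym; exact: cop_big.
rewrite -[j]/(val (Ordinal jn)); set c := Ordinal jn.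
case: t; last first.
  rewrite copF; move: z; apply: tens_eqf => [x y|x y|y x].
  - by rewrite (@ractDl _ T _ x y) crossD.
  - by rewrite crossD (@opD TX).
  rewrite ctensor_ractE !crossE /cross TX_op bB_op_other //.
  have h p : lact p (ract x ('X_c : Rn n)) = @op Xc false (val c) (lact p x) by rewrite copF lract.
  by apply: pairE; last apply: pairE; exact: h.
rewrite copT; move: z; apply: tens_eqf => [x y|x y|y x].
- by rewrite (@lactDr _ T) crossD.
- by rewrite crossD (@opD TX).
rewrite ctensor_lactE !crossE /cross TX_op.
apply: pairE; first by rewrite copT /= lactA.
have op_lact s (p : {mpoly int[n]}) : @op Xc true (val s) (lact (p : Rn n) x) = lact ('X_s * p : Rn n) x.
  by rewrite copT lactA.
have lB (p q : Rn n) := @lactDl _ X p q x.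
have lN (p : Rn n) : lact (- p) x = - lact p x := additive_funN (fun a b => lactDl a b x) p.
case: (eqVneq c xa) => [->|ca].
  have [e0 e1] := coo_xa y.1.
  apply: etrans (esym (bB_op_a (lact (coo false y.1) x) (lact (coo true y.1) x))).
  rewrite !op_lact -!lB -lN; apply: pairE; congr lact.
    by apply: etrans e0 _; ring.
  by apply: etrans e1 _; ring.
case: (eqVneq c xb) => [->|cb].
  have [e0 e1] := coo_xb y.1.
  apply: etrans (esym (bB_op_b (lact (coo false y.1) x) (lact (coo true y.1) x))).
  rewrite !op_lact -!lB -lN; apply: pairE; congr lact.
    by apply: etrans e0 _; ring.
  exact: e1.
rewrite [X in _ = (_, X).2]bB_op_other; last by rewrite -!val_eqE /= in ca cb *; rewrite ca cb.
by apply: pairE; rewrite [RHS]op_lact; congr lact; exact: coo_x.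
Qed.

Lemma cross_dd (z : T) : crossT (diff z) = @dd TX (crossT z).
Proof.
move: z; apply: tens_eqf => [x y|x y|y x].
- by rewrite diffD crossD.
- by rewrite crossD (@ddD TX).
have [_ dl _] := diff_bimap X.
rewrite [diff _]ctensor_diffE crossD !crossE /cross ksign_gen.
have lN (p : Rn n) x : lact (- p) x = - @lact _ X p x := additive_funN (fun a b => lactDl a b x) p.
apply: pairE; last apply: pairE; rewrite /= ?dl.
- rewrite [RHS]addrC; congr (_ + _).
  rewrite -[cop true i _]/(@op Xc true (val xa) _) copT lactA -lactDl; congr lact; exact: Bmul_coo.
- rewrite (additive_fun0 (@cooD n i false)) (additive_funN (@cooD n i false)) lN.
  by rewrite (additive_fun0 (fun a b => lactDl a b x)) add0r.
- rewrite (additive_fun0 (@cooD n i true)) (additive_funN (@cooD n i true)) lN.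
  by rewrite (additive_fun0 (fun a b => lactDl a b x)) add0r.
Qed.

Lemma cross_hd k (z : T) : @hd (cxof T) k z -> @hd TX k (crossT z).
Proof.
apply: (@hd_tens n F X TX) => [|g h y x]; first exact: crossD.
rewrite crossE /cross; case: y => b r.
have hx : @hd Xc h.2 (gr X h x) := @hd_gr n X h x.
rewrite [gr F g (b, r)]/= /two_term_comp /=.
have z0 : lact (0 : Rn n) (gr X h x) = 0 := additive_fun0 (fun a b => lactDl a b _).
have hl k' p : k' = h.2 -> @hd Xc k' (lact p (gr X h x)) by move=> ->; exact: hd_lact.
case: (eqVneq g.2 (-1)) => [g1|g1].
  rewrite g1 /= z0; split; first exact: (@hd0 Xc).
  by split; apply: hl; rewrite addr0 addrAC addNr add0r.
rewrite !(additive_fun0 (cooD _)) z0; case: (eqVneq g.2 0) => [g0|g0].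
  by split; [apply: hl; rewrite g0 add0r | split; exact: (@hd0 Xc)].
by rewrite z0; split; [exact: (@hd0 Xc) | split; exact: (@hd0 Xc)].
Qed.

Program Definition crossm : cmor 0 (cxof T) TX := @Cmor 0 (cxof T) TX crossT crossD cross_op cross_dd _.
Next Obligation. by move=> k z; rewrite addr0; exact: cross_hd. Qed.
End Crossing.

Lemma addr_swap3 (M : zmodType) (a a' b b' c c' : M) :
  a + a' + (b + b') + (c + c') = a + b + c + (a' + b' + c').
Proof. by zlin. Qed.
Lemma addr_cone (M : zmodType) (a b c b' c' : M) :
  a + (b + c) - b' - c' = a + (b - b') + (c - c').
Proof. by zlin. Qed.

Section Inverse.
Variables (n : nat) (i : 'I_n.-1) (X : complex n).
Local Notation xa := (Ordinal (sgen_subproof0 i)).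
Local Notation xb := (Ordinal (sgen_subproof1 i)).
Local Notation F := (rouquier_gen i).
Local Notation Xc := (cxof X).
Local Notation T := (ctensor F X).
Local Notation TX := (tT i i.+1 Xc).
Local Notation Bt := (tens_bimod (invariants i) (reg n) (reg n)).

Definition e0 (r : {mpoly int[n]}) : F := (0 : Bt, r).
Definition e1 (b : Bt) : F := (b, 0 : {mpoly int[n]}).

Lemma e0_hd r : @hd (cxof F) 0 (e0 r).
Proof.
suff h (y : F) : pr 0 (e0 y.2) = e0 y.2 by exact: (h (e0 r)).
move: y; apply: homog_eqf => [x y|x y|g y].
- by rewrite -(prD 0); congr pr; apply: pairE; rewrite //= addr0.
- by apply: pairE; rewrite //= addr0.
have [g0|g0] := eqVneq g.2 0.
  have -> : e0 (gr F g y).2 = gr F g (e0 y.2).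
    by apply: pairE; rewrite /= ?g0 //= if_same.
  by rewrite pr_homog g0.
have -> : e0 (gr F g y).2 = 0 by apply: pairE; rewrite //= (negPf g0).
exact: additive_fun0 (prD 0).
Qed.

Lemma e1_hd b : @hd (cxof F) (-1) (e1 b).
Proof.
suff h (y : F) : pr (-1) (e1 y.1) = e1 y.1 by exact: (h (e1 b)).
move: y; apply: homog_eqf => [x y|x y|g y].
- by rewrite -(prD (-1)); congr pr; apply: pairE; rewrite //= addr0.
- by apply: pairE; rewrite //= addr0.
have [g1|g1] := eqVneq g.2 (-1).
  have -> : e1 (gr F g y).1 = gr F g (e1 y.1).
    by apply: pairE; rewrite /= ?g1 //= if_same.
  by rewrite pr_homog g1.
have -> : e1 (gr F g y).1 = 0 by apply: pairE; rewrite //= (negPf g1).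
exact: additive_fun0 (prD (-1)).
Qed.

Definition G0 r (x : X) : T := tprod (e0 r) x.
Definition G1 b (x : X) : T := tprod (e1 b) x.
Lemma e1D : additive_fun e1.
Proof. by move=> r s; apply: pairE; rewrite //= addr0. Qed.

Lemma G0D r : additive_fun (G0 r). Proof. exact: tprodDr. Qed.
Lemma G1D r : additive_fun (G1 r). Proof. exact: tprodDr. Qed.
Lemma G1Dl x : additive_fun (G1 ^~ x).
Proof. by move=> r s; rewrite /G1 e1D tprodDl. Qed.

Lemma G0_ract r c x : G0 (r * c) x = G0 r (lact (c : Rn n) x).
Proof.
rewrite /G0 -(@tprodA _ (@all_of n) F X c) //; congr tprod; apply: pairE => //=.
exact: esym (additive_fun0 (@ractDl _ Bt c)).
Qed.
Lemma G1_ract b c x : G1 (@ract _ Bt b c) x = G1 b (lact (c : Rn n) x).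
Proof.
rewrite /G1 -(@tprodA _ (@all_of n) F X c) //; congr tprod; apply: pairE => //=.
by rewrite mul0r.
Qed.
Lemma lact_G0 r c x : @lact _ T c (G0 r x) = G0 (c * r) x.
Proof.
rewrite /G0 ctensor_lactE; congr tprod; apply: pairE => //=.
exact: (additive_fun0 (@lactDr _ Bt c)).
Qed.
Lemma lact_G1 b c x : @lact _ T c (G1 b x) = G1 (@lact _ Bt c b) x.
Proof. by rewrite /G1 ctensor_lactE; congr tprod; apply: pairE; rewrite //= mulr0. Qed.
Lemma ract_G0 r c x : @ract _ T (G0 r x) c = G0 r (ract x c).
Proof. exact: ctensor_ractE. Qed.
Lemma ract_G1 r c x : @ract _ T (G1 r x) c = G1 r (ract x c).
Proof. exact: ctensor_ractE. Qed.

Lemma diff_G0 r x : @diff n T (G0 r x) = G0 r (diff x).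
Proof.
rewrite [LHS]ctensor_diffE ksign_gen /G0.
rewrite (_ : @diff n F (e0 r) = 0); last first.
  by apply: pairE => //=; exact: (additive_fun0 (@BmulD n i)).
rewrite (additive_fun0 (tprodDl _ x)) add0r; congr tprod.
by apply: pairE; rewrite //= oppr0.
Qed.
Lemma diff_G1 b x : @diff n T (G1 b x) = G0 (@Bmul n i b) x - G1 b (diff x).
Proof.
rewrite [LHS]ctensor_diffE ksign_gen; congr (_ + _).
by rewrite -(additive_funN (G1Dl (diff x))) /G1; congr tprod; apply: pairE.
Qed.

Local Notation u1 := (u1 i).
Local Notation u2 := (u2 i).

Definition uncross (w : TX) : T := G0 1 w.1 + G1 u1 (w.2 : Xc * Xc).1 + G1 u2 (w.2 : Xc * Xc).2.

Lemma uncrossD : additive_fun uncross.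
Proof.
move=> [x [x' x'']] [y [y' y'']].
rewrite -[LHS]/(G0 1 (x + y) + G1 u1 (x' + y') + G1 u2 (x'' + y'')).
rewrite G0D !G1D; exact: (@addr_swap3 T).
Qed.

Lemma lact_u1 (c : 'I_n) : c != xa -> c != xb -> @lact _ Bt ('X_c : Rn n) u1 = @ract _ Bt u1 ('X_c : Rn n).
Proof. by move=> ca cb; rewrite /u1 lactE inv_u //; exact: invX. Qed.
Lemma lact_u2 (c : 'I_n) : c != xa -> c != xb -> @lact _ Bt ('X_c : Rn n) u2 = @ract _ Bt u2 ('X_c : Rn n).
Proof. by move=> ca cb; rewrite /u2 lactE inv_u //; exact: invX. Qed.
Lemma xa_u1 : @lact _ Bt ('X_xa : Rn n) u1 = u2.
Proof. by rewrite /u1 lactE mulr1. Qed.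
Lemma u_sub (f g : {mpoly int[n]}) :
  @tprod _ (invariants i) (reg n) (reg n) (f - g) (1 : {mpoly int[n]}) =
  @tprod _ _ (reg n) (reg n) f (1 : {mpoly int[n]}) - @tprod _ _ (reg n) (reg n) g (1 : {mpoly int[n]}).
Proof. exact: (additive_funB (@tprodDl _ (invariants i) (reg n) (reg n) _)). Qed.
Lemma xa_u2 : @lact _ Bt ('X_xa : Rn n) u2 =
  @ract _ Bt u2 ('X_xa + 'X_xb : Rn n) - @ract _ Bt u1 ('X_xa * 'X_xb : Rn n).
Proof.
rewrite -(inv_u _ (inv_add i)) -(inv_u _ (inv_mul i)) -u_sub /u2 lactE; congr tprod; ring.
Qed.
Lemma xb_u1 : @lact _ Bt ('X_xb : Rn n) u1 = @ract _ Bt u1 ('X_xa + 'X_xb : Rn n) - u2.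
Proof. by rewrite -(inv_u _ (inv_add i)) -u_sub /u1 lactE; congr tprod; ring. Qed.
Lemma xb_u2 : @lact _ Bt ('X_xb : Rn n) u2 = @ract _ Bt u1 ('X_xa * 'X_xb : Rn n).
Proof. by rewrite -(inv_u _ (inv_mul i)) /u2 lactE; congr tprod; ring. Qed.

Lemma uncross_op t j (w : TX) : uncross (@op TX t j w) = @op (cxof T) t j (uncross w).
Proof.
have ib := sgen_subproof1 i; have TD := @opD (cxof T).
case: w => x [y z]; case: (ltnP j n) => jn; last first.
  rewrite TX_op bB_op_other; last by apply/orP; right; lia.
  rewrite [RHS]cop_big // /uncross !cop_big //.
  by rewrite (additive_fun0 (G0D _)) !(additive_fun0 (G1D _)) !addr0.
rewrite -[j]/(val (Ordinal jn)); set c := Ordinal jn.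
case: t; last first.
  by rewrite TX_op bB_op_other // /uncross !TD !copF ract_G0 !ract_G1.
have gX : G0 ('X_c * 1) x = G0 1 (lact ('X_c : Rn n) x) by rewrite mulrC G0_ract.
suff h : G1 u1 (bB_op i i.+1 true (val c) (y, z)).1 + G1 u2 (bB_op i i.+1 true (val c) (y, z)).2 =
    G1 (@lact _ Bt ('X_c : Rn n) u1) y + G1 (@lact _ Bt ('X_c : Rn n) u2) z.
  rewrite TX_op [in RHS]/uncross !TD !copT lact_G0 !lact_G1 gX.
  have := f_equal (fun w : T => G0 1 (lact ('X_c : Rn n) x) + w) h; rewrite !addrA -copT; exact.
have lB (p q : Rn n) u := @lactDl _ X p q u.
have f1 (u v : Xc) : (u, v).1 = u by [].
have f2 (u v : Xc) : (u, v).2 = v by [].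
case: (eqVneq c xa) => [->|ca].
  rewrite bB_op_a f1 f2 !copT xa_u1 xa_u2 (additive_funB (G1Dl z)) !G1_ract.
  by rewrite (additive_funN (G1D u1)) lB !(G1D u2) lactM addrC -!addrA.
case: (eqVneq c xb) => [->|cb].
  rewrite bB_op_b f1 f2 !copT xb_u1 xb_u2 (additive_funB (G1Dl y)) !G1_ract.
  rewrite (additive_funN (G1D u2)) lB !(G1D u1) lactM -!addrA; congr (_ + (_ + _)); exact: addrC.
rewrite bB_op_other; last by rewrite -!val_eqE /= in ca cb *; rewrite ca cb.
by rewrite lact_u1 // lact_u2 // !G1_ract -!copT.
Qed.

Lemma uncross_dd (w : TX) : uncross (dd w) = @dd (cxof T) (uncross w).
Proof.
have TD := @ddD (cxof T); case: w => x [y z].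
have d0 r v : @dd (cxof T) (G0 r v) = G0 r (@dd Xc v) := diff_G0 r v.
have d1 b v : @dd (cxof T) (G1 b v) = G0 (@Bmul n i b) v - G1 b (@dd Xc v) := diff_G1 b v.
rewrite [in RHS]/uncross !TD d0 !d1.
have -> : @Bmul n i u1 = 1 :> {mpoly int[n]} by rewrite /u1 BmulE mulr1.
have -> : @Bmul n i u2 = 1 * 'X_xa :> {mpoly int[n]} by rewrite /u2 BmulE mulrC.
rewrite G0_ract -copT.
rewrite -[LHS]/(G0 1 (dd x + (y + op true (val xa) z)) + G1 u1 (- dd y) + G1 u2 (- dd z)).
rewrite !(additive_funN (G1D _)) !G0D; exact: (@addr_cone T).
Qed.

Lemma uncross_hd k (w : TX) : @hd TX k w -> @hd (cxof T) k (uncross w).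
Proof.
case: w => x [y z] [hx [hy hz]]; rewrite /uncross.
have e (v : X) r : @hd Xc (k + 0 + 1) v -> @hd (cxof T) k (G1 r v).
  by move=> hv; have := tprod_hd (e1_hd r) hv; rewrite addr0 addrCA addNr addr0.
apply: (@hdD (cxof T)); last exact: e.
apply: (@hdD (cxof T)); last exact: e.
by have := tprod_hd (e0_hd 1) hx; rewrite add0r.
Qed.

Program Definition uncrossm : cmor 0 TX (cxof T) :=
  @Cmor 0 TX (cxof T) uncross uncrossD uncross_op uncross_dd _.
Next Obligation. by move=> k z; rewrite addr0; exact: uncross_hd. Qed.

Lemma crossK (z : T) : uncross (crossT z) = z.
Proof.
move: z; apply: tens_eqf => [x y|x y|y x] //.
  by rewrite crossD uncrossD.
rewrite crossE /cross /uncross -G0_ract -!G1_ract mul1r.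
rewrite -addrA -(G1Dl x) -coo_decomp -tprodDl; congr tprod.
by case: y => b r; apply: pairE; rewrite /= ?addr0 ?add0r.
Qed.

Lemma retr_cross : retr (cxof T) TX.
Proof. exact: (@retr_inv (cxof T) TX (crossm i X) uncrossm crossK). Qed.
End Inverse.

Lemma retr_base n : retr (cxof (conc (reg n))) (U n).
Proof.
have opE t j (p : {mpoly int[n]}) : @op (cxof (conc (reg n))) t j p = @op (U n) t j p.
  by rewrite /= /cop /Uop; case: insub => [i|//]; case: t; rewrite //= mulrC.
have hdE k (p : {mpoly int[n]}) : @hd (cxof (conc (reg n))) k p <-> k = 0 \/ p = 0.
  split=> [<-|[->|->]]; last exact: hd0.
    have [->|k0] := eqVneq k 0; [by left | right].
    move: p; apply: (@homog_eqf n (conc (reg n)) (conc (reg n))) => [p q|p q|g p].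
    - exact: (@prD n (conc (reg n)) k).
    - by rewrite addr0.
    rewrite pr_homog; case: eqP => // gk; rewrite /= gk (negPf k0) //.
  suff h : forall x : conc (reg n), pr 0 x = x by exact: h.
  apply: homog_eqf => [x y|x y|g x] //; first exact: prD.
  rewrite pr_homog; case: eqP => // g0 /=; case: ifP => // g1.
  by move/eqP: g1 => g1; rewrite g1 in g0.
pose R := {mpoly int[n]}.
have hf k (x : R) : @hd (cxof (conc (reg n))) (k + 0) x -> @hd (U n) k x.
  by rewrite addr0 => /hdE.
have hg k (x : R) : @hd (U n) (k + 0) x -> @hd (cxof (conc (reg n))) k x.
  by rewrite addr0 => hx; apply/hdE.
have hD : {morph (id : R -> R) : x y / x + y} by [].
pose f := @Cmor 0 (cxof (conc (reg n))) (U n) (id : R -> R) hD opE (fun=> erefl) hf.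
pose g := @Cmor 0 (U n) (cxof (conc (reg n))) (id : R -> R) hD
  (fun t j p => esym (opE t j p)) (fun=> erefl) hg.
exact: (@retr_inv _ _ f g).
Qed.

Lemma retr_rouquier n (w : seq 'I_n.-1) :
  retr (cxof (rouquier w)) (capp (tw (map val w)) (U n)).
Proof.
elim: w => [|i w ih]; first exact: retr_base.
exact: retr_trans (retr_cross _ _) (retr_lapp (T i) ih).
Qed.

Theorem corollary1p4 (m n : nat) (w : seq 'I_(m + n).-1)
    (P : projective_resolution (m + n)) (i j k : int) :
  reduced_word (torus_perm m n) w -> odd `|k|%N ->
  forall c : HHH P (rouquier w) i j k, c = 0%R.
Proof.
move=> hw ok; apply: HHH_van; apply: (retr_van (@retr_rouquier _ w)).
exact: (van_beq (beq_sym (reduced_torus hw)) (van_torus (addnC n m) ok)).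
Qed.
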